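(* Let $n\ge 3$ and let $(\alpha,\beta)$ satisfy $\beta\ge 0$, $0<\alpha+\beta<n-\beta$ and $\frac{n-\alpha-2\beta}{2n}+\frac{n-\alpha}{2(n-1)}<1$. Then: (1) If $\alpha\le 1$ (equivalently $p\ge 2$), there exists a constant $c_0>0$ such that for all $u\in L^p(\mathbb S^{n-1})$ with $u\not\equiv 0$, $$c^p_{\alpha,\beta}-\frac{\|Q_{\alpha,\beta}u\|^p_{L^q(\mathbb B^n)}}{\|u\|^p_{L^p(\mathbb S^{n-1})}}\ \ge\ c_0\inf_{\Psi,\lambda}\Big(\big\|\lambda|\mathbb S^{n-1}|^{\frac1p}u_\Psi-1\big\|^p_{L^p(\mathbb S^{n-1})}+\big\|\lambda|\mathbb S^{n-1}|^{\frac1p}u_\Psi-1\big\|^2_{L^2(\mathbb S^{n-1})}\Big).$$ (2) If $1<\alpha<n$ (equivalently $1<p<2$), there exists a constant $c_0>0$ such that for all $u\in L^p(\mathbb S^{n-1})$ with $u\not\equiv 0$, $$c^p_{\alpha,\beta}-\frac{\|Q_{\alpha,\beta}u\|^p_{L^q(\mathbb B^n)}}{\|u\|^p_{L^p(\mathbb S^{n-1})}}\ \ge\ c_0\inf_{\Psi,\lambda}\big\|\lambda|\mathbb S^{n-1}|^{\frac1p}u_\Psi-1\big\|^2_{L^p(\mathbb S^{n-1})}.$$ In both cases the infimum is over all conformal transformations $\Psi$ of $\mathbb B^n$ and all $\lambda\in\mathbb R$.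
   Context: $\mathbb B^n$ is the open unit ball in $\mathbb R^n$, $\mathbb S^{n-1}$ the unit sphere with its standard surface measure $\mathrm dV$, $|\mathbb S^{n-1}|$ its area. Set $p=\frac{2(n-1)}{n+\alpha-2}$, $q=\frac{2n}{n-\alpha-2\beta}$. For $u$ on $\mathbb S^{n-1}$ and $\xi\in\mathbb B^n$, $Q_{\alpha,\beta}(u)(\xi)=\left(\frac{1-|\xi|^2}{2}\right)^{\beta}\int_{\mathbb S^{n-1}}|\xi-\eta|^{\alpha-n}u(\eta)\,\mathrm dV(\eta)$. The constant $c_{\alpha,\beta}$ is the sharp constant $c_{\alpha,\beta}=\sup\{\|Q_{\alpha,\beta}u\|_{L^q(\mathbb B^n)}/\|u\|_{L^p(\mathbb S^{n-1})}: 0\not\equiv u\in L^p(\mathbb S^{n-1})\}$, which is finite and equals $|\mathbb S^{n-1}|^{-1/p}\|Q_{\alpha,\beta}(1)\|_{L^q(\mathbb B^n)}$. A conformal transformation $\Psi$ of $\mathbb B^n$ is a conformal (Möbius) diffeomorphism of $\overline{\mathbb B^n}$ onto itself (e.g. compositions of orthogonal maps with $\Psi_\zeta(\eta)=\frac{(1-|\zeta|^2)(\eta-\zeta)-|\eta-\zeta|^2\zeta}{1-2\zeta\cdot\eta+|\zeta|^2|\eta|^2}$, $\zeta\in\mathbb B^n$); for such $\Psi$, $u_\Psi:=(\det \mathrm d\Psi|_{\partial\mathbb B^n})^{1/p}\,u\circ\Psi$, where $\det\mathrm d\Psi|_{\partial\mathbb B^n}$ is the Jacobian of the restriction of $\Psi$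 to $\mathbb S^{n-1}$ (for $\Psi_\zeta$ it equals $\big(\frac{1-|\zeta|^2}{1-2\zeta\cdot\eta+|\zeta|^2}\big)^{n-1}$). *)

(* Defs.v *)
From HB Require Import structures.
From mathcomp Require Import all_boot all_order all_algebra.
From mathcomp Require Import all_classical all_reals all_analysis.
Set Implicit Arguments. Unset Strict Implicit. Unset Printing Implicit Defensive.
Import Order.TTheory GRing.Theory Num.Theory.
Import numFieldNormedType.Exports.
Local Open Scope classical_set_scope.
Local Open Scope ring_scope.

(* Points of R^n are represented as n.-tuple R (which carries the product,
   i.e. Borel, sigma-algebra of mathcomp-analysis). *)
Section Defs.
Context {R : realType}.

Definition dotp n (x y : n.-tuple R) : R := \sum_(i < n) tnth x i * tnth y i.
Definition enorm n (x : n.-tuple R) : R := Num.sqrt (dotp x x).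
Definition tsub n (x y : n.-tuple R) : n.-tuple R :=
  [tuple tnth x i - tnth y i | i < n].
Definition tscale n (a : R) (x : n.-tuple R) : n.-tuple R :=
  [tuple a * tnth x i | i < n].

Definition unit_ball n : set (n.-tuple R) := [set x | enorm x < 1].
Definition unit_sphere n : set (n.-tuple R) := [set x | enorm x = 1].

(* Lebesgue integral of a nonnegative function over R^n, computed as an
   iterated integral w.r.t. one-dimensional Lebesgue measure (Tonelli). *)
Fixpoint iint (n : nat) : (n.-tuple R -> \bar R) -> \bar R :=
  match n return (n.-tuple R -> \bar R) -> \bar R with
  | 0 => fun f => f [tuple]
  | m.+1 => fun f =>
      (\int[@lebesgue_measure R]_(x in [set: R]) iint (fun t => f (cons_tuple x t)))%E
  end.

Definition ball_int n (f : n.-tuple R -> \bar R) : \bar R :=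
  iint (fun x => if enorm x < 1 then f x else 0%E).

(* integral of a nonnegative function over S^{n-1} w.r.t. the standard surface
   measure dV, via polar coordinates: int_S g dV = n * int_B g(x/|x|) dx *)
Definition sphere_int n (g : n.-tuple R -> \bar R) : \bar R :=
  (n%:R%:E * iint (fun x => if ((0 < enorm x) && (enorm x < 1))%R
                            then g (tscale (enorm x)^-1%R x) else 0%E))%E.

Definition sphere_rint n (g : n.-tuple R -> R) : R :=
  fine (sphere_int (fun x => (Num.max (g x) 0)%:E)
        - sphere_int (fun x => (Num.max (- g x) 0)%:E))%E.

Definition sphere_area n : R := fine (sphere_int (fun _ : n.-tuple R => 1%E)).

Definition LpS_pow n (r : R) (g : n.-tuple R -> R) : \bar R :=
  sphere_int (fun x => (`|g x| `^ r)%:E).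
Definition LqB_pow n (r : R) (f : n.-tuple R -> R) : \bar R :=
  ball_int (fun x => (`|f x| `^ r)%:E).

Definition inLpS n (r : R) (u : n.-tuple R -> R) : Prop :=
  measurable_fun (@unit_sphere n) u /\ (LpS_pow r u < +oo)%E.

Definition p_exp (n : nat) (alpha : R) : R := 2 * (n%:R - 1) / (n%:R + alpha - 2).
Definition q_exp (n : nat) (alpha beta : R) : R := 2 * n%:R / (n%:R - alpha - 2 * beta).

Definition Qab n (alpha beta : R) (u : n.-tuple R -> R) (xi : n.-tuple R) : R :=
  ((1 - enorm xi ^+ 2) / 2) `^ beta *
  sphere_rint (fun eta => enorm (tsub xi eta) `^ (alpha - n%:R) * u eta).

Definition Qratio n (alpha beta : R) (u : n.-tuple R -> R) : \bar R :=
  (poweR (LqB_pow (q_exp n alpha beta) (Qab alpha beta u)) (q_exp n alpha beta)^-1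
   * ((fine (LpS_pow (p_exp n alpha) u)) `^ (p_exp n alpha)^-1)^-1%:E)%E.

Definition c_ab n (alpha beta : R) : \bar R :=
  ereal_sup [set Qratio alpha beta u | u in
     [set u : n.-tuple R -> R | inLpS (p_exp n alpha) u
                                /\ (0 < LpS_pow (p_exp n alpha) u)%E]].

(* conformal transformations of B^n : eta |-> O (Psi_zeta eta),
   O orthogonal, zeta in B^n *)
Definition Psi n (zeta eta : n.-tuple R) : n.-tuple R :=
  [tuple ((1 - enorm zeta ^+ 2) * (tnth eta i - tnth zeta i)
          - enorm (tsub eta zeta) ^+ 2 * tnth zeta i)
         / (1 - 2 * dotp zeta eta + enorm zeta ^+ 2 * enorm eta ^+ 2) | i < n].
Definition mxapp n (O : 'M[R]_n) (x : n.-tuple R) : n.-tuple R :=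
  [tuple \sum_(j < n) O i j * tnth x j | i < n].
Definition orthogonal n (O : 'M[R]_n) : Prop := O *m O^T = 1%:M.
Definition conf_map n (O : 'M[R]_n) (zeta : n.-tuple R) : n.-tuple R -> n.-tuple R :=
  fun eta => mxapp O (Psi zeta eta).
(* Jacobian of the restriction of eta |-> O (Psi_zeta eta) to S^{n-1} *)
Definition conf_jac n (zeta eta : n.-tuple R) : R :=
  ((1 - enorm zeta ^+ 2) / (1 - 2 * dotp zeta eta + enorm zeta ^+ 2)) ^+ n.-1.

Definition u_conf n (p : R) (O : 'M[R]_n) (zeta : n.-tuple R) (u : n.-tuple R -> R)
  : n.-tuple R -> R :=
  fun eta => conf_jac zeta eta `^ p^-1 * u (conf_map O zeta eta).

Definition deviation n (p : R) (O : 'M[R]_n) (zeta : n.-tuple R) (lambda : R)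
  (u : n.-tuple R -> R) : n.-tuple R -> R :=
  fun eta => lambda * sphere_area n `^ p^-1 * u_conf p O zeta u eta - 1.

Definition inf_conf n (D : 'M[R]_n -> n.-tuple R -> R -> \bar R) : \bar R :=
  ereal_inf [set d | exists O zeta lambda, orthogonal O /\ enorm zeta < 1
                                         /\ d = D O zeta lambda].

Definition deficit n (alpha beta : R) (u : n.-tuple R -> R) : \bar R :=
  (poweR (c_ab n alpha beta) (p_exp n alpha)
   - poweR (Qratio alpha beta u) (p_exp n alpha))%E.

End Defs.

(* Main.v *)
(** Write [s = (n - alpha) / 2] and [x = 2 xi / (1 - |xi|^2)].  On the hyperboloid the
    problem becomes that of [T u x = int (sqrt (1 + |x|^2) - x.y)^-s u(y) dP(y)] from
    [L^p(P)], [P] uniform on the sphere, to [L^q(dx / sqrt (1 + |x|^2))]; [beta] only enters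
    through [q], and conformal maps act as Lorentz boosts, isometrically on both sides.
    - [T] is bounded, also for slightly smaller [q]; hence for an almost maximizer [u] of norm 1
      [sup |T u|] is bounded below, and a boost puts its supremum almost at the origin, which
      makes the first moments [int (e.y) u] small.
    - The gain under two-point polarization forces such a centered [u] to be almost invariant
      under all reflections, so [T u] is almost radial; the Euler-Lagrange equation then makes
      [u] almost constant.  In particular constants are extremal.
    - Second variation at 1: the quadratic form commutes with reflections and its kernel is
      positive on functions antisymmetric under a reflection.  So it contracts the Lipschitz
      constant along reflections as much as it does on linear functions, and log-convexity of
      the moments turns this into a spectral gap modulo linear functions, which centering
      controls.
    - Near 1, elementary inequalities for [|1 + t|^p] and [|1 + t|^q], split at [|t| = d], give
      the local estimate. *)

Require Import Defs.
From HB Require Import structures.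
From mathcomp Require Import all_boot all_order all_algebra.
From mathcomp Require Import all_classical all_reals all_analysis.
From mathcomp Require Import measurable_realfun ring lra.
Set Implicit Arguments. Unset Strict Implicit. Unset Printing Implicit Defensive.
Import Order.TTheory GRing.Theory Num.Theory.
Import numFieldNormedType.Exports.
Local Open Scope classical_set_scope.
Local Open Scope ring_scope.
Local Notation mbl := (measurable_fun setT).
Local Notation nonneg f := (forall x, 0 <= f x).
Local Notation enneg f := (forall x, 0 <= f x)%E.
Local Notation lam := (@lebesgue_measure _).

Section Basics.
Context {R : realType}.

(** Put [N = n - 1]. The analysis runs on [0 < s < N], [p = N / (N - s)], [N < q s] and
    [N < q (N - s)]. The last inequality is the numerical hypothesis of the theorem; the two are
    exchanged by [s -> N - s], which leaves [phi = T 1] unchanged. The obstacle is the noncompact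
    conformal group, along which almost maximizers can escape. No limits are taken: each stage is
    quantitative, since polarization bounds the asymmetry of an almost maximizer by a power of its
    deficit plus its first moments. The price is that centering is only approximate; as the theorem
    bounds the deficit by an infimum, an inequality up to an arbitrary [e > 0] suffices. Reflections
    also replace eigenfunction expansions: invariance under them identifies radial functions and the
    eigenvalue on linear functions. The gap itself comes from subtracting a multiple of the kernel
    [y.w] small enough to keep reflection positivity: this lowers the linear eigenvalue, which still
    dominates. When the deficit is not small, [lambda = 0] already gives a bounded distance. *)

Lemma one_powR (r : R) : 1 `^ r = 1.
Proof. exact: (congr1 (fun h => h r) (powR1 R)). Qed.

Lemma eq_lew d (T : porderType d) (a b : T) : a = b -> (a <= b)%O.
Proof. by move=> ->. Qed.

Lemma inv_powR (r a : R) : 0 < a -> a^-1 `^ r = (a `^ r)^-1.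
Proof.
move=> a0; have ar : 0 < a `^ r by exact: powR_gt0.
apply: (mulfI (lt0r_neq0 ar)); rewrite mulfV ?gt_eqF// -powRM ?invr_ge0 ?(ltW a0)// mulfV ?gt_eqF//; exact: one_powR.
Qed.

End Basics.

(** * Push-forward of a measure with a density *)

Section WeightedPushforward.
Local Open Scope ereal_scope.
Context d1 d2 (T : measurableType d1) (X : measurableType d2) (R : realType).
Variables (m : {measure set T -> \bar R}) (phi : T -> X) (w : T -> R).
Hypotheses (mphi : mbl phi) (mw : mbl w).
Hypothesis w0 : nonneg w.

(** The proofs are arguments of the set function so that the measure structure can be attached to
    it. The measures on tuples, on the sphere and on the hyperboloid are all obtained in this
    way. *)
Definition wpush (_ : mbl phi) (_ : mbl w)
  (_ : forall t, (0 <= w t)%R) (A : set X) : \bar R :=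
 \int[m]_(t in phi @^-1` A) (w t)%:E.

Local Notation nu := (wpush mphi mw w0).

Let mpre A : measurable A -> measurable (phi @^-1` A).
Proof. by move=> mA; rewrite -[X in measurable X]setTI; exact: mphi. Qed.

Let wpush0 : nu set0 = 0.
Proof. by rewrite /wpush preimage_set0 integral_set0. Qed.

Let wpush_ge0 A : 0 <= nu A.
Proof. by apply: integral_ge0 => t _; rewrite lee_fin. Qed.

Let wpush_sigma_additive : semi_sigma_additive nu.
Proof.
move=> F mF tF mUF; rewrite /wpush preimage_bigcup.
apply: cvg_toP; last first.
 rewrite ge0_integral_bigcup//.
 - by move=> k; exact: mpre.
 - apply/measurable_EFinP; exact: measurable_funTS.
 - by move=> x _; rewrite lee_fin.
 - apply/trivIsetP => i j _ _ ij.
  rewrite -preimage_setI; move/trivIsetP: tF => /(_ i j I I ij) ->.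
  by rewrite preimage_set0.
apply: is_cvg_ereal_nneg_natsum_cond => n _ _.
exact: wpush_ge0.
Qed.

HB.instance Definition _ := isMeasure.Build _ _ _ nu
 wpush0 wpush_ge0 wpush_sigma_additive.

Import HBNNSimple.

Let int_indic A : measurable A ->
 \int[m]_t (\1_A (phi t) * w t)%:E = nu A.
Proof.
move=> mA; rewrite /wpush [RHS]integral_mkcond; apply: eq_integral => t _.
rewrite patchE; case: ifPn => [|]; rewrite /indic.
 by rewrite inE /= => At; rewrite mem_set// mul1r.
by move=> tA; rewrite memNset ?mul0r// => At; move/negP: tA; apply; rewrite inE.
Qed.

Let mEw (g : X -> R) : mbl g ->
 mbl (fun t => (g (phi t) * w t)%:E).
Proof.
by move=> mg; apply/measurable_EFinP/measurable_funM => //; exact: measurableT_comp.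
Qed.

Lemma wpush_int (f : X -> \bar R) : mbl f ->
 enneg f ->
 \int[nu]_x f x = \int[m]_t (f (phi t) * (w t)%:E).
Proof.
move=> mf f0; pose g := nnsfun_approx measurableT mf.
transitivity (limn (fun n => \int[nu]_x (g n x)%:E)).
 rewrite -monotone_convergence//.
 - apply: eq_integral => y _; apply/esym/cvg_lim => //.
  exact: cvg_nnsfun_approx.
 - by move=> n; exact/measurable_EFinP/measurable_funP.
 - by move=> n y _; rewrite lee_fin.
 - by move=> y _ a b ab; rewrite lee_fin; exact/lefP/nd_nnsfun_approx.
transitivity (limn (fun n => \int[m]_t (g n (phi t) * w t)%:E)); last first.
 rewrite -monotone_convergence//.
 - apply: eq_integral => t _; apply/cvg_lim => //.
  under eq_fun do rewrite EFinM muleC.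
  rewrite muleC; apply: cvgeZl => //.
  exact: cvg_nnsfun_approx.
 - by move=> n; apply: mEw; exact: measurable_funP.
 - by move=> n y _; rewrite lee_fin mulr_ge0.
 - move=> y _ a b ab; rewrite lee_fin ler_wpM2r//.
  exact/lefP/nd_nnsfun_approx.
congr (limn _); apply/funext => n.
have mpr r : measurable (g n @^-1` [set r]) by rewrite -[X in measurable X]setTI; exact: measurable_funP.
rewrite (eq_integral (fun x => \sum_(r \in range (g n)) (r * \1_(g n @^-1` [set r]) x)%:E)); last by move=> x _; rewrite fimfunE -fsumEFin.
rewrite ge0_integral_fsum//; last 2 first.
 - by move=> r; exact/measurable_EFinP/measurable_funM.
 - by move=> y x _; rewrite nnfun_muleindic_ge0.
rewrite [RHS](eq_integral (fun t => \sum_(r \in range (g n)) (r * \1_(g n @^-1` [set r]) (phi t) * w t)%:E)); last by move=> x _; rewrite fimfunE mulr_fsuml -fsumEFin.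
rewrite [RHS]ge0_integral_fsum//; last 2 first.
 - move=> r; apply: (mEw (g := fun x => (r * \1_(g n @^-1` [set r]) x)%R)).
  exact: measurable_funM.
 - move=> r t _; rewrite EFinM mule_ge0//; last by rewrite lee_fin.
  rewrite EFinM; exact: (nnfun_muleindic_ge0 (g n)).
apply: eq_fsbigr => r _; rewrite integralZl_indic_nnsfun// integral_indic// setIT -[X in r%:E * X]/(nu (g n @^-1` [set r])) -int_indic//.
have [r0|r0] := ltP r 0%R.
 have e : g n @^-1` [set r] = set0.
  apply/seteqP; split=> // x /= gr; have : (0 <= g n x)%R by [].
  by rewrite gr leNgt r0.
 rewrite !e; under eq_integral do rewrite indic0 mul0r.
 by rewrite integral0 mule0; apply/esym/integral0_eq => t _; rewrite indic0 mulr0 mul0r.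
rewrite -ge0_integralZl//.
- by apply: eq_integral => t _; rewrite -mulrA EFinM.
- by apply: mEw.
- by move=> t _; rewrite lee_fin mulr_ge0.
Qed.

End WeightedPushforward.

(** * Lebesgue measure on tuples *)

Section LebesgueTuples.
Local Open Scope ereal_scope.
Context {R : realType}.

Definition cons_pair n (z : R * n.-tuple R) : n.+1.-tuple R := cons_tuple z.1 z.2.
Definition uncons n (t : n.+1.-tuple R) : R * n.-tuple R := (thead t, behead_tuple t).

Lemma measurable_cons_pair n : mbl (@cons_pair n).
Proof. exact: measurable_cons. Qed.

Lemma measurable_uncons n : mbl (@uncons n).
Proof.
apply/measurable_fun_pair; first exact: measurable_tnth.
apply/measurable_fun_tnthP => i.
rewrite (_ : _ \o _ = fun t : n.+1.-tuple R => tnth t (lift ord0 i)).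
 exact: measurable_tnth.
apply/funext => t /=; case/tupleP: t => a t; rewrite tnthS; congr tnth; exact/val_inj.
Qed.

Lemma cons_pairK n : cancel (@cons_pair n) (@uncons n).
Proof. by case=> a t; rewrite /uncons /cons_pair; congr pair; exact/val_inj. Qed.

Let one_ge0 (T : Type) (t : T) : (0 <= (fun _ : T => 1 : R) t)%R.
Proof. exact: ler01. Qed.

Let measurable_one d (T : measurableType d) : mbl (fun _ : T => 1%R : R).
Proof. exact: measurable_cst. Qed.

Definition leb_step n (m : {sigma_finite_measure set (n.-tuple R) -> \bar R}) :
  set (n.+1.-tuple R) -> \bar R :=
 wpush (lam \x m) (measurable_cons_pair (n:=n))
  (measurable_one (T:=(R * n.-tuple R)%type)) (@one_ge0 _).

HB.instance Definition _ n (m : {sigma_finite_measure set (n.-tuple R) -> \bar R}) :=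
 Measure.on (leb_step m).

Let leb_step_sigma_finite n (m : {sigma_finite_measure set (n.-tuple R) -> \bar R}) :
 sigma_finite setT (leb_step m).
Proof.
have /sigma_finiteP[A [AT ndA finA]] := sigma_finiteT (@lebesgue_measure R).
have /sigma_finiteP[B [BT ndB finB]] := sigma_finiteT m.
exists (fun k => uncons (n:=n) @^-1` (A k `*` B k)).
 apply/esym/seteqP; split => // t _.
 have [i _ Ai] : (\bigcup_i A i) (uncons t).1 by rewrite -AT.
 have [j _ Bj] : (\bigcup_i B i) (uncons t).2 by rewrite -BT.
 exists (maxn i j) => //; split.
  by move/subsetPset: (ndA _ _ (leq_maxl i j)); apply.
 by move/subsetPset: (ndB _ _ (leq_maxr i j)); apply.
move=> k; have [mA fA] := finA k; have [mB fB] := finB k; split.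
 rewrite -[X in measurable X]setTI; apply: measurable_uncons => //.
 exact: measurableX.
rewrite /leb_step /wpush [X in \int[_]_(_ in X) _](_ : _ = A k `*` B k); last first.
 by apply/seteqP; split => z; have := cons_pairK z; rewrite /preimage /mkset => ->.
rewrite integral_cst ?mul1e; last exact: measurableX.
rewrite [X in X < _](_ : _ = lam (A k) * m (B k)); last exact: product_measure1E.
by apply: lte_mul_pinfty => //; rewrite ge0_fin_numE.
Qed.

HB.instance Definition _ n (m : {sigma_finite_measure set (n.-tuple R) -> \bar R}) :=
 Measure_isSigmaFinite.Build _ _ _ (leb_step m) (leb_step_sigma_finite m).

(** Built one coordinate at a time, so that Tonelli makes integration against it the iterated
    integral [iint]; dimension zero carries a Dirac mass. *)
Fixpoint leb n : {sigma_finite_measure set (n.-tuple R) -> \bar R} :=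
 if n is m.+1 then leb_step (leb m) else (\d_([tuple] : 0.-tuple R)).

Lemma lebS_int n (f : n.+1.-tuple R -> \bar R) : mbl f ->
 enneg f ->
 \int[leb n.+1]_x f x =
 \int[lam]_a \int[leb n]_t f (cons_tuple a t).
Proof.
move=> mf f0; rewrite [LHS]wpush_int//.
under eq_integral do rewrite mule1.
rewrite fubini_tonelli1//.
by apply: measurableT_comp => //; exact: measurable_cons_pair.
Qed.

Lemma lebS_int' n (f : n.+1.-tuple R -> \bar R) : mbl f ->
 enneg f ->
 \int[leb n.+1]_x f x =
 \int[leb n]_t \int[lam]_a f (cons_tuple a t).
Proof.
move=> mf f0; rewrite [LHS]wpush_int//.
under eq_integral do rewrite mule1.
rewrite fubini_tonelli2//.
by apply: measurableT_comp => //; exact: measurable_cons_pair.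
Qed.

Lemma iintE n (f : n.-tuple R -> \bar R) : mbl f ->
 enneg f -> iint f = \int[leb n]_x f x.
Proof.
elim: n f => [|n IH] f mf f0 /=.
 by rewrite integral_dirac// diracT mul1e.
rewrite lebS_int//; apply: eq_integral => a _; rewrite IH//.
apply: (measurableT_comp mf); exact: measurable_cons.
Qed.

End LebesgueTuples.

(** * Substitution in one variable *)

Section Substitution1D.
Local Open Scope ereal_scope.
Context {R : realType}.

Lemma integral_is_derive (A A' : R -> R) (a b : R) : (a <= b)%R ->
 (forall x : R, derivable A x 1) -> (forall x, A^`()%classic x = A' x) -> continuous A' ->
 \int[lam]_(x in `]a, b]) (A' x)%:E = (A b - A a)%:E.
Proof.
rewrite le_eqVlt => /predU1P[<- _ _ _|ab dA DA cA'].
 by rewrite set_itvoc0 ?integral_set0 ?subrr.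
rewrite integral_itv_obnd_cbnd; last first.
 by apply/measurable_EFinP; apply: measurable_funTS; exact: continuous_measurable_fun.
have cA x : {for x, continuous A}.
 by apply: differentiable_continuous; apply/derivable1_diffP; exact: dA.
rewrite (continuous_FTC2 ab (f := A') (F := A)).
- by rewrite EFinB.
- exact: continuous_subspaceT.
- split=> [x _| |]; first exact: dA.
 + exact: cvg_at_right_filter (cA a).
 + exact: cvg_at_left_filter (cA b).
- by move=> x _; exact: DA.
Qed.

(** [B] is the inverse of the increasing map [A] on its range [J]. The order hypothesis makes the
    push-forward under [B] of Lebesgue measure on [J] and the measure of density [A'] agree on
    half-open intervals, which determine them. The derivative may vanish at points, which covers odd
    powers. *)
Lemma integral_substitution (A A' B : R -> R) (J : set R) (G : R -> \bar R) :
 (forall x : R, derivable A x 1) -> (forall x, A^`()%classic x = A' x) -> continuous A' ->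
 (forall x, 0 <= A' x)%R -> mbl B -> measurable J ->
 (forall x1 x2 y, (x1 < x2)%R ->
  (J y /\ (x1 < B y <= x2)%R) <-> (A x1 < y <= A x2)%R) ->
 mbl G -> enneg G ->
 \int[lam]_(y in J) G (B y) = \int[lam]_x (G x * (A' x)%:E).
Proof.
move=> dA DA cA' A'0 mB mJ JB mG G0.
have mA' : mbl A' by exact: continuous_measurable_fun.
have mono a b : (a <= b)%R -> (A a <= A b)%R.
 move=> ab; have := integral_is_derive ab dA DA cA'.
 have : 0 <= \int[lam]_(x in `]a, b]) (A' x)%:E by apply: integral_ge0 => x _; rewrite lee_fin.
 by move=> /[swap] ->; rewrite lee_fin subr_ge0.
have m1J : mbl (\1_J : R -> R) by exact: measurable_indic.
have J0 t : (0 <= (\1_J : R -> R) t)%R by [].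
pose n1 := wpush lam mB m1J J0.
pose n2 := wpush lam (@measurable_id _ R setT) mA' A'0.
have n2E a b : (a <= b)%R -> n2 `]a, b]%classic = (A b - A a)%:E.
 by move=> ab; rewrite /n2 /wpush preimage_id; exact: integral_is_derive DA cA'.
have n12 X : ocitv X -> n2 X = n1 X.
 move=> /ocitvP[->|[[a b] /= ab ->]].
  by rewrite /n1 /n2 /wpush !preimage_set0 !integral_set0.
 rewrite n2E ?ltW// /n1 /wpush.
 rewrite integral_indic//; last first.
  by rewrite -[X in measurable X]setTI; exact: (mB measurableT).
 rewrite (_ : _ `&` _ = `](A a), (A b)]%classic); last first.
  apply/seteqP; split => y /=; rewrite !in_itv/=.
   by move=> [Jy yab]; apply/(JB a b).
  by move/(JB a b _ ab).
 suff : lebesgue_measure ([set` `](A a), (A b)]%R] : set R) = (A b - A a)%:E by move=> <-.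
 rewrite lebesgue_measure_itv/= lte_fin; case: ltP => //.
 by move=> h; rewrite (_ : A a = A b) ?subrr//; apply/le_anti; rewrite h mono// ltW.
have mE Y : measurable Y -> n2 Y = n1 Y.
 apply: (@measure_unique _ _ _ (@ocitv R) (fun k => `](- k%:R)%R, k%:R%R]%classic)).
 - by [].
 - exact: ocitvI.
 - by move=> i; exact: is_ocitv.
 - apply/seteqP; split => // x _.
  exists (Num.truncn `|x : R|%R).+1 => //=; rewrite in_itv/=.
  move: (truncnS_gt `|x : R|%R).
  by rewrite ltr_norml => /andP[-> /ltW].
 - exact: n12.
 - by move=> k; rewrite [X in X < _]n2E ?ltry// lerNl -subr_ge0 opprK addr_ge0.
have := wpush_int lam (@measurable_id _ R setT) mA' A'0 mG G0.
rewrite (@eq_measure_integral _ _ _ _ n1); last by move=> Y mY _; exact: mE.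
rewrite wpush_int// => <-.
rewrite [LHS]integral_mkcond; apply: eq_integral => y _; rewrite patchE indicE.
by case: ifPn => yJ; rewrite ?mule1 ?mule0.
Qed.

Lemma integral_translate (c : R) (G : R -> \bar R) :
 mbl G -> enneg G ->
 \int[lam]_y G (y + c)%R = \int[lam]_x G x.
Proof.
move=> mG G0.
rewrite (@integral_substitution (fun x => x - c)%R (fun=> 1%R) (fun x => x + c)%R setT)//.
- by apply: eq_integral => x _; rewrite mule1.
- by move=> x; rewrite derive1E deriveB// derive_id derive_cst subr0.
- by move=> x; exact: cvg_cst.
- exact: measurable_funD.
- by move=> x1 x2 y _; rewrite ltrBlDr lerBrDr; split=> [[]|].
Qed.

Lemma integral_dilate (c : R) (G : R -> \bar R) : (0 < c)%R ->
 mbl G -> enneg G ->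
 \int[lam]_y G (c * y)%R = c^-1%:E * \int[lam]_x G x.
Proof.
move=> c0 mG G0.
rewrite (@integral_substitution (fun x => c^-1 * x)%R (fun=> c^-1%R) (fun x => c * x)%R setT)//.
- rewrite -ge0_integralZl//; last by rewrite lee_fin invr_ge0 ltW.
 by apply: eq_integral => x _; rewrite muleC.
- by move=> x; rewrite derive1E deriveZ// derive_id -[RHS]mulr1.
- by move=> x; exact: cvg_cst.
- by move=> x; rewrite invr_ge0 ltW.
- exact: measurable_funM.
- move=> x1 x2 y _; rewrite ltr_pdivrMl// ler_pdivlMl//; split=> [[]|]//.
Qed.

End Substitution1D.

(** * Vectors and reflections *)

Section Vectors.
Context {R : realType}.
Implicit Types n : nat.

Definition tadd n (x y : n.-tuple R) : n.-tuple R := [tuple tnth x i + tnth y i | i < n].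
Definition refl n (e x : n.-tuple R) : n.-tuple R :=
 [tuple tnth x i - 2 * dotp e x * tnth e i | i < n].
(** Radial projection to the sphere; the origin is sent to itself because [0^-1 = 0]. *)
Definition nrm n (x : n.-tuple R) : n.-tuple R := tscale (enorm x)^-1 x.
Definition t0 n : n.-tuple R := [tuple 0 | i < n].

Lemma dotpC n (x y : n.-tuple R) : dotp x y = dotp y x.
Proof. by apply: eq_bigr => i _; rewrite mulrC. Qed.

Lemma dotpDl n (x y z : n.-tuple R) : dotp (tadd x y) z = dotp x z + dotp y z.
Proof. by rewrite -big_split; apply: eq_bigr => i _; rewrite tnth_mktuple mulrDl. Qed.

Lemma dotpZl n a (x y : n.-tuple R) : dotp (tscale a x) y = a * dotp x y.
Proof. by rewrite mulr_sumr; apply: eq_bigr => i _; rewrite tnth_mktuple mulrA. Qed.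

Lemma dotpZr n a (x y : n.-tuple R) : dotp y (tscale a x) = a * dotp y x.
Proof. by rewrite dotpC dotpZl dotpC. Qed.

Lemma dotpBl n (x y z : n.-tuple R) : dotp (tsub x y) z = dotp x z - dotp y z.
Proof. by rewrite -sumrB; apply: eq_bigr => i _; rewrite tnth_mktuple mulrBl. Qed.

Lemma dotpBr n (x y z : n.-tuple R) : dotp z (tsub x y) = dotp z x - dotp z y.
Proof. by rewrite !(dotpC z) dotpBl. Qed.

Lemma dotp_refll n (e x y : n.-tuple R) :
 dotp (refl e x) y = dotp x y - 2 * dotp e x * dotp e y.
Proof.
rewrite mulr_sumr -sumrB; apply: eq_bigr => i _; rewrite tnth_mktuple.
by ring.
Qed.

Lemma dotp_refl n (e x y : n.-tuple R) : dotp e e = 1 ->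
 dotp (refl e x) (refl e y) = dotp x y.
Proof.
by move=> e1; rewrite dotp_refll !(dotpC _ (refl e y)) !dotp_refll e1 (dotpC y x) (dotpC y e); ring.
Qed.

Lemma dotp_refl_self n (e x : n.-tuple R) : dotp e e = 1 ->
 dotp e (refl e x) = - dotp e x.
Proof. by move=> e1; rewrite dotpC dotp_refll e1 (dotpC x e); ring. Qed.

Lemma dotp_reflC n (e x y : n.-tuple R) : dotp (refl e x) y = dotp x (refl e y).
Proof. by rewrite dotp_refll (dotpC x (refl e y)) dotp_refll (dotpC y x); ring. Qed.

Lemma reflK n (e : n.-tuple R) : dotp e e = 1 -> involutive (refl e).
Proof.
move=> e1 x; apply: eq_from_tnth => i.
rewrite !tnth_mktuple dotp_refl_self//; ring.
Qed.

Lemma reflD n (e x y : n.-tuple R) : refl e (tadd x y) = tadd (refl e x) (refl e y).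
Proof.
apply: eq_from_tnth => i; rewrite !tnth_mktuple dotpC dotpDl !(dotpC _ e); ring.
Qed.

Lemma dotp_ge0 n (x : n.-tuple R) : 0 <= dotp x x.
Proof. by apply: sumr_ge0 => i _; rewrite -expr2 sqr_ge0. Qed.

Lemma enorm_ge0 n (x : n.-tuple R) : 0 <= enorm x.
Proof. exact: sqrtr_ge0. Qed.

Lemma enormE n (x : n.-tuple R) : enorm x ^+ 2 = dotp x x.
Proof. by rewrite sqr_sqrtr// dotp_ge0. Qed.

Lemma enorm_eq0 n (x : n.-tuple R) : enorm x = 0 -> x = t0 n.
Proof.
move=> x0; have := enormE x; rewrite x0 expr0n/= => /esym/eqP.
rewrite /dotp psumr_eq0; last by move=> i _; rewrite -expr2 sqr_ge0.
move=> /allP h; apply: eq_from_tnth => i; rewrite tnth_mktuple.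
by have := h i (mem_index_enum i); rewrite mulf_eq0 orbb => /eqP.
Qed.

Lemma dotp_sqr_le n (x y : n.-tuple R) : dotp x y ^+ 2 <= dotp x x * dotp y y.
Proof.
have [y0|y0] := eqVneq (dotp y y) 0.
 have -> : y = t0 n by apply: enorm_eq0; rewrite /enorm y0 sqrtr0.
 rewrite (_ : dotp x (t0 n) = 0) ?expr0n ?mulr_ge0 ?dotp_ge0//.
 by apply: big1 => i _; rewrite tnth_mktuple mulr0.
have yp : 0 < dotp y y by rewrite lt_neqAle eq_sym y0 dotp_ge0.
have := dotp_ge0 (tsub (tscale (dotp y y) x) (tscale (dotp x y) y)).
rewrite dotpBl !dotpBr !dotpZl !dotpZr (dotpC y x).
rewrite (_ : _ - _ = dotp y y * (dotp x x * dotp y y - dotp x y ^+ 2)); last by ring.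
by rewrite pmulr_rge0// subr_ge0.
Qed.

Lemma dotp_le n (x y : n.-tuple R) : `|dotp x y| <= enorm x * enorm y.
Proof.
rewrite -(@ler_pXn2r _ 2)// ?nnegrE ?mulr_ge0 ?enorm_ge0//.
by rewrite real_normK ?num_real// exprMn !enormE dotp_sqr_le.
Qed.

Lemma enorm_refl n (e x : n.-tuple R) : dotp e e = 1 -> enorm (refl e x) = enorm x.
Proof. by move=> e1; rewrite /enorm dotp_refl. Qed.

Lemma enormZ n a (x : n.-tuple R) : enorm (tscale a x) = `|a| * enorm x.
Proof.
by rewrite /enorm dotpZl dotpZr mulrA -expr2 sqrtrM ?sqr_ge0// sqrtr_sqr.
Qed.

Lemma nrm_refl n (e x : n.-tuple R) : dotp e e = 1 -> nrm (refl e x) = refl e (nrm x).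
Proof.
move=> e1; apply: eq_from_tnth => i; rewrite !tnth_mktuple enorm_refl// dotpZr; ring.
Qed.

Lemma enorm_nrm n (x : n.-tuple R) : 0 < enorm x -> enorm (nrm x) = 1.
Proof.
move=> x0; rewrite enormZ ger0_norm ?invr_ge0 ?enorm_ge0// mulVf// gt_eqF//.
Qed.

Lemma enorm_nrm_le1 n (x : n.-tuple R) : enorm (nrm x) <= 1.
Proof.
have := enorm_ge0 x; rewrite le_eqVlt => /predU1P[x0|/enorm_nrm->//].
by rewrite enormZ -x0 mulr0 ler01.
Qed.

Lemma dotp_cons n a b (t u : n.-tuple R) :
 dotp (cons_tuple a t) (cons_tuple b u) = a * b + dotp t u.
Proof.
rewrite /dotp big_ord_recl /=; congr (_ + _).
by apply: eq_bigr => i _; rewrite !tnthS.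
Qed.

Lemma tnth_enorm_le n (x : n.-tuple R) i : `|tnth x i| <= enorm x.
Proof.
rewrite -(@ler_pXn2r _ 2)// ?nnegrE ?enorm_ge0// real_normK ?num_real// enormE.
rewrite /dotp (bigD1 i)//= -expr2 lerDl.
by apply: sumr_ge0 => j _; rewrite -expr2 sqr_ge0.
Qed.

Definition dlt n (i : 'I_n) : n.-tuple R := [tuple (j == i)%:R | j < n].

Lemma dotp_dlt n (i : 'I_n) x : dotp (dlt i) x = tnth x i.
Proof.
rewrite /dotp (bigD1 i)//= !tnth_mktuple eqxx mul1r big1 ?addr0// => j ji.
by rewrite !tnth_mktuple (negbTE ji) mul0r.
Qed.

Lemma dlt_unit n (i : 'I_n) : dotp (dlt i) (dlt i) = 1.
Proof. by rewrite dotp_dlt tnth_mktuple eqxx. Qed.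

Lemma t0E n : enorm (t0 n) = 0.
Proof.
by rewrite /enorm (_ : dotp _ _ = 0) ?sqrtr0//; apply: big1 => i _; rewrite tnth_mktuple mulr0.
Qed.

End Vectors.

(** Functions on the sphere are extended to all tuples by radial projection. This is the extension
    of the linear function [e.y]; it is bounded by [|e|] everywhere. *)
Notation dn e y := (dotp e (nrm y)).

(** * Measurability and positivity *)

Lemma measurable_inv (R : realType) : mbl (@GRing.inv R).
Proof.
have -> : @GRing.inv R = fun x => (if 0 < x then 1 else -1) * `|x| `^ (-1).
 apply/funext => x; rewrite powR_inv1//.
 case: ltgtP => [x0|x0|<-]; last by rewrite normr0 invr0 mulr0.
  by rewrite gtr0_norm// mul1r.
 by rewrite ltr0_norm// invrN mulN1r opprK.
apply: measurable_funM.
 by apply: measurable_fun_ifT => //; exact: measurable_fun_ltr.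
exact: (measurableT_comp (measurable_powR (-1)) (@normr_measurable _ setT)).
Qed.

Lemma measurable_sqrt (R : realType) : mbl (@Num.sqrt R).
Proof. by apply: continuous_measurable_fun; exact: sqrt_continuous. Qed.

Section MeasComp.
Context (R : realType) (d : measure_display) (T : measurableType d).
Implicit Types f g : T -> R.

Lemma meas_EFin f : mbl f -> mbl (fun x => (f x)%:E).
Proof. by move=> mf; apply/measurable_EFinP. Qed.
Lemma meas_mul f g : mbl f -> mbl g -> mbl (fun x => f x * g x).
Proof. exact: measurable_funM. Qed.
Lemma meas_neg (b : T -> bool) : mbl b -> mbl (fun x => ~~ b x).
Proof.
move=> mb; rewrite (_ : (fun _ => _) = fun x => if b x then false else true).
 exact: measurable_fun_ifT.
by apply/funext => x; case: (b x).
Qed.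
Lemma meas_inv f : mbl f -> mbl (fun x => (f x)^-1).
Proof. by move=> mf; apply: (@measurableT_comp _ _ _ _ _ _ (@GRing.inv R)) => //; exact: measurable_inv. Qed.
Lemma meas_sqrt f : mbl f -> mbl (fun x => Num.sqrt (f x)).
Proof. by move=> mf; apply: (@measurableT_comp _ _ _ _ _ _ (@Num.sqrt R)) => //; exact: measurable_sqrt. Qed.
Lemma meas_powR f p : mbl f -> mbl (fun x => f x `^ p).
Proof. exact: measurableT_comp (measurable_powR p). Qed.
Lemma meas_norm f : mbl f -> mbl (fun x => `|f x|).
Proof. exact: measurableT_comp (@normr_measurable R setT). Qed.
Lemma meas_opp f : mbl f -> mbl (fun x => - f x).
Proof. exact: measurableT_comp (@oppr_measurable R setT). Qed.
Lemma meas_tnth n (F : T -> n.-tuple R) i : mbl F -> mbl (fun x => tnth (F x) i).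
Proof. exact: measurableT_comp (measurable_tnth i). Qed.
Lemma meas_dotp n (F G : T -> n.-tuple R) : mbl F ->
 mbl G -> mbl (fun x => dotp (F x) (G x)).
Proof.
by move=> mF mG; apply: measurable_sum => i; apply: measurable_funM; exact: meas_tnth.
Qed.
Lemma meas_enorm n (F : T -> n.-tuple R) : mbl F -> mbl (fun x => enorm (F x)).
Proof. by move=> mF; apply: meas_sqrt; exact: meas_dotp. Qed.
Lemma meas_mktuple n (F : 'I_n -> T -> R) : (forall i, mbl (F i)) -> mbl (fun x => [tuple F i x | i < n]).
Proof.
move=> mF; apply/measurable_fun_tnthP => i.
by rewrite (_ : _ \o _ = F i)//; apply/funext => x /=; rewrite tnth_mktuple.
Qed.
Lemma meas_tadd n (F G : T -> n.-tuple R) : mbl F ->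
 mbl G -> mbl (fun x => tadd (F x) (G x)).
Proof. by move=> mF mG; apply: meas_mktuple => i; apply: measurable_funD; exact: meas_tnth. Qed.
Lemma meas_tsub n (F G : T -> n.-tuple R) : mbl F ->
 mbl G -> mbl (fun x => tsub (F x) (G x)).
Proof. by move=> mF mG; apply: meas_mktuple => i; apply: measurable_funB; exact: meas_tnth. Qed.
Lemma meas_tscale n f (F : T -> n.-tuple R) : mbl f ->
 mbl F -> mbl (fun x => tscale (f x) (F x)).
Proof. by move=> mf mF; apply: meas_mktuple => i; apply: measurable_funM => //; exact: meas_tnth. Qed.
Lemma meas_refl n (e : n.-tuple R) (F : T -> n.-tuple R) : mbl F -> mbl (fun x => refl e (F x)).
Proof.
move=> mF; apply: meas_mktuple => i; apply: measurable_funB; first exact: meas_tnth.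
by apply: measurable_funM => //; apply: measurable_funM => //; exact: meas_dotp.
Qed.
Lemma meas_nrm n (F : T -> n.-tuple R) : mbl F -> mbl (fun x => nrm (F x)).
Proof. by move=> mF; apply: meas_tscale => //; apply: meas_inv; exact: meas_enorm. Qed.
Lemma meas_natb (b : T -> bool) : mbl b -> mbl (fun x => (b x)%:R : R).
Proof.
move=> mb; rewrite (_ : (fun _ => _) = fun x => if b x then 1 else 0).
 exact: measurable_fun_ifT.
by apply/funext => x; case: (b x).
Qed.
End MeasComp.

(** A hook for operations introduced later ([hgt], [K], [phi], [Top]); [pos_ext] plays the same role
    for positivity. *)
Ltac meas_ext := fail.
Ltac meas1 := lazymatch goal with
 | |- mbl (fun _ => ?c) => exact: measurable_cst
 | |- mbl (fun x => x) => exact: measurable_id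
 | |- mbl (fun x => EFin (@?f x)) => apply: (meas_EFin (f := f))
 | |- mbl (fun x => GRing.add (@?f x) (@?g x)) => apply: (measurable_funD (f := f) (g := g))
 | |- mbl (fun x => GRing.mul (@?f x) (@?g x)) => apply: (meas_mul (f := f) (g := g))
 | |- mbl (fun x => mule (@?f x) (@?g x)) => apply: (emeasurable_funM (f := f) (g := g))
 | |- mbl (fun x => GRing.opp (@?f x)) => apply: (meas_opp (f := f))
 | |- mbl (fun x => GRing.inv (@?f x)) => apply: (meas_inv (f := f))
 | |- mbl (fun x => Num.sqrt (@?f x)) => apply: (meas_sqrt (f := f))
 | |- mbl (fun x => powR (@?f x) ?p) => apply: (meas_powR p (f := f))
 | |- mbl (fun x => Num.norm (@?f x)) => apply: (meas_norm (f := f))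
 | |- mbl (fun x => GRing.exp (@?f x) ?k) => apply: (measurable_funX k (f := f))
 | |- mbl (fun x => Order.max (@?f x) (@?g x)) => apply: (measurable_maxr (f := f) (g := g))
 | |- mbl (fun x => Order.min (@?f x) (@?g x)) => apply: (measurable_minr (f := f) (g := g))
 | |- mbl (fun x => tnth (@?f x) ?i) => apply: (meas_tnth i (F := f))
 | |- mbl (fun x => dotp (@?f x) (@?g x)) => apply: (meas_dotp (F := f) (G := g))
 | |- mbl (fun x => enorm (@?f x)) => apply: (meas_enorm (F := f))
 | |- mbl (fun x => nrm (@?f x)) => apply: (meas_nrm (F := f))
 | |- mbl (fun x => refl ?e (@?f x)) => apply: (meas_refl e (F := f))
 | |- mbl (fun x => tscale (@?f x) (@?g x)) => apply: (meas_tscale (f := f) (F := g))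
 | |- mbl (fun x => tadd (@?f x) (@?g x)) => apply: (meas_tadd (F := f) (G := g))
 | |- mbl (fun x => tsub (@?f x) (@?g x)) => apply: (meas_tsub (F := f) (G := g))
 | |- mbl (fun x => cons_tuple (@?f x) (@?g x)) => apply: (measurable_cons (f := f) (g := g))
 | |- mbl (fun x => Order.lt (@?f x) (@?g x)) => apply: (measurable_fun_ltr (f := f) (g := g))
 | |- mbl (fun x => Order.le (@?f x) (@?g x)) => apply: (measurable_fun_ler (f := f) (g := g))
 | |- mbl (fun x => andb (@?f x) (@?g x)) => apply: (measurable_and (f := f) (g := g))
 | |- mbl (fun x => negb (@?f x)) => apply: (meas_neg (b := f))
 | |- mbl (fun x => GRing.natmul 1 (nat_of_bool (@?b x))) => apply: (meas_natb (b := b))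
 | |- mbl (fun x => fst x) => exact: measurable_fst
 | |- mbl (fun x => snd x) => exact: measurable_snd
 | |- mbl fst => exact: measurable_fst
 | |- mbl snd => exact: measurable_snd
 | H : mbl ?u |- mbl ?u => exact: H
 | H : mbl ?u |- mbl (fun x => ?u x) => exact: H
 | H : mbl ?u |- mbl (fun x => ?u (@?f x)) =>
   apply: (measurableT_comp H)
 | |- mbl (fun x => _) => first [meas_ext | apply: measurable_fun_ifT]
 | |- measurable_fun ?D (?h ?c) => change (measurable_fun D (fun x => h c x))
 end.
Ltac meas := repeat meas1.

Ltac nneg1 := first
 [ assumption | exact: ler0n | exact: ler01 | exact: normr_ge0 | exact: powR_ge0 | exact: sqrtr_ge0
 | exact: enorm_ge0 | exact: sqr_ge0 | exact: dotp_ge0 | apply: mulr_ge0 | apply: addr_ge0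
 | rewrite invr_ge0 | apply: exprn_ge0 | apply: mule_ge0 | apply: integral_ge0
 | apply: sumr_ge0 | apply: prodr_ge0 | rewrite lee_fin ].
Ltac nneg := intros; repeat (nneg1; intros).
Ltac pos_ext := fail.
Ltac pos1 := first
 [ nneg1 | exact: ltr01 | rewrite ltr0n | apply: mulr_gt0 | apply: addr_gt0 | apply: powR_gt0
 | apply: exprn_gt0 | rewrite invr_gt0 | pos_ext | apply: ltW ].
Ltac side := first [ by [] | by meas | by (intros; repeat (pos1; intros)) ].

Section NonnegIntegral.
Local Open Scope ereal_scope.
Context (R : realType) (d : measure_display) (T : measurableType d).
Variable m : {measure set T -> \bar R}.
Implicit Types f g : T -> \bar R.

Lemma int_le f g : enneg f -> mbl f ->
 mbl g -> (forall x, f x <= g x) ->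
 \int[m]_x f x <= \int[m]_x g x.
Proof. by move=> f0 mf mg fg; apply: ge0_le_integral => // x _; exact: fg. Qed.

Lemma int_Zl k f : (0 <= k)%R -> mbl f -> enneg f ->
 \int[m]_x (k%:E * f x) = k%:E * \int[m]_x f x.
Proof. by move=> k0 mf f0; rewrite ge0_integralZl. Qed.

Lemma int_Zr k f : (0 <= k)%R -> mbl f -> enneg f ->
 \int[m]_x (f x * k%:E) = \int[m]_x f x * k%:E.
Proof. by move=> k0 mf f0; rewrite ge0_integralZr. Qed.

Lemma eq_int f g : f =1 g -> \int[m]_x f x = \int[m]_x g x.
Proof. by move=> fg; apply: eq_integral => x _; exact: fg. Qed.
End NonnegIntegral.

(** * Translations, dilations and the unit ball *)

Section LebesgueInvariance.
Local Open Scope ereal_scope.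
Context {R : realType}.

Lemma tadd_cons n a b (t u : n.-tuple R) :
 tadd (cons_tuple a t) (cons_tuple b u) = cons_tuple (a + b)%R (tadd t u).
Proof.
apply: eq_from_tnth => i; rewrite tnth_mktuple.
case: (unliftP ord0 i) => [j|] -> //; by rewrite !tnthS tnth_mktuple.
Qed.

Lemma tscale_cons n a b (t : n.-tuple R) :
 tscale a (cons_tuple b t) = cons_tuple (a * b)%R (tscale a t).
Proof.
apply: eq_from_tnth => i; rewrite tnth_mktuple.
case: (unliftP ord0 i) => [j|] -> //; by rewrite !tnthS tnth_mktuple.
Qed.

Lemma leb_translate n (c : n.-tuple R) (f : n.-tuple R -> \bar R) :
 mbl f -> enneg f ->
 \int[leb n]_x f (tadd x c) = \int[leb n]_x f x.
Proof.
elim: n c f => [|n IH] c f mf f0.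
 by apply: eq_integral => x _; rewrite (tuple0 (tadd x c)) (tuple0 x).
case/tupleP: c => a c.
rewrite lebS_int; [|by meas|side].
rewrite [RHS](lebS_int mf f0).
transitivity (\int[lam]_b \int[leb n]_t f (cons_tuple (b + a)%R t)).
 apply: eq_integral => b _; rewrite -(IH c (fun t => f (cons_tuple (b + a)%R t)))//.
  by apply: eq_integral => t _; rewrite -tadd_cons; congr f; congr tadd; exact/val_inj.
 by meas.
rewrite (@integral_translate _ a (fun b => \int[leb n]_t f (cons_tuple b t)))//.
 apply: (@measurable_fun_fubini_tonelli_F _ _ _ _ _ (leb n) (fun z => f (cons_tuple z.1 z.2))) => //.
 by meas.
by move=> b; exact: integral_ge0.
Qed.

Lemma leb_dilate n (c : R) (f : n.-tuple R -> \bar R) : (0 < c)%R ->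
 mbl f -> enneg f ->
 \int[leb n]_x f (tscale c x) = (c ^- n)%:E * \int[leb n]_x f x.
Proof.
move=> c0; elim: n f => [|n IH] f mf f0.
 rewrite expr0 invr1 mul1e.
 by apply: eq_integral => x _; rewrite (tuple0 (tscale _ x)) (tuple0 x).
rewrite lebS_int; [|by meas|side].
rewrite [in RHS](lebS_int mf f0).
have mF : mbl (fun b => \int[leb n]_t f (cons_tuple b t)).
 apply: (@measurable_fun_fubini_tonelli_F _ _ _ _ _ (leb n) (fun z => f (cons_tuple z.1 z.2))) => //.
 by meas.
have F0 b : 0 <= \int[leb n]_t f (cons_tuple b t) by exact: integral_ge0.
transitivity (\int[lam]_b ((c ^- n)%:E * \int[leb n]_t f (cons_tuple (c * b)%R t))).
 apply: eq_integral => b _; rewrite -(IH (fun t => f (cons_tuple (c * b)%R t)))//.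
  by apply: eq_integral => t _; rewrite -tscale_cons; congr f; congr tscale; exact/val_inj.
 by meas.
rewrite ge0_integralZl; [|by []|by apply: (measurableT_comp mF); exact: measurable_funM|side|]; last first.
 side.
rewrite (@integral_dilate _ c (fun b => \int[leb n]_t f (cons_tuple b t)))//.
by rewrite muleA -EFinM exprSr invfM.
Qed.

Lemma leb_prod_fin n (w : R -> R) : mbl w -> (forall t, 0 <= w t)%R ->
 \int[lam]_t (w t)%:E < +oo -> \int[@leb R n]_x (\prod_(i < n) w (tnth x i))%:E < +oo.
Proof.
move=> mw w0 wfin; have mp k : mbl (fun x : k.-tuple R => (\prod_(i < k) w (tnth x i))%:E).
 apply: meas_EFin; apply: measurable_prod => i _; meas.
have p0 k (x : k.-tuple R) : 0 <= (\prod_(i < k) w (tnth x i))%:E by nneg.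
elim: n => [|n IH].
 rewrite (eq_int _ (g := fun=> 1)); last by move=> x; rewrite big_ord0.
 by rewrite integral_cst//= mul1e diracT ltry.
rewrite (lebS_int (mp n.+1) (p0 n.+1)).
rewrite [X in X < _](_ : _ = \int[lam]_a ((w a)%:E * \int[leb n]_t (\prod_(i < n) w (tnth t i))%:E)); last first.
 apply: eq_integral => a _; rewrite -int_Zl; [|exact: w0|exact: mp|exact: p0].
 apply: eq_int => t; rewrite big_ord_recl EFinM; congr (_ * _%:E).
 by apply: eq_bigr => i _; rewrite tnthS.
rewrite -(@fineK _ (\int[leb n]_t _)) ?ge0_fin_numE ?integral_ge0//.
rewrite int_Zr; [|by apply: fine_ge0; apply: integral_ge0 => t _; exact: p0|by meas|side].
apply: lte_mul_pinfty => //; last by rewrite ltry.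
 by apply: integral_ge0 => t _; rewrite lee_fin.
by rewrite ge0_fin_numE// integral_ge0// => t _; rewrite lee_fin.
Qed.

Lemma leb_ball_fin n : \int[@leb R n]_x ((enorm x < 1)%R%:R)%:E < +oo.
Proof.
apply: (@le_lt_trans _ _ (\int[@leb R n]_x (\prod_(i < n) ((`|tnth x i| <= 1)%R%:R))%:E)).
 apply: int_le; [nneg|by meas| |].
  by apply: meas_EFin; apply: measurable_prod => i _; meas.
 move=> x; case: ltP => [x1|_] /=; last by nneg.
 rewrite lee_fin big1// => i _.
 by rewrite (le_trans (tnth_enorm_le x i) (ltW x1)).
apply: (@leb_prod_fin n (fun t => (`|t| <= 1)%R%:R)); [by meas|by nneg|].
rewrite [X in X < _](_ : _ = \int[lam]_x (\1_(`[(-1)%R, 1%R]%classic : set R) x)%:E); last first.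
 by apply: eq_integral => x _; rewrite indicE; congr (_%:R%:E); rewrite ler_norml mem_setE in_itv.
rewrite integral_indic// setIT.
have := @lebesgue_measure_itv R `[(-1)%R, 1%R]; move=> /= ->.
by rewrite lte_fin; case: ifP => _ //; rewrite ltry.
Qed.

(** By induction: the product of []0, 1/2]] with the ball of radius [1/2] lies in the unit ball. *)
Lemma leb_ball_gt0 n : 0 < \int[@leb R n]_x ((enorm x < 1)%R%:R)%:E.
Proof.
elim: n => [|n IH].
 under eq_integral do rewrite /enorm /dotp big_ord0 sqrtr0 ltr01.
 by rewrite integral_cst//= mul1e diracT lte_fin ltr01.
pose g (t : n.-tuple R) : \bar R := ((enorm (tscale 2 t) < 1)%R%:R)%:E.
have mg : mbl g by rewrite /g; meas.
have g0 t : 0 <= g t by rewrite lee_fin ler0n.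
have intg : 0 < \int[leb n]_t g t.
 rewrite (@leb_dilate n 2 (fun t => ((enorm t < 1)%R%:R)%:E)); [|by []|by meas|by nneg].
 by rewrite mule_gt0// lte_fin invr_gt0 exprn_gt0.
have : 0 < \int[lam]_a (\1_(`](0%R), (2^-1)%R]%classic) a)%:E * \int[leb n]_t g t.
 rewrite mule_gt0// integral_indic// setIT.
 have := @lebesgue_measure_itv R `](0%R), (2^-1)%R]; move=> /= ->.
 by rewrite lte_fin invr_gt0 ltr0n sube0 lte_fin invr_gt0 ltr0n.
move=> /lt_le_trans; apply.
have m1 : mbl (fun a : R => (\1_(`](0%R), (2^-1)%R]%classic) a : R)) by exact: measurable_indic.
rewrite -ge0_integralZr; [|by []|by meas|by move=> x _; rewrite lee_fin|by apply: integral_ge0].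
rewrite lebS_int; [|by meas|by nneg].
apply: int_le.
- side.
- by apply: emeasurable_funM; [by meas|exact: measurable_cst].
- apply: (@measurable_fun_fubini_tonelli_F _ _ _ _ _ (leb n) (fun z => ((enorm (cons_tuple z.1 z.2) < 1)%R%:R)%:E)).
  by meas.
 by nneg.
move=> a; rewrite -int_Zl; [|by rewrite indicE|exact: mg|exact: g0].
apply: int_le; [by move=> t; rewrite mule_ge0// lee_fin|by meas|by meas|].
move=> t; rewrite /g -EFinM lee_fin indicE mem_setE in_itv/=.
case: andP => [a2|_]; last by rewrite mul0r ler0n.
case: ltP => [h|_]; last by rewrite mulr0 ler0n.
suff -> : (enorm (cons_tuple a t) < 1)%R by rewrite mulr1.
have := h; rewrite enormZ ger0_norm// => h'.
rewrite -(@ltr_pXn2r _ 2)// ?nnegrE ?enorm_ge0// enormE dotp_cons -enormE expr1n.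
have := enorm_ge0 t; move: a2 => [a0 a2]; nra.
Qed.

End LebesgueInvariance.

(** * Invariance of Lebesgue measure under reflections *)

Section Isometry.
Local Open Scope ereal_scope.
Context {R : realType}.

Lemma int_swap d1 d2 (T1 : measurableType d1) (T2 : measurableType d2)
  (m1 : {sigma_finite_measure set T1 -> \bar R})
  (m2 : {sigma_finite_measure set T2 -> \bar R}) (f : T1 -> T2 -> \bar R) :
 mbl (fun z => f z.1 z.2) -> (forall x y, 0 <= f x y) ->
 \int[m1]_x \int[m2]_y f x y = \int[m2]_y \int[m1]_x f x y.
Proof.
move=> mf f0.
by rewrite -(@fubini_tonelli _ _ _ _ _ m1 m2 (fun z => f z.1 z.2)).
Qed.

Lemma measurable_int2 d1 d2 (T1 : measurableType d1) (T2 : measurableType d2)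
  (m2 : {sigma_finite_measure set T2 -> \bar R}) (f : T1 -> T2 -> \bar R) :
 mbl (fun z => f z.1 z.2) -> (forall x y, 0 <= f x y) -> mbl (fun x => \int[m2]_y f x y).
Proof.
by move=> mf f0; apply: (@measurable_fun_fubini_tonelli_F _ _ _ _ _ m2 (fun z => f z.1 z.2)).
Qed.

Section Haar.
Variables (n : nat) (s : n.-tuple R -> n.-tuple R).
Hypotheses (ms : mbl s) (sK : involutive s).
Hypothesis sD : forall x y, s (tadd x y) = tadd (s x) (s y).
Hypothesis sZ : forall a x, s (tscale a x) = tscale a (s x).
Hypothesis sN : forall x, enorm (s x) = enorm x.

Local Notation b := (fun x : n.-tuple R => ((enorm x < 1)%R%:R)%:E : \bar R).
Local Notation neg := (@tscale R n (-1)%R).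

Let addNK (x y : n.-tuple R) : tadd x (tadd y (neg x)) = y.
Proof. by apply: eq_from_tnth => i; rewrite !tnth_mktuple; ring. Qed.

Let mb : mbl b. Proof. by meas. Qed.
Let b0 x : 0 <= b x. Proof. by nneg. Qed.

(* Uniqueness of Haar measure: both [f o s] and [f o neg] are compared with the unit ball,
  which [s] preserves. *)
Lemma leb_isometry_neg (f : n.-tuple R -> \bar R) : mbl f ->
 enneg f -> \int[leb n]_x f (s x) = \int[leb n]_x f (neg x).
Proof.
move=> mf f0.
have mfs : mbl (fun x => f (s x)) by exact: measurableT_comp.
have ib0 : 0 < \int[leb n]_x b x := leb_ball_gt0 n.
have ibf : \int[leb n]_x b x \is a fin_num by rewrite ge0_fin_numE ?ltW// leb_ball_fin.
set I := \int[leb n]_x b x in ib0 ibf *.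
suff E : \int[leb n]_x f (s x) * I = \int[leb n]_x f (neg x) * I.
 have I0 : (fine I != 0)%R by rewrite gt_eqF// fine_gt0// ib0 ltey_eq ibf.
 have := congr1 (fun z => z * (fine I)^-1%:E) E.
 by rewrite -!muleA -{1 3}(fineK ibf) -!EFinM divff// !mule1.
transitivity (\int[leb n]_y \int[leb n]_x (f (s y) * b (tadd x (s y)))).
 rewrite -ge0_integralZr//; last exact: ltW.
 apply: eq_integral => y _.
 rewrite (@leb_translate _ n (s y) (fun x => f (s y) * b x)); [|by apply: emeasurable_funM; [exact: measurable_cst|exact: mb]|by move=> x; rewrite mule_ge0].
 by rewrite ge0_integralZl.
(* The ball is invariant under [s]: [|x + s y| = |s x + y|]. *)
transitivity (\int[leb n]_y \int[leb n]_x (f (s y) * b (tadd (s x) y))).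
 apply: eq_integral => y _; apply: eq_integral => x _.
 by rewrite -(sN (tadd (s x) y)) sD sK.
rewrite int_swap; last 2 first.
- apply: emeasurable_funM; first exact: (measurableT_comp mfs measurable_fst).
 apply: (measurableT_comp mb); apply: meas_tadd; last by meas.
 exact: (measurableT_comp ms measurable_snd).
- by move=> x y; rewrite mule_ge0.
transitivity (\int[leb n]_x \int[leb n]_y (f (tadd (s y) (neg x)) * b y)).
 apply: eq_integral => x _.
 rewrite -(@leb_translate _ n (neg (s x)) (fun y => f (s y) * b (tadd (s x) y))); last 2 first.
 - side.
 - by move=> y; rewrite mule_ge0.
 apply: eq_integral => y _; rewrite addNK sD sZ sK; congr (f _ * _).
rewrite int_swap; last 2 first.
- apply: emeasurable_funM; last by meas.
 apply: (measurableT_comp mf); apply: meas_tadd; last by meas.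
 exact: (measurableT_comp ms measurable_snd).
- by move=> x y; rewrite mule_ge0.
rewrite -ge0_integralZl//; last by apply: integral_ge0.
apply: eq_integral => y _.
rewrite ge0_integralZr//; last by meas.
congr (_ * _).
rewrite -(@leb_translate _ n (neg (s y)) (fun x => f (neg x))); [|by meas|by []].
apply: eq_integral => x _; congr f.
by apply: eq_from_tnth => i; rewrite !tnth_mktuple; ring.
Qed.

End Haar.

(** Both [refl e] and the identity turn the integral into that of [f] composed with the antipodal
    map, so they agree. *)
Lemma leb_refl n (e : n.-tuple R) (f : n.-tuple R -> \bar R) : dotp e e = 1%R ->
 mbl f -> enneg f ->
 \int[leb n]_x f (refl e x) = \int[leb n]_x f x.
Proof.
move=> e1 mf f0; rewrite leb_isometry_neg//; last 5 first.
- by meas.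
- exact: reflK.
- exact: reflD.
- move=> a x; apply: eq_from_tnth => i; rewrite !tnth_mktuple dotpZr; ring.
- by move=> x; exact: enorm_refl.
by rewrite -(@leb_isometry_neg n id).
Qed.

End Isometry.

(** * Polar coordinates *)

Section Polar.
Local Open Scope ereal_scope.
Context {R : realType}.
Variable n : nat.
Local Notation X := (n.-tuple R).
Local Notation ind b := ((b)%:R : R).

(** Dilation by 2 fixes the origin and multiplies its finite mass by [2^-n], so the mass is zero. *)
Lemma leb_origin : (0 < n)%N -> \int[leb n]_x (ind (enorm (x : X) <= 0)%R)%:E = 0.
Proof.
move=> n0; set a := \int[_]_x _.
have a0 : 0 <= a by apply: integral_ge0 => x _; nneg.
have afin : a \is a fin_num.
 rewrite ge0_fin_numE//; apply: le_lt_trans (leb_ball_fin n).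
 apply: int_le; [by nneg|by meas|by meas|] => x; rewrite lee_fin.
 case: (leP (enorm x) 0%R) => [h|_]; last exact: ler0n.
 by rewrite (le_lt_trans h ltr01).
have : a = (2 ^- n)%:E * a.
 rewrite /a -(@leb_dilate _ n 2 (fun x => (ind (enorm x <= 0)%R)%:E)); [|by []|by meas|by nneg].
 apply: eq_int => x; rewrite enormZ ger0_norm//; congr ((nat_of_bool _)%:R%:E).
 by rewrite pmulr_rle0.
rewrite -(fineK afin) -EFinM => -[h]; congr EFin.
apply/eqP; move/eqP: h; rewrite -subr_eq0 -{1}[fine a]mul1r -mulrBl mulf_eq0 => /orP[|//].
rewrite subr_eq0 eq_sym invr_eq1 => /eqP h.
have : (1 < 2 ^+ n :> R)%R by rewrite exprn_egt1 ?ltr1n// -lt0n.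
by rewrite h ltxx.
Qed.

(** The origin is the one point whose radial projection is not a unit vector. *)
Lemma leb_punctured (F : X -> \bar R) : (0 < n)%N -> mbl F ->
 enneg F ->
 \int[leb n]_x F x = \int[leb n]_x ((ind (0 < enorm x)%R)%:E * F x).
Proof.
move=> n0 mF F0.
transitivity (\int[leb n]_x ((ind (0 < enorm x)%R)%:E * F x + (ind (enorm x <= 0)%R)%:E * F (t0 n))).
 apply: eq_int => x; case: (ltP 0%R (enorm x)) => h; first by rewrite mul1e mul0e adde0.
 rewrite mul0e add0e mul1e; congr F; apply: enorm_eq0.
 by apply/le_anti; rewrite h enorm_ge0.
rewrite ge0_integralD//; last 4 first.
- by move=> x _; rewrite mule_ge0 ?lee_fin ?ler0n.
- by meas.
- by move=> x _; rewrite mule_ge0 ?lee_fin ?ler0n.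
- by meas.
rewrite [X in _ + X](_ : _ = 0) ?adde0//.
rewrite ge0_integralZr; [|by []|by meas|by nneg|exact: F0].
by rewrite leb_origin// mul0e.
Qed.

(** The constant [1/n] of the polar coordinate formula. Its value is never computed: it is positive
    and finite and cancels between two sides. *)
Definition polc : \bar R := \int[lam]_t (ind (1 < t)%R * t ^- n.+1)%:E.

(* Integrate [F(x) |x|^n t^(-n-1)] over [0 < |x| < t] in both orders; in the second one
  rescale [x] by [t], then [t] by [1/|x|]. *)
Lemma polar_aux (F : X -> \bar R) : (0 < n)%N -> mbl F ->
 enneg F ->
 \int[leb n]_x F x * polc =
 \int[leb n]_x ((ind ((0 < enorm x) && (enorm x < 1))%R)%:E *
  \int[lam]_t ((ind (0 < t)%R * t ^+ n.-1)%:E * F (tscale t (nrm x)))).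
Proof.
move=> n0 mF F0; rewrite leb_punctured//.
have En (a : R) : (a ^+ n = a * a ^+ n.-1)%R by rewrite -exprS prednK.
have mFs : mbl (fun z : R * X => F (tscale z.1 z.2)).
 side.
pose w (x : X) (t : R) := (ind ((0 < enorm x) && (enorm x < t))%R * enorm x ^+ n * t ^- n.+1)%R.
have w0 x t : (0 <= w x t)%R.
 rewrite /w; case: (ltP 0%R (enorm x)) => [x0|_]; last by rewrite !mul0r.
 case: (ltP (enorm x) t) => [xt|_]; last by rewrite !mul0r.
 by rewrite mul1r; nneg; exact: ltW (lt_trans x0 xt).
have mw : mbl (fun z : X * R => (w z.1 z.2)%:E) by rewrite /w; meas.
transitivity (\int[leb n]_x \int[lam]_t (F x * (w x t)%:E)).
 rewrite -ge0_integralZr; [|by []|by meas|by move=> x _; rewrite mule_ge0 ?lee_fin ?ler0n|]; last first.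
  by apply: integral_ge0 => t _; rewrite lee_fin; case: (ltP 1%R t) => h; rewrite ?mul0r// mul1r; nneg; exact/ltW/(lt_trans ltr01).
 apply: eq_int => x; case: (ltP 0%R (enorm x)) => x0; last first.
  rewrite mul0e mul0e; apply/esym/integral0_eq => t _.
  by rewrite /w ltNge x0 /= !mul0r mule0.
 rewrite mul1e ge0_integralZl; [|by []|by rewrite /w; meas|by move=> t _; rewrite lee_fin|by []].
 congr (_ * _); rewrite /polc.
 transitivity ((enorm x)^-1%:E * \int[lam]_t (enorm x * w x t)%:E); last first.
  rewrite [X in _ * X](_ : _ = (enorm x)%:E * \int[lam]_t (w x t)%:E); last first.
   by rewrite -int_Zl; [|exact: ltW|rewrite /w; meas|move=> t; rewrite lee_fin].
  by rewrite muleA -EFinM mulVf ?mul1e// gt_eqF.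
 rewrite -(@integral_dilate _ (enorm x) (fun t => (enorm x * w x t)%:E)); [|by []|by rewrite /w; meas|by move=> t; rewrite lee_fin mulr_ge0// ltW].
 apply: eq_int => t; congr EFin; rewrite /w x0 /=.
 rewrite ltr_pMr//.
 case: (ltP 1%R t) => h; last by rewrite !mul0r mulr0.
 rewrite !mul1r exprMn invfM mulrA mulrA -exprS divff ?mul1r//.
 by rewrite expf_neq0// gt_eqF.
rewrite int_swap; last 2 first.
- by apply: emeasurable_funM => //; exact: (measurableT_comp mF measurable_fst).
- by move=> x t; rewrite mule_ge0// lee_fin.
transitivity (\int[lam]_t \int[leb n]_x (F (tscale t x) *
  (ind (0 < t)%R * t ^+ n.-1 * ind ((0 < enorm x) && (enorm x < 1))%R * enorm x ^+ n)%:E)).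
 apply: eq_int => t; case: (ltP 0%R t) => t0; last first.
  rewrite !integral0_eq// => x _; first by rewrite !mul0r mule0.
  rewrite /w; case: (ltP 0%R (enorm x)) => [x0|_]; last by rewrite !mul0r mule0.
  by rewrite (ltNge (enorm x)) (le_trans t0 (ltW x0)) !mul0r mule0.
 rewrite -[LHS]mul1e -[X in X%:E * _](@mulfV _ (t ^- n)) ?invr_neq0 ?expf_neq0 ?gt_eqF//.
 rewrite mulrC EFinM -muleA -(@leb_dilate _ n t (fun x => F x * (w x t)%:E))//; last 2 first.
 - by apply: emeasurable_funM => //; rewrite /w; meas.
 - by move=> x; rewrite mule_ge0// lee_fin.
 rewrite invrK -int_Zl; [|side| |by move=> x; rewrite mule_ge0// lee_fin]; last first.
  by apply: emeasurable_funM; [meas|rewrite /w; meas].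
 apply: eq_int => x; rewrite muleCA -EFinM; congr (_ * _%:E).
 rewrite /w enormZ gtr0_norm// pmulr_rgt0// mul1r.
 rewrite gtr_pMr//.
 case: (_ && _); last by rewrite !(mul0r, mulr0).
 have tz : (t : R) != 0%R by rewrite gt_eqF.
 have tp : ((t : R) ^+ n.-1 != 0)%R by rewrite expf_neq0.
 by rewrite !mul1r mulr1 exprMn exprS !En; field; rewrite tz tp.
rewrite int_swap; last 2 first.
- side.
- move=> t x; rewrite mule_ge0// lee_fin; case: (ltP 0%R t) => h; last by rewrite !mul0r.
 side.
apply: eq_int => x; case: andP => [[x0 x1]|_]; last first.
 by rewrite mul0e integral0_eq// => t _; rewrite mulr0 mul0r mule0.
rewrite mul1e.
pose g t := (ind (0 < t)%R * t ^+ n.-1)%:E * F (tscale t (nrm x)).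
have g0 t : 0 <= g t.
 rewrite mule_ge0// lee_fin; case: (ltP 0%R t) => h; last by rewrite mul0r.
 side.
have mg : mbl g by apply: emeasurable_funM; meas.
rewrite -[RHS]mul1e -[X in X%:E * _](@mulfV _ (enorm x)) ?gt_eqF// EFinM -muleA.
rewrite -(@integral_dilate _ (enorm x) g)// -int_Zl; [|exact: ltW|by apply: (measurableT_comp mg); meas|by []].
apply: eq_int => t; rewrite /g muleA -EFinM muleC; congr (_%:E * F _).
 rewrite mulr1 pmulr_rgt0// exprMn En; ring.
by apply: eq_from_tnth => i; rewrite !tnth_mktuple; field; rewrite gt_eqF.
Qed.

End Polar.

(** * The uniform probability on the sphere *)

Section SphereMeasure.
Local Open Scope ereal_scope.
Context {R : realType}.
Variable n : nat.
Local Notation X := (n.-tuple R).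
Local Notation ind b := ((b)%:R : R).

Definition vball : R := fine (\int[leb n]_x (ind (enorm (x : X) < 1)%R)%:E).

Lemma vballE : \int[leb n]_x (ind (enorm (x : X) < 1)%R)%:E = vball%:E.
Proof. by rewrite fineK// ge0_fin_numE ?leb_ball_fin//; exact/ltW/leb_ball_gt0. Qed.

Lemma vball_gt0 : (0 < vball)%R.
Proof. by rewrite -lte_fin -vballE leb_ball_gt0. Qed.

Let mnrm : mbl (@nrm R n). Proof. exact: meas_nrm. Qed.
Let mwt : mbl (fun x : X => vball^-1 * ind (enorm x < 1)%R)%R.
Proof. by meas. Qed.
Let wt_ge0 (x : X) : (0 <= vball^-1 * ind (enorm x < 1)%R)%R.
Proof. by nneg; exact/ltW/vball_gt0. Qed.

(** Normalized Lebesgue measure of the unit ball, projected radially. It is a probability on the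
    ambient tuples, so that integrands remain total functions; [sph_unit] below shows that it lives
    on the unit sphere. *)
Definition sph : set X -> \bar R := wpush (leb n) mnrm mwt wt_ge0.

HB.instance Definition _ := Measure.on sph.

Lemma sph_int (f : X -> \bar R) : mbl f -> enneg f ->
 \int[sph]_x f x = vball^-1%:E * \int[leb n]_x ((ind (enorm x < 1)%R)%:E * f (nrm x)).
Proof.
move=> mf f0; rewrite [LHS]wpush_int// -int_Zl.
- by apply: eq_int => x; rewrite EFinM muleC muleA.
- by nneg; exact/ltW/vball_gt0.
- side.
- by move=> x; rewrite mule_ge0// lee_fin ler0n.
Qed.

Let sph1 : sph setT = 1.
Proof.
have <- : \int[sph]_x (cst 1 x) = sph setT by rewrite integral_cst// mul1e.
rewrite sph_int//.
under eq_integral do rewrite mule1.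
by rewrite vballE -EFinM mulVf// gt_eqF// vball_gt0.
Qed.

HB.instance Definition _ := Measure_isProbability.Build _ _ _ sph sph1.

Hypothesis n0 : (0 < n)%N.

Lemma polar_sph (F : X -> \bar R) : mbl F -> enneg F ->
 \int[leb n]_x F x * polc n = vball%:E *
 \int[sph]_y \int[lam]_t ((ind (0 < t)%R * t ^+ n.-1)%:E * F (tscale t y)).
Proof.
move=> mF F0; rewrite polar_aux//.
have g0 y t : 0 <= (ind (0 < t)%R * t ^+ n.-1)%:E * F (tscale t y).
 rewrite mule_ge0// lee_fin; case: (ltP 0%R t) => h; last by rewrite mul0r.
 side.
have mI : mbl (fun y => \int[lam]_t ((ind (0 < t)%R * t ^+ n.-1)%:E * F (tscale t y))).
 apply: measurable_int2 => //; apply: emeasurable_funM; first by meas.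
 side.
rewrite sph_int//; last by move=> y; exact: integral_ge0.
rewrite muleA -EFinM mulfV ?gt_eqF ?vball_gt0// mul1e.
rewrite [RHS]leb_punctured//; last 2 first.
- by apply: emeasurable_funM; [meas|apply: (measurableT_comp mI); exact: meas_nrm].
- by move=> x; rewrite mule_ge0 ?lee_fin ?ler0n// integral_ge0.
apply: eq_int => x; rewrite muleA -EFinM -natrM mulnb //.
Qed.

Lemma polc_gt0 : 0 < @polc R n.
Proof.
have : 0 < \int[lam]_t ((2 ^- n.+1)%:E * (\1_(`](1%R), 2%R]%classic : set R) t)%:E).
 rewrite ge0_integralZl ?lee_fin ?invr_ge0 ?exprn_ge0//; last exact/measurable_EFinP/measurable_indic.
 rewrite integral_indic// setIT.
 have := @lebesgue_measure_itv R `](1%R), 2%R]; move=> /= ->.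
 by rewrite lte_fin ltr1n /= -EFinB -EFinM lte_fin mulr_gt0 ?invr_gt0 ?exprn_gt0// subr_gt0 ltr1n.
move=> /lt_le_trans; apply; apply: int_le.
- side.
- by apply: emeasurable_funM; [meas|exact/measurable_EFinP/measurable_indic].
- by meas.
move=> t; rewrite -EFinM lee_fin indicE mem_setE in_itv/=.
case: (ltP 1%R t) => t1 /=; last by rewrite mulr0 mul0r.
rewrite mul1r; have t0 : (0 < t)%R := lt_trans ltr01 t1.
case: (leP (t : R) 2%R) => t2; last by rewrite mulr0 invr_ge0 exprn_ge0// ltW.
by rewrite mulr1 lef_pV2 ?posrE ?exprn_gt0// ler_pXn2r// nnegrE ltW.
Qed.

(** Polar coordinates for the indicator of the unit ball: each radial integral is at most the length
    of []0, 1]], so [polc <= 1]. *)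
Lemma polc_fin : @polc R n < +oo.
Proof.
have E := @polar_aux R n (fun x => (ind (enorm x < 1)%R)%:E) n0.
have {}E := E _ _; rewrite vballE in E.
have : vball%:E * polc n <= vball%:E * 1.
 rewrite E; [|by meas|by nneg].
 rewrite mule1 -vballE; apply: int_le; last move=> x.
 - move=> x; rewrite mule_ge0 ?lee_fin ?ler0n// integral_ge0// => t _.
  rewrite -EFinM lee_fin; case: (ltP 0%R t) => h; last by rewrite !mul0r.
  side.
 - apply: emeasurable_funM; first by meas.
  apply: measurable_int2; first by meas.
  move=> x t; rewrite -EFinM lee_fin; case: (ltP 0%R t) => h; last by rewrite !mul0r.
  side.
 - by meas.
 case: (ltP 0%R (enorm x)) => x0; last by rewrite mul0e lee_fin ler0n.
 case: (ltP (enorm x) 1%R) => x1; last by rewrite mul0e.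
 rewrite mul1e; apply: (@le_trans _ _ (\int[lam]_t (\1_(`](0%R), 1%R]%classic : set R) t)%:E)).
  apply: int_le.
  - move=> t; rewrite -EFinM lee_fin; case: (ltP 0%R t) => h; last by rewrite !mul0r.
   side.
  - by meas.
  - exact/measurable_EFinP/measurable_indic.
  move=> t; rewrite -EFinM lee_fin indicE mem_setE in_itv/=.
  case: (ltP 0%R t) => t0 /=; last by rewrite !mul0r.
  rewrite enormZ enorm_nrm// mulr1 gtr0_norm// mul1r.
  case: (ltP t 1%R) => t1; last by rewrite mulr0 ler0n.
  by rewrite mulr1 (ltW t1) exprn_ile1 ?ltW.
 rewrite integral_indic// setIT.
 have := @lebesgue_measure_itv R `](0%R), 1%R]; move=> /= ->.
 by rewrite lte_fin ltr01 sube0.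
rewrite lee_pmul2l ?lte_fin ?vball_gt0// => /le_lt_trans; apply.
exact: ltry.
Qed.

End SphereMeasure.

(** * The hyperboloid and its invariant measure *)

Section HyperbolicMeasure.
Local Open Scope ereal_scope.
Context {R : realType}.
Variable n : nat.
Local Notation X := (n.-tuple R).
Local Notation ind b := ((b)%:R : R).
Local Notation P := (@sph R n).

(** The time coordinate of the point [(hgt x, x)] of the hyperboloid [t^2 - |x|^2 = 1]. *)
Definition hgt (x : X) : R := Num.sqrt (1 + dotp x x).

Lemma hgt_ge1 x : (1 <= hgt x)%R.
Proof. by rewrite -{1}sqrtr1 ler_wsqrtr// lerDl dotp_ge0. Qed.

Lemma hgt_gt0 x : (0 < hgt x)%R.
Proof. exact: lt_le_trans ltr01 (hgt_ge1 x). Qed.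

Lemma hgt_sqr x : (hgt x ^+ 2 = 1 + dotp x x)%R.
Proof. by rewrite sqr_sqrtr// addr_ge0// dotp_ge0. Qed.

Lemma enorm_lt_hgt x : (enorm x < hgt x)%R.
Proof.
rewrite -(@ltr_pXn2r _ 2)// ?nnegrE ?enorm_ge0 ?(ltW (hgt_gt0 x))//.
by rewrite hgt_sqr enormE ltrDr.
Qed.

Lemma meas_hgt d (T : measurableType d) (F : T -> X) : mbl F -> mbl (fun x => hgt (F x)).
Proof. by move=> mF; rewrite /hgt; meas. Qed.

Let mid : mbl (id : X -> X). Proof. exact: measurable_id. Qed.
Let mwt : mbl (fun x : X => (hgt x)^-1)%R.
Proof. by apply: meas_inv; exact: meas_hgt. Qed.
Let wt_ge0 (x : X) : (0 <= (hgt x)^-1)%R.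
Proof. by side. Qed.

(** The measure [dx / hgt x]: the Lorentz-invariant volume of the hyperboloid in the chart of space
    coordinates. *)
Definition hyp : set X -> \bar R := wpush (leb n) mid mwt wt_ge0.

HB.instance Definition _ := Measure.on hyp.

Lemma hyp_int (f : X -> \bar R) : mbl f -> enneg f ->
 \int[hyp]_x f x = \int[leb n]_x (f x * (hgt x)^-1%:E).
Proof. by move=> mf f0; rewrite [LHS]wpush_int. Qed.

Let hyp_sigma_finite : sigma_finite setT hyp.
Proof.
exists (fun k => [set x : X | (enorm x < k.+1%:R)%R]).
 apply/esym/seteqP; split=> // x _.
 by exists (Num.truncn (enorm x)) => //=; exact: truncnS_gt.
move=> k.
have mA : measurable [set x : X | (enorm x < k.+1%:R)%R].
 have mf : mbl (fun x : X => (enorm x < k.+1%:R)%R) by meas.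
 have := mf measurableT [set true] I; rewrite setTI.
 side.
split=> //.
rewrite /hyp /wpush preimage_id integral_mkcond.
apply: (@le_lt_trans _ _ (\int[leb n]_x (ind (enorm (tscale k.+1%:R^-1 x) < 1)%R)%:E)).
 apply: int_le.
 - by move=> x; rewrite patchE; case: ifP => // _; rewrite lee_fin.
 - by apply/(measurable_restrictT _ mA); apply: measurable_funTS; apply: meas_EFin.
 - by meas.
 move=> x; rewrite patchE; case: ifPn => [|_]; last by nneg.
 rewrite inE /= => xk; rewrite lee_fin enormZ ger0_norm ?invr_ge0//.
 rewrite mulrC ltr_pdivrMr// mul1r xk.
 by rewrite invf_le1 ?hgt_gt0// hgt_ge1.
rewrite (@leb_dilate _ n k.+1%:R^-1 (fun x => (ind (enorm x < 1)%R)%:E)); [|by rewrite invr_gt0|by meas|by nneg].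
by rewrite vballE -EFinM ltry.
Qed.

HB.instance Definition _ := Measure_isSigmaFinite.Build _ _ _ hyp hyp_sigma_finite.

Lemma hgt_refl e x : dotp e e = 1%R -> hgt (refl e x) = hgt x.
Proof. by move=> e1; rewrite /hgt dotp_refl. Qed.

Lemma hyp_refl (e : X) (f : X -> \bar R) : dotp e e = 1%R ->
 mbl f -> enneg f ->
 \int[hyp]_x f (refl e x) = \int[hyp]_x f x.
Proof.
move=> e1 mf f0; rewrite !hyp_int//; last by meas.
rewrite -[RHS](@leb_refl _ n e); [|by []|by apply: emeasurable_funM => //; exact: meas_EFin|by move=> x; rewrite mule_ge0// lee_fin].
by apply: eq_int => x; rewrite hgt_refl.
Qed.

Lemma sph_refl (e : X) (f : X -> \bar R) : dotp e e = 1%R ->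
 mbl f -> enneg f ->
 \int[P]_x f (refl e x) = \int[P]_x f x.
Proof.
move=> e1 mf f0; rewrite !sph_int//; last by meas.
rewrite -[in RHS](@leb_refl _ n e); [|by []|by apply: emeasurable_funM; meas|by move=> x; rewrite mule_ge0// lee_fin ler0n].
by congr (_ * _); apply: eq_int => x; rewrite enorm_refl// nrm_refl.
Qed.

Hypothesis n0 : (0 < n)%N.

(** Once the origin is removed every [nrm x] has norm 1, so the measure does not see points off the
    sphere. *)
Lemma sph_unit (f : X -> \bar R) : mbl f -> enneg f ->
 \int[P]_x f x = \int[P]_x ((ind (enorm x == 1)%R)%:E * f x).
Proof.
move=> mf f0.
have m1 : mbl (fun x : X => ind (enorm x == 1)%R).
 rewrite (_ : (fun _ => _) = (fun x : X => ind ((enorm x <= 1) && (1 <= enorm x))%R)); first by meas.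
 by apply/funext => x; rewrite eq_le.
rewrite !sph_int//; last 2 first.
- by apply: emeasurable_funM => //; exact: meas_EFin.
- by move=> x; rewrite mule_ge0// lee_fin ler0n.
congr (_ * _).
rewrite leb_punctured//; last 2 first.
- side.
- by move=> x; rewrite mule_ge0// lee_fin ler0n.
rewrite [RHS]leb_punctured//; last 2 first.
- apply: emeasurable_funM; first by meas.
 apply: emeasurable_funM; last by meas.
 by apply: meas_EFin; apply: (measurableT_comp m1); exact: meas_nrm.
- by move=> x; rewrite !mule_ge0// lee_fin ler0n.
apply: eq_int => x; case: (ltP 0%R (enorm x)) => x0; last by rewrite !mul0e.
by rewrite enorm_nrm// eqxx !mul1e.
Qed.

End HyperbolicMeasure.

Ltac meas_ext ::= lazymatch goal with
 | |- measurable_fun _ (fun x => hgt (@?f x)) => apply: (meas_hgt (F := f))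
 end.

(** * Lorentz boosts *)

Section Boost1D.
Local Open Scope ereal_scope.
Context {R : realType}.
Variables (c k : R).
Hypotheses (c0 : (0 < c)%R) (ck : (c ^+ 2 = 1 + k ^+ 2)%R).

Lemma boost_k_lt : (`|k| < c)%R.
Proof.
have : (`|k| ^+ 2 < c ^+ 2)%R by rewrite real_normK ?num_real// ck ltrDr.
by rewrite ltr_pXn2r// nnegrE ltW.
Qed.

Lemma boost_pos (w y : R) : (`|y| <= w)%R -> (0 < w)%R -> (0 < c * w + k * y)%R.
Proof.
move=> yw w0; have := boost_k_lt; have : (- (`|k| * `|y|) <= k * y)%R.
 by rewrite -normrM; exact: lerNnormlW.
have : (`|k| * `|y| <= `|k| * w)%R by rewrite ler_wpM2l.
move=> h1 h2 h3; have h4 : (`|k| * w < c * w)%R by rewrite ltr_pM2r.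
lra.
Qed.

Variable m : R.
Hypothesis m0 : (0 < m)%R.
Local Notation w y := (Num.sqrt (m + y ^+ 2)).

Let w_gt0 y : (0 < w y)%R.
Proof. by rewrite sqrtr_gt0 ltr_pwDl// sqr_ge0. Qed.
Let w_sqr y : (w y ^+ 2 = m + y ^+ 2)%R.
Proof. by rewrite sqr_sqrtr// addr_ge0 ?sqr_ge0// ltW. Qed.
Let w_ge y : (`|y| <= w y)%R.
Proof. by rewrite -sqrtr_sqr ler_wsqrtr// lerDr ltW. Qed.

(** Here [c] and [k] are the hyperbolic cosine and sine of the rapidity, and [(w y, y)] runs over
    the hyperbola [w^2 - y^2 = m], which the boost preserves. The value [m = 1 + |t|^2] gives the
    hyperboloid, [m = |t|^2] the light cone. *)
Lemma sqrt_boost y : w (c * y + k * w y) = (c * w y + k * y)%R.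
Proof.
apply/eqP; rewrite -(@eqrXn2 _ 2)// ?sqrtr_ge0//; last exact/ltW/boost_pos.
rewrite w_sqr; apply/eqP; move: (w y) (w_sqr y) => W E.
have -> : m = (W ^+ 2 - y ^+ 2)%R by rewrite E; ring.
rewrite -[RHS]subr0 -(mul0r (W ^+ 2 - y ^+ 2)%R).
have -> : 0%R = (c ^+ 2 - 1 - k ^+ 2)%R by rewrite ck; ring.
ring.
Qed.

End Boost1D.

Section Boost1Dint.
Local Open Scope ereal_scope.
Context {R : realType}.
Variables (c k m : R).
Hypotheses (c0 : (0 < c)%R) (ck : (c ^+ 2 = 1 + k ^+ 2)%R) (m0 : (0 < m)%R).
Local Notation w y := (Num.sqrt (m + y ^+ 2)).

Let ckN : (c ^+ 2 = 1 + (- k) ^+ 2)%R. Proof. by rewrite sqrrN. Qed.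
Let w_gt0 y : (0 < w y)%R.
Proof. by rewrite sqrtr_gt0 ltr_pwDl// sqr_ge0. Qed.
Let w_ge y : (`|y| <= w y)%R.
Proof. by rewrite -sqrtr_sqr ler_wsqrtr// lerDr ltW. Qed.

(** In terms of rapidity [dy / w y] is arc length and the boost a translation. Concretely, the
    inverse boost [A] has derivative [w (A x) / w x]. *)
Lemma integral_boost (G : R -> \bar R) : mbl G -> enneg G ->
 \int[lam]_y (G (c * y + k * w y)%R * (w y)^-1%:E) = \int[lam]_y (G y * (w y)^-1%:E).
Proof.
move=> mG G0.
pose A x := (c * x + (- k) * w x)%R.
pose B x := (c * x + k * w x)%R.
pose A' x := (c + (- k) * (x / w x))%R.
have wB y : w (B y) = (c * w y + k * y)%R by exact: sqrt_boost.
have wA y : w (A y) = (c * w y + (- k) * y)%R by exact: sqrt_boost.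
have AB y : A (B y) = y.
 rewrite /A wB /B; have E : y = ((1 + k ^+ 2 - k ^+ 2) * y)%R by ring.
 by rewrite [RHS]E -ck; ring.
have A'w x : (A' x * w x = w (A x))%R.
 by rewrite wA /A' mulrDl -mulrA divfK// gt_eqF.
have A'0 x : (0 < A' x)%R by rewrite -(pmulr_lgt0 _ (w_gt0 x)) A'w.
have mono x y : (x < y)%R -> (A x < A y)%R.
 move=> xy; rewrite /A.
 have := boost_k_lt c0 ck; have wx := w_gt0 x; have wy := w_gt0 y.
 have E : ((w y - w x) * (w y + w x) = (y - x) * (y + x))%R.
  rewrite -!subr_sqr !sqr_sqrtr ?addr_ge0 ?sqr_ge0 ?ltW//; ring.
 have : (`|w y - w x| <= y - x)%R.
  have ws : (0 < w y + w x)%R by exact: addr_gt0.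
  rewrite -(ler_pM2r ws) -{1}(gtr0_norm ws) -normrM E normrM (@gtr0_norm _ (y - x)%R) ?subr_gt0//.
  rewrite ler_pM2l ?subr_gt0//; apply: le_trans (ler_normD _ _) _.
  by apply: lerD; exact: w_ge.
 move=> h1 h2; rewrite -subr_gt0.
 have -> : (c * y + - k * w y - (c * x + - k * w x) = c * (y - x) - k * (w y - w x))%R by ring.
 rewrite subr_gt0; apply: (@le_lt_trans _ _ (`|k| * (y - x))%R); last first.
  by rewrite ltr_pM2r ?subr_gt0.
 apply: le_trans (ler_norm _) _; rewrite normrM ler_wpM2l//.
have dw (x : R) : is_derive x (1%R : R) (fun y => w y) (x / w x)%R.
 have h : is_derive x (1%R : R) (fun y : R => m + y ^+ 2)%R (2 * x)%R.
  by apply: is_derive_eq; rewrite /GRing.scale/= ?expr1; ring.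
 have hs : is_derive (m + x ^+ 2)%R (1%R : R) Num.sqrt (2 * w x)^-1%R.
  by apply: is_derive1_sqrt; rewrite ltr_pwDl ?sqr_ge0.
 have := @is_derive1_comp _ (@Num.sqrt R) (fun y : R => m + y ^+ 2)%R x _ _ hs h.
 rewrite (_ : _ * _ = x / w x)%R //.
 by have w0 := w_gt0 x; field; rewrite gt_eqF.
have dA (x : R) : is_derive x (1%R : R) A (A' x).
 apply: is_derive_eq; rewrite /A' /GRing.scale/=; ring.
have cw : continuous (fun x : R => w x).
 move=> x; apply: differentiable_continuous; apply/derivable1_diffP; exact: (@ex_derive _ _ _ _ _ _ _ (dw x)).
pose H x := G x * (w (A x))^-1%:E.
have mA : mbl A by rewrite /A; meas.
transitivity (\int[lam]_y H (B y)).
 by apply: eq_int => y; rewrite /H AB.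
rewrite (@integral_substitution _ A A' B setT H).
- apply: eq_int => x; rewrite /H -muleA -EFinM; congr (_ * _%:E).
 by have := w_gt0 x; have := A'0 x => a0 w0; rewrite -A'w; field; rewrite !gt_eqF.
- side.
- by move=> x; rewrite derive1E; exact: derive_val.
- move=> x; apply: cvgD; first exact: cvg_cst.
 apply: cvgM; first exact: cvg_cst.
 apply: cvgM; first exact: cvg_id.
 by apply: cvgV; [rewrite gt_eqF|exact: cw].
- by move=> x; exact: ltW.
- by rewrite /B; meas.
- by [].
- move=> x1 x2 y _.
 have lt1 x : (x < B y)%R = (A x < y)%R.
  apply/idP/idP => [/mono|]; first by rewrite AB.
  move=> h; rewrite ltNge; apply/negP; rewrite le_eqVlt => /predU1P[e|/mono].
   by move: h; rewrite -e AB ltxx.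
  by rewrite AB => /(lt_trans h); rewrite ltxx.
 by rewrite lt1 !(leNgt _ x2) !(leNgt _ (A x2)) lt1; split=> [[]|].
- by apply: emeasurable_funM => //; meas.
- by move=> x; rewrite mule_ge0// lee_fin invr_ge0 sqrtr_ge0.
Qed.

End Boost1Dint.

Section Boost.
Local Open Scope ereal_scope.
Context {R : realType}.
Variables (N : nat) (c k : R).
Hypotheses (c0 : (0 < c)%R) (ck : (c ^+ 2 = 1 + k ^+ 2)%R).
Local Notation X := (N.+1.-tuple R).
Local Notation ind b := ((b)%:R : R).

Definition boost (x : X) : X := cons_tuple (c * tnth x ord0 + k * hgt x)%R (behead_tuple x).
Definition cboost (x : X) : X := cons_tuple (c * tnth x ord0 + k * enorm x)%R (behead_tuple x).
(** The time coordinate of the boosted light-like vector [(|x|, x)]. It is the conformal factor on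
    the boundary: the sphere map [nrm (cboost y)] has Jacobian [dil^-N], see [sph_boost]. *)
Definition dil (x : X) : R := (c * enorm x + k * tnth x ord0)%R.

Lemma dotp_cons0 (x y : X) :
 dotp x y = (tnth x ord0 * tnth y ord0 + dotp (behead_tuple x) (behead_tuple y))%R.
Proof.
case/tupleP: x => a t; case/tupleP: y => b u; rewrite dotp_cons.
by congr (_ * _ + dotp _ _)%R; apply/val_inj.
Qed.

Lemma hgt_cons a (t : N.-tuple R) :
 hgt (cons_tuple a t) = Num.sqrt ((1 + dotp t t) + a ^+ 2).
Proof. by rewrite /hgt dotp_cons -expr2; congr Num.sqrt; ring. Qed.

Lemma enorm_cons a (t : N.-tuple R) :
 enorm (cons_tuple a t) = Num.sqrt (dotp t t + a ^+ 2).
Proof. by rewrite /enorm dotp_cons -expr2; congr Num.sqrt; ring. Qed.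

Lemma behead_cons a (t : N.-tuple R) : behead_tuple (cons_tuple a t) = t.
Proof. exact/val_inj. Qed.

Lemma meas_boost d (T : measurableType d) (F : T -> X) : mbl F -> mbl (fun x => boost (F x)).
Proof.
move=> mF; apply: measurable_cons; first by meas.
have := measurableT_comp (measurable_snd : mbl (@snd R (N.-tuple R))) (measurable_uncons (n := N)).
by move=> h; exact: (measurableT_comp h mF).
Qed.

Lemma meas_cboost d (T : measurableType d) (F : T -> X) : mbl F -> mbl (fun x => cboost (F x)).
Proof.
move=> mF; apply: measurable_cons; first by meas.
have := measurableT_comp (measurable_snd : mbl (@snd R (N.-tuple R))) (measurable_uncons (n := N)).
by move=> h; exact: (measurableT_comp h mF).
Qed.

Lemma hyp_boost (f : X -> \bar R) : mbl f -> enneg f ->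
 \int[@hyp R N.+1]_x f (boost x) = \int[@hyp R N.+1]_x f x.
Proof.
move=> mf f0; rewrite !hyp_int//; last exact: (measurableT_comp mf (meas_boost (@measurable_id _ _ setT))).
have w0 (x : X) : 0 <= (hgt x)^-1%:E by rewrite lee_fin invr_ge0 ltW// hgt_gt0.
rewrite !lebS_int'; last 4 first.
- side.
- by move=> x; rewrite mule_ge0.
- apply: emeasurable_funM; last by meas.
 exact: (measurableT_comp mf (meas_boost (@measurable_id _ _ setT))).
- by move=> x; rewrite mule_ge0.
apply: eq_int => t.
have := @integral_boost R c k (1 + dotp t t) c0 ck _ (fun a => f (cons_tuple a t)).
move=> H; transitivity (\int[lam]_y
 (f (cons_tuple (c * y + k * Num.sqrt (1 + dotp t t + y ^+ 2))%R t) * (Num.sqrt (1 + dotp t t + y ^+ 2))^-1%:E)).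
 by apply: eq_int => a; rewrite /boost hgt_cons behead_cons.
rewrite H; [|by rewrite ltr_pwDl// dotp_ge0|by meas|by []].
by apply: eq_int => a; rewrite hgt_cons.
Qed.

Hypothesis N0 : (0 < N)%N.

(** The invariance of [dy / w y] on each fibre, with [m = |t|^2] in place of [1 + |t|^2]. The
    degenerate fibre [t = 0] is null because [N > 0]. *)
Lemma cone_boost (f : X -> \bar R) : mbl f -> enneg f ->
 \int[leb N.+1]_x (f (cboost x) * (enorm x)^-1%:E) =
 \int[leb N.+1]_x (f x * (enorm x)^-1%:E).
Proof.
move=> mf f0.
have mfc := measurableT_comp mf (meas_cboost (@measurable_id _ _ setT)).
have w0 (x : X) : 0 <= (enorm x)^-1%:E by nneg.
have m1 : mbl (fun x => f (cboost x) * (enorm x)^-1%:E) by apply: emeasurable_funM => //; meas.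
have m2 : mbl (fun x => f x * (enorm x)^-1%:E) by apply: emeasurable_funM => //; meas.
have p1 x : 0 <= f (cboost x) * (enorm x)^-1%:E by rewrite mule_ge0.
have p2 x : 0 <= f x * (enorm x)^-1%:E by rewrite mule_ge0.
rewrite (lebS_int' m1 p1) (lebS_int' m2 p2).
have mm g : mbl g -> (forall x : X, 0 <= g x) ->
 mbl (fun t : N.-tuple R => \int[lam]_a g (cons_tuple a t)).
 by move=> mg g0; apply: measurable_int2 => //; meas.
rewrite (leb_punctured N0 (mm _ m1 p1) (fun t => integral_ge0 _ (fun a _ => p1 _))).
rewrite (leb_punctured N0 (mm _ m2 p2) (fun t => integral_ge0 _ (fun a _ => p2 _))).
apply: eq_int => t; case: (ltP 0%R (enorm t)) => t0; last by rewrite !mul0e.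
congr (_ * _).
have tt : (0 < dotp t t)%R by rewrite -enormE exprn_gt0.
have H := @integral_boost R c k (dotp t t) c0 ck tt (fun a => f (cons_tuple a t)).
transitivity (\int[lam]_y
 (f (cons_tuple (c * y + k * Num.sqrt (dotp t t + y ^+ 2))%R t) * (Num.sqrt (dotp t t + y ^+ 2))^-1%:E)).
 by apply: eq_int => a; rewrite /cboost enorm_cons behead_cons.
rewrite H; [|by meas|by []].
by apply: eq_int => a; rewrite enorm_cons.
Qed.

Lemma cboostZ t (x : X) : (0 < t)%R -> cboost (tscale t x) = tscale t (cboost x).
Proof.
move=> t0; case/tupleP: x => a u; rewrite -[[tuple of _]]/(cons_tuple a u).
rewrite /cboost tscale_cons !behead_cons -[in enorm _]tscale_cons enormZ gtr0_norm//.
rewrite [RHS]tscale_cons; congr cons_tuple.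
by change ((c * (t * a) + k * (t * enorm (cons_tuple a u))) = (t * (c * a + k * enorm (cons_tuple a u))))%R; ring.
Qed.

Lemma enorm_cboost (x : X) : (0 <= dil x)%R -> enorm (cboost x) = dil x.
Proof.
move=> d0; rewrite /cboost enorm_cons -[RHS]ger0_norm// -sqrtr_sqr; congr Num.sqrt.
rewrite /dil; have := enormE x; rewrite dotp_cons0 => E.
have -> : dotp (behead_tuple x) (behead_tuple x) = (enorm x ^+ 2 - tnth x ord0 ^+ 2)%R by rewrite E; ring.
rewrite -[RHS]subr0 -(mul0r (enorm x ^+ 2 - tnth x ord0 ^+ 2)%R).
have -> : 0%R = (c ^+ 2 - 1 - k ^+ 2)%R by rewrite ck; ring.
ring.
Qed.

Lemma dil_gt0 (x : X) : (0 < enorm x)%R -> (0 < dil x)%R.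
Proof. by move=> x0; apply: boost_pos => //; exact: tnth_enorm_le. Qed.

Lemma dil_ge0 (x : X) : (0 <= dil x)%R.
Proof.
have := enorm_ge0 x; rewrite le_eqVlt => /predU1P[x0|/dil_gt0/ltW//].
rewrite /dil -x0 mulr0 add0r (_ : tnth x ord0 = 0%R) ?mulr0//.
by have := tnth_enorm_le x ord0; rewrite -x0 normr_le0 => /eqP.
Qed.

Lemma nrmZ t (x : X) : (0 < t)%R -> nrm (tscale t x) = nrm x.
Proof.
move=> t0; apply: eq_from_tnth => i; rewrite !tnth_mktuple enormZ gtr0_norm// invfM.
by rewrite mulrACA mulVf ?mul1r// gt_eqF.
Qed.

(** Invariance of [dx / |x|] on the cone, applied to [G (nrm x) |x|] on the unit ball. In polar
    coordinates the preimage of the ball is [t dil(y) < 1], and the radial integral produces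
    [dil^-N]. *)
Lemma sph_boost_aux (G : X -> \bar R) : mbl G -> enneg G ->
 \int[@sph R N.+1]_y G y * polc N.+1 =
 \int[@sph R N.+1]_y (G (nrm (cboost y)) * (dil y ^- N)%:E) *
 \int[lam]_t (ind (0 < t < 1)%R * t ^+ N)%:E.
Proof.
move=> mG G0.
have md : mbl dil by rewrite /dil; meas.
have mGc : mbl (fun y => G (nrm (cboost y))).
 by apply: (measurableT_comp mG); apply: meas_nrm; exact: meas_cboost.
have mi : mbl (fun y : X => ind (enorm y == 1)%R).
 rewrite (_ : (fun _ => _) = (fun x : X => ind ((enorm x <= 1) && (1 <= enorm x))%R)); first by meas.
 by apply/funext => x; rewrite eq_le.
pose I1 := \int[lam]_t (ind (0 < t < 1)%R * t ^+ N)%:E.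
have I1_0 t : 0 <= (ind (0 < t < 1)%R * t ^+ N)%:E.
 by rewrite lee_fin; case: (ltP 0%R t) => h /=; rewrite ?mul0r//; nneg; exact: ltW.
have I1E (d : R) : (0 < d)%R ->
  \int[lam]_t (ind (0 < t)%R * t ^+ N * ind (t * d < 1)%R)%:E = (d ^- N.+1)%:E * I1.
 move=> d0; rewrite exprS invfM EFinM muleAC [d^-1%:E * _]muleC -[I1]/(\int[lam]_t _).
 rewrite muleC -[X in _ * X]muleC.
 rewrite -(@integral_dilate _ d (fun t => (ind (0 < t < 1)%R * t ^+ N)%:E) d0 _ I1_0); last by meas.
 rewrite -int_Zl; [|by nneg; exact: ltW|by meas|side].
 apply: eq_int => t; rewrite -EFinM; congr EFin.
 rewrite pmulr_rgt0// mulrC (mulrC t d).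
 case: (ltP 0%R t) => h /=; last by ring.
 rewrite exprMn; have dN : (d ^+ N != 0)%R by rewrite expf_neq0// gt_eqF.
 by field.
pose H (G : X -> \bar R) (x : X) := G (nrm x) * (enorm x * ind (enorm x < 1)%R)%:E.
have mH F : mbl F -> mbl (H F).
 by move=> mF; apply: emeasurable_funM; meas.
have H0 F x : enneg F -> 0 <= H F x by move=> F0; rewrite mule_ge0//; nneg.
have E1 F : mbl F -> enneg F ->
  \int[leb N.+1]_x (H F x * (enorm x)^-1%:E) = (@vball R N.+1)%:E * \int[@sph R N.+1]_y F y.
 move=> mF F0; rewrite sph_int// muleA -EFinM mulfV ?gt_eqF ?vball_gt0// mul1e.
 rewrite leb_punctured//; last 2 first.
 - by apply: emeasurable_funM; [exact: mH|meas].
 - by move=> x; rewrite mule_ge0 ?H0//; nneg.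
 rewrite [RHS]leb_punctured//; last 2 first.
 - side.
 - by move=> x; rewrite mule_ge0//; nneg.
 apply: eq_int => x; case: (ltP 0%R (enorm x)) => x0; last by rewrite !mul0e.
 rewrite !mul1e /H -muleA -EFinM muleC; congr (_%:E * _).
 by rewrite mulrAC divff ?mul1r// gt_eqF.
have v0 : (@vball R N.+1 != 0)%R by rewrite gt_eqF// vball_gt0.
have -> : \int[@sph R N.+1]_y G y =
  ((@vball R N.+1)^-1)%:E * \int[leb N.+1]_x (H G x * (enorm x)^-1%:E).
 by rewrite E1// muleA -EFinM mulVf// mul1e.
have HG0 x : 0 <= H G x by exact: H0.
have mHc : mbl (fun x => H G (cboost x)).
 exact: (measurableT_comp (mH _ mG) (meas_cboost (@measurable_id _ _ setT))).
have mHe : mbl (fun x => H G (cboost x) * (enorm x)^-1%:E).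
 side.
have He0 x : 0 <= H G (cboost x) * (enorm x)^-1%:E by rewrite mule_ge0//; nneg.
rewrite -(cone_boost (mH _ mG) HG0) -muleA (polar_sph (ltn0Sn N) mHe He0) muleA -EFinM mulVf// mul1e.
have mJ : mbl (fun y => \int[lam]_t ((ind (0 < t)%R * t ^+ N)%:E *
  (H G (cboost (tscale t y)) * (enorm (tscale t y))^-1%:E))).
 apply: measurable_int2.
  apply: emeasurable_funM; first by meas.
  by apply: (measurableT_comp mHe); meas.
 move=> y t; rewrite mule_ge0// lee_fin.
 by case: (ltP 0%R t) => h; rewrite ?mul0r//; nneg; exact: ltW.
have J0 y : 0 <= \int[lam]_t ((ind (0 < t)%R * t ^+ N)%:E *
  (H G (cboost (tscale t y)) * (enorm (tscale t y))^-1%:E)).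
 apply: integral_ge0 => t _; rewrite mule_ge0// lee_fin.
 by case: (ltP 0%R t) => h; rewrite ?mul0r//; nneg; exact: ltW.
rewrite (sph_unit (ltn0Sn N) mJ J0).
have mG2 : mbl (fun y => G (nrm (cboost y)) * (dil y ^- N)%:E).
 side.
have p2 y : 0 <= G (nrm (cboost y)) * (dil y ^- N)%:E.
 by rewrite mule_ge0// lee_fin invr_ge0 exprn_ge0// dil_ge0.
rewrite (sph_unit (ltn0Sn N) mG2 p2) -ge0_integralZr; last 4 first.
- by [].
- by apply: emeasurable_funM => //; exact: meas_EFin.
- by move=> y _; rewrite mule_ge0// lee_fin ler0n.
- by apply: integral_ge0 => t _; exact: I1_0.
apply: eq_int => y; case: eqP => [y1|_]; last by rewrite !mul0e.
have y0 : (0 < enorm y)%R by rewrite y1.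
have d0 := dil_gt0 y0.
rewrite !mul1e; transitivity (\int[lam]_t (G (nrm (cboost y)) *
  ((dil y)%:E * (ind (0 < t)%R * t ^+ N * ind (t * dil y < 1)%R)%:E))).
 apply: eq_int => t; case: (ltP 0%R t) => h; last by rewrite !mul0r mul0e mule0 mule0.
 rewrite cboostZ// /H nrmZ// !enormZ gtr0_norm// y1 enorm_cboost ?ltW// mulr1.
 rewrite muleCA -muleA; congr (_ * _); rewrite -!EFinM; congr EFin.
 by rewrite !mul1r; field; rewrite gt_eqF.
have q0 t : (0 <= ind (0 < t)%R * t ^+ N * ind (t * dil y < 1)%R)%R.
 by case: (ltP 0%R t) => h; rewrite ?mul0r//; nneg; exact: ltW.
rewrite ge0_integralZl; [|by []|by meas|by move=> t _; rewrite mule_ge0// lee_fin; [exact: ltW|exact: q0]|exact: G0].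
rewrite int_Zl; [|exact: ltW|by meas|side].
rewrite I1E// -muleA; congr (_ * _); rewrite muleA -EFinM; congr (_%:E * _).
by rewrite exprS; field; rewrite expf_neq0 gt_eqF.
Qed.

End Boost.

Section SphereBoost.
Local Open Scope ereal_scope.
Context {R : realType}.
Variables (N : nat) (c k : R).
Hypotheses (c0 : (0 < c)%R) (ck : (c ^+ 2 = 1 + k ^+ 2)%R) (N0 : (0 < N)%N).
Local Notation X := (N.+1.-tuple R).

Lemma sph_boost (G : X -> \bar R) : mbl G -> enneg G ->
 \int[@sph R N.+1]_y (G (nrm (cboost c k y)) * (dil c k y ^- N)%:E) =
 \int[@sph R N.+1]_y G y.
Proof.
move=> mG G0; have E := sph_boost_aux c0 ck N0 mG G0.
set I1 := \int[lebesgue_measure]_t _ in E.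
have P1 : \int[@sph R N.+1]_y (cst 1 y) = 1.
 by rewrite integral_cst// mul1e [LHS]probability_setT.
have le01 (x : X) : 0 <= (cst 1 x : \bar R) by rewrite lee_fin.
(* The trivial boost [c = 1], [k = 0] with [G = 1] identifies the two radial constants. *)
have E1 : polc N.+1 = I1.
 have h : (1 ^+ 2 = 1 + 0 ^+ 2 :> R)%R by rewrite expr1n expr0n addr0.
 have := @sph_boost_aux R N 1 0 ltr01 h N0 (cst 1) (measurable_cst _) le01.
 rewrite P1 mul1e => ->; rewrite [X in X * _](_ : _ = 1) ?mul1e//.
 rewrite (sph_unit (ltn0Sn N)); last 2 first.
 - by rewrite /dil; meas.
 - by move=> x; rewrite mul1e lee_fin invr_ge0 exprn_ge0// dil_ge0.
 rewrite -[RHS]P1 [RHS](sph_unit (ltn0Sn N)) //.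
 apply: eq_int => y; case: eqP => [y1|_]; last by rewrite !mul0e.
 by rewrite /dil y1 mulr1 mul0r addr0 expr1n invr1 !mul1e.
have pf : @polc R N.+1 \is a fin_num by rewrite ge0_fin_numE ?polc_fin// ltW// polc_gt0.
have p0 : (fine (@polc R N.+1) != 0)%R by rewrite gt_eqF// fine_gt0// polc_gt0 polc_fin.
move: E; rewrite -E1 => E.
have := congr1 (fun z => z * (fine (@polc R N.+1))^-1%:E) E.
by rewrite -!muleA -{1 3}(fineK pf) -!EFinM divff// !mule1 => ->.
Qed.

End SphereBoost.

(** * From the ball to the hyperboloid *)

Section BallHyperbolic.
Local Open Scope ereal_scope.
Context {R : realType}.
Variable N : nat.
Local Notation X := (N.+1.-tuple R).
Local Notation ind b := ((b)%:R : R).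
Local Notation w r := (Num.sqrt (1 + r ^+ 2)).

(** The substitution [r = 2 t / (1 - t^2)], with inverse [t = r / (1 + w r)]; both sides integrate
    against hyperbolic arc length. *)
Lemma stereo_1D (H : R -> \bar R) : mbl H -> (forall r, 0 <= H r) ->
 \int[lam]_t ((ind (-1 < t < 1)%R * (2 / (1 - t ^+ 2)))%:E * H (2 * t / (1 - t ^+ 2))%R) =
 \int[lam]_r (H r * (w r)^-1%:E).
Proof.
move=> mH H0.
have w_gt0 (r : R) : (0 < w r)%R by rewrite sqrtr_gt0 ltr_pwDl// sqr_ge0.
have w_sqr (r : R) : (w r ^+ 2 = 1 + r ^+ 2)%R by rewrite sqr_sqrtr// addr_ge0 ?sqr_ge0.
pose A (r : R) := (r / (1 + w r))%R.
pose A' (r : R) := ((w r * (1 + w r))^-1)%R.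
pose B (t : R) := (2 * t / (1 - t ^+ 2))%R.
pose J := [set t : R | (-1 < t < 1)%R].
have sq (t : R) : (-1 < t < 1)%R -> (0 < 1 - t ^+ 2)%R by move=> /andP[a b]; nra.
have BA (r : R) : B (A r) = r.
 rewrite /B /A; have w0 := w_gt0 r; have e := w_sqr r.
 have w1 : (1 + w r != 0)%R by rewrite gt_eqF// addr_gt0.
 move: (w r) w0 e w1 => W w0 e w1.
 have -> : (1 - (r / (1 + W)) ^+ 2 = 2 / (1 + W))%R.
  rewrite expr_div_n; have -> : (r ^+ 2 = W ^+ 2 - 1)%R by rewrite e; ring.
  by field.
 by field.
have JA (r : R) : (-1 < A r < 1)%R.
 rewrite -ltr_norml /A normrM normfV (@gtr0_norm _ (1 + w r)%R) ?addr_gt0//.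
 rewrite ltr_pdivrMr ?addr_gt0// mul1r -sqrtr_sqr.
 by rewrite (@le_lt_trans _ _ (w r))// ?ltrDr// ler_wsqrtr// lerDr.
have monoB (t u : R) : (-1 < t < 1)%R -> (-1 < u < 1)%R -> (B t < B u)%R = (t < u)%R.
 move=> Jt Ju; have := sq _ Jt; have := sq _ Ju => u0 t0.
 rewrite /B ltr_pdivrMr// mulrAC ltr_pdivlMr// -subr_gt0.
 have -> : (2 * u * (1 - t ^+ 2) - 2 * t * (1 - u ^+ 2) = (u - t) * (2 * (1 + t * u)))%R by ring.
 rewrite pmulr_lgt0 ?subr_gt0//.
 by move: Jt Ju => /andP[? ?] /andP[? ?]; nra.
have dw (x : R) : is_derive x (1%R : R) (fun y : R => w y) (x / w x)%R.
 have h : is_derive x (1%R : R) (fun y : R => 1 + y ^+ 2)%R (2 * x)%R.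
  by apply: is_derive_eq; rewrite /GRing.scale/= ?expr1; ring.
 have hs : is_derive (1 + x ^+ 2)%R (1%R : R) Num.sqrt (2 * w x)^-1%R.
  by apply: is_derive1_sqrt; rewrite ltr_pwDl ?sqr_ge0.
 have := @is_derive1_comp _ (@Num.sqrt R) (fun y : R => 1 + y ^+ 2)%R x _ _ hs h.
 rewrite (_ : _ * _ = x / w x)%R //.
 by have w0 := w_gt0 x; field; rewrite gt_eqF.
have dA (x : R) : is_derive x (1%R : R) A (A' x).
 have w0 := w_gt0 x; have e := w_sqr x.
 have w1 : (1 + w x != 0)%R by rewrite gt_eqF// addr_gt0.
 have d1 : is_derive x (1%R : R) (fun y : R => 1 + w y)%R (x / w x)%R.
  have := is_deriveD (is_derive_cst (1%R : R) x (1%R : R)) (dw x).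
  by rewrite add0r.
 have d2 : is_derive x (1%R : R) (fun y : R => (1 + w y)^-1)%R (- (1 + w x) ^- 2 *: (x / w x))%R.
  exact: is_deriveV.
 have d3 := is_deriveM (is_derive_id x (1%R : R)) d2.
 have -> : A' x = (x *: (- (1 + w x) ^- 2 *: (x / w x)) + (1 + w x)^-1 *: 1)%R; last exact: d3.
 rewrite /A' /GRing.scale/=.
 move: (w x) w0 e w1 => W w0 e w1.
 have E : (x * x = W ^+ 2 - 1)%R by rewrite e; ring.
 have -> : (x * (- (1 + W) ^- 2 * (x / W)) + (1 + W)^-1 * 1 =
   (x * x) * (- (1 + W) ^- 2 / W) + (1 + W)^-1)%R by ring.
 by rewrite E; field; rewrite w1 gt_eqF.
have cw : continuous (fun x : R => w x).
 by move=> x; apply: differentiable_continuous; apply/derivable1_diffP; exact: (@ex_derive _ _ _ _ _ _ _ (dw x)).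
have wB (t : R) : (0 < 1 - t ^+ 2)%R -> w (B t) = ((1 + t ^+ 2) / (1 - t ^+ 2))%R.
 move=> t2; have q : (0 <= (1 + t ^+ 2) / (1 - t ^+ 2))%R by apply: divr_ge0; [nneg|exact: ltW].
 rewrite -[RHS](ger0_norm q) -sqrtr_sqr.
 by congr Num.sqrt; rewrite /B; field; rewrite gt_eqF.
(* The weight is absorbed into the integrand: [1 + w (B t) = 2 / (1 - t^2)]. *)
pose F r := H r * (1 + w r)%:E.
have mF : mbl F by apply: emeasurable_funM => //; meas.
have F0 r : 0 <= F r by rewrite mule_ge0// lee_fin; nneg.
have mJ : measurable J.
 have mf : mbl (fun x : R => (-1 < x < 1)%R) by meas.
 have := mf measurableT [set true] I; rewrite setTI.
 side.
transitivity (\int[lam]_(t in J) F (B t)).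
 rewrite [RHS]integral_mkcond; apply: eq_int => t; rewrite patchE.
 case: ifPn => [|tJ]; last first.
  rewrite (_ : (-1 < t < 1)%R = false) ?mul0r ?mul0e//.
  by apply/negbTE; apply: contra tJ => h; rewrite inE.
 rewrite inE /= => Jt; rewrite Jt mul1r muleC /F; congr (_ * _%:E).
 have t2 := sq _ Jt.
 rewrite (wB t t2).
 by field; rewrite gt_eqF.
rewrite (@integral_substitution _ A A' B J F).
- apply: eq_int => r; rewrite /F -muleA -EFinM; congr (_ * _%:E).
 by rewrite /A'; have w0 := w_gt0 r; field; rewrite !gt_eqF// addr_gt0.
- side.
- by move=> x; rewrite derive1E; exact: derive_val.
- move=> x; have w0 := w_gt0 x; apply: cvgV; first by rewrite mulf_neq0// gt_eqF// addr_gt0.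
 by apply: cvgM; [exact: cw|apply: cvgD; [exact: cvg_cst|exact: cw]].
- side.
- by rewrite /B; meas.
- exact: mJ.
- move=> x1 x2 y _.
 have lt1 x : (-1 < y < 1)%R -> (x < B y)%R = (A x < y)%R.
  by move=> Jy; rewrite -{1}(BA x) monoB.
 split=> [[Jy]|h].
  by rewrite lt1// !(leNgt _ x2) !(leNgt _ (A x2)) lt1.
 have Jy : (-1 < y < 1)%R.
  by move: h (JA x1) (JA x2) => /andP[? ?] /andP[? ?] /andP[? ?]; apply/andP; split; lra.
 by split=> //; rewrite lt1// leNgt lt1// -leNgt.
- exact: mF.
- exact: F0.
Qed.

(** Equality of the ray integrals suffices; the common factor [polc] is finite and nonzero and
    cancels. *)
Lemma polar_eq (f1 f2 : X -> \bar R) : mbl f1 -> mbl f2 ->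
 enneg f1 -> enneg f2 ->
 (forall y, enorm y = 1%R ->
  \int[lam]_t ((ind (0 < t)%R * t ^+ N)%:E * f1 (tscale t y)) =
  \int[lam]_t ((ind (0 < t)%R * t ^+ N)%:E * f2 (tscale t y))) ->
 \int[leb N.+1]_x f1 x = \int[leb N.+1]_x f2 x.
Proof.
move=> m1 m2 n1 n2 E12.
have pf : @polc R N.+1 \is a fin_num by rewrite ge0_fin_numE ?polc_fin// ltW// polc_gt0.
have p0 : (fine (@polc R N.+1) != 0)%R by rewrite gt_eqF// fine_gt0// polc_gt0 polc_fin.
suff E : \int[leb N.+1]_x f1 x * polc N.+1 = \int[leb N.+1]_x f2 x * polc N.+1.
 have := congr1 (fun z => z * (fine (@polc R N.+1))^-1%:E) E.
 by rewrite -!muleA -{1 3}(fineK pf) -!EFinM divff// !mule1.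
rewrite (polar_sph (ltn0Sn N) m1 n1) (polar_sph (ltn0Sn N) m2 n2); congr (_ * _).
have q0 t : (0 <= ind (0 < t)%R * t ^+ N)%R.
 by case: (ltP 0%R t) => h; rewrite ?mul0r//; nneg; exact: ltW.
have mm g : mbl g -> (forall x : X, 0 <= g x) ->
  mbl (fun y => \int[lam]_t ((ind (0 < t)%R * t ^+ N)%:E * g (tscale t y))).
 move=> mg g0; apply: measurable_int2; last by move=> y t; rewrite mule_ge0// lee_fin.
 side.
have nn g : (forall x : X, 0 <= g x) -> forall y,
  0 <= \int[lam]_t ((ind (0 < t)%R * t ^+ N)%:E * g (tscale t y)).
 by move=> g0 y; apply: integral_ge0 => t _; rewrite mule_ge0// lee_fin.
rewrite (sph_unit (ltn0Sn N) (mm _ m1 n1) (nn _ n1)) (sph_unit (ltn0Sn N) (mm _ m2 n2) (nn _ n2)).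
by apply: eq_int => y; case: eqP => [y1|_]; [rewrite E12|rewrite !mul0e].
Qed.

(** The map [x -> 2 x / (1 - |x|^2)] carries the conformal volume [(2 / (1 - |x|^2))^n dx] of the
    ball to [hyp]. On each ray this is [stereo_1D]. *)
Lemma ball_hyp (f : X -> \bar R) : mbl f -> enneg f ->
 \int[leb N.+1]_x ((ind (enorm x < 1)%R * (2 / (1 - enorm x ^+ 2)) ^+ N.+1)%:E *
   f (tscale (2 / (1 - enorm x ^+ 2)) x)) = \int[@hyp R N.+1]_x f x.
Proof.
move=> mf f0; rewrite hyp_int//; apply: polar_eq.
- side.
- side.
- move=> x; rewrite mule_ge0// lee_fin.
 case: (ltP (enorm x) 1%R) => x1; last by rewrite mul0r.
 by rewrite mul1r exprn_ge0// divr_ge0// subr_ge0 exprn_ile1 ?enorm_ge0 ?ltW.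
- by move=> x; rewrite mule_ge0// lee_fin invr_ge0 ltW// hgt_gt0.
move=> y y1.
have q0 t : (0 <= ind (0 < t)%R * t ^+ N)%R.
 by case: (ltP 0%R t) => h; rewrite ?mul0r//; nneg; exact: ltW.
have mH : mbl (fun r : R => (ind (0 < r)%R * r ^+ N)%:E * f (tscale r y)).
 side.
have H0 (r : R) : 0 <= (ind (0 < r)%R * r ^+ N)%:E * f (tscale r y) by rewrite mule_ge0// lee_fin.
have := stereo_1D mH H0.
rewrite [X in _ = X](_ : _ = \int[lam]_t ((ind (0 < t)%R * t ^+ N)%:E * (f (tscale t y) * (hgt (tscale t y))^-1%:E))); last first.
 apply: eq_int => r; rewrite muleA /hgt dotpZl dotpZr -enormE y1 expr1n mulr1.
 side.
move=> <-; apply: eq_int => t.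
rewrite enormZ y1 mulr1 real_normK ?num_real//.
case: (ltP 0%R t) => t0; last first.
 rewrite mul0r mul0e; case: (ltP (-1)%R t) => t1 /=; last by rewrite mul0r mul0e.
 case: (ltP t 1%R) => t2; last by rewrite mul0r mul0e.
 rewrite (_ : (0 < _)%R = false) ?mul0r ?mul0e ?mule0//.
 apply/negbTE; rewrite -leNgt; apply: mulr_le0_ge0; first by lra.
 by rewrite invr_ge0; nra.
rewrite gtr0_norm// (_ : (-1 < t)%R) /=; last by rewrite (lt_trans _ t0)// ltrN10.
case: (ltP t 1%R) => t1; last by rewrite !mul0r !mul0e mule0.
have t2 : (0 < 1 - t ^+ 2)%R by nra.
rewrite (_ : (0 < 2 * t / _)%R); last side.
rewrite !mul1r !muleA -!EFinM; congr (_%:E * f _).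
 rewrite exprS !exprMn exprVn; ring.
by apply: eq_from_tnth => i; rewrite !tnth_mktuple; ring.
Qed.

End BallHyperbolic.

(** * Finiteness of integrals *)

Section FiniteIntegrals.
Local Open Scope ereal_scope.
Context {R : realType}.
Local Notation ind b := ((b)%:R : R).

(** For [a <= b]: a singularity of order [a] at 0 and decay of order [b] at infinity. *)
Definition pmin (a b t : R) : R := (Num.min (`|t| `^ (- a)) (`|t| `^ (- b)))%R.

Lemma pmin_ge0 a b t : (0 <= pmin a b t)%R.
Proof. by rewrite /pmin le_min !powR_ge0. Qed.

Lemma meas_pmin a b d (T : measurableType d) (f : T -> R) : mbl f -> mbl (fun x => pmin a b (f x)).
Proof. by move=> mf; rewrite /pmin; meas. Qed.

Local Notation w r := (Num.sqrt (1 + r ^+ 2)).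

(** After the substitution of [stereo_1D] the integrand becomes 1 on [(-1, 1)]. This is the
    comparison integral for [pmin_integrable]. *)
Lemma integral_inv_sqr : \int[@lebesgue_measure R]_r ((w r * (1 + w r))^-1)%:E < +oo.
Proof.
have := @stereo_1D R (fun r => (1 + w r)^-1%:E) _ _.
rewrite [X in _ = X](_ : _ = \int[@lebesgue_measure R]_r ((w r * (1 + w r))^-1)%:E); last first.
 by apply: eq_int => r; rewrite -EFinM invfM mulrC.
move=> <-; [|by meas|by nneg].
apply: (@le_lt_trans _ _ (\int[lam]_t (\1_(`[(-1)%R, 1%R]%classic : set R) t)%:E)).
 have k0 (t : R) : (0 <= ind (-1 < t < 1)%R * (2 / (1 - t ^+ 2)))%R.
  case: andP => [[a b]|_]; last by rewrite mul0r.
  by rewrite mul1r divr_ge0//; nra.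
 apply: int_le.
 - by move=> t; rewrite mule_ge0// lee_fin//; nneg.
 - side.
 - exact/measurable_EFinP/measurable_indic.
 move=> t; rewrite -EFinM lee_fin; case: andP => [[a b]|_]; last by rewrite !mul0r.
 rewrite indicE mem_setE in_itv/= (ltW a) (ltW b) mul1r.
 have t2 : (0 < 1 - t ^+ 2)%R by nra.
 rewrite ler_pdivrMr ?addr_gt0 ?sqrtr_gt0 ?ltr_pwDl ?sqr_ge0//.
 have -> : w (2 * t / (1 - t ^+ 2)) = ((1 + t ^+ 2) / (1 - t ^+ 2))%R.
  have q : (0 <= (1 + t ^+ 2) / (1 - t ^+ 2))%R by apply: divr_ge0; [nneg|exact: ltW].
  rewrite -[RHS](ger0_norm q) -sqrtr_sqr.
  by congr Num.sqrt; field; rewrite gt_eqF.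
 by rewrite mul1r; apply: eq_lew; field; rewrite gt_eqF.
rewrite integral_indic// setIT.
have := @lebesgue_measure_itv R `[(-1)%R, 1%R]; move=> /= ->.
by rewrite lte_fin; case: ifP => _ //; rewrite ltry.
Qed.

Definition oroot (k : nat) (y : R) : R :=
 if (0 <= y)%R then (y `^ k%:R^-1)%R else (- ((- y) `^ k%:R^-1))%R.

Lemma norm_oroot k y : `|oroot k y|%R = (`|y| `^ k%:R^-1)%R.
Proof.
rewrite /oroot; case: leP => h; first by rewrite !ger0_norm// powR_ge0.
by rewrite normrN (ltr0_norm h) ger0_norm// powR_ge0.
Qed.

Lemma ltr_odd_exp k (x y : R) : odd k -> (x ^+ k < y ^+ k)%R = (x < y)%R.
Proof.
move=> ok; have k0 : k != 0%N by case: k ok.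
have en (z : R) : ((- z) ^+ k = - z ^+ k)%R by rewrite exprNn -signr_odd ok expr1 mulN1r.
case: (leP 0%R x) => x0.
 case: (leP 0%R y) => y0; first by rewrite ltr_pXn2r ?nnegrE// lt0n.
 have -> : (x < y)%R = false by apply/negbTE; rewrite -leNgt (le_trans (ltW y0)).
 apply/negbTE; rewrite -leNgt (@le_trans _ _ 0%R)// ?exprn_ge0//.
 by rewrite -oppr_ge0 -en exprn_ge0// oppr_ge0 ltW.
case: (leP 0%R y) => y0.
 have -> : (x < y)%R by rewrite (lt_le_trans x0).
 rewrite (@lt_le_trans _ _ 0%R)// ?exprn_ge0//.
 by rewrite -oppr_gt0 -en exprn_gt0// oppr_gt0.
have p (z : R) : (z < 0)%R -> (0 <= - z)%R by move=> /ltW; rewrite oppr_ge0.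
by rewrite -[LHS]ltrN2 -!en ltr_pXn2r ?nnegrE ?p ?lt0n// ltrN2.
Qed.

Lemma oroot_exp k y : odd k -> (oroot k y ^+ k = y)%R.
Proof.
move=> ok; have k0 : (k%:R != 0 :> R)%R by rewrite pnatr_eq0; case: k ok.
rewrite /oroot; case: leP => h.
 by rewrite -powR_mulrn ?powR_ge0// -powRrM mulVf// powRr1.
rewrite exprNn -signr_odd ok expr1 mulN1r -powR_mulrn ?powR_ge0// -powRrM mulVf//.
by rewrite powRr1 ?opprK// oppr_ge0 ltW.
Qed.

(** Substitute [t = x^k] with [k = 2 m + 1] large: the Jacobian [k x^(2m)] absorbs the singularity
    at 0, and at infinity the integrand decays at least like [x^-2]. *)
Lemma pmin_integrable a b : (0 <= a)%R -> (a < 1)%R -> (1 < b)%R ->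
 \int[lam]_t (pmin a b t)%:E < +oo.
Proof.
move=> a0 a1 b1.
(* [m > a / (1 - a)] gives [a k <= 2 m], and [m > 1 / (b - 1)] gives [b k >= 2 m + 2]. *)
pose m := (Num.truncn (a / (1 - a) + (b - 1)^-1)%R).+1.
pose k := m.*2.+1.
have ok : odd k by rewrite /= odd_double.
have mgt : (a / (1 - a) + (b - 1)^-1 < m%:R)%R by exact: truncnS_gt.
have h1 : (0 <= m.*2%:R - a * k%:R :> R)%R.
 have : (a / (1 - a) < m%:R)%R by apply: le_lt_trans mgt; rewrite lerDl invr_ge0; lra.
 rewrite ltr_pdivrMr; last by lra.
 rewrite /k -addn1 natrD -mul2n natrM; have : (0 <= m%:R :> R)%R by [].
 by set M : R := m%:R => M0 h; nra.
have h2 : (m.*2%:R - b * k%:R <= -2 :> R)%R.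
 have : ((b - 1)^-1 < m%:R)%R by apply: le_lt_trans mgt; rewrite lerDr divr_ge0//; lra.
 rewrite -div1r ltr_pdivrMr; last by lra.
 rewrite /k -addn1 natrD -mul2n natrM; have : (0 <= m%:R :> R)%R by [].
 by set M : R := m%:R => M0 h; nra.
have k0 : (k%:R != 0 :> R)%R by rewrite pnatr_eq0.
pose A x := (x ^+ k)%R : R.
pose A' x := (k%:R * x ^+ m.*2)%R : R.
pose G x := (pmin (a * k%:R) (b * k%:R) x)%:E.
have A'0 x : (0 <= A' x)%R by rewrite /A' mulr_ge0// -mul2n exprM exprn_ge0// sqr_ge0.
have mG : mbl G by apply: meas_EFin; exact: meas_pmin.
have mB : mbl (oroot k) by rewrite /oroot; apply: measurable_fun_ifT; meas.
have Ek := @integral_substitution R A A' (oroot k) setT G.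
rewrite [X in X < _](_ : _ = \int[lam]_t G (oroot k t)); last first.
 apply: eq_int => t; rewrite /G /pmin norm_oroot -!powRrM.
 by rewrite !mulrN ![(k%:R^-1 * _)%R]mulrC !mulfK.
rewrite Ek //; last 5 first.
- by move=> x; exact: exprn_derivable.
- move=> x; by rewrite /A /k derive1E exp_derive /A' /GRing.scale/= mulr1.
- move=> x; apply: cvgM; first exact: cvg_cst.
 exact: exprn_continuous.
- move=> x1 x2 y _; have lt1 x : (x < oroot k y)%R = (A x < y)%R.
  by rewrite -(@ltr_odd_exp k)// oroot_exp.
 by rewrite lt1 !(leNgt _ x2) !(leNgt _ (A x2)) lt1; split=> [[]|].
- by move=> x; rewrite lee_fin pmin_ge0.
apply: (@le_lt_trans _ _ (\int[@lebesgue_measure R]_r ((k%:R * 6)%:E * ((w r * (1 + w r))^-1)%:E))).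
 apply: int_le.
 - by move=> x; rewrite mule_ge0 ?lee_fin ?pmin_ge0.
 - by apply: emeasurable_funM => //; rewrite /A'; meas.
 - by meas.
 move=> x; rewrite -!EFinM lee_fin /A' mulrCA -mulrA ler_wpM2l//.
 have [->|x0] := eqVneq x 0%R.
  have -> : (0 ^+ m.*2 = 0 :> R)%R by rewrite /m doubleS exprS mul0r.
  by rewrite mulr0; nneg.
 have xp : (0 < `|x|)%R by rewrite normr_gt0.
 have -> : (x ^+ m.*2 = `|x| `^ m.*2%:R)%R.
  by rewrite powR_mulrn// -mul2n !exprM real_normK ?num_real.
 have pw r : (`|x| `^ (- r) * `|x| `^ m.*2%:R = `|x| `^ (m.*2%:R - r))%R.
  by rewrite mulrC -powRD// (gt_eqF xp) implybT.
 have W0 : (0 < w x * (1 + w x))%R.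
  have : (0 < w x)%R by rewrite sqrtr_gt0 ltr_pwDl ?sqr_ge0.
  side.
 rewrite ler_pdivlMr// mulrC.
 have wle : (w x <= 1 + `|x|)%R.
  rewrite -[leRHS]ger0_norm ?addr_ge0// -sqrtr_sqr ler_wsqrtr//.
  rewrite -(real_normK (num_real (x : R))).
  by have := normr_ge0 (x : R); nra.
 have w0 : (0 <= w x)%R by nneg.
 case: (leP `|x|%R 1%R) => x1.
  apply: (@le_trans _ _ (6 * 1)%R); last by rewrite mulr1.
  apply: ler_pM; [by nneg|by nneg; exact: pmin_ge0|by nra|].
  apply: (@le_trans _ _ (`|x| `^ (- (a * k%:R)) * `|x| `^ m.*2%:R)%R).
   by rewrite ler_wpM2r ?powR_ge0// /pmin ge_min lexx.
  by rewrite pw -[leRHS](powRr0 `|x|%R) ger_powR// xp.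
 have E : (w x * (1 + w x) <= 6 * (`|x| ^+ 2))%R by nra.
 apply: (@le_trans _ _ (6 * `|x| ^+ 2 * `|x| `^ (-2))%R); last first.
  by rewrite powRN (powR_mulrn 2)// mulfK// expf_neq0// gt_eqF.
 apply: ler_pM; [by nneg|by nneg; exact: pmin_ge0|exact: E|].
 apply: (@le_trans _ _ (`|x| `^ (- (b * k%:R)) * `|x| `^ m.*2%:R)%R).
  by rewrite ler_wpM2r ?powR_ge0// /pmin ge_min lexx orbT.
 by rewrite pw ler_powR// ltW.
rewrite int_Zl; [|by []|by meas|by nneg].
by apply: lte_mul_pinfty; [nneg| |exact: integral_inv_sqr].
Qed.

Lemma lam_punctured (f : R -> \bar R) : mbl f -> enneg f ->
 \int[lam]_t f t = \int[lam]_t ((ind (t != 0%R))%:E * f t).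
Proof.
move=> mf f0.
rewrite -(@integral_setD1 _ f 0%R setT); last 2 first.
- by apply: measurableD => //; exact: measurable_set1.
- exact: measurable_funTS.
rewrite integral_mkcond; apply: eq_int => t; rewrite patchE.
case: ifPn => [|tn].
 by rewrite inE /= => -[_ /eqP ->]; rewrite mul1e.
have -> : (t != 0%R) = false; last by rewrite mul0e.
by apply: contraNF tn => /eqP t0; rewrite inE.
Qed.

(** The coordinate hyperplanes are null, so pointwise estimates may assume that no coordinate
    vanishes. *)
Lemma leb_coords n (f : n.-tuple R -> \bar R) : mbl f -> enneg f ->
 \int[leb n]_x f x = \int[leb n]_x ((\prod_(i < n) ind (tnth x i != 0%R))%:E * f x).
Proof.
have mne : mbl (fun t : R => ind (t != 0%R)).
 rewrite (_ : (fun _ => _) = (fun t : R => ind (0 < `|t|)%R)); first by meas.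
 by apply/funext => t; rewrite normr_gt0.
have mp k : mbl (fun x : k.-tuple R => (\prod_(i < k) ind (tnth x i != 0%R))%:E).
 by apply: meas_EFin; apply: measurable_prod => i _; apply: (measurableT_comp mne); meas.
have p0 k (x : k.-tuple R) : 0 <= (\prod_(i < k) ind (tnth x i != 0%R))%:E by nneg.
elim: n f => [|n IH] f mf f0.
 by apply: eq_int => x; rewrite big_ord0 mul1e.
have mg (a : R) : mbl (fun t => f (cons_tuple a t)) by meas.
have mI : mbl (fun a => \int[leb n]_t f (cons_tuple a t)).
 by apply: measurable_int2 => //; meas.
rewrite (lebS_int mf f0) [RHS]lebS_int; [|by apply: emeasurable_funM; [exact: mp|exact: mf]|by move=> x; rewrite mule_ge0].
rewrite lam_punctured//; last by move=> a; exact: integral_ge0.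
apply: eq_int => a; rewrite IH// -int_Zl; [|by []|by apply: emeasurable_funM; [exact: mp|exact: mg]|by move=> x; rewrite mule_ge0].
apply: eq_int => t; rewrite muleA -EFinM big_ord_recl; congr (_%:E * _).
by congr (_ * _)%R; apply: eq_bigr => i _; rewrite tnthS.
Qed.

Lemma leb_prod_bound n (F : n.-tuple R -> R) (C : R) (w : R -> R) :
 mbl F -> (forall x, 0 <= F x)%R -> mbl w ->
 (forall t, 0 <= w t)%R -> \int[lam]_t (w t)%:E < +oo -> (0 <= C)%R ->
 (forall x, (forall i, tnth x i != 0%R) -> F x <= C * \prod_(i < n) w (tnth x i))%R ->
 \int[leb n]_x (F x)%:E < +oo.
Proof.
move=> mF F0 mw w0 fw C0 Fw; rewrite leb_coords//; last exact: meas_EFin.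
have mne : mbl (fun t : R => ind (t != 0%R)).
 rewrite (_ : (fun _ => _) = (fun t : R => ind (0 < `|t|)%R)); first by meas.
 by apply/funext => t; rewrite normr_gt0.
have mp : mbl (fun x : n.-tuple R => (\prod_(i < n) ind (tnth x i != 0%R))%:E).
 by apply: meas_EFin; apply: measurable_prod => i _; apply: (measurableT_comp mne); meas.
have mpw : mbl (fun x : n.-tuple R => (\prod_(i < n) w (tnth x i))%:E).
 by apply: meas_EFin; apply: measurable_prod => i _; meas.
apply: (@le_lt_trans _ _ (\int[leb n]_x (C%:E * (\prod_(i < n) w (tnth x i))%:E))); last first.
 rewrite int_Zl//; last by nneg.
 by apply: lte_mul_pinfty => //; exact: leb_prod_fin.
apply: int_le; [by nneg|by apply: emeasurable_funM => //; exact: meas_EFin|by apply: emeasurable_funM; [exact: measurable_cst|exact: mpw]|].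
move=> x; rewrite -!EFinM lee_fin.
have [h|] := boolP [forall i, tnth x i != 0%R].
 rewrite big1 ?mul1r; first by apply: Fw => i; exact: (forallP h).
 by move=> i _; rewrite (forallP h).
rewrite negb_forall => /existsP[i]; rewrite negbK => /eqP xi.
by rewrite (bigD1 i)//= xi eqxx mul0r mul0r; nneg.
Qed.

End FiniteIntegrals.

(** * Integrals of real functions *)

Section RealIntegral.
Context {R : realType} {d : measure_display} {T : measurableType d}.
Variable m : {measure set T -> \bar R}.
Implicit Types f g : T -> R.

Definition L1 f : Prop := m.-integrable setT (EFin \o f).
(* Sealed: conversion must not unfold Lebesgue integrals. *)
Fact Ir_key : {I : (T -> R) -> R | forall f, I f = fine (\int[m]_x (f x)%:E)}.
Proof. by exists (fun f => fine (\int[m]_x (f x)%:E)). Qed.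
Definition Ir : (T -> R) -> R := sval Ir_key.
Lemma Ir_def f : Ir f = fine (\int[m]_x (f x)%:E).
Proof. exact: (svalP Ir_key). Qed.

Lemma L1_meas f : L1 f -> mbl f.
Proof. by move=> /integrableP[/measurable_EFinP]. Qed.

Lemma IrE f : L1 f -> (\int[m]_x (f x)%:E = (Ir f)%:E)%E.
Proof. by move=> h; rewrite Ir_def fineK//; exact: integrable_fin_num. Qed.

Lemma L1_bound f (c : R) : mbl f -> nonneg f ->
 (\int[m]_x (f x)%:E <= c%:E)%E -> L1 f /\ Ir f <= c.
Proof.
move=> mf f0 h.
have I : L1 f.
 apply/integrableP; split; first exact/measurable_EFinP.
 rewrite (eq_integral (EFin \o f)); last by move=> x _; rewrite /= ger0_norm.
 exact: le_lt_trans h (ltry _).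
by split=> //; rewrite -lee_fin -IrE.
Qed.

Lemma L1_fin f : mbl f -> nonneg f ->
 (\int[m]_x (f x)%:E < +oo)%E -> L1 f.
Proof.
move=> mf f0 h; apply/integrableP; split; first exact/measurable_EFinP.
by rewrite (eq_integral (EFin \o f)); last by move=> x _; rewrite /= ger0_norm.
Qed.

Lemma L1_fin_lt f : L1 f -> (\int[m]_x (f x)%:E < +oo)%E.
Proof. by move=> h; rewrite IrE// ltry. Qed.

Lemma L1_le f g : L1 g -> mbl f -> (forall x, `|f x| <= g x) -> L1 f.
Proof.
move=> ig mf fg; apply: (le_integrable measurableT _ _ ig).
 exact/measurable_EFinP.
by move=> x _ /=; rewrite lee_fin (le_trans (fg x))// ler_norm.
Qed.

Lemma L1_ext f g : f =1 g -> L1 f -> L1 g.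
Proof. by move=> /funext ->. Qed.
Lemma Ir_ext f g : f =1 g -> Ir f = Ir g.
Proof. by move=> /funext ->. Qed.

Lemma L1_0 : L1 (fun=> 0).
Proof. exact: integrable0. Qed.
Lemma L1_D f g : L1 f -> L1 g -> L1 (fun x => f x + g x).
Proof. by move=> h1 h2; have := integrableD measurableT h1 h2. Qed.
Lemma L1_Z (k : R) f : L1 f -> L1 (fun x => k * f x).
Proof. by move=> h; have := integrableZl measurableT k h. Qed.
Lemma L1_N f : L1 f -> L1 (fun x => - f x).
Proof. by move=> /(L1_Z (-1)); apply: L1_ext => x; rewrite mulN1r. Qed.
Lemma L1_B f g : L1 f -> L1 g -> L1 (fun x => f x - g x).
Proof. by move=> h /L1_N; exact: L1_D. Qed.
Lemma L1_abs f : L1 f -> L1 (fun x => `|f x|).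
Proof. by move=> h; apply: (L1_le (g := fun x => `|f x|)); [exact: integrable_abse h|apply: meas_norm; exact: L1_meas|move=> x; rewrite normr_id]. Qed.

Lemma Ir_D f g : L1 f -> L1 g -> Ir (fun x => f x + g x) = Ir f + Ir g.
Proof.
move=> h1 h2; rewrite !Ir_def (_ : (\int[m]_x (f x + g x)%:E = \int[m]_x (f x)%:E + \int[m]_x (g x)%:E)%E).
 by rewrite fineD//; exact: integrable_fin_num.
by rewrite -(integralD measurableT h1 h2).
Qed.
Lemma Ir_Z (k : R) f : L1 f -> Ir (fun x => k * f x) = k * Ir f.
Proof.
move=> h; rewrite !Ir_def (_ : (\int[m]_x (k * f x)%:E = k%:E * \int[m]_x (f x)%:E)%E).
 by rewrite fineM//; exact: integrable_fin_num.
by rewrite -(integralZl measurableT h).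
Qed.
Lemma Ir_N f : L1 f -> Ir (fun x => - f x) = - Ir f.
Proof. by move=> h; rewrite -mulN1r -Ir_Z//; apply: Ir_ext => x; rewrite mulN1r. Qed.
Lemma Ir_B f g : L1 f -> L1 g -> Ir (fun x => f x - g x) = Ir f - Ir g.
Proof. by move=> h1 h2; rewrite Ir_D ?Ir_N//; exact: L1_N. Qed.
Lemma Ir_ge0 f : nonneg f -> 0 <= Ir f.
Proof. by move=> f0; rewrite Ir_def; apply: fine_ge0; apply: integral_ge0 => x _; rewrite lee_fin. Qed.
Lemma Ir_le f g : L1 f -> L1 g -> (forall x, f x <= g x) -> Ir f <= Ir g.
Proof.
move=> h1 h2 fg; rewrite -subr_ge0 -Ir_B//; apply: Ir_ge0 => x.
by rewrite subr_ge0.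
Qed.
Lemma Ir_abs f : L1 f -> `|Ir f| <= Ir (fun x => `|f x|).
Proof.
move=> h; have ha := L1_abs h.
rewrite ler_norml -Ir_N//; apply/andP; split; apply: Ir_le => //.
- exact: L1_N.
- by move=> x; rewrite lerNl -normrN ler_norm.
- by move=> x; exact: ler_norm.
Qed.
Lemma Ir_0 : Ir (fun=> 0) = 0.
Proof. by rewrite !Ir_def integral0. Qed.

Lemma L1_sum (I : finType) (F : I -> T -> R) : (forall i, L1 (F i)) ->
 L1 (fun x => \sum_i F i x).
Proof.
move=> h; elim: (index_enum I) => [|i r IH].
 by apply: (L1_ext _ L1_0) => x; rewrite big_nil.
by apply: (L1_ext _ (L1_D (h i) IH)) => x; rewrite big_cons.
Qed.
Lemma Ir_sum (I : finType) (F : I -> T -> R) : (forall i, L1 (F i)) ->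
 Ir (fun x => \sum_i F i x) = \sum_i Ir (F i).
Proof.
move=> h.
have : L1 (fun x => \sum_(i <- index_enum I) F i x) /\
 Ir (fun x => \sum_(i <- index_enum I) F i x) = \sum_(i <- index_enum I) Ir (F i); last by case.
elim: (index_enum I) => [|i r [IH1 IH2]].
 split; first by apply: (L1_ext _ L1_0) => x; rewrite big_nil.
 by rewrite big_nil -[RHS]Ir_0; apply: Ir_ext => x; rewrite big_nil.
split; first by apply: (L1_ext _ (L1_D (h i) IH1)) => x; rewrite big_cons.
rewrite big_cons -IH2 -Ir_D//; apply: Ir_ext => x; by rewrite big_cons.
Qed.

Lemma int_max_split f : (\int[m]_x (f x)%:E =
 \int[m]_x (Num.max (f x) 0)%:E - \int[m]_x (Num.max (- f x) 0)%:E)%E.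
Proof.
rewrite integralE; congr (_ - _)%E; apply: eq_int => x.
 by rewrite EFin_max funeposE.
by rewrite EFin_max funenegE.
Qed.

(** Turns a change of variables known for nonnegative extended functions into one for real
    functions, through positive and negative parts. *)
Lemma Ir_transfer (s : T -> T) (w : T -> R) f : mbl f ->
 nonneg w ->
 (forall h : T -> \bar R, mbl h -> enneg h ->
  \int[m]_x (h (s x) * (w x)%:E) = \int[m]_x h x)%E ->
 mbl s -> mbl w ->
 (L1 f -> L1 (fun x => f (s x) * w x)) /\ Ir (fun x => f (s x) * w x) = Ir f.
Proof.
move=> mf w0 H ms mw.
have mg : mbl (fun x => f (s x) * w x).
 side.
have P1 (g : T -> R) : mbl g ->
  (\int[m]_x (Num.max (g (s x) * w x) 0)%:E = \int[m]_x (Num.max (g x) 0)%:E)%E.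
 move=> mg'; rewrite -(H (fun x => (Num.max (g x) 0)%:E)).
 - by apply: eq_int => x; rewrite -EFinM maxr_pMl// mul0r.
 - by meas.
 - by move=> x; rewrite lee_fin le_max lexx orbT.
have E : (\int[m]_x (f (s x) * w x)%:E = \int[m]_x (f x)%:E)%E.
 rewrite [LHS]int_max_split [RHS]int_max_split; congr (_ - _)%E; first exact: P1.
 rewrite -(P1 (fun x => - f x)); last exact: meas_opp.
 by apply: eq_int => x; rewrite mulNr.
split; last by rewrite !Ir_def E.
move=> /integrableP[_ hf]; apply/integrableP; split; first exact/measurable_EFinP.
apply: le_lt_trans hf; apply: eq_lew.
rewrite -(H (fun x => `|(EFin \o f) x|)%E); last 2 first.
- by apply: measurableT_comp => //; exact/measurable_EFinP.
- side.
by apply: eq_int => x; rewrite /= normrM (ger0_norm (w0 x)) EFinM.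
Qed.

End RealIntegral.

Section FubiniReal.
Context {R : realType} d1 d2 (T1 : measurableType d1) (T2 : measurableType d2).
Variable m1 : {sigma_finite_measure set T1 -> \bar R}.
Variable m2 : {sigma_finite_measure set T2 -> \bar R}.

(** Sections are assumed integrable everywhere, not merely almost everywhere, so that no exceptional
    sets appear. *)
Lemma Ir_fubini (F : T1 -> T2 -> R) : mbl (fun z => F z.1 z.2) ->
 (forall x, L1 m2 (F x)) -> (forall y, L1 m1 (fun x => F x y)) ->
 L1 m1 (fun x => Ir m2 (fun y => `|F x y|)) ->
 [/\ L1 m1 (fun x => Ir m2 (F x)), L1 m2 (fun y => Ir m1 (fun x => F x y)) &
  Ir m1 (fun x => Ir m2 (F x)) = Ir m2 (fun y => Ir m1 (fun x => F x y))].
Proof.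
move=> mF h2 h1 hI; pose f (z : T1 * T2) := (F z.1 z.2)%:E.
have mf : mbl f by exact/measurable_EFinP.
have imf : (m1 \x m2)%E.-integrable setT f.
 apply/integrable12ltyP => //.
 rewrite (eq_integral (fun x => (Ir m2 (fun y => `|F x y|))%:E)); first exact: L1_fin_lt.
 by move=> x _; rewrite -IrE//; exact: L1_abs.
have i1 : L1 m1 (fun x => Ir m2 (F x)).
 have := integrable_fubini_F imf; rewrite /L1.
 by congr (_.-integrable _ _); apply/funext => x /=; rewrite -IrE.
have i2 : L1 m2 (fun y => Ir m1 (fun x => F x y)).
 pose g (z : T2 * T1) := (F z.2 z.1)%:E.
 have mg : mbl g.
  by apply/measurable_EFinP; exact: (measurableT_comp mF (@measurable_swap _ _ T2 T1)).
 have img : (m2 \x m1)%E.-integrable setT g.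
  apply/integrable12ltyP => //; rewrite int_swap.
  - rewrite (eq_integral (fun x => (Ir m2 (fun y => `|F x y|))%:E)); first exact: L1_fin_lt.
   by move=> x _; rewrite -IrE//; exact: L1_abs.
  - exact: measurableT_comp.
  - side.
 have := integrable_fubini_F img; rewrite /L1.
 by congr (_.-integrable _ _); apply/funext => y /=; rewrite -IrE.
split=> //; apply: EFin_inj; rewrite -!IrE//.
rewrite (eq_integral (fun x => \int[m2]_y f (x, y))%E); last by move=> x _; rewrite -IrE.
rewrite [RHS](eq_integral (fun y => \int[m1]_x f (x, y))%E); last by move=> y _; rewrite -IrE.
exact: Fubini.
Qed.

End FubiniReal.

(** * Real integrals on the sphere and the hyperboloid *)

Section SphereHypReal.
Context {R : realType} (n : nat).
Local Notation X := (n.-tuple R).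
Local Notation P := (@sph R n).
Local Notation M := (@hyp R n).

Lemma L1_P_cst (c : R) : L1 P (fun=> c).
Proof.
exact: finite_measure_integrable_cst.
Qed.

Lemma Ir_P_cst (c : R) : Ir P (fun=> c) = c.
Proof. by rewrite !Ir_def integral_cst// [X in (_ * X)%E]probability_setT mule1. Qed.

Lemma L1_P_bd (f : X -> R) (c : R) : mbl f -> (forall x, `|f x| <= c) -> L1 P f.
Proof. exact: L1_le (L1_P_cst c). Qed.

Lemma P_refl (e : X) (f : X -> R) : dotp e e = 1 -> mbl f ->
 (L1 P f -> L1 P (fun x => f (refl e x))) /\ Ir P (fun x => f (refl e x)) = Ir P f.
Proof.
move=> e1 mf.
have := @Ir_transfer _ _ _ P (refl e) (fun=> 1) f mf (fun=> ler01) _ _ _.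
rewrite (_ : (fun x => f (refl e x) * 1) = (fun x => f (refl e x))); last by apply/funext => x; rewrite mulr1.
apply; [|by meas|by meas].
by move=> h mh h0; under eq_integral do rewrite mule1; exact: sph_refl.
Qed.

Lemma M_refl (e : X) (f : X -> R) : dotp e e = 1 -> mbl f ->
 (L1 M f -> L1 M (fun x => f (refl e x))) /\ Ir M (fun x => f (refl e x)) = Ir M f.
Proof.
move=> e1 mf.
have := @Ir_transfer _ _ _ M (refl e) (fun=> 1) f mf (fun=> ler01) _ _ _.
rewrite (_ : (fun x => f (refl e x) * 1) = (fun x => f (refl e x))); last by apply/funext => x; rewrite mulr1.
apply; [|by meas|by meas].
by move=> h mh h0; under eq_integral do rewrite mule1; exact: hyp_refl.
Qed.

Hypothesis n0 : (0 < n)%N.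

(** Identities that hold only for unit vectors, such as [nrm y = y], may be used under the
    integral. *)
Lemma P_unit (f g : X -> R) : mbl f -> mbl g ->
 (forall y, enorm y = 1 -> f y = g y) -> (L1 P f -> L1 P g) /\ Ir P f = Ir P g.
Proof.
move=> mf mg fg.
have P1 (a b : X -> R) : mbl a -> mbl b ->
  nonneg a -> nonneg b ->
  (forall y, enorm y = 1 -> a y = b y) -> (\int[P]_x (a x)%:E = \int[P]_x (b x)%:E)%E.
 move=> ma mb a0 b0 ab; rewrite (sph_unit n0); [|by meas|side].
 rewrite [RHS](sph_unit n0); [|by meas|side].
 by apply: eq_int => y; case: eqP => [/ab ->//|_]; rewrite !mul0e.
split.
 move=> /integrableP[_ hf]; apply/integrableP; split; first exact/measurable_EFinP.
 apply: le_lt_trans hf; apply: eq_lew.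
 by apply: P1 => //; [meas|meas|move=> y /fg ->].
rewrite !Ir_def [in LHS]int_max_split [in RHS]int_max_split; congr (fine (_ - _)%E); apply: P1.
1,6: by meas.
1,5: by meas.
all: move=> y; rewrite ?le_max ?lexx ?orbT//.
all: by move=> /fg ->.
Qed.

Lemma Ir_P_le (f g : X -> R) : L1 P f -> L1 P g ->
 (forall y, enorm y = 1 -> f y <= g y) -> Ir P f <= Ir P g.
Proof.
move=> hf hg fg.
have mf := L1_meas hf; have mg := L1_meas hg.
have [h1 h2] := @P_unit f (fun x => Num.min (f x) (g x)) mf (measurable_minr mf mg) (fun y y1 => esym (min_idPl (fg y y1))).
rewrite h2; apply: Ir_le => //; first exact: h1.
by move=> x; rewrite ge_min lexx orbT.
Qed.

End SphereHypReal.

(** * Convexity inequalities for powers *)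

Section Scalar.
Context {R : realType}.
Implicit Types a b t x y r s p q : R.

(** The graph of [t^r] lies above its tangent at [b]: Young's inequality for [a * b^(r-1)] with
    exponents [r] and [r / (r-1)]. *)
Lemma tan_ge r a b : 1 <= r -> 0 <= a -> 0 <= b ->
 b `^ r + r * b `^ (r - 1) * (a - b) <= a `^ r.
Proof.
rewrite le_eqVlt => /predU1P[<-|r1] a0 b0.
 by rewrite subrr powRr0 mulr1 mul1r !powRr1//; lra.
have rp : 0 < r by lra.
have r1n : r - 1 != 0 by rewrite gt_eqF//; lra.
have := @conjugate_powR _ a (b `^ (r - 1)) r (r / (r - 1)) a0 (powR_ge0 _ _) rp _ _.
rewrite -powRrM mulrCA divff ?mulr1//.
have -> : r^-1 + (r / (r - 1))^-1 = 1 by field; rewrite r1n gt_eqF.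
move=> /(_ _ erefl) H.
have {}H := H (divr_gt0 rp _); have r2 : 0 < r - 1 by lra.
have := H r2; have E : b * b `^ (r - 1) = b `^ r by rewrite mulr_powRB1.
move=> h; have : r * (a * b `^ (r - 1)) <= a `^ r + (r - 1) * b `^ r.
 have -> : a `^ r + (r - 1) * b `^ r = r * (a `^ r / r + b `^ r / (r / (r - 1))).
  by field; rewrite r1n gt_eqF.
 by rewrite ler_pM2l.
rewrite -E; set B := b `^ (r - 1); set A := a `^ r; nra.
Qed.

(** [tan_ge] with exponent [1/r] at the points [a^r] and [b^r], solved for [a^r]. *)
Lemma tan_le r a b : 0 <= r <= 1 -> 0 <= a -> 0 < b ->
 a `^ r <= b `^ r + r * b `^ (r - 1) * (a - b).
Proof.
move=> /andP[]; rewrite le_eqVlt => /predU1P[<- _ _ _|r0 r1 a0 b0].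
 by rewrite !powRr0 mul0r mul0r addr0.
have rn : r != 0 by rewrite gt_eqF.
have ir : 1 <= r^-1 by rewrite invf_ge1.
have := @tan_ge r^-1 (a `^ r) (b `^ r) ir (powR_ge0 _ _) (powR_ge0 _ _).
have E0 c : 0 <= c -> (c `^ r) `^ r^-1 = c by move=> c0; rewrite -powRrM mulfV// powRr1.
have E1 : (b `^ r) `^ (r^-1 - 1) = b `^ (1 - r) by rewrite -powRrM; congr powR; field.
rewrite E1 (E0 a a0) (E0 b (ltW b0)) => h.
have bp : 0 < b `^ (r - 1) by exact: powR_gt0.
have E : b `^ (1 - r) * b `^ (r - 1) = 1.
 rewrite -powRD ?(gt_eqF b0) ?implybT//; have -> : 1 - r + (r - 1) = 0 by ring.
 exact: powRr0.
have : r * b `^ (r - 1) * (b + r^-1 * b `^ (1 - r) * (a `^ r - b `^ r)) <= r * b `^ (r - 1) * a.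
 by rewrite ler_pM2l// mulr_gt0.
have -> : r * b `^ (r - 1) * (b + r^-1 * b `^ (1 - r) * (a `^ r - b `^ r)) =
 r * b `^ (r - 1) * b + (r * r^-1) * (b `^ (1 - r) * b `^ (r - 1)) * (a `^ r - b `^ r) by ring.
rewrite E mulfV// !mul1r; lra.
Qed.

Lemma tan_neg s a b : 0 <= s -> 0 < a -> 0 < b ->
 b `^ (- s) - s * b `^ (- s - 1) * (a - b) <= a `^ (- s).
Proof.
rewrite le_eqVlt => /predU1P[<- _ _|s0 a0 b0].
 by rewrite oppr0 !powRr0 mul0r mul0r subr0.
have sn : s != 0 by rewrite gt_eqF.
have s1 : 1 + s != 0 by rewrite gt_eqF//; lra.
have s1p : 0 < 1 + s by lra.
have ab : 0 < a / b by exact: divr_gt0.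
pose t := a / b.
have := @conjugate_powR _ (t `^ (- (s / (1 + s)))) (t `^ (s / (1 + s))) (1 + s) ((1 + s) / s)
 (powR_ge0 _ _) (powR_ge0 _ _) s1p (divr_gt0 s1p s0) _.
rewrite -powRD ?(gt_eqF ab) ?implybT// addNr powRr0 -!powRrM.
have -> : - (s / (1 + s)) * (1 + s) = - s by field.
have -> : s / (1 + s) * ((1 + s) / s) = 1 by field; rewrite sn.
rewrite (powRr1 (ltW ab)) => H.
have {H} : 1 <= t `^ (- s) / (1 + s) + t / ((1 + s) / s).
 by apply: H; field; rewrite sn.
move=> H; have : (1 + s) <= t `^ (- s) + t * s.
 have -> : t `^ (- s) + t * s = (1 + s) * (t `^ (- s) / (1 + s) + t / ((1 + s) / s)).
  by field; rewrite sn.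
 by rewrite -[leLHS]mulr1 ler_pM2l.
have E : a `^ (- s) = b `^ (- s) * t `^ (- s).
 by rewrite -powRM ?ltW// /t mulrC divfK// gt_eqF.
have Eb : b `^ (- s) = b * b `^ (- s - 1).
 by rewrite -[X in X * _](powRr1 (ltW b0)) -powRD ?(gt_eqF b0) ?implybT//; congr powR; ring.
have tb : t * b = a by rewrite /t divfK// gt_eqF.
rewrite E; move=> h; have bs : 0 < b `^ (- s) by exact: powR_gt0.
have : b `^ (- s) * (1 + s) <= b `^ (- s) * (t `^ (- s) + t * s) by rewrite ler_pM2l.
have -> : s * b `^ (- s - 1) * (a - b) = s * (t - 1) * (b `^ (- s)) by rewrite Eb -tb; ring.
by set B := b `^ (- s); nra.
Qed.

Lemma powR_le a b r : 0 <= r -> 0 <= a -> a <= b -> a `^ r <= b `^ r.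
Proof. by move=> r0 a0 ab; apply: ge0_ler_powR => //; rewrite nnegrE// (le_trans a0). Qed.

Lemma powRN_le a b r : 0 <= r -> 0 < a -> a <= b -> b `^ (- r) <= a `^ (- r).
Proof.
move=> r0 a0 ab; rewrite !powRN lef_pV2 ?posrE ?powR_gt0 ?(lt_le_trans a0)//.
by apply: powR_le => //; exact: ltW.
Qed.

Lemma powRD1 a b r : a != 0 -> a `^ (b + r) = a `^ b * a `^ r.
Proof. by move=> a0; rewrite powRD// a0 implybT. Qed.

Lemma powR_superadd r a b : 1 <= r -> 0 <= a -> 0 <= b -> a `^ r + b `^ r <= (a + b) `^ r.
Proof.
move=> r1 a0 b0; have rp : 0 < r by lra.
rewrite -(mulr_powRB1 a0 rp) -(mulr_powRB1 b0 rp) -(mulr_powRB1 (addr_ge0 a0 b0) rp) mulrDl.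
by apply: lerD; apply: ler_wpM2l => //; apply: powR_le => //; lra.
Qed.

Lemma powR_subadd r a b : 0 <= r <= 1 -> 0 <= a -> 0 <= b -> (a + b) `^ r <= a `^ r + b `^ r.
Proof.
move=> /andP[]; rewrite le_eqVlt => /predU1P[<- _ _ _|r0 r1 a0 b0].
 by rewrite !powRr0; lra.
have rn : r != 0 by rewrite gt_eqF.
have ir : 1 <= r^-1 by rewrite invf_ge1.
have := @powR_superadd r^-1 (a `^ r) (b `^ r) ir (powR_ge0 _ _) (powR_ge0 _ _).
rewrite -!powRrM mulfV// !powRr1// => h.
have := @powR_le _ _ r (ltW r0) (addr_ge0 a0 b0) h.
by rewrite -powRrM mulVf// powRr1// addr_ge0// powR_ge0.
Qed.

Lemma powR_lip r a b : 1 <= r -> 0 <= a -> 0 <= b ->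
 `|a `^ r - b `^ r| <= r * Num.max a b `^ (r - 1) * `|a - b|.
Proof.
move=> r1 a0 b0; wlog ab : a b a0 b0 / b <= a.
 move=> H; case/orP: (le_total b a) => h; first exact: H.
 by rewrite distrC (distrC a) maxC; exact: H.
have := @tan_ge r b a r1 b0 a0.
rewrite max_l// !ger0_norm ?subr_ge0//; last by apply: powR_le => //; lra.
by set A := a `^ r; set B := b `^ r; set C := a `^ (r - 1); lra.
Qed.

Lemma powR_holder r a b : 0 <= r <= 1 -> 0 <= a -> 0 <= b -> `|a `^ r - b `^ r| <= `|a - b| `^ r.
Proof.
move=> r1 a0 b0; wlog ab : a b a0 b0 / b <= a.
 move=> H; case/orP: (le_total b a) => h; first exact: H.
 by rewrite distrC (distrC a); exact: H.
rewrite !ger0_norm ?subr_ge0//; last by apply: powR_le => //; case/andP: r1.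
have := @powR_subadd r (a - b) b r1 _ b0; rewrite subrK subr_ge0 => /(_ ab); lra.
Qed.

(* Second difference of a power, the strict part of the two-point polarization inequality. *)
Lemma pol_strict q B x y : 2 <= q -> 0 <= B -> 0 <= x -> 0 <= y ->
 (B + x) `^ q + (B + y) `^ q + q / 2 * Num.min x y `^ q <= (B + x + y) `^ q + B `^ q.
Proof.
move=> q2 B0 x0 y0; wlog yx : x y x0 y0 / y <= x.
 move=> H; case/orP: (le_total y x) => h; first exact: H.
 by have := H y x y0 x0 h; rewrite minC [B + y + x]addrAC; lra.
rewrite min_r//.
have q1 : 1 <= q by lra.
have h0 : 0 <= B + x + y / 2 by lra.
(* Four tangents in half-steps [y/2]. The slopes at [B + x + y/2] and [B + y/2] differ by at least
   [q x^(q-1)], by superadditivity for the exponent [q - 1 >= 1]; those at [B + x] and [B + y] are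
   ordered since [y <= x]. *)
have h1 := @tan_ge q (B + x + y) (B + x + y / 2) q1 ltac:(lra) h0.
have h2 := @tan_ge q B (B + y / 2) q1 B0 ltac:(lra).
have h3 := @tan_ge q (B + x + y / 2) (B + x) q1 h0 ltac:(lra).
have h4 := @tan_ge q (B + y / 2) (B + y) q1 ltac:(lra) ltac:(lra).
have h5 := @powR_superadd (q - 1) x (B + y / 2) ltac:(lra) x0 ltac:(lra).
have h6 := @powR_le (B + y) (B + x) (q - 1) ltac:(lra) ltac:(lra) ltac:(lra).
have h7 := @powR_le y x (q - 1) ltac:(lra) y0 yx.
have e : y * y `^ (q - 1) = y `^ q by rewrite mulr_powRB1//; lra.
have e1 : x + (B + y / 2) = B + x + y / 2 by ring.
rewrite e1 in h5.
have e2 : B + x + y - (B + x + y / 2) = y / 2 by field.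
have e3 : B - (B + y / 2) = - (y / 2) by ring.
have e4 : B + x + y / 2 - (B + x) = y / 2 by ring.
have e5 : B + y / 2 - (B + y) = - (y / 2) by field.
rewrite e2 in h1; rewrite e3 in h2; rewrite e4 in h3; rewrite e5 in h4.
rewrite -e.
move: h1 h2 h3 h4 h5 h6 h7.
move: ((B + x + y) `^ q) ((B + x + y / 2) `^ q) ((B + x + y / 2) `^ (q - 1)) (B `^ q)
 ((B + y / 2) `^ q) ((B + y / 2) `^ (q - 1)) ((B + x) `^ q) ((B + x) `^ (q - 1))
 ((B + y) `^ q) ((B + y) `^ (q - 1)) (x `^ (q - 1)) (y `^ (q - 1)).
move=> a1 a2 a3 a4 a5 a6 a7 a8 a9 b1 b2 b3 h1 h2 h3 h4 h5 h6 h7.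
have p1 : 0 <= q * (y / 2) by rewrite mulr_ge0//; lra.
have k1 : q * (y / 2) * b3 <= q * (y / 2) * (a3 - a6) by rewrite ler_wpM2l//; lra.
have k2 : q * (y / 2) * b1 <= q * (y / 2) * a8 by rewrite ler_wpM2l.
have -> : q / 2 * (y * b3) = q * (y / 2) * b3 by ring.
lra.
Qed.

Lemma tan_abs q a b : 1 <= q -> 0 <= a -> a `^ q + q * a `^ (q - 1) * b <= `|a + b| `^ q.
Proof.
move=> q1 a0; have := @tan_ge q `|a + b| a q1 (normr_ge0 _) a0; apply: le_trans.
rewrite lerD2l ler_wpM2l ?mulr_ge0 ?powR_ge0//; first by lra.
by have := ler_norm (a + b); lra.
Qed.

End Scalar.

(** * Taylor-type estimates for powers *)

Section ScalarTaylor.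
Context {R : realType}.
Implicit Types a b t x y r s p q : R.

(** Integrates a bound on the derivative: each Taylor estimate below follows from the preceding one
    for the exponent [r - 1]. *)
Lemma mvt_pow (G G' : R -> R) (C : R) (k : nat) : 0 <= C -> G 0 = 0 ->
 (forall t, `|t| <= 1 / 2 -> is_derive t 1 G (G' t)) ->
 (forall t, `|t| <= 1 / 2 -> `|G' t| <= C * `|t| ^+ k) ->
 forall t, `|t| <= 1 / 2 -> `|G t| <= C * `|t| ^+ k.+1.
Proof.
move=> C0 G0 dG bG t t12.
have key a b : a <= b -> `|a| <= 1 / 2 -> `|b| <= 1 / 2 -> (a = 0 \/ b = 0) ->
  `|G b - G a| <= C * (`|a| + `|b|) ^+ k.+1.
 move=> ab a1 b1 ab0.
 have cb c : c \in `[a, b] -> `|c| <= 1 / 2.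
  by rewrite in_itv/= => /andP[? ?]; move: a1 b1; rewrite !ler_norml => /andP[? ?] /andP[? ?]; apply/andP; split; lra.
 have [c cab ->] : exists2 c, c \in `[a, b] & G b - G a = G' c * (b - a).
  apply: (@MVT_segment R G G' a b) => //.
   by move=> x xab; apply: dG; apply: cb; apply: subset_itv_oo_cc xab.
  apply: derivable_within_continuous => x xab.
  by have := dG x (cb _ xab) => -[].
 rewrite normrM; have hc : `|c| <= `|a| + `|b|.
  move: cab; rewrite in_itv/= => /andP[? ?]; rewrite ler_norml; apply/andP.
  by have := ler_norm a; have := ler_norm b; have := ler_norm (- a); have := ler_norm (- b); rewrite !normrN; have := normr_ge0 a; have := normr_ge0 b; split; lra.
 have hba : `|b - a| <= `|a| + `|b| by rewrite [leRHS]addrC -(normrN a) ler_normD.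
 rewrite exprSr mulrA; apply: ler_pM => //.
 by apply: le_trans (bG c (cb _ cab)) _; apply: ler_wpM2l => //; apply: lerXn2r => //; rewrite nnegrE// addr_ge0.
case: (leP 0 t) => [t0|/ltW t0].
 have := key 0 t t0; rewrite normr0 add0r G0 subr0; apply => //; by left.
have := key t 0 t0 t12; rewrite normr0 addr0 G0 sub0r normrN; apply => //; by right.
Qed.

Lemma half_pos t : `|t| <= 1 / 2 -> 1 / 2 <= 1 + t <= 3 / 2.
Proof. by rewrite ler_norml => /andP[? ?]; apply/andP; split; lra. Qed.

Lemma powR1_bd r : exists2 C, 0 <= C & forall t, `|t| <= 1 / 2 -> `|(1 + t) `^ r| <= C.
Proof.
exists ((3 / 2) `^ r + (1 / 2) `^ r); first side.
move=> t /half_pos/andP[t1 t2]; rewrite ger0_norm ?powR_ge0//.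
case: (leP 0 r) => r0.
 by apply: (le_trans (@powR_le _ _ (3 / 2) r r0 _ t2)); [lra|rewrite lerDl powR_ge0].
apply: (le_trans (y := (1 / 2) `^ r)); last by rewrite lerDr powR_ge0.
by have := @powRN_le _ (1 / 2) (1 + t) (- r); rewrite opprK; apply; lra.
Qed.

Lemma is_derive_powR1 r t : `|t| <= 1 / 2 -> is_derive t 1 (fun t => (1 + t) `^ r) (r * (1 + t) `^ (r - 1)).
Proof.
move=> /half_pos/andP[t1 t2].
have t0 : 0 < 1 + t by lra.
have h1 := @is_derive1_powR R r (1 + t) t0.
have h2 : is_derive t 1 (fun t : R => 1 + t) 1.
 rewrite -[X in is_derive _ _ _ X]add0r; exact: is_deriveD.
have := @is_derive1_comp _ (fun x => x `^ r) (fun t : R => 1 + t) t _ _ h1 h2.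
by rewrite mulr1.
Qed.

Lemma powR1_taylor0 r : exists2 C, 0 <= C & forall t, `|t| <= 1 / 2 ->
 `|(1 + t) `^ r - 1| <= C * `|t|.
Proof.
have [C C0 h] := powR1_bd (r - 1).
exists (`|r| * C); first side.
move=> t ht; rewrite -[`|t|]expr1.
apply: (@mvt_pow (fun t => (1 + t) `^ r - 1) (fun t => r * (1 + t) `^ (r - 1)) _ 0) => //.
- side.
- by rewrite addr0 powR1 subrr.
- move=> x hx; have h1 := is_derive_powR1 r hx.
 by apply: is_derive_eq; rewrite subr0.
- by move=> x hx; rewrite normrM expr0 mulr1 ler_wpM2l// h.
Qed.

Lemma powR1_taylor1 r : exists2 C, 0 <= C & forall t, `|t| <= 1 / 2 ->
 `|(1 + t) `^ r - 1 - r * t| <= C * t ^+ 2.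
Proof.
have [C C0 h] := powR1_taylor0 (r - 1).
exists (`|r| * C); first side.
move=> t ht; rewrite -[t ^+ 2](real_normK (num_real t)).
apply: (@mvt_pow (fun t => (1 + t) `^ r - 1 - r * t) (fun t => r * (1 + t) `^ (r - 1) - r) _ 1) => //.
- side.
- by rewrite addr0 powR1 subrr mulr0 subrr.
- move=> x hx; have h1 := is_derive_powR1 r hx.
 by apply: is_derive_eq; rewrite subr0 /GRing.scale/= mulr1.
- move=> x hx; rewrite -[X in _ - X]mulr1 -mulrBr normrM expr1 -mulrA ler_wpM2l// h//.
Qed.

Lemma powR1_taylor2 r : exists2 C, 0 <= C & forall t, `|t| <= 1 / 2 ->
 `|(1 + t) `^ r - 1 - r * t - r * (r - 1) / 2 * t ^+ 2| <= C * `|t| ^+ 3.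
Proof.
have [C C0 h] := powR1_taylor1 (r - 1).
exists (`|r| * C); first side.
apply: (@mvt_pow (fun t => (1 + t) `^ r - 1 - r * t - r * (r - 1) / 2 * t ^+ 2)
 (fun t => r * (1 + t) `^ (r - 1) - r - r * (r - 1) * t) _ 2) => //.
- side.
- by rewrite addr0 powR1 subrr mulr0 subrr expr0n mulr0 subr0.
- move=> x hx; have h1 := is_derive_powR1 r hx.
 apply: is_derive_eq; rewrite subr0 /GRing.scale/= !mulr1.
 by field.
- move=> x hx; rewrite (_ : _ - _ - _ = r * ((1 + x) `^ (r - 1) - 1 - (r - 1) * x)); last by ring.
 by rewrite normrM -mulrA ler_wpM2l// (le_trans (h x hx))// real_normK// num_real.
Qed.

Lemma powR_1D_le r a : 0 <= r -> 0 <= a -> (1 + a) `^ r <= 2 `^ r * (1 + a `^ r).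
Proof.
move=> r0 a0; case: (leP a 1) => a1.
 apply: (le_trans (@powR_le _ (1 + a) 2 r r0 _ _)); [lra|lra|].
 by rewrite ler_peMr ?powR_ge0// lerDl powR_ge0.
apply: (le_trans (@powR_le _ (1 + a) (2 * a) r r0 _ _)); [lra|lra|].
by rewrite powRM// ler_wpM2l ?powR_ge0// lerDr.
Qed.

(** The error is uniform in [a]: the derivative [t^(p-1)] is Hoelder continuous for [p <= 2] and
    locally Lipschitz for [p >= 2], which gives the exponent [min p 2]. If [a + b] is negative then
    [a <= t], and every term is of order [t^p]. *)
Lemma powR_var p : 1 < p -> exists2 C, 0 <= C & forall a b t, 0 <= a -> `|b| <= t -> t <= 1 ->
 `|a + b| `^ p <= a `^ p + p * a `^ (p - 1) * b + C * t `^ Num.min p 2 * (1 + a `^ p).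
Proof.
move=> p1; have p0 : 0 <= p by lra.
exists (1 + p + p * (p * 2 `^ p)).
 by rewrite !addr_ge0 ?mulr_ge0 ?powR_ge0//; lra.
move=> a b t a0 bt t1.
have t0 : 0 <= t by exact: le_trans bt.
have A0 : 0 <= a `^ p by exact: powR_ge0.
have tp : t `^ p <= t `^ Num.min p 2.
 case/orP: (le_total p 2) => h; first by rewrite min_l.
 rewrite min_r//; case: (ltgtP t 0) (t0) => // [tt|->] _; last by rewrite !powR0//; lra.
 by apply: ger_powR; rewrite ?tt.
set tm := t `^ Num.min p 2 in tp *.
have tm0 : 0 <= tm by exact: powR_ge0.
have tp0 : 0 <= t `^ p by exact: powR_ge0.
have D0 : 0 <= p * 2 `^ p by rewrite mulr_ge0// powR_ge0.
have pa : 0 <= a `^ (p - 1) by exact: powR_ge0.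
case: (leP 0 (a + b)) => ab.
 rewrite ger0_norm//; set c := a + b.
 have h1 := @tan_ge _ p a c (ltW p1) a0 ab.
 have e1 : a - c = - b by rewrite /c; ring.
 rewrite e1 in h1.
 suff k : (c `^ (p - 1) - a `^ (p - 1)) * b <= (1 + p * 2 `^ p) * tm * (1 + a `^ p).
  have k2 : p * ((c `^ (p - 1) - a `^ (p - 1)) * b) <= p * ((1 + p * 2 `^ p) * tm * (1 + a `^ p)).
   by rewrite ler_wpM2l.
  have k3 : 0 <= tm * (1 + a `^ p) by rewrite mulr_ge0//; lra.
  move: h1 k2; set X := c `^ p; set Y := c `^ (p - 1); set Z := a `^ (p - 1); lra.
 apply: (le_trans (ler_norm _)); rewrite normrM.
 have e2 : c - a = b by rewrite /c; ring.
 case/orP: (le_total p 2) => h.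
  have r1 : 0 <= p - 1 <= 1 by lra.
  have := @powR_holder _ (p - 1) c a r1 ab a0; rewrite e2 => k.
  have k4 : `|c `^ (p - 1) - a `^ (p - 1)| * `|b| <= t `^ p.
   apply: (le_trans (ler_wpM2r (normr_ge0 _) k)).
   rewrite mulrC mulr_powRB1//; last by lra.
   exact: powR_le.
  apply: (le_trans k4); apply: (le_trans tp).
  rewrite -[leLHS]mulr1; apply: ler_pM => //; last by lra.
  by rewrite ler_peMl// lerDl.
 have p12 : 1 <= p - 1 by lra.
 have := @powR_lip _ (p - 1) c a p12 ab a0; rewrite e2 => k.
 have c1a : Num.max c a <= 1 + a.
  rewrite ge_max; apply/andP; split; last by lra.
  by rewrite /c addrC lerD2r (le_trans (ler_norm b))// (le_trans bt).
 have k5 : Num.max c a `^ (p - 1 - 1) <= 2 `^ p * (1 + a `^ p).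
  apply: (le_trans (@powR_le _ _ (1 + a) (p - 1 - 1) _ _ c1a)); [lra| |].
   by rewrite le_max ab.
  apply: (le_trans (y := (1 + a) `^ p)); last exact: powR_1D_le.
  by apply: ler_powR; lra.
 have tm2 : `|b| * `|b| <= tm.
  rewrite /tm min_r// powR_mulrn// expr2; exact: ler_pM.
 apply: (le_trans (ler_wpM2r (normr_ge0 _) k)).
 rewrite -[leLHS]mulrA.
 have : (p - 1) * Num.max c a `^ (p - 1 - 1) * (`|b| * `|b|) <= p * (2 `^ p * (1 + a `^ p)) * tm.
  apply: ler_pM => //.
   by rewrite mulr_ge0 ?powR_ge0//; lra.
  apply: ler_pM => //; [lra|exact: powR_ge0|lra].
 move=> h2; apply: (le_trans h2).
 have : 0 <= tm * (1 + a `^ p) by side.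
 set X := 2 `^ p; nra.
have h1 : `|a + b| <= t.
 rewrite ltr0_norm// opprD; have := ler_norm (- b); rewrite normrN; lra.
have h2 : `|a + b| `^ p <= t `^ p by exact: powR_le.
have h3 : a <= t by have := ler_norm (- b); rewrite normrN; lra.
have h4 : a `^ (p - 1) * `|b| <= t `^ p.
 rewrite -(mulr_powRB1 t0) 1?mulrC; last by lra.
 by apply: ler_pM => //; apply: powR_le => //; lra.
have h5 : - `|b| <= b by rewrite lerNl -normrN ler_norm.
have h6 : - (p * t `^ p) <= p * a `^ (p - 1) * b.
 have : p * a `^ (p - 1) * (- `|b|) <= p * a `^ (p - 1) * b by rewrite ler_wpM2l// mulr_ge0.
 by have := ler_wpM2l p0 h4; lra.
have h7 : 0 <= p * (p * 2 `^ p) * tm * (1 + a `^ p) by rewrite !mulr_ge0 ?powR_ge0//; lra.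
have h8 : (1 + p) * tm <= (1 + p) * tm * (1 + a `^ p) by rewrite ler_peMr ?mulr_ge0//; lra.
have h9 : (1 + p) * t `^ p <= (1 + p) * tm by rewrite ler_wpM2l//; lra.
lra.
Qed.

Lemma powR_lower_near p (e : R) : 1 < p -> 0 < e -> exists2 d, 0 < d <= 1 / 2 & forall t, `|t| <= d ->
 1 + p * t + p * (p - 1) / 2 * (1 - e) * t ^+ 2 <= `|1 + t| `^ p.
Proof.
move=> p1 e0; have [C C0 h] := powR1_taylor2 p.
have c0 : 0 < p * (p - 1) / 2 * e by rewrite !mulr_gt0//; lra.
exists (Num.min (1 / 2) (p * (p - 1) / 2 * e / (C + 1))).
 by rewrite lt_min ge_min lexx andbT !divr_gt0//; lra.
move=> t; rewrite le_min => /andP[t1 t2].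
have /andP[t3 _] := half_pos t1.
have := h t t1; rewrite ler_norml => /andP[h1 _].
rewrite ger0_norm; last by lra.
have h2 : C * `|t| ^+ 3 <= p * (p - 1) / 2 * e * t ^+ 2.
 rewrite exprS mulrA -[t ^+ 2](real_normK (num_real t)); apply: ler_wpM2r; first exact: exprn_ge0.
 move: t2; rewrite ler_pdivlMr; last by lra.
 by have := normr_ge0 t; nra.
by move: h1 h2; set X := C * _; set Y := _ `^ p; lra.
Qed.

(** The gap above the tangent, known at [+e] and [-e] from [powR_lower_near], is propagated outwards
    by convexity ([mid]); for large [|t|] the growth of order [p] takes over ([big]). *)
Lemma powR_lower_far p (d : R) : 1 < p -> 0 < d <= 1 / 2 -> exists2 c, 0 < c & forall t, d < `|t| ->
 1 + p * t + c * `|t| `^ p <= `|1 + t| `^ p.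
Proof.
move=> p1 /andP[d0 d2]; have p0 : 0 < p by lra.
have [d1 /andP[d10 d12] hn] := @powR_lower_near p (1 / 2) p1 ltac:(lra).
pose c0 := p * (p - 1) / 2 * (1 - 1 / 2) * Num.min d d1 ^+ 2.
have m0 : 0 < Num.min d d1 by rewrite lt_min d0.
have c00 : 0 < c0 by rewrite /c0 !mulr_gt0 ?exprn_gt0//; lra.
pose e := Num.min d d1.
have ee : `|e| <= d1 by rewrite gtr0_norm// ge_min lexx orbT.
have ed : e <= d by rewrite ge_min lexx.
have e12 : e <= 1 / 2 by lra.
have hp := hn e ee; have hm := hn (- e); rewrite normrN in hm; have {}hm := hm ee.
rewrite sqrrN in hm; rewrite -/c0 in hp hm.
rewrite ger0_norm in hp; last side.
rewrite ger0_norm in hm; last by lra.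
have e0 : 0 < e by [].
(* For [t >= L] one has [t^(p-1) >= 2 (p + 1)], so half of [t^p] dominates the linear term. *)
pose L := Num.max 2 ((2 * (p + 1)) `^ (p - 1)^-1).
have L2 : 2 <= L by rewrite le_max lexx.
have Lp : 0 < L `^ p by apply: powR_gt0; lra.
have mid t : d < `|t| -> 1 + p * t + c0 <= `|1 + t| `^ p.
 move=> dt; case: (leP 0 t) => t0.
  rewrite ger0_norm in dt => //.
  have := @tan_abs _ p (1 + e) (t - e) (ltW p1) ltac:(lra).
  have -> : 1 + e + (t - e) = 1 + t by ring.
  have q1 : 1 <= (1 + e) `^ (p - 1).
   by rewrite -[X in X <= _](congr1 (fun f => f (p - 1)) (@powR1 R)); apply: powR_le; lra.
  move: hp q1; set X := _ `^ p; set Y := _ `^ (p - 1) => hp q1.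
  have : p * (t - e) <= p * Y * (t - e) by rewrite ler_wpM2r//; [lra|rewrite ler_peMr//; lra].
  lra.
 rewrite ltr0_norm in dt => //.
 have := @tan_abs _ p (1 - e) (t + e) (ltW p1) ltac:(lra).
 have -> : 1 - e + (t + e) = 1 + t by ring.
 have q1 : (1 - e) `^ (p - 1) <= 1.
  by rewrite -[X in _ <= X](congr1 (fun f => f (p - 1)) (@powR1 R)); apply: powR_le; lra.
 move: hm q1; set X := _ `^ p; set Y := _ `^ (p - 1) => hm q1.
 have : p * (- (t + e)) * Y <= p * (- (t + e)) by rewrite ler_piMr// mulr_ge0//; lra.
 lra.
have big t : L <= `|t| -> 1 + p * t + (1 / 2) `^ p * `|t| `^ p <= `|1 + t| `^ p.
 move=> Lt; case: (leP 0 t) => t0.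
  rewrite (ger0_norm t0) in Lt *; rewrite ger0_norm; last by lra.
  have h1 : t `^ p + 1 <= (1 + t) `^ p.
   by have := @powR_superadd _ p t 1 (ltW p1) t0 ler01; rewrite powR1 [t + 1]addrC.
  have h2 : (1 / 2) `^ p <= 1 / 2 :> R.
   by rewrite -[X in _ <= X]powRr1; [apply: ger_powR; [apply/andP; split|]|]; lra.
  have h3 : 2 * (p + 1) <= t `^ (p - 1).
   have : (2 * (p + 1)) `^ (p - 1)^-1 <= t by apply: le_trans Lt; rewrite le_max lexx orbT.
   have p10 : 0 <= p - 1 by rewrite subr_ge0 ltW.
   move=> /(@powR_le _ _ _ (p - 1) p10 (powR_ge0 _ _)).
   by rewrite -powRrM mulVf ?powRr1//; [lra|rewrite gt_eqF//; lra].
  have h4 : t * (2 * (p + 1)) <= t `^ p by rewrite -(mulr_powRB1 t0 p0) ler_wpM2l.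
  have h5 : (1 / 2) `^ p * t `^ p <= 1 / 2 * t `^ p by rewrite ler_wpM2r// powR_ge0.
  move: h1 h4 h5; set X := t `^ p; set Y := _ `^ p; set Z := _ `^ p; nra.
 have i2 : 0 <= 1 / 2 :> R by lra.
 rewrite -(@powRM _ _ _ p i2 (normr_ge0 t)).
 have h1 : (1 / 2 * `|t|) `^ p <= `|1 + t| `^ p.
  apply: powR_le; [lra|side|].
  rewrite (ltr0_norm t0) in Lt *; rewrite -normrN.
  by apply: le_trans (ler_norm _); lra.
 rewrite (ltr0_norm t0) in Lt h1 *.
 have : 1 + p * t <= 0 by nra.
 lra.
exists (Num.min (c0 / L `^ p) ((1 / 2) `^ p)).
 by rewrite lt_min divr_gt0//= powR_gt0//; lra.
move=> t dt; case: (leP L `|t|) => Lt.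
 apply: le_trans (big t Lt); rewrite lerD2l ler_wpM2r ?powR_ge0//.
 by rewrite ge_min lexx orbT.
apply: le_trans (mid t dt); rewrite lerD2l.
apply: (le_trans (y := c0 / L `^ p * `|t| `^ p)).
 by rewrite ler_wpM2r ?powR_ge0// ge_min lexx.
rewrite mulrAC ler_pdivrMr// ler_wpM2l//; first exact: ltW.
by apply: powR_le; [lra|by []|exact: ltW].
Qed.

(** Taylor's formula for [|t| <= d]; beyond [d] all terms are dominated by [|t|^q], with a constant
    depending on [e]. *)
Lemma powR_upper q (e : R) : 2 <= q -> 0 < e -> exists2 C, 0 <= C & forall t,
 `|1 + t| `^ q <= 1 + q * t + q * (q - 1) / 2 * (1 + e) * t ^+ 2 + C * `|t| `^ q.
Proof.
move=> q2 e0; have [C C0 h] := powR1_taylor2 q.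
have c0 : 0 < q * (q - 1) / 2 * e by rewrite !mulr_gt0//; lra.
pose d := Num.min (1 / 2) (q * (q - 1) / 2 * e / (C + 1)).
have d0 : 0 < d by rewrite lt_min !divr_gt0//; lra.
exists ((d^-1 + 1) `^ q + q * d `^ (1 - q)).
 by rewrite addr_ge0 ?mulr_ge0 ?powR_ge0//; lra.
move=> t; case: (leP `|t| d) => td.
 move: td; rewrite le_min => /andP[t1 t2].
 have /andP[t3 _] := half_pos t1.
 have := h t t1; rewrite ler_norml => /andP[_ h1].
 rewrite ger0_norm; last by lra.
 have h2 : C * `|t| ^+ 3 <= q * (q - 1) / 2 * e * t ^+ 2.
  rewrite exprS mulrA -[t ^+ 2](real_normK (num_real t)); apply: ler_wpM2r; first exact: exprn_ge0.
  move: t2; rewrite ler_pdivlMr; last by lra.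
  by have := normr_ge0 t; nra.
 have h3 : 0 <= ((d^-1 + 1) `^ q + q * d `^ (1 - q)) * `|t| `^ q.
  by rewrite mulr_ge0 ?powR_ge0// addr_ge0 ?mulr_ge0 ?powR_ge0//; lra.
 by move: h1 h2 h3; set X := C * _; set Y := _ `^ q; set Z := _ * `|t| `^ q; lra.
have h1 : `|1 + t| `^ q <= (d^-1 + 1) `^ q * `|t| `^ q.
 rewrite -powRM//; last by rewrite addr_ge0// invr_ge0 ltW.
 apply: powR_le => //; first by lra.
 apply: (le_trans (ler_normD _ _)); rewrite normr1 mulrDl mul1r lerD2r.
 by rewrite mulrC ler_pdivlMr// mul1r ltW.
have t0 : 0 < `|t| by exact: lt_trans td.
have h2 : `|t| <= d `^ (1 - q) * `|t| `^ q.
 rewrite -{1}[`|t|]powRr1// -{1}(subrK q 1) powRD1 ?gt_eqF//.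
 rewrite ler_wpM2r ?powR_ge0//.
 by have := @powRN_le _ d `|t| (q - 1); rewrite opprB; apply; lra.
have h3 : - `|t| <= t by rewrite lerNl -normrN ler_norm.
have h4 : 0 <= q * (q - 1) / 2 * (1 + e) * t ^+ 2.
 by rewrite mulr_ge0 ?sqr_ge0// !mulr_ge0//; lra.
have h5 := ler_wpM2l (_ : 0 <= q) h2; have {}h5 := h5 ltac:(lra).
have h6 : q * (- `|t|) <= q * t by rewrite ler_wpM2l//; lra.
rewrite mulrDl; move: h1 h4 h5 h6; set X := _ `^ q; set Y := _ * `|t| `^ q; set Z := d `^ _ * _.
rewrite -[q * d `^ _ * _]mulrA -/Z; lra.
Qed.

(* The inverse of a power is uniformly continuous up to an arbitrarily small multiple of [1 + u^p]. *)
Lemma powR_inv_le p r (z : R) : 1 < p -> 0 < r -> 0 < z -> exists2 C, 0 <= C & forall u a, 0 <= u ->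
 0 <= a <= 1 -> u <= a + z * (1 + u `^ p) + C * `|u `^ r - a `^ r|.
Proof.
move=> p1 r0 z0.
(* For [u >= L] one has [u <= z u^p]. For [a + z < u < L] the increment of the power is at least
   [c], so that [L / c] times it exceeds [u]. *)
pose L := z `^ (- (p - 1)^-1).
pose c := Num.min (z `^ r) (r * (1 + z) `^ (r - 1) * z).
have c0 : 0 < c.
 by rewrite lt_min powR_gt0//= !mulr_gt0 ?powR_gt0//; lra.
exists (L / c); first side.
move=> u a u0 /andP[a0 a1].
have X0 : 0 <= L / c * `|u `^ r - a `^ r|.
 side.
have up0 : 0 <= u `^ p by exact: powR_ge0.
case: (leP u (a + z)) => h.
 have : 0 <= z * u `^ p by side.
 by move: X0; set X := _ * `|_|; lra.
case: (leP L u) => hL.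
 have k : u <= z * u `^ p.
  rewrite -(mulr_powRB1 u0); last by lra.
  rewrite mulrCA ler_peMr//.
  have := @powR_le _ L u (p - 1) ltac:(lra) (powR_ge0 _ _) hL.
  rewrite /L -powRrM mulNr mulVf; last by rewrite gt_eqF//; lra.
  rewrite powRN (powRr1 (ltW z0)) => k.
  by have := ler_wpM2l (ltW z0) k; rewrite divff// gt_eqF.
 by move: X0; set X := _ * `|_|; lra.
have k : c <= `|u `^ r - a `^ r|.
 have k1 : (a + z) `^ r <= u `^ r by apply: powR_le; lra.
 apply: (le_trans (y := (a + z) `^ r - a `^ r)); last first.
  by apply: le_trans (ler_norm _); lra.
 case: (leP 1 r) => r1.
  rewrite ge_min; apply/orP; left.
  by have := @powR_superadd _ r a z r1 a0 (ltW z0); lra.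
 rewrite ge_min; apply/orP; right.
 have k2 := @tan_le _ r a (a + z) ltac:(lra) a0 ltac:(lra).
 have k3 : (1 + z) `^ (r - 1) <= (a + z) `^ (r - 1).
  by have := @powRN_le _ (a + z) (1 + z) (1 - r); rewrite opprB; apply; lra.
 have k4 : r * (1 + z) `^ (r - 1) * z <= r * (a + z) `^ (r - 1) * z.
  by rewrite ler_pM2r// ler_pM2l.
 have e : a - (a + z) = - z by ring.
 move: k2; rewrite e; move: k4; set X := _ `^ r; set Y := _ `^ r; set Z := _ `^ _ ; set W := _ `^ _; lra.
have k5 : u <= L / c * `|u `^ r - a `^ r|.
 apply: (le_trans (ltW hL)).
 by rewrite mulrAC ler_pdivlMr// ler_wpM2l// powR_ge0.
have : 0 <= z * (1 + u `^ p) by side.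
lra.
Qed.

End ScalarTaylor.

(** * Reflections and radial functions *)

Section ReflMeas.
Context {R : realType}.

(** The mirror is the bisector of the two points, with normal [x - x']. Through [radial_eq],
    invariance under reflections stands in for rotation invariance. *)
Lemma refl_exists n (x x' : n.-tuple R) : enorm x = enorm x' ->
 x = x' \/ exists2 e, dotp e e = 1 & refl e x = x'.
Proof.
move=> xx'; have [->|ne] := eqVneq x x'; [by left|right].
pose w := tsub x x'.
have w0 : 0 < enorm w.
 rewrite lt_neqAle enorm_ge0 andbT eq_sym; apply: contra ne => /eqP/enorm_eq0 h.
 apply/eqP/eq_from_tnth => i; apply/eqP; rewrite -subr_eq0.
 by have := congr1 (fun z : n.-tuple R => tnth z i) h; rewrite !tnth_mktuple => ->.
have xx : dotp x x = dotp x' x' by rewrite -!enormE xx'.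
have e1 : dn (nrm w) w = 1 by rewrite -enormE enorm_nrm// expr1n.
exists (nrm w) => //.
have E : dotp w w = 2 * dotp w x.
 by rewrite /w !dotpBl !dotpBr xx (dotpC x' x); ring.
apply: eq_from_tnth => i; rewrite !tnth_mktuple dotpZl.
have -> : 2 * ((enorm w)^-1 * dotp w x) * ((enorm w)^-1 * (tnth x i - tnth x' i)) =
 (2 * dotp w x) * (enorm w) ^- 2 * (tnth x i - tnth x' i) by rewrite -exprVn; ring.
by rewrite -E -enormE mulfV ?expf_eq0 ?gt_eqF//; ring.
Qed.

Lemma radial_eq n (A : Type) (F : n.-tuple R -> A) : (forall e x, dotp e e = 1 -> F (refl e x) = F x) ->
 forall x x', enorm x = enorm x' -> F x = F x'.
Proof. by move=> H x x' /refl_exists[->//|[e e1 <-]]; rewrite H. Qed.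

Lemma meas_Ir2 d d' (T : measurableType d) (Y : measurableType d') (P : {sigma_finite_measure set Y -> \bar R})
 (F : T -> Y -> R) :
 mbl (fun z => F z.1 z.2) -> mbl (fun x : T => Ir P (F x)).
Proof.
move=> mF.
have mp : mbl (fun z : T => (\int[P]_y (Num.max (F z y) 0)%:E)%E).
 apply: (@measurable_int2 R _ _ _ _ P (fun z y => (Num.max (F z y) 0)%:E)).
  side.
 by move=> z y; rewrite lee_fin le_max lexx orbT.
have mm : mbl (fun z : T => (\int[P]_y (Num.max (- F z y) 0)%:E)%E).
 apply: (@measurable_int2 R _ _ _ _ P (fun z y => (Num.max (- F z y) 0)%:E)).
  side.
 by move=> z y; rewrite lee_fin le_max lexx orbT.
rewrite (_ : (fun x => _) = (fun z => fine (\int[P]_y (Num.max (F z y) 0)%:E - \int[P]_y (Num.max (- F z y) 0)%:E)%E)); last first.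
 by apply/funext => z; rewrite Ir_def int_max_split.
by apply: measurableT_comp => //; exact: emeasurable_funB.
Qed.

End ReflMeas.

(** * The kernel and the operator *)

Section Kernel.
Context {R : realType} {N : nat}.
Local Notation X := (N.+1.-tuple R).
Local Notation P := (@sph R N.+1).
Local Notation M := (@hyp R N.+1).
Implicit Types (x y e : X) (u v : X -> R) (s r : R).

(** For [|y| = 1], the Lorentz product of the point [(hgt x, x)] with the light-like vector
    [(1, y)]. *)
Definition ker x y : R := hgt x - dn x y.

Lemma dotp_nrm_le x y : `|dn x y| <= enorm x.
Proof.
by apply: le_trans (dotp_le _ _) _; rewrite ler_piMr ?enorm_ge0// enorm_nrm_le1.
Qed.

(** [(hgt x - |x|) (hgt x + |x|) = 1], and the second factor is below [2 hgt x]. *)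
Lemma hgt_enorm x : (2 * hgt x)^-1 <= hgt x - enorm x.
Proof.
have h := enorm_lt_hgt x; have h0 := hgt_gt0 x; have e0 := enorm_ge0 x.
have E : (hgt x - enorm x) * (hgt x + enorm x) = 1.
 have -> : (hgt x - enorm x) * (hgt x + enorm x) = hgt x ^+ 2 - enorm x ^+ 2 by ring.
 by rewrite hgt_sqr enormE addrK.
rewrite -div1r ler_pdivrMr; last by lra.
rewrite -{1}E ler_pM2l; lra.
Qed.

Lemma ker_ge x y : (2 * hgt x)^-1 <= ker x y.
Proof.
apply: le_trans (hgt_enorm x) _; rewrite lerD2l lerN2.
exact: le_trans (ler_norm _) (dotp_nrm_le _ _).
Qed.

Lemma ker_gt0 x y : 0 < ker x y.
Proof. by apply: lt_le_trans (ker_ge x y); rewrite invr_gt0 mulr_gt0 ?hgt_gt0. Qed.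

Lemma ker_le x y : ker x y <= 2 * hgt x.
Proof.
have := dotp_nrm_le x y; rewrite ler_norml => /andP[h _].
by have := enorm_lt_hgt x; rewrite /ker; lra.
Qed.

Lemma ker_reflC e x y : dotp e e = 1 -> ker (refl e x) y = ker x (refl e y).
Proof. by move=> e1; rewrite /ker hgt_refl// dotp_reflC nrm_refl. Qed.

Lemma ker_refl e x y : dotp e e = 1 -> ker (refl e x) (refl e y) = ker x y.
Proof. by move=> e1; rewrite ker_reflC// reflK. Qed.

Lemma ker_reflB e x y : dotp e e = 1 ->
 ker x (refl e y) = ker x y + 2 * (dotp e x * dn e y).
Proof.
by move=> e1; rewrite /ker nrm_refl// -dotp_reflC dotp_refll; ring.
Qed.

Lemma meas_ker d (T : measurableType d) (F G : T -> X) : mbl F ->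
 mbl G -> mbl (fun z => ker (F z) (G z)).
Proof.
move=> mF mG; apply: measurable_funD; first exact: meas_hgt.
side.
Qed.

Definition K s x y : R := ker x y `^ (- s).

Lemma K_gt0 s x y : 0 < K s x y.
Proof. exact/powR_gt0/ker_gt0. Qed.
Lemma K_ge0 s x y : 0 <= K s x y.
Proof. exact/ltW/K_gt0. Qed.

Lemma inv_powRN (a s : R) : 0 < a -> a^-1 `^ (- s) = a `^ s.
Proof.
move=> a0; rewrite -[X in X `^ _]powR_inv1 ?ltW// -powRrM mulN1r opprK //.
Qed.

Lemma K_le s x y : 0 <= s -> K s x y <= (2 * hgt x) `^ s.
Proof.
have h : 0 < 2 * hgt x by rewrite mulr_gt0 ?hgt_gt0.
move=> s0; rewrite -(inv_powRN s h); apply: powRN_le => //.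
- side.
- exact: ker_ge.
Qed.

Lemma K_ge s x y : 0 <= s -> (2 * hgt x) `^ (- s) <= K s x y.
Proof. by move=> s0; apply: powRN_le => //; [exact: ker_gt0|exact: ker_le]. Qed.

Lemma K_refl s e x y : dotp e e = 1 -> K s (refl e x) (refl e y) = K s x y.
Proof. by move=> e1; rewrite /K ker_refl. Qed.
Lemma K_reflC s e x y : dotp e e = 1 -> K s (refl e x) y = K s x (refl e y).
Proof. by move=> e1; rewrite /K ker_reflC. Qed.

Lemma meas_K d (T : measurableType d) s (F G : T -> X) : mbl F ->
 mbl G -> mbl (fun z => K s (F z) (G z)).
Proof. by move=> mF mG; apply: meas_powR; exact: meas_ker. Qed.

(* Convexity of [t |-> t^-s]: the kernel is larger on the reflected side, with two-sided
  linear control. *)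
Lemma K_diff s e x y : 0 <= s -> dotp e e = 1 -> 0 <= dotp e x * dn e y ->
 (2 * s * (2 * hgt x) `^ (- s - 1)) * (dotp e x * dn e y) <= K s x y - K s x (refl e y)
 <= (2 * s * (2 * hgt x) `^ (s + 1)) * (dotp e x * dn e y).
Proof.
move=> s0 e1; set z := dotp e x * _ => z0.
have Db : ker x (refl e y) = ker x y + 2 * z by exact: ker_reflB.
have a0 := ker_gt0 x y; have b0 := ker_gt0 x (refl e y).
have h : 0 < 2 * hgt x by rewrite mulr_gt0 ?hgt_gt0.
have s1 : 0 <= s + 1 by rewrite addr_ge0.
have e2 : - s - 1 = - (s + 1) by ring.
have k1 : (2 * hgt x) `^ (- s - 1) <= ker x (refl e y) `^ (- s - 1).
 by rewrite e2; apply: powRN_le => //; exact: ker_le.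
have k2 : ker x y `^ (- s - 1) <= (2 * hgt x) `^ (s + 1).
 rewrite e2 -(inv_powRN _ h); apply: powRN_le => //; first side.
 exact: ker_ge.
have h1 := @tan_neg _ s (ker x y) _ s0 a0 b0.
have h2 := @tan_neg _ s _ (ker x y) s0 b0 a0.
rewrite Db in h1 h2 k1; rewrite /K Db.
have z1 : 0 <= s * (2 * z) by apply: mulr_ge0 => //; apply: mulr_ge0.
have l1 := ler_wpM2l z1 k1; have l2 := ler_wpM2l z1 k2.
have E1 : ker x y - (ker x y + 2 * z) = - (2 * z) by ring.
have E2 : ker x y + 2 * z - ker x y = 2 * z by ring.
rewrite E1 in h1; rewrite E2 in h2.
move: h1 h2 l1 l2; move: (_ `^ (- s)) (_ `^ (- s)) (_ `^ (- s - 1)) (_ `^ (- s - 1)) (_ `^ (- s - 1)) (_ `^ (s + 1)).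
by move=> c1 c2 c3 c4 c5 c6 *; apply/andP; split; lra.
Qed.

Lemma K_lip s e x y : 0 <= s -> dotp e e = 1 ->
 `|K s x y - K s x (refl e y)| <= (2 * s * (2 * hgt x) `^ (s + 1)) * (`|dotp e x| * `|dn e y|).
Proof.
move=> s0 e1; rewrite -normrM.
have c0 : 0 <= 2 * s * (2 * hgt x) `^ (- s - 1) by rewrite !mulr_ge0 ?powR_ge0.
case: (leP 0 (dotp e x * dn e y)) => h.
 have /andP[h1 h2] := K_diff s0 e1 h.
 rewrite !ger0_norm//; apply: le_trans h1; exact: mulr_ge0.
have h' : 0 <= dotp e x * dn e (refl e y).
 by rewrite nrm_refl// dotp_refl_self// mulrN oppr_ge0 ltW.
have := K_diff s0 e1 h'; rewrite reflK// => /andP[h1 h2].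
rewrite (ltr0_norm h) -mulrN -(dotp_refl_self _ e1) -nrm_refl// distrC ger0_norm//.
apply: le_trans h1; exact: mulr_ge0.
Qed.

(** At the origin the kernel is 1 and this is the mean of [u]. The image [phi] of the constant 1 is
    a spherical function of hyperbolic space. *)
Definition Top s u x : R := Ir P (fun y => K s x y * u y).
Definition phi s x : R := Top s (fun=> 1) x.

Section FixS.
Variable s : R.
Hypothesis s0 : 0 <= s.

Lemma Top_L1 u x : L1 P u -> L1 P (fun y => K s x y * u y).
Proof.
move=> hu; apply: (L1_le (L1_Z ((2 * hgt x) `^ s) (L1_abs hu))).
 by apply: meas_mul; [apply: meas_K; [exact: measurable_cst|exact: measurable_id]|exact: L1_meas hu].
move=> y; rewrite normrM ger0_norm ?K_ge0// ler_wpM2r//; exact: K_le.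
Qed.

Lemma Top_D u v x : L1 P u -> L1 P v -> Top s (fun y => u y + v y) x = Top s u x + Top s v x.
Proof.
move=> hu hv; rewrite /Top -Ir_D; [|exact: Top_L1|exact: Top_L1].
by apply: Ir_ext => y; rewrite mulrDr.
Qed.
Lemma Top_Z c u x : L1 P u -> Top s (fun y => c * u y) x = c * Top s u x.
Proof.
move=> hu; rewrite /Top -Ir_Z; last exact: Top_L1.
by apply: Ir_ext => y; rewrite mulrCA.
Qed.
Lemma Top_B u v x : L1 P u -> L1 P v -> Top s (fun y => u y - v y) x = Top s u x - Top s v x.
Proof.
move=> hu hv; rewrite /Top -Ir_B; [|exact: Top_L1|exact: Top_L1].
by apply: Ir_ext => y; rewrite mulrBr.
Qed.
Lemma Top_ge0 u x : nonneg u -> 0 <= Top s u x.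
Proof. by move=> u0; apply: Ir_ge0 => y; rewrite mulr_ge0// K_ge0. Qed.
Lemma Top_le u v x : L1 P u -> L1 P v -> (forall y, u y <= v y) -> Top s u x <= Top s v x.
Proof.
move=> hu hv uv; apply: Ir_le; [exact: Top_L1|exact: Top_L1|].
by move=> y; rewrite ler_wpM2l// K_ge0.
Qed.
Lemma Top_abs u x : L1 P u -> `|Top s u x| <= Top s (fun y => `|u y|) x.
Proof.
move=> hu; apply: le_trans (Ir_abs (Top_L1 x hu)) _.
apply: eq_lew; apply: Ir_ext => y.
by rewrite normrM ger0_norm ?K_ge0.
Qed.
Lemma Top_ext u v x : u =1 v -> Top s u x = Top s v x.
Proof. by move=> uv; apply: Ir_ext => y; rewrite uv. Qed.

Lemma meas_Top d (T : measurableType d) u (F : T -> X) : mbl u -> mbl F ->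
 mbl (fun z => Top s u (F z)).
Proof.
move=> mu mF; apply: (@meas_Ir2 _ _ _ _ _ P); apply: meas_mul.
 by apply: meas_K; [exact: (measurableT_comp mF measurable_fst)|exact: measurable_snd].
exact: (measurableT_comp mu measurable_snd).
Qed.

Lemma Top_refl e u x : dotp e e = 1 -> mbl u ->
 Top s u (refl e x) = Top s (fun y => u (refl e y)) x.
Proof.
move=> e1 mu; rewrite /Top.
rewrite -(P_refl e1 _).2; first by apply: Ir_ext => y; rewrite K_refl.
by apply: meas_mul => //; apply: meas_K; [exact: measurable_cst|exact: measurable_id].
Qed.

(** On antisymmetric functions the operator acts through the kernel difference across the mirror, to
    which [K_diff] and [K_lip] apply. *)
Lemma Top_anti e u x : dotp e e = 1 -> L1 P u -> (forall y, u (refl e y) = - u y) ->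
 Top s u x = 2^-1 * Ir P (fun y => (K s x y - K s x (refl e y)) * u y).
Proof.
move=> e1 hu ua.
have E : Top s u x = - Ir P (fun y => K s x (refl e y) * u y).
 rewrite /Top -(P_refl e1 (L1_meas (Top_L1 x hu))).2 -Ir_N; last first.
  apply: (L1_ext _ (Top_L1 (refl e x) hu)) => y; by rewrite K_reflC.
 by apply: Ir_ext => y; rewrite ua mulrN.
rewrite (Ir_ext _ (fun y => mulrBl _ _ _)) Ir_B; [|exact: Top_L1|].
 by move: E; rewrite -/(Top s u x) => E; rewrite [X in _ - X](_ : _ = - Top s u x) ?E ?opprK//; lra.
apply: (L1_ext _ (Top_L1 (refl e x) hu)) => y; by rewrite K_reflC.
Qed.

Lemma phi_L1 x : L1 P (fun y => K s x y).
Proof. by apply: (L1_ext _ (Top_L1 x (L1_P_cst N.+1 1))) => y; rewrite mulr1. Qed.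
Lemma phiE x : phi s x = Ir P (K s x).
Proof. by apply: Ir_ext => y; rewrite mulr1. Qed.
Lemma phi_ge x : (2 * hgt x) `^ (- s) <= phi s x.
Proof.
rewrite phiE -[leLHS](Ir_P_cst N.+1); apply: Ir_le; [exact: L1_P_cst|exact: phi_L1|].
by move=> y; exact: K_ge.
Qed.
Lemma phi_gt0 x : 0 < phi s x.
Proof. by apply: lt_le_trans (phi_ge x); rewrite powR_gt0// mulr_gt0 ?hgt_gt0. Qed.
Lemma phi_refl e x : dotp e e = 1 -> phi s (refl e x) = phi s x.
Proof. by move=> e1; rewrite /phi Top_refl//; exact: measurable_cst. Qed.
Lemma meas_phi d (T : measurableType d) (F : T -> X) : mbl F ->
 mbl (fun z => phi s (F z)).
Proof. by move=> mF; apply: meas_Top => //; exact: measurable_cst. Qed.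

Lemma Top_le_sup u x c : L1 P u -> (forall y, `|u y| <= c) -> `|Top s u x| <= c * phi s x.
Proof.
move=> hu uc; apply: le_trans (Top_abs x hu) _.
rewrite /phi -Top_Z; last exact: L1_P_cst.
by apply: Top_le => //; [exact: L1_abs|apply: L1_Z; exact: L1_P_cst|move=> y; rewrite mulr1].
Qed.

End FixS.

End Kernel.

Ltac meas_ext ::= lazymatch goal with
 | |- measurable_fun _ (fun x => hgt (@?f x)) => apply: (meas_hgt (F := f))
 | |- measurable_fun _ (fun x => K ?s (@?f x) (@?g x)) => apply: (meas_K s (F := f) (G := g))
 | |- measurable_fun _ (fun x => phi ?s (@?f x)) => apply: (meas_phi s (F := f))
 | |- measurable_fun _ (fun x => Top ?s ?u (@?f x)) => apply: (meas_Top s (u := u) (F := f))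
 end.

(** * Integrability of powers of the norm *)

Section NormIntegrals.
Context {R : realType}.

Lemma pmin_mono (a b t t' : R) : 0 <= a -> 0 <= b -> 0 < `|t| -> `|t| <= `|t'| -> pmin a b t' <= pmin a b t.
Proof.
move=> a0 b0 t0 tt'; rewrite /pmin le_min; apply/andP; split; rewrite ge_min; apply/orP; [left|right];
 exact: powRN_le.
Qed.

Lemma pmin_exp (a b t : R) k : pmin a b t ^+ k = pmin (a * k%:R) (b * k%:R) t.
Proof.
have E c : `|t| `^ (- (c * k%:R)) = (`|t| `^ (- c)) ^+ k.
 by rewrite -mulNr powRrM powR_mulrn ?powR_ge0.
rewrite /pmin !E; set x := _ `^ _; set y := _ `^ _.
have x0 : 0 <= x by exact: powR_ge0.
have y0 : 0 <= y by exact: powR_ge0.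
case/orP: (le_total x y) => h; first by rewrite !min_l// lerXn2r.
by rewrite !min_r// lerXn2r.
Qed.

(** Since [|x_i| <= |x|], a decreasing function of the norm is bounded by a product over the
    coordinates, each taking the share [1/n] of the exponents; [A/n < 1 < B/n] makes every factor
    integrable. *)
Lemma leb_norm_fin n (A B : R) (F : n.-tuple R -> R) : (0 < n)%N -> 0 <= A -> A < n%:R -> n%:R < B ->
 mbl F -> nonneg F ->
 (forall x, 0 < enorm x -> F x <= pmin A B (enorm x)) ->
 (\int[@leb R n]_x (F x)%:E < +oo)%E.
Proof.
move=> n0 A0 An Bn mF F0 FA.
have np : 0 < n%:R :> R by rewrite ltr0n.
have nn : n%:R != 0 :> R by rewrite gt_eqF.
apply: (@leb_prod_bound R n _ 1 (pmin (A / n%:R) (B / n%:R))) => //.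
- side.
- by move=> t; exact: pmin_ge0.
- apply: pmin_integrable.
 + by side.
 + by rewrite ltr_pdivrMr// mul1r.
 + by rewrite ltr_pdivlMr// mul1r.
move=> x hx; rewrite mul1r.
have x0 : 0 < enorm x.
 by apply: lt_le_trans (tnth_enorm_le x (Ordinal n0)); rewrite normr_gt0.
apply: le_trans (FA x x0) _.
have -> : pmin A B (enorm x) = \prod_(i < n) pmin (A / n%:R) (B / n%:R) (enorm x).
 by rewrite prodr_const card_ord pmin_exp !divfK.
apply: ler_prod => i _; rewrite pmin_ge0/=; apply: pmin_mono.
- side.
- by rewrite divr_ge0// ltW// (lt_trans np).
- by rewrite normr_gt0.
- by rewrite (ger0_norm (enorm_ge0 x)) tnth_enorm_le.
Qed.

Lemma hgt_powR_L1 N (t : R) : N%:R < t -> L1 (@hyp R N.+1) (fun x => hgt x `^ (- t)).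
Proof.
move=> Nt.
have t0 : 0 < t by apply: le_lt_trans Nt; rewrite ler0n.
have t1 : N.+1%:R < t + 1 by rewrite -natr1 ltrD2r.
apply: L1_fin; [by meas|side|].
rewrite hyp_int; [|by meas|side].
rewrite (_ : (\int[_]_x _)%E = (\int[@leb R N.+1]_x (hgt x `^ (- (t + 1)))%:E)%E); last first.
 apply: eq_int => x; rewrite -EFinM opprD powRD1 ?gt_eqF ?hgt_gt0//.
 by rewrite powR_inv1// ltW// hgt_gt0.
have t10 : 0 <= t + 1 by rewrite addr_ge0// ltW.
apply: (@leb_norm_fin N.+1 0 (t + 1)) => //.
- by meas.
- side.
move=> x x0; rewrite /pmin (gtr0_norm x0) le_min; apply/andP; split.
 by rewrite oppr0 powRr0 -[leRHS](powRr0 (hgt x)); apply: ler_powR; [exact: hgt_ge1|rewrite oppr_le0].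
by apply: powRN_le => //; apply/ltW/enorm_lt_hgt.
Qed.
End NormIntegrals.

(** * Conformal covariance *)

Section BoostKernel.
Context {R : realType} {N : nat}.
Local Notation X := (N.+1.-tuple R).
Local Notation P := (@sph R N.+1).
Local Notation M := (@hyp R N.+1).
Implicit Types (x y e : X) (u v : X -> R).

Lemma nrm1 x : enorm x = 1 -> nrm x = x.
Proof. by move=> x1; apply: eq_from_tnth => i; rewrite tnth_mktuple x1 invr1 mul1r. Qed.

Lemma nrmK x : nrm (nrm x) = nrm x.
Proof.
have [h|h] := eqVneq (enorm x) 0; last by apply: nrm1; rewrite enorm_nrm// lt_neqAle eq_sym h enorm_ge0.
have E : nrm x = x by rewrite (enorm_eq0 h); apply: eq_from_tnth => i; rewrite !tnth_mktuple mulr0.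
by rewrite !E.
Qed.

Section CK.
Variables (c k : R).
Hypotheses (c0 : 0 < c) (ck : c ^+ 2 = 1 + k ^+ 2) (N0 : (0 < N)%N).

Lemma hgt_boost x : hgt (boost c k x) = c * hgt x + k * tnth x ord0.
Proof.
case/tupleP: x => a t; rewrite /boost hgt_cons.
have -> : behead_tuple [tuple of a :: t] = t by exact/val_inj.
have m0 : 0 < 1 + dotp t t by rewrite ltr_pwDl// dotp_ge0.
have -> : tnth [tuple of a :: t] ord0 = a by [].
have -> : hgt [tuple of a :: t] = Num.sqrt ((1 + dotp t t) + a ^+ 2) := hgt_cons a t.
exact: (sqrt_boost c0 ck m0 a).
Qed.

(** Invariance of the Lorentz product; [dil] rescales the boosted light-like vector to time
    coordinate 1. *)
Lemma ker_boost x y : enorm y = 1 -> ker (boost c k x) (nrm (cboost c k y)) * dil c k y = ker x y.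
Proof.
move=> y1; have d0 : 0 < dil c k y by apply: dil_gt0; rewrite ?y1.
rewrite /ker nrmK (nrm1 y1) hgt_boost /nrm dotpZr enorm_cboost; [|by []..|exact: ltW].
rewrite mulrBl -[_ * dotp _ _ * _]mulrA [dotp _ _ * _]mulrC mulrA mulVf ?gt_eqF// mul1r.
rewrite !dotp_cons0 /boost /cboost /dil !behead_cons y1.
rewrite (_ : tnth (cons_tuple _ _) ord0 = c * tnth x ord0 + k * hgt x)//.
rewrite (_ : tnth (cons_tuple _ _) ord0 = c * tnth y ord0 + k * 1)//.
move: (hgt x) (tnth x ord0) (tnth y ord0) (dotp _ _) => h a b D.
have -> : h - (a * b + D) = (c ^+ 2 - k ^+ 2) * (h - a * b) - D.
 by rewrite ck; ring.
ring.
Qed.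

(** The boundary action of a boost with weight [s - N = - N / p]. It preserves the [L^p] norm, and
    [T] carries it to composition with the boost. *)
Definition ucf s u y : R := dil c k y `^ (s - N%:R) * u (nrm (cboost c k y)).

Lemma meas_Psi d (T : measurableType d) (F : T -> X) : mbl F ->
 mbl (fun z : T => nrm (cboost c k (F z))).
Proof. by move=> mF; apply: meas_nrm; apply: meas_cboost. Qed.

Lemma meas_dil d (T : measurableType d) (F : T -> X) : mbl F ->
 mbl (fun z : T => dil c k (F z)).
Proof. by move=> mF; rewrite /dil; meas. Qed.

Lemma P_boost u : mbl u ->
 (L1 P u -> L1 P (fun y => u (nrm (cboost c k y)) * dil c k y ^- N)) /\
 Ir P (fun y => u (nrm (cboost c k y)) * dil c k y ^- N) = Ir P u.
Proof.
move=> mu; apply: (@Ir_transfer _ _ _ P (fun y => nrm (cboost c k y)) (fun y => dil c k y ^- N) u mu).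
- by move=> y; rewrite invr_ge0 exprn_ge0// dil_ge0.
- by move=> h mh h0; exact: sph_boost.
- exact: meas_Psi.
- by apply: meas_inv; apply: measurable_funX; exact: meas_dil.
Qed.

Lemma meas_ucf s u : mbl u -> mbl (ucf s u).
Proof.
move=> mu; apply: meas_mul; first by apply: meas_powR; exact: meas_dil.
by apply: (measurableT_comp mu); exact: meas_Psi.
Qed.

Lemma Top_boost s u x : mbl u -> Top s u (boost c k x) = Top s (ucf s u) x.
Proof.
move=> mu; rewrite /Top.
have mK : mbl (fun y => K s (boost c k x) y * u y) by meas.
rewrite -(P_boost mK).2; apply: (P_unit (ltn0Sn N) _ _ _).2.
- apply: meas_mul; first by exact: (measurableT_comp mK (meas_Psi (@measurable_id _ _ setT))).
 by apply: meas_inv; apply: measurable_funX; exact: meas_dil.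
- by apply: meas_mul; [meas|exact: meas_ucf].
move=> y y1; have d0 : 0 < dil c k y by apply: dil_gt0; rewrite ?y1.
rewrite /ucf /K -(ker_boost x y1) powRM ?(ltW d0)//; last exact/ltW/ker_gt0.
have E : dil c k y `^ (- s) * dil c k y `^ (s - N%:R) = dil c k y ^- N.
 by rewrite -powRD1 ?gt_eqF// addrA addNr sub0r powRN powR_mulrn// ltW.
rewrite -E; ring.
Qed.

Lemma ucf_pow s u (p : R) y : s != N%:R -> p = N%:R / (N%:R - s) -> enorm y = 1 ->
 `|ucf s u y| `^ p = `|u (nrm (cboost c k y))| `^ p * dil c k y ^- N.
Proof.
move=> sN pE y1; have d0 : 0 < dil c k y by apply: dil_gt0; rewrite ?y1.
rewrite /ucf normrM (ger0_norm (powR_ge0 _ _)) powRM ?powR_ge0// mulrC -powRrM; congr (_ * _).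
have -> : (s - N%:R) * p = - N%:R.
 rewrite pE; field; rewrite subr_eq0 eq_sym //.
by rewrite powRN powR_mulrn// ltW.
Qed.

End CK.

Lemma phi_boost0 (s c k : R) : 0 < c -> c ^+ 2 = 1 + k ^+ 2 -> (0 < N)%N ->
 phi s (boost c k (t0 N.+1)) = Ir P (fun y => dil c k y `^ (s - N%:R)).
Proof.
move=> c0 ck N0; rewrite /phi Top_boost//; apply: Ir_ext => y.
rewrite /ucf mulr1 /K /ker /hgt.
have d0 z : dotp (t0 N.+1) z = 0 :> R by apply: big1 => i _; rewrite tnth_mktuple mul0r.
by rewrite !d0 addr0 sqrtr1 subr0 powR1 mul1r.
Qed.

(** A boost carries the origin to some [z] with [|z| = |x|]. Covariance turns [phi s z] into the
    mean of [dil^(s-N)], and [dil] is [ker z] after a reflection, so this mean is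
    [phi (N - s) z]. *)
Lemma phi_sym (s : R) x : (0 < N)%N -> phi s x = phi (N%:R - s) x.
Proof.
move=> N0; pose c := hgt x; pose k := enorm x.
have c0 : 0 < c by exact: hgt_gt0.
have ck : c ^+ 2 = 1 + k ^+ 2 by rewrite hgt_sqr enormE.
pose z := boost c k (t0 N.+1).
have h0 : hgt (t0 N.+1) = 1 :> R by rewrite /hgt -enormE t0E expr0n addr0 sqrtr1.
have zE : z = cons_tuple k (t0 N).
 have beh : behead_tuple (@t0 R N.+1) = @t0 R N.
  by apply: eq_from_tnth => i; rewrite tnth_behead !tnth_mktuple.
 by rewrite /z /boost h0 beh tnth_mktuple mulr0 add0r mulr1.
have ez : enorm z = enorm x.
 by rewrite zE enorm_cons -enormE t0E expr0n add0r sqrtr_sqr ger0_norm// enorm_ge0.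
have hz : hgt z = c by rewrite /hgt -enormE ez enormE.
rewrite -(radial_eq (F := phi s) _ ez); last by move=> *; exact: phi_refl.
rewrite -(radial_eq (F := phi (N%:R - s)) _ ez); last by move=> *; exact: phi_refl.
rewrite phi_boost0// -/z.
pose e : X := cons_tuple 1 (t0 N).
have e1 : dotp e e = 1 by rewrite dotp_cons -enormE t0E expr0n addr0 mulr1.
have mK : mbl (fun y => K (N%:R - s) z y * 1) by meas.
rewrite /phi /Top -(P_refl e1 mK).2.
apply: (P_unit (ltn0Sn N) _ _ _).2.
- by apply: meas_powR; apply: meas_dil; meas.
- by apply: (measurableT_comp mK); apply: meas_refl; meas.
move=> y y1; rewrite mulr1 /K opprB; congr powR.
rewrite ker_reflB// /ker hz (nrm1 y1) zE.
case/tupleP: y y1 => a t y1.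
have td : dotp (t0 N) t = 0 by apply: big1 => i _; rewrite tnth_mktuple mul0r.
rewrite /dil y1 !dotp_cons td -enormE t0E.
by rewrite [tnth _ ord0](_ : _ = a)//; ring.
Qed.
End BoostKernel.

(** * Decay of the spherical function *)

Section PhiDecay.
Context {R : realType} {N : nat}.
Hypothesis N0 : (0 < N)%N.
Local Notation X := (N.+1.-tuple R).
Local Notation P := (@sph R N.+1).
Local Notation M := (@hyp R N.+1).
Local Notation ind b := ((b)%:R : R).
Implicit Types (x y e : X) (u v : X -> R).

Lemma nrm_coord x i : 0 < enorm x -> tnth (nrm x) i = (enorm x)^-1 * tnth x i.
Proof. by rewrite tnth_mktuple. Qed.

Lemma P_le_coords (f g : X -> R) : mbl f -> mbl g ->
 nonneg f -> nonneg g ->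
 (forall y, enorm y = 1 -> (forall i, tnth y i != 0) -> f y <= g y) ->
 (\int[P]_y (f y)%:E <= \int[P]_y (g y)%:E)%E.
Proof.
move=> mf mg f0 g0 fg.
have mn : mbl (@nrm R N.+1) by apply: meas_nrm; meas.
have mF (h : X -> R) : mbl h -> mbl (fun x => ((ind (enorm x < 1)%R)%:E * (h (nrm x))%:E)%E).
 by move=> mh; apply: emeasurable_funM; [meas|apply: meas_EFin; exact: (measurableT_comp mh mn)].
rewrite !sph_int; [|by meas|by move=> y; rewrite lee_fin|by meas|side].
apply: lee_wpmul2l; first by rewrite lee_fin invr_ge0 ltW// vball_gt0.
have p0 (h : X -> R) x : nonneg h -> (0 <= (ind (enorm x < 1)%R)%:E * (h (nrm x))%:E)%E.
 by move=> h0; rewrite mule_ge0// lee_fin.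
rewrite leb_coords; [|exact: mF|by move=> x; exact: p0].
rewrite [leRHS]leb_coords; [|exact: mF|by move=> x; exact: p0].
have mc : mbl (fun x : X => (\prod_(i < N.+1) ind (tnth x i != 0))%:E).
 apply: meas_EFin; apply: measurable_prod => i _.
 rewrite (_ : (fun x => _) = (fun x : X => ind (0 < `|tnth x i|)%R)); first by meas.
 by apply/funext => x; rewrite normr_gt0.
have c0 x : (0 <= (\prod_(i < N.+1) ind (tnth x i != 0))%:E)%E by rewrite lee_fin prodr_ge0.
apply: int_le.
- by move=> x; rewrite mule_ge0// p0.
- by apply: emeasurable_funM => //; exact: mF.
- by apply: emeasurable_funM => //; exact: mF.
move=> x; have [/forallP hx|hx] := boolP [forall i, tnth x i != 0]; last first.
 move: hx; rewrite negb_forall => /existsP[i]; rewrite negbK => xi.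
 by rewrite (bigD1 i)//= xi mul0r !mul0e.
apply: lee_wpmul2l => //; apply: lee_wpmul2l; first side.
have x0 : 0 < enorm x by apply: lt_le_trans (tnth_enorm_le x ord0); rewrite normr_gt0.
rewrite lee_fin; apply: fg; first exact: enorm_nrm.
by move=> i; rewrite nrm_coord// mulf_neq0// invr_eq0 gt_eqF.
Qed.

Lemma coord2_le x (i : 'I_N) : enorm x = 1 -> tnth x (lift ord0 i) ^+ 2 / 2 <= 1 - `|tnth x ord0|.
Proof.
move=> x1; have : dotp x x = 1 by rewrite -enormE x1 expr1n.
rewrite /dotp big_ord_recl (bigD1 i)//= => E.
have h : 0 <= \sum_(j < N | j != i) tnth x (lift ord0 j) * tnth x (lift ord0 j).
 side.
have := sqr_ge0 (1 - `|tnth x ord0|); have := real_normK (num_real (tnth x ord0)).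
move: E h; rewrite -!expr2; move: (\sum_(j < N | _) _) (tnth x ord0 ^+ 2) (tnth x _ ^+ 2) `|tnth x ord0| => A B C D.
move=> *; nra.
Qed.

(** On the sphere each of the last [N] coordinates satisfies [y_i^2 / 2 <= 1 - |y_0|]. Giving each
    the share [a/N] bounds the integrand by a product of powers [|y_i|^(-2a/N)], of order below
    1. *)
Lemma P_cap_fin (a : R) : 0 <= a -> 2 * a < N%:R ->
 (\int[P]_y ((1 - `|tnth y ord0|) `^ (- a))%:E < +oo)%E.
Proof.
move=> a0 aN.
have Np : 0 < N%:R :> R by rewrite ltr0n.
have Nn : N%:R != 0 :> R by rewrite gt_eqF.
rewrite sph_int; [|by meas|side].
apply: lte_mul_pinfty; [by rewrite lee_fin invr_ge0 ltW// vball_gt0|by []|].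
have E : (\int[leb N.+1]_x ((ind (enorm (x : X) < 1)%R)%:E * ((1 - `|tnth (nrm x) ord0|) `^ (- a))%:E) =
 \int[leb N.+1]_x (ind (enorm (x : X) < 1)%R * (1 - `|tnth (nrm x) ord0|) `^ (- a))%R%:E)%E.
 side.
rewrite E.
pose b := 2 * a / N%:R.
have b0 : 0 <= b by rewrite divr_ge0 ?mulr_ge0// ltW.
have b1 : b < 1 by rewrite ltr_pdivrMr// mul1r.
apply: (@leb_prod_bound R N.+1 _ (2 `^ a) (pmin b 2)).
- by meas.
- side.
- side.
- by move=> t; exact: pmin_ge0.
- by apply: pmin_integrable; [|exact: b1|rewrite ltr1n].
- exact: powR_ge0.
move=> x hx.
have x0 : 0 < enorm x by apply: lt_le_trans (tnth_enorm_le x ord0); rewrite normr_gt0.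
case: (ltP (enorm x) 1) => x1; last first.
 by rewrite mul0r mulr_ge0 ?powR_ge0// prodr_ge0// => i _; exact: pmin_ge0.
rewrite mul1r; set A := 1 - `|_|.
have xi1 i : 0 < `|tnth x i| <= 1.
 by rewrite normr_gt0 hx/= (le_trans (tnth_enorm_le x i))// ltW.
have pE i : pmin b 2 (tnth x i) = `|tnth x i| `^ (- b).
 rewrite /pmin min_l//; apply: ger_powR; first exact: xi1.
 by rewrite lerN2; apply: ltW; apply: lt_trans b1 _; rewrite ltr1n.
have hA i : (tnth x (lift ord0 i)) ^+ 2 / 2 <= A.
 apply: le_trans (coord2_le i (enorm_nrm x0)).
 rewrite nrm_coord// exprMn ler_pM2r ?invr_gt0// ler_peMl ?sqr_ge0// exprVn invf_ge1 ?exprn_gt0//.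
 by rewrite exprn_ile1 ?enorm_ge0// ltW.
have A0 : 0 < A.
 have := hA (Ordinal N0); apply: lt_le_trans; rewrite divr_gt0//.
 by rewrite lt_neqAle sqr_ge0 andbT eq_sym sqrf_eq0.
have e1 : A `^ (- a) = \prod_(i < N) A `^ (- (a / N%:R)).
 rewrite prodr_const card_ord -powR_mulrn ?powR_ge0// -powRrM; congr powR.
 by rewrite mulNr divfK.
have e2 : 2 `^ a = \prod_(i < N) 2 `^ (a / N%:R) :> R.
 rewrite prodr_const card_ord -powR_mulrn ?powR_ge0// -powRrM; congr powR.
 by rewrite divfK.
rewrite e1 e2 big_ord_recl mulrCA -big_split/=.
rewrite -[leLHS]mul1r; apply: ler_pM => //; first side.
 rewrite pE -(powRr0 `|tnth x ord0|); apply: ger_powR; first exact: xi1.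
 by rewrite oppr_le0.
apply: ler_prod => i _; rewrite powR_ge0/= pE.
have aN0 : 0 <= a / N%:R by rewrite divr_ge0// ltW.
have s0 : 0 < tnth x (lift ord0 i) ^+ 2 by rewrite lt_neqAle sqr_ge0 andbT eq_sym sqrf_eq0.
apply: le_trans (powRN_le aN0 _ (hA i)) _; first side.
rewrite powRM ?sqr_ge0// ?invr_ge0// mulrC inv_powRN// ler_pM2l ?powR_gt0//.
by rewrite -(real_normK (num_real _)) -powR_mulrn// -powRrM /b; apply: eq_lew; congr powR; ring.
Qed.

(** As [phi] is radial, [x] may be taken on the first axis, where
    [ker x y >= hgt x * (1 - |y_0|)]. *)
Lemma phi_decay0 (a : R) : 0 <= a -> 2 * a < N%:R ->
 exists2 C, 0 <= C & forall x, phi a x <= C * hgt x `^ (- a).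
Proof.
move=> a0 aN; pose j y := (1 - `|tnth (y : X) ord0|) `^ (- a).
have mj : mbl j by rewrite /j; meas.
have j0 y : 0 <= j y by exact: powR_ge0.
have hj : L1 P j by apply: L1_fin => //; exact: P_cap_fin.
exists (Ir P j); first exact: Ir_ge0.
move=> x; pose c := hgt x; pose k := enorm x.
have c0 : 0 < c by exact: hgt_gt0.
pose z : X := cons_tuple k (t0 N).
have ez : enorm z = enorm x.
 by rewrite enorm_cons -enormE t0E expr0n add0r sqrtr_sqr ger0_norm// enorm_ge0.
have hz : hgt z = c by rewrite /hgt -enormE ez enormE.
rewrite -(radial_eq (F := phi a) _ ez); last by move=> *; exact: phi_refl.
rewrite phiE mulrC -Ir_Z// -lee_fin -!IrE; [|exact: L1_Z|exact: phi_L1].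
apply: P_le_coords.
- by meas.
- by meas.
- side.
- by move=> y; rewrite mulr_ge0// powR_ge0.
move=> y y1 hy; rewrite /j /K -powRM ?(ltW c0)//; last first.
 have := tnth_enorm_le y ord0; rewrite y1; lra.
have A0 : 0 < 1 - `|tnth y ord0|.
 apply: lt_le_trans (coord2_le (Ordinal N0) y1); rewrite divr_gt0//.
 by rewrite lt_neqAle sqr_ge0 andbT eq_sym sqrf_eq0.
apply: powRN_le => //; first side.
rewrite /ker hz (nrm1 y1) dotp_cons0 behead_cons.
have -> : dotp (t0 N) (behead_tuple y) = 0 by apply: big1 => i _; rewrite tnth_mktuple mul0r.
rewrite [tnth z ord0](_ : _ = k)// addr0 mulrBr mulr1 lerD2l lerN2.
apply: le_trans (ler_norm _) _; rewrite normrM ler_wpM2r// ger0_norm ?enorm_ge0//.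
exact/ltW/enorm_lt_hgt.
Qed.

(** By [phi_sym] the exponent becomes [N - s < N/2], where [phi_decay0] applies without loss. *)
Lemma phi_decay_lt (s : R) : 0 < s -> N%:R / 2 < s -> s < N%:R ->
 exists2 C, 0 < C & forall x, phi s x <= C * hgt x `^ (- (N%:R - s)).
Proof.
move=> s0 sN sN'; have [||C C0 h] := @phi_decay0 (N%:R - s); [lra|lra|].
exists (C + 1); first by rewrite ltr_wpDl.
move=> x; rewrite phi_sym//; apply: le_trans (h x) _.
by rewrite ler_wpM2r ?powR_ge0// lerDl.
Qed.

(* At the borderline [s = N/2] there is a logarithmic loss, so the exponent is taken slightly smaller. *)
Lemma phi_decay (s b : R) : 0 < s -> s < N%:R -> b < s -> b < N%:R - s ->
 exists2 C, 0 < C & forall x, phi s x <= C * hgt x `^ (- b).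
Proof.
wlog sN : s / s <= N%:R / 2.
 move=> H s0 sN bs bN; case: (leP s (N%:R / 2)) => h; first exact: H.
 have [|||||C C0 hC] := H (N%:R - s); [lra..|].
 by exists C => // x; rewrite phi_sym.
move=> s0 sN' bs bN.
(* Writing [K_s = K_(s-a) K_a] and bounding the first factor gives the exponent
   [(s - a) - a <= - b]; [b + s < N] keeps [2 a < N]. *)
pose a := Num.max 0 ((b + s) / 2).
have a0 : 0 <= a by rewrite le_max lexx.
have as_ : a < s by rewrite gt_max s0/=; lra.
have ab : b + s <= 2 * a.
 have : (b + s) / 2 <= a by rewrite le_max lexx orbT.
 lra.
have [||C C0 h] := @phi_decay0 a; [by []|lra|].
exists (2 `^ (s - a) * (C + 1)); first by rewrite mulr_gt0 ?powR_gt0// ltr_wpDl.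
move=> x; have hx := hgt_gt0 x.
have k1 : phi s x <= (2 * hgt x) `^ (s - a) * phi a x.
 rewrite !phiE -Ir_Z; last exact: phi_L1.
 apply: Ir_le; [exact/phi_L1/ltW|by apply: L1_Z; exact: phi_L1|move=> y].
 have -> : K s x y = K (s - a) x y * K a x y.
  by rewrite /K -powRD1 ?gt_eqF ?ker_gt0//; congr powR; ring.
 by rewrite ler_wpM2r ?K_ge0// K_le//; lra.
apply: le_trans k1 _; rewrite powRM// ?(ltW hx)// -!mulrA ler_wpM2l ?powR_ge0//.
apply: (le_trans (y := hgt x `^ (s - a) * ((C + 1) * hgt x `^ (- a)))).
 rewrite ler_wpM2l ?powR_ge0//; apply: le_trans (h x) _.
 by rewrite ler_wpM2r ?powR_ge0// lerDl.
rewrite mulrCA ler_pM2l ?ltr_wpDl// -powRD1 ?gt_eqF//.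
by apply: ler_powR; [exact: hgt_ge1|lra].
Qed.

Lemma phi_powR_L1 (s q : R) : 0 < s -> s < N%:R -> N%:R < q * s -> N%:R < q * (N%:R - s) ->
 L1 M (fun x => phi s x `^ q).
Proof.
move=> s0 sN qs qN.
have q0 : 0 < q by have : 0 <= N%:R :> R by []; nra.
pose m := Num.min s (N%:R - s).
have qm : N%:R < q * m by rewrite /m minr_pMr ?lt_min ?qs ?qN// ltW.
have [b hb1 hb2] : exists2 b, N%:R < q * b & b < m.
 exists ((N%:R / q + m) / 2).
  by have := qm; rewrite -ltr_pdivrMl// mulrC => h; rewrite -ltr_pdivrMl// mulrC; lra.
 by have := qm; rewrite -ltr_pdivrMl// mulrC => h; lra.
have [||C C0 h] := @phi_decay s b s0 sN.
- by apply: lt_le_trans hb2 _; rewrite ge_min lexx.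
- by apply: lt_le_trans hb2 _; rewrite ge_min lexx orbT.
apply: (L1_le (L1_Z (C `^ q) (hgt_powR_L1 hb1))); first by meas.
move=> x; rewrite ger0_norm ?powR_ge0//.
apply: le_trans (@powR_le _ _ _ q (ltW q0) _ (h x)) _; first exact/ltW/phi_gt0/ltW.
by rewrite powRM ?powR_ge0 ?(ltW C0)// -powRrM mulNr [b * q]mulrC.
Qed.
End PhiDecay.

(** * Hoelder's inequality *)

Section Hoelder.
Context {R : realType} {d : measure_display} {T : measurableType d}.
Variable m : {measure set T -> \bar R}.
Implicit Types f g : T -> R.

Lemma young_scaled (a b X Y f g : R) : 0 < a -> 0 < b -> a^-1 + b^-1 = 1 -> 0 < X -> 0 < Y ->
 0 <= f -> 0 <= g ->
 f * g <= X * Y * (a^-1 * (X `^ a)^-1 * f `^ a + b^-1 * (Y `^ b)^-1 * g `^ b).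
Proof.
move=> a0 b0 ab X0 Y0 f0 g0.
have sc (c r h : R) : 0 < c -> 0 <= h -> (c^-1 * h) `^ r = (c `^ r)^-1 * h `^ r.
 move=> c0 h0; have {2}-> : h = c * (c^-1 * h) by rewrite mulrA divff ?mul1r// gt_eqF.
 by rewrite [in RHS]powRM ?mulr_ge0 ?invr_ge0 ?(ltW c0)// mulrA mulVf ?mul1r// gt_eqF// powR_gt0.
have F0 : 0 <= X^-1 * f by rewrite mulr_ge0// invr_ge0 ltW.
have G0 : 0 <= Y^-1 * g by rewrite mulr_ge0// invr_ge0 ltW.
have := @conjugate_powR _ (X^-1 * f) (Y^-1 * g) a b F0 G0 a0 b0 ab.
rewrite !sc// => H.
have -> : f * g = X * Y * ((X^-1 * f) * (Y^-1 * g)) by field; rewrite !gt_eqF.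
rewrite ler_pM2l ?mulr_gt0//; apply: le_trans H _.
by apply: eq_lew; ring.
Qed.

Lemma Ir_holder_bd f g (a b X Y : R) : 0 < a -> 0 < b -> a^-1 + b^-1 = 1 -> 0 < X -> 0 < Y ->
 mbl f -> mbl g ->
 nonneg f -> nonneg g ->
 L1 m (fun x => f x `^ a) -> L1 m (fun x => g x `^ b) ->
 Ir m (fun x => f x `^ a) <= X `^ a -> Ir m (fun x => g x `^ b) <= Y `^ b ->
 L1 m (fun x => f x * g x) /\ Ir m (fun x => f x * g x) <= X * Y.
Proof.
move=> a0 b0 ab X0 Y0 mf mg f0 g0 hf hg fX gY.
pose F z := X * Y * (a^-1 * (X `^ a)^-1 * f z `^ a + b^-1 * (Y `^ b)^-1 * g z `^ b).
have h1 : L1 m (fun z => a^-1 * (X `^ a)^-1 * f z `^ a) by exact: L1_Z.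
have h2 : L1 m (fun z => b^-1 * (Y `^ b)^-1 * g z `^ b) by exact: L1_Z.
have hF : L1 m F by apply: L1_Z; exact: L1_D.
have fgF z : f z * g z <= F z by exact: young_scaled.
have hfg : L1 m (fun x => f x * g x).
 by apply: (L1_le hF); [exact: meas_mul|move=> z; rewrite ger0_norm ?mulr_ge0].
split=> //; apply: (le_trans (Ir_le hfg hF fgF)).
rewrite Ir_Z; last exact: L1_D.
rewrite (Ir_D h1 h2) (Ir_Z _ hf) (Ir_Z _ hg) -[leRHS]mulr1 ler_pM2l ?mulr_gt0//.
have XA : 0 < X `^ a by exact: powR_gt0.
have YB : 0 < Y `^ b by exact: powR_gt0.
rewrite -[leRHS]ab; apply: lerD; rewrite -[leLHS]mulrA ler_piMr ?invr_ge0 ?(ltW a0) ?(ltW b0)//.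
 by rewrite mulrC ler_pdivrMr// mul1r.
by rewrite mulrC ler_pdivrMr// mul1r.
Qed.

(** The previous form needs positive bounds. It is applied with both norms enlarged by a small
    amount, which then tends to 0; this covers vanishing norms. *)
Lemma Ir_holder f g (a b : R) : 0 < a -> 0 < b -> a^-1 + b^-1 = 1 ->
 mbl f -> mbl g ->
 nonneg f -> nonneg g ->
 L1 m (fun x => f x `^ a) -> L1 m (fun x => g x `^ b) ->
 L1 m (fun x => f x * g x) /\
 Ir m (fun x => f x * g x) <= Ir m (fun x => f x `^ a) `^ a^-1 * Ir m (fun x => g x `^ b) `^ b^-1.
Proof.
move=> a0 b0 ab mf mg f0 g0 hf hg.
have A0 : 0 <= Ir m (fun x => f x `^ a) by apply: Ir_ge0 => x; exact: powR_ge0.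
have B0 : 0 <= Ir m (fun x => g x `^ b) by apply: Ir_ge0 => x; exact: powR_ge0.
have key := fun X Y X0 Y0 => @Ir_holder_bd f g a b X Y a0 b0 ab X0 Y0 mf mg f0 g0 hf hg.
move: (Ir m (fun x => f x `^ a)) (Ir m (fun x => g x `^ b)) A0 B0 key => A B A0 B0.
move: (L1 m (fun x => f x * g x)) (Ir m (fun x => f x * g x)) => Q I; clear mf mg f0 g0 hf hg => key.
have x0 : 0 <= A `^ a^-1 by exact: powR_ge0.
have y0 : 0 <= B `^ b^-1 by exact: powR_ge0.
have xA : (A `^ a^-1) `^ a = A by rewrite -powRrM mulVf ?gt_eqF// powRr1.
have yB : (B `^ b^-1) `^ b = B by rewrite -powRrM mulVf ?gt_eqF// powRr1.
move: (A `^ a^-1) (B `^ b^-1) x0 y0 xA yB => x y x0 y0 xA yB.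
have key2 (e : R) : 0 < e -> Q /\ I <= (x + e) * (y + e).
 move=> e0; apply: key.
 - by rewrite ltr_wpDl.
 - by rewrite ltr_wpDl.
 - by rewrite -xA; apply: powR_le; [exact: ltW|exact: x0|rewrite lerDl ltW].
 - by rewrite -yB; apply: powR_le; [exact: ltW|exact: y0|rewrite lerDl ltW].
split; first by have [] := key2 1 ltr01.
apply/ler_addgt0Pr => e e0.
have D0 : 0 < x + y + 1 by rewrite ltr_wpDl// addr_ge0.
have [t [t0 t1 t2]] : exists t, [/\ 0 < t, t <= 1 & t * (x + y + 1) <= e].
 exists (Num.min 1 (e / (x + y + 1))); split.
 - by rewrite lt_min ltr01 divr_gt0.
 - by rewrite ge_min lexx.
 - by rewrite -ler_pdivlMr// ge_min lexx orbT.
have [_ h] := key2 t t0; apply: le_trans h _.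
have : t * t <= t by rewrite ler_piMr// ltW.
have -> : (x + t) * (y + t) = x * y + (t * x + t * y) + t * t by ring.
move: t2; rewrite !mulrDr mulr1; lra.
Qed.
End Hoelder.

(** * Boundedness of the operator *)

Section Bounded.
Context {R : realType} {N : nat}.
Hypothesis N0 : (0 < N)%N.
Local Notation X := (N.+1.-tuple R).
Local Notation P := (@sph R N.+1).
Local Notation M := (@hyp R N.+1).
Local Notation ind b := ((b)%:R : R).
Implicit Types (x y e : X) (u v : X -> R).
Let Np : 0 < N%:R :> R. Proof. by rewrite ltr0n. Qed.

Lemma Lp_L1 (p : R) u : 1 <= p -> mbl u -> L1 P (fun y => `|u y| `^ p) -> L1 P u.
Proof.
move=> p1 mu hu; apply: (L1_le (L1_D (L1_P_cst N.+1 1) hu)) => // y.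
case: (leP `|u y| 1) => h; first by rewrite (le_trans h)// lerDl powR_ge0.
by rewrite (le_trans (le1r_powR (ltW h) p1))// lerDr.
Qed.

Lemma sph_cst_unit (f : X -> \bar R) (c : \bar R) : mbl f -> enneg f ->
 (forall z, enorm z = 1 -> f z = c) -> (\int[P]_z f z = c)%E.
Proof.
move=> mf f0 fc; have c0 : (0 <= c)%E.
 pose z : X := cons_tuple 1 (t0 N).
 by rewrite -(fc z)// enorm_cons -enormE t0E expr0n add0r expr1n sqrtr1.
rewrite (sph_unit (ltn0Sn N) mf f0).
have -> : (\int[P]_z ((ind (enorm z == 1)%R)%:E * f z) = \int[P]_z ((ind (enorm z == 1)%R)%:E * c))%E.
 by apply: eq_int => z; case: eqP => z1; [rewrite fc|rewrite !mul0e].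
rewrite -(sph_unit (ltn0Sn N) (@measurable_cst _ _ _ _ setT c) (fun=> c0)).
have P1 : P setT = 1%E := probability_setT P.
by rewrite (integral_cst P measurableT c) [X in (_ * X)%E]P1 mule1.
Qed.

(* Integrating a radial function against the kernel does not depend on the boundary point. *)
Lemma kernel_avg (s : R) (G : X -> R) y : 0 <= s -> mbl G -> nonneg G ->
 (forall e x, dotp e e = 1 -> G (refl e x) = G x) -> enorm y = 1 ->
 (\int[M]_x (K s x y * G x)%:E = \int[M]_x (phi s x * G x)%:E)%E.
Proof.
move=> s0 mG G0 rG y1.
have m1 (z : X) : mbl (fun x => (K s x z * G x)%:E) by meas.
have p1 (z : X) x : (0 <= (K s x z * G x)%:E)%E by rewrite lee_fin mulr_ge0 ?K_ge0.
have rI e z : dotp e e = 1 -> (\int[M]_x (K s x (refl e z) * G x)%:E = \int[M]_x (K s x z * G x)%:E)%E.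
 move=> e1; rewrite -[RHS](hyp_refl e1); [|exact: m1|exact: p1].
 by apply: eq_int => x; rewrite K_reflC// rG.
have cst z : enorm z = 1 -> (\int[M]_x (K s x z * G x)%:E = \int[M]_x (K s x y * G x)%:E)%E.
 move=> z1; apply: (radial_eq (F := fun z => \int[M]_x (K s x z * G x)%:E)%E); last by rewrite z1.
 side.
have mF : mbl (fun z : X * X => (K s z.1 z.2 * G z.1)%:E).
 side.
have E : (\int[M]_x (phi s x * G x)%:E = \int[M]_x \int[P]_z (K s x z * G x)%:E)%E.
 apply: eq_int => x; rewrite EFinM phiE -IrE; last exact: phi_L1.
 rewrite -int_Zr; [by []|exact: G0|by meas|side].
rewrite E (@int_swap R _ _ _ _ M P (fun x z => (K s x z * G x)%:E) mF (fun x z => p1 z x)).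
have mI : mbl (fun z : X => \int[M]_x (K s x z * G x)%:E)%E.
 apply: (@measurable_int2 R _ _ _ _ M (fun z x => (K s x z * G x)%:E)) => //.
 side.
rewrite (sph_cst_unit mI _ cst)//; by move=> z; apply: integral_ge0 => x _; exact: p1.
Qed.

(** Hoelder with exponents [N/s] and [p]: the kernel factor is a power of [phi N x], which equals
    [phi 0 x = 1] by [phi_sym]. *)
Lemma T_le1 (s p : R) u x : 0 < s -> s < N%:R -> p = N%:R / (N%:R - s) -> mbl u ->
 nonneg u -> L1 P (fun y => u y `^ p) -> Ir P (fun y => u y `^ p) <= 1 -> Top s u x <= 1.
Proof.
move=> s0 sN pE mu u0 hu u1.
have sn : s != 0 by rewrite gt_eqF.
have Nn : N%:R != 0 :> R by rewrite gt_eqF.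
have Ns : N%:R - s != 0 by rewrite gt_eqF// subr_gt0.
have p0 : 0 < p by rewrite pE divr_gt0// subr_gt0.
have EK y : K s x y `^ (N%:R / s) = K N%:R x y.
 by rewrite /K -powRrM; congr powR; rewrite mulNr mulrC divfK.
have hK : L1 P (fun y => K s x y `^ (N%:R / s)).
 by apply: (L1_ext _ (phi_L1 (ler0n R N) x)) => y; rewrite EK.
have ab : (N%:R / s)^-1 + p^-1 = 1 by rewrite pE; field; rewrite Nn sn Ns.
have mK : mbl (K s x) by meas.
have [_ H] := @Ir_holder _ _ _ P (K s x) u (N%:R / s) p (divr_gt0 Np s0) p0 ab mK mu (K_ge0 s x) u0 hK hu.
apply: le_trans H _.
have -> : Ir P (fun y => K s x y `^ (N%:R / s)) = 1.
 rewrite (Ir_ext _ EK) -phiE phi_sym// subrr phiE -[RHS](@Ir_P_cst R N.+1 1).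
 by apply: Ir_ext => y; rewrite /K oppr0 powRr0.
rewrite powR1 mul1r -[leRHS](one_powR p^-1).
apply: powR_le => //; first side.
by apply: Ir_ge0 => y; exact: powR_ge0.
Qed.

Lemma sph_le_unit (f g : X -> \bar R) : mbl f -> mbl g ->
 enneg f -> enneg g -> (forall y, enorm y = 1 -> (f y <= g y)%E) ->
 (\int[P]_y f y <= \int[P]_y g y)%E.
Proof.
move=> mf mg f0 g0 fg; rewrite (sph_unit (ltn0Sn N) mf f0) (sph_unit (ltn0Sn N) mg g0).
have mi : mbl (fun y : X => (ind (enorm y == 1)%R)%:E).
 rewrite (_ : (fun _ => _) = (fun y : X => (ind ((enorm y <= 1) && (1 <= enorm y))%R)%:E)); first by meas.
 by apply/funext => y; rewrite eq_le.
apply: int_le.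
- by move=> y; rewrite mule_ge0// lee_fin.
- exact: emeasurable_funM.
- exact: emeasurable_funM.
by move=> y; case: eqP => y1; [apply: lee_wpmul2l => //; exact: fg|rewrite !mul0e].
Qed.

Lemma pmin_prod (a q r : R) : 0 < r -> 1 <= q -> r `^ (- (a + 1)) * Num.min 1 (r `^ (- a)) `^ (q - 1) =
 pmin (a + 1) (a * q + 1) r.
Proof.
move=> r0 q1; rewrite /pmin (gtr0_norm r0).
have E : r `^ (- (a * q + 1)) = r `^ (- (a + 1)) * (r `^ (- a)) `^ (q - 1).
 by rewrite -powRrM -powRD1 ?gt_eqF//; congr powR; ring.
have E1 : r `^ (- (a + 1)) = r `^ (- (a + 1)) * 1 `^ (q - 1) by rewrite powR1 mulr1.
rewrite E; have q0 : 0 <= q - 1 by lra.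
have P0 : 0 < r `^ (- (a + 1)) by exact: powR_gt0.
case/orP: (le_total 1 (r `^ (- a))) => h.
 rewrite (min_l h) [in LHS]powR1 mulr1 min_l// {1}E1 ler_pM2l//.
 by apply: powR_le.
rewrite (min_r h) min_r// {2}E1 ler_pM2l//.
by apply: powR_le => //; exact: powR_ge0.
Qed.

(* Scaling [x = tau x'] with [tau^a = L]. *)
Lemma layer_bound (a q : R) : 0 < a -> a < N%:R -> 1 <= q -> N%:R < a * q ->
 exists2 C, 0 <= C & forall L : R, 0 < L ->
 (\int[leb N.+1]_x (ind (0 < enorm (x : X))%R * (enorm x `^ (- (a + 1)) * Num.min 1 (L * enorm x `^ (- a)) `^ (q - 1)))%:E
  <= (C * L `^ (N%:R / a - 1))%:E)%E.
Proof.
move=> a0 aN q1 aq.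
pose J (x : X) : R := pmin (a + 1) (a * q + 1) (enorm x).
have mJ : mbl (fun x => (J x)%:E) by apply: meas_EFin; apply: meas_pmin; meas.
have J0 x : (0 <= (J x)%:E)%E by rewrite lee_fin pmin_ge0.
have fJ : (\int[leb N.+1]_x (J x)%:E < +oo)%E.
 apply: (@leb_norm_fin R N.+1 (a + 1) (a * q + 1)) => //.
 - side.
 - by rewrite -natr1 ltrD2r.
 - by rewrite -natr1 ltrD2r.
 - exact/measurable_EFinP.
pose C := fine (\int[leb N.+1]_x (J x)%:E).
have CE : (\int[leb N.+1]_x (J x)%:E = C%:E)%E.
 by rewrite fineK// ge0_fin_numE//; apply: integral_ge0.
have C0 : 0 <= C by apply: fine_ge0; apply: integral_ge0.
exists C => // L L0.
pose tau := L `^ a^-1.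
have t0 : 0 < tau by exact: powR_gt0.
have tL : tau `^ a = L by rewrite -powRrM mulVf ?gt_eqF// powRr1// ltW.
have ti0 : 0 < tau^-1 by rewrite invr_gt0.
have h := @leb_dilate R N.+1 tau^-1 (fun x => (J x)%:E) ti0 mJ J0.
have -> : (C * L `^ (N%:R / a - 1))%:E = ((tau `^ (- (a + 1)))%:E * \int[leb N.+1]_x (J (tscale tau^-1 x))%:E)%E.
 rewrite h CE -!EFinM exprVn invrK mulrA mulrC; congr (_%:E); congr (_ * _).
 rewrite -powR_mulrn ?(ltW t0)// -powRD1 ?gt_eqF// /tau -powRrM; congr powR.
 by rewrite -natr1; field; rewrite gt_eqF.
have mJt : mbl (fun x : X => (J (tscale tau^-1 x))%:E).
 by apply: (measurableT_comp mJ); apply: meas_tscale; meas.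
rewrite -int_Zl; [|exact: powR_ge0|exact: mJt|by move=> x; exact: J0].
apply: int_le.
- by move=> x; rewrite lee_fin !mulr_ge0 ?powR_ge0.
- by meas.
- side.
move=> x; rewrite -EFinM lee_fin; case: (ltP 0 (enorm x)) => x0; last first.
 by rewrite mul0r mulr_ge0 ?powR_ge0// pmin_ge0.
rewrite mul1r /J enormZ (gtr0_norm ti0) -pmin_prod; [|by rewrite mulr_gt0|by []].
have sc (r : R) : (tau^-1 * enorm x) `^ (- r) = tau `^ r * enorm x `^ (- r).
 by rewrite powRM ?(ltW x0) ?(ltW ti0)// inv_powRN.
by rewrite !sc tL mulrA mulrA -powRD1 ?gt_eqF// addNr powRr0 mul1r.
Qed.

(** The decay of [phi] reduces this to [layer_bound] with [a = N - s]. The power of [l] is [p - 1],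
    so that taking [l = u y] and multiplying by [u y] will produce [(u y)^p]. *)
Lemma phi_layer (s q : R) : 0 < s -> N%:R / 2 < s -> s < N%:R -> 1 <= q -> N%:R < (N%:R - s) * q ->
 exists2 C, 0 <= C & forall l : R, 0 <= l ->
 (\int[M]_x (phi s x * Num.min 1 (2 * phi s x * l) `^ (q - 1))%:E <= (C * l `^ (N%:R / (N%:R - s) - 1))%:E)%E.
Proof.
move=> s0 sN2 sN q1 aq; pose a := N%:R - s.
have a0 : 0 < a by rewrite subr_gt0.
have aN : a < N%:R by rewrite /a; lra.
have q11 : 1 < q.
 move: aq; rewrite -/a => aq; apply: contraTT isT; rewrite -leNgt => h; move: (lt_trans aN aq).
 by rewrite ltNge ler_piMr// ltW.
have [C0 C00 hphi] := phi_decay_lt N0 s0 sN2 sN.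
have [C C0' hC] := @layer_bound a q a0 aN q1 aq.
have pN : 0 < N%:R / a - 1 by rewrite subr_gt0 ltr_pdivlMr// mul1r.
exists (C0 * C * (2 * C0) `^ (N%:R / a - 1)); first side.
have phx x : 0 <= phi s x by exact/ltW/phi_gt0/ltW.
move=> l; rewrite le_eqVlt => /predU1P[<-|l0].
 rewrite powR0 ?gt_eqF// mulr0.
 have -> : (\int[M]_x (phi s x * Num.min 1 (2 * phi s x * 0) `^ (q - 1))%:E = \int[M]_x 0)%E.
  by apply: eq_int => x; rewrite mulr0 min_r// powR0 ?mulr0// gt_eqF// subr_gt0.
 by rewrite integral0.
pose L : R := 2 * C0 * l.
have L0 : 0 < L by rewrite !mulr_gt0.
have mphi : mbl (fun x : X => phi s x) by meas.
rewrite hyp_int; [|by meas|by move=> x; rewrite lee_fin mulr_ge0 ?powR_ge0].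
have hg x : 0 <= (hgt (x : X))^-1 by rewrite invr_ge0 ltW// hgt_gt0.
rewrite leb_punctured; [|by []|by meas|by move=> x; rewrite mule_ge0// lee_fin ?mulr_ge0 ?powR_ge0//].
have -> : (C0 * C * (2 * C0) `^ (N%:R / a - 1) * l `^ (N%:R / (N%:R - s) - 1))%:E =
 (C0%:E * (C * L `^ (N%:R / a - 1))%:E)%E.
 rewrite -EFinM /L [(2 * C0 * l) `^ _]powRM; [|by rewrite mulr_ge0 ?(ltW C00)|exact: ltW].
 by rewrite -/a; congr (_%:E); rewrite -!mulrA.
apply: le_trans (lee_wpmul2l _ (hC L L0)); last side.
rewrite -int_Zl; [|exact: ltW|by meas|by move=> x; rewrite lee_fin !mulr_ge0 ?powR_ge0].
apply: int_le.
- by move=> x; rewrite !mule_ge0// lee_fin ?mulr_ge0 ?powR_ge0.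
- by meas.
- by meas.
move=> x; rewrite -!EFinM lee_fin; case: (ltP 0 (enorm x)) => x0; last by rewrite !mul0r mulr0.
rewrite !mul1r.
have hE := enorm_lt_hgt x.
have ph1 : phi s x <= C0 * enorm x `^ (- a).
 apply: le_trans (hphi x) _; rewrite ler_pM2l//; apply: powRN_le => //; [exact: ltW|exact: ltW].
have hi : (hgt x)^-1 <= enorm x `^ (- 1).
 by rewrite powR_inv1 ?(ltW x0)// lef_pV2 ?posrE ?hgt_gt0// ltW.
rewrite [- (a + 1)]opprD [enorm x `^ (_ - _)]powRD1 ?gt_eqF//.
have m0 : 0 <= Num.min 1 (2 * phi s x * l) by rewrite le_min ler01/= !mulr_ge0// ltW.
have mm : Num.min 1 (2 * phi s x * l) `^ (q - 1) <= Num.min 1 (L * enorm x `^ (- a)) `^ (q - 1).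
 apply: powR_le => //; first by lra.
 rewrite le_min ge_min lexx/= ge_min; apply/orP; right.
 have -> : L * enorm x `^ (- a) = 2 * (C0 * enorm x `^ (- a)) * l by rewrite /L; ring.
 by rewrite ler_pM2r// ler_pM2l.
rewrite mulrA; apply: (le_trans (y := (C0 * enorm x `^ (- a)) * Num.min 1 (L * enorm x `^ (- a)) `^ (q - 1) * enorm x `^ (-1))).
 apply: ler_pM => //; first by rewrite mulr_ge0// powR_ge0.
 by apply: ler_pM => //; exact: powR_ge0.
by apply: eq_lew; ring.
Qed.

(** The part of [u] below the level [t = T u / (2 phi)] contributes at most half of [T u]. Where
    [u > t], [T u] is at most [min 1 (2 phi u)], which replaces [q - 1] of the [q] factors. *)
Lemma Top_layer (s q : R) u x : 0 < s -> 1 <= q -> L1 P u -> nonneg u -> Top s u x <= 1 ->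
 L1 P (fun y => K s x y * (u y * Num.min 1 (2 * phi s x * u y) `^ (q - 1))) /\
 Top s u x `^ q <= 2 * Ir P (fun y => K s x y * (u y * Num.min 1 (2 * phi s x * u y) `^ (q - 1))).
Proof.
move=> s0 q1 hu u0 f1.
have mu := L1_meas hu.
have ph : 0 < phi s x by exact/phi_gt0/ltW.
have f0 : 0 <= Top s u x by exact: Top_ge0.
have mm y : 0 <= Num.min 1 (2 * phi s x * u y) by rewrite le_min ler01/= !mulr_ge0// ltW.
have hw : L1 P (fun y => u y * Num.min 1 (2 * phi s x * u y) `^ (q - 1)).
 apply: (L1_le hu); first by meas.
 move=> y; rewrite ger0_norm ?mulr_ge0 ?powR_ge0// ler_piMr//.
 apply: le_trans (@powR_le _ _ 1 (q - 1) _ (mm y) _) _; [lra|by rewrite ge_min lexx|by rewrite powR1].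
split; first exact: (Top_L1 (ltW s0) x hw).
pose t := Top s u x / (2 * phi s x).
have tE : t * (2 * phi s x) = Top s u x by rewrite divfK// gt_eqF// mulr_gt0.
have tt0 : 0 <= t by rewrite divr_ge0// mulr_ge0// ltW.
pose w y := u y * ind (t < u y)%R.
have hw2 : L1 P w.
 by apply: (L1_le hu); [rewrite /w; meas|move=> y; rewrite /w ger0_norm ?mulr_ge0// ler_piMr// lern1; case: (_ < _)].
have h1 : Top s u x <= Top s w x + t * phi s x.
 rewrite /phi -(Top_Z (ltW s0) _ _ (L1_P_cst _ 1)) -(Top_D (ltW s0)); [|exact: hw2|by apply: L1_Z; exact: L1_P_cst].
 apply: (Top_le (ltW s0)) => //; first by apply: L1_D => //; apply: L1_Z; exact: L1_P_cst.
 move=> y; rewrite mulr1 /w; case: (ltP t (u y)) => h; first by rewrite mulr1 lerDl.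
 by rewrite mulr0 add0r.
have h2 : Top s u x <= 2 * Top s w x by move: h1 tE; set A := Top s w x; set B := Top s u x; lra.
have q1' : 0 <= q - 1 by lra.
have fq : Top s u x `^ q <= 2 * (Top s u x `^ (q - 1) * Top s w x).
 rewrite -(mulr_powRB1 f0); last by lra.
 rewrite mulrC mulrCA; exact: (ler_wpM2l (powR_ge0 _ _) h2).
apply: le_trans fq _; rewrite ler_pM2l// -(Top_Z (ltW s0) _ _ hw2).
apply: (Top_le (ltW s0)) => //; first exact: L1_Z.
move=> y; rewrite /w mulrCA; case: (ltP t (u y)) => h; last by rewrite !mulr0 mulr_ge0 ?powR_ge0.
rewrite mulr1 ler_wpM2l//; apply: powR_le => //; rewrite le_min f1/=.
by rewrite -tE mulrC ler_wpM2l ?mulr_ge0 ?ltW.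
Qed.

(** After exchanging the integrals the weight is radial in [x] for each fixed [y], so [kernel_avg]
    replaces [K] by [phi], and [phi_layer] leaves a multiple of the integral of [u^p]. *)
Lemma T_bound_big (s q : R) : 0 < s -> N%:R / 2 < s -> s < N%:R -> 1 <= q -> N%:R < (N%:R - s) * q ->
 exists2 C, 0 <= C & forall u, mbl u -> nonneg u ->
  L1 P (fun y => u y `^ (N%:R / (N%:R - s))) -> Ir P (fun y => u y `^ (N%:R / (N%:R - s))) <= 1 ->
  (\int[M]_x (Top s u x `^ q)%:E <= C%:E)%E.
Proof.
move=> s0 sN2 sN q1 aq.
have [C C0 hC] := phi_layer s0 sN2 sN q1 aq.
exists (2 * C); first side.
move=> u mu u0 hp up1.
set p := N%:R / _ in hp up1 hC.
have a0 : 0 < N%:R - s by rewrite subr_gt0.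
have p1 : 1 < p by rewrite /p ltr_pdivlMr// mul1r ltrBlDr ltrDl.
have hu : L1 P u.
 by apply: (Lp_L1 (ltW p1) mu); apply: (L1_ext _ hp) => y; rewrite ger0_norm.
have f1 x : Top s u x <= 1 by exact: (T_le1 x s0 sN (erefl p) mu u0 hp up1).
have ph x : 0 <= phi s x by exact/ltW/phi_gt0/ltW.
pose F x y : R := K s x y * (u y * Num.min 1 (2 * phi s x * u y) `^ (q - 1)).
have F0 x y : (0 <= (F x y)%:E)%E.
 by rewrite lee_fin !mulr_ge0 ?K_ge0 ?powR_ge0.
have mF : mbl (fun z : X * X => (F z.1 z.2)%:E).
 have mu2 := measurableT_comp mu (measurable_snd : mbl (@snd X X)).
 by rewrite /F; meas.
apply: (le_trans (y := (2%:E * \int[M]_x \int[P]_y (F x y)%:E)%E)).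
 rewrite -int_Zl//; last 2 first.
 - by apply: (@measurable_int2 R _ _ _ _ P (fun x y => (F x y)%:E)).
 - by move=> x; apply: integral_ge0.
 apply: int_le.
 - side.
 - by meas.
 - apply: emeasurable_funM; first exact: measurable_cst.
  by apply: (@measurable_int2 R _ _ _ _ P (fun x y => (F x y)%:E)).
 move=> x; have [h1 h2] := Top_layer s0 q1 hu u0 (f1 x).
 by rewrite -/(F x) in h1 h2; rewrite (IrE h1) -EFinM lee_fin.
rewrite EFinM; apply: lee_wpmul2l; first side.
rewrite (@int_swap R _ _ _ _ M P (fun x y => (F x y)%:E) mF F0).
have mI : mbl (fun y : X => \int[M]_x (F x y)%:E)%E.
 apply: (@measurable_int2 R _ _ _ _ M (fun y x => (F x y)%:E)) => //.
 have mu2 := measurableT_comp mu (measurable_fst : mbl (@fst X X)).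
 by rewrite /F; meas.
have I0 y : (0 <= \int[M]_x (F x y)%:E)%E by apply: integral_ge0.
apply: (le_trans (y := (\int[P]_y (C * u y `^ p)%:E)%E)); last first.
 by rewrite (IrE (L1_Z C hp)) lee_fin (Ir_Z _ hp) ler_piMr.
apply: sph_le_unit => //; [by meas|side|].
move=> y y1.
pose G x : R := Num.min 1 (2 * phi s x * u y) `^ (q - 1).
have -> : (\int[M]_x (F x y)%:E = (u y)%:E * \int[M]_x (K s x y * G x)%:E)%E.
 rewrite -int_Zl; [|exact: u0|by rewrite /G; meas|by move=> x; rewrite lee_fin mulr_ge0 ?K_ge0 ?powR_ge0].
 by apply: eq_int => x; rewrite -EFinM /F -/(G x); congr (_%:E); ring.
rewrite (kernel_avg (ltW s0) (G := G) _ _ _ y1); last 3 first.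
- by rewrite /G; meas.
- side.
- by move=> e x e1; rewrite /G phi_refl.
apply: le_trans (lee_wpmul2l _ (hC (u y) (u0 y))) _; first by rewrite lee_fin.
by rewrite -EFinM lee_fin mulrCA mulr_powRB1// (lt_trans ltr01).
Qed.

Lemma powR_split (a b c : R) : 0 <= a -> 0 < b -> 0 < c -> b + c = 1 -> a `^ b * a `^ c = a.
Proof.
move=> a0 b0 c0 bc; move: a0; rewrite le_eqVlt => /predU1P[<-|a0].
 by rewrite !powR0 ?mul0r// gt_eqF.
by rewrite -powRD1 ?gt_eqF// bc powRr1// ltW.
Qed.

(** Hoelder with exponents [t/s] and [t/(t-s)]; [u] is distributed so that the second factor is a
    power of the integral of [u^p], hence at most 1. *)
Lemma Top_reduce (s t : R) u x : 0 < s -> s < t -> t < N%:R -> mbl u ->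
 nonneg u ->
 let p := N%:R / (N%:R - s) in let p2 := N%:R / (N%:R - t) in
 L1 P (fun y => u y `^ p) -> Ir P (fun y => u y `^ p) <= 1 ->
 Top s u x <= Top t (fun y => u y `^ (p / p2)) x `^ (s / t).
Proof.
move=> s0 st tN mu u0 p p2 hp up1.
have t0 : 0 < t by exact: lt_trans st.
have sn : s != 0 by rewrite gt_eqF.
have tn : t != 0 by rewrite gt_eqF.
have Nn : N%:R != 0 :> R by rewrite gt_eqF.
have tsp : 0 < t - s by rewrite subr_gt0.
have tsn : t - s != 0 by rewrite gt_eqF.
have Nt : 0 < N%:R - t by rewrite subr_gt0.
have Ns : 0 < N%:R - s by rewrite subr_gt0 (lt_trans st).
have Ntn : N%:R - t != 0 by rewrite gt_eqF.
have Nsn : N%:R - s != 0 by rewrite gt_eqF.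
have p0 : 0 < p by rewrite /p divr_gt0.
have p20 : 0 < p2 by rewrite /p2 divr_gt0.
pose a := t / s; pose b := t / (t - s).
have a0 : 0 < a by rewrite divr_gt0.
have b0 : 0 < b by rewrite divr_gt0.
have ab : a^-1 + b^-1 = 1 by rewrite /a /b; field; rewrite sn tn tsn.
pose v y := u y `^ (p / p2).
have mv : mbl v by rewrite /v; meas.
have v0 y : 0 <= v y by exact: powR_ge0.
have p2p : 1 <= p2 by rewrite /p2 ler_pdivlMr// mul1r lerBlDr lerDl ltW.
have hv : L1 P v.
 apply: (Lp_L1 p2p mv); apply: (L1_ext _ hp) => y.
 by rewrite ger0_norm// /v -powRrM divfK// gt_eqF.
pose f y := (K t x y * v y) `^ a^-1; pose g y := u y `^ (p / b).
have f0 y : 0 <= f y by exact: powR_ge0.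
have g0 y : 0 <= g y by exact: powR_ge0.
have fa y : f y `^ a = K t x y * v y.
 by rewrite /f -powRrM mulVf ?gt_eqF// powRr1// mulr_ge0 ?K_ge0.
have gb y : g y `^ b = u y `^ p by rewrite /g -powRrM divfK// gt_eqF.
have fg y : f y * g y = K s x y * u y.
 rewrite /f powRM ?K_ge0// -mulrA; congr (_ * _).
  by rewrite /K -powRrM; congr powR; rewrite /a invf_div; field.
 rewrite /v /g -powRrM; apply: powR_split => //; [by rewrite !divr_gt0|side|].
 by rewrite /a /b /p /p2; field; rewrite tn sn Nn Ntn Nsn tsn.
have hfa : L1 P (fun y => f y `^ a).
 by apply: (L1_ext _ (Top_L1 (ltW t0) x hv)) => y; rewrite fa.
have hgb : L1 P (fun y => g y `^ b) by apply: (L1_ext _ hp) => y; rewrite gb.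
have mf : mbl f by rewrite /f; meas.
have mg : mbl g by rewrite /g; meas.
have e1 : Top s u x = Ir P (fun y => f y * g y) by apply: Ir_ext => y; rewrite fg.
have e2 : Top t (fun y => u y `^ (p / p2)) x = Ir P (fun y => f y `^ a) by apply: Ir_ext => y; rewrite fa.
have e3 : Ir P (fun y => g y `^ b) = Ir P (fun y => u y `^ p) by apply: Ir_ext => y; rewrite gb.
have [_ h] := @Ir_holder _ _ _ P f g a b a0 b0 ab mf mg f0 g0 hfa hgb.
have fin (I F G T1 T2 U : R) : T1 = I -> T2 = F -> G = U -> I <= F `^ a^-1 * G `^ b^-1 ->
  0 <= U -> U <= 1 -> T1 <= T2 `^ (s / t).
 move=> -> -> -> H U0 U1; apply: (le_trans H).
 rewrite [a^-1]invf_div ler_piMr ?powR_ge0//.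
 rewrite -[leRHS](one_powR b^-1); apply: powR_le => //.
 by rewrite invr_ge0 ltW.
by apply: (fin _ _ _ _ _ _ e1 e2 e3 h) => //; apply: Ir_ge0 => y; exact: powR_ge0.
Qed.

(** The layer argument uses the lossless decay of [phi] for parameters above [N/2]. For [s <= N/2]
    the estimate is transferred to some [t > N/2] with exponent [q s / t]. *)
Lemma T_bound_pos (s q : R) : 0 < s -> s < N%:R -> N%:R < q * s -> N%:R < q * (N%:R - s) ->
 exists2 C, 0 <= C & forall u, mbl u -> nonneg u ->
  L1 P (fun y => u y `^ (N%:R / (N%:R - s))) -> Ir P (fun y => u y `^ (N%:R / (N%:R - s))) <= 1 ->
  (\int[M]_x (Top s u x `^ q)%:E <= C%:E)%E.
Proof.
move=> s0 sN qs qN.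
have q1 : 1 < q.
 rewrite ltNge; apply/negP => h; move: qs; apply/negP; rewrite -leNgt.
 by apply: le_trans (ltW sN); rewrite ler_piMl// ltW.
case: (ltP (N%:R / 2) s) => s2.
 by apply: (T_bound_big s0 s2 sN (ltW q1)); rewrite mulrC.
pose A := q * s.
have A0 : 0 < N%:R + A by rewrite addr_gt0//; exact: (lt_trans Np qs).
(* [t (N + A) < A N] is the condition [N < (N - t) q s / t]; it leaves room above [N/2] because
   [A = q s > N]. *)
have [t [t2 tN tA]] : exists t : R, [/\ N%:R / 2 < t, t < N%:R & t * (N%:R + A) < A * N%:R].
 have hA : N%:R / 2 < A * N%:R / (N%:R + A).
  rewrite ltr_pdivlMr//; have qs' : N%:R < A by [].
  have := mulr_gt0 Np (_ : 0 < A - N%:R); rewrite subr_gt0 => /(_ qs'); rewrite mulrBr.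
  by rewrite mulrDr [A * _]mulrC [_ / 2 * _]mulrAC [_ / 2 * A]mulrAC; lra.
 have hA2 : A * N%:R / (N%:R + A) < N%:R.
  by rewrite ltr_pdivrMr// mulrC ltr_pM2l// ltrDr.
 exists ((N%:R / 2 + A * N%:R / (N%:R + A)) / 2); split; [lra|lra|].
 by rewrite -ltr_pdivlMr//; lra.
have st : s < t by exact: le_lt_trans t2.
have t0 : 0 < t by exact: lt_trans st.
pose q2 := q * (s / t).
have Nq2 : N%:R < (N%:R - t) * q2.
 rewrite /q2 mulrC -mulrA mulrAC mulrA ltr_pdivlMr//.
 by move: tA; rewrite mulrA -/A mulrBr mulrDr [N%:R * t]mulrC [A * t]mulrC; lra.
have q21 : 1 <= q2.
 rewrite leNgt; apply/negP => h; move: Nq2; apply/negP; rewrite -leNgt.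
 apply: (le_trans (y := N%:R - t)); last by rewrite gerBl ltW.
 by rewrite ler_piMr// ltW// subr_gt0.
have [C C0 hC] := T_bound_big t0 t2 tN q21 Nq2.
exists C => // u mu u0 hp up1.
set p := N%:R / (N%:R - s) in hp up1; pose p2 := N%:R / (N%:R - t).
pose v y := u y `^ (p / p2).
have mv : mbl v by rewrite /v; meas.
have v0 y : 0 <= v y by exact: powR_ge0.
have vp y : v y `^ p2 = u y `^ p.
 by rewrite /v -powRrM divfK// mulf_neq0 ?invr_eq0 ?gt_eqF// subr_gt0.
have hv : L1 P (fun y => v y `^ p2) by apply: (L1_ext _ hp) => y; rewrite vp.
have v1 : Ir P (fun y => v y `^ p2) <= 1 by rewrite (Ir_ext _ vp).
apply: le_trans (hC v mv v0 hv v1).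
apply: int_le.
- side.
- by meas.
- by meas.
move=> x; rewrite lee_fin; have h := Top_reduce x s0 st tN mu u0 hp up1.
apply: le_trans (@powR_le _ _ _ q (ltW (lt_trans ltr01 q1)) _ h) _; first exact: Top_ge0.
by rewrite -powRrM /q2 [_ * q]mulrC.
Qed.

Lemma T_bound (s q : R) : 0 < s -> s < N%:R -> N%:R < q * s -> N%:R < q * (N%:R - s) ->
 exists2 C, 0 < C & forall u, mbl u ->
  L1 P (fun y => `|u y| `^ (N%:R / (N%:R - s))) -> Ir P (fun y => `|u y| `^ (N%:R / (N%:R - s))) <= 1 ->
  L1 M (fun x => `|Top s u x| `^ q) /\ Ir M (fun x => `|Top s u x| `^ q) <= C.
Proof.
move=> s0 sN qs qN; have [C C0 hC] := T_bound_pos s0 sN qs qN.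
exists (C + 1); first by rewrite ltr_wpDl.
move=> u mu hp up1.
have q0 : 0 <= q.
 rewrite leNgt; apply/negP => h; move: qs; apply/negP; rewrite -leNgt.
 by apply: (le_trans (y := 0)); [rewrite nmulr_rle0// ltW|exact: ltW].
have p1 : 1 <= N%:R / (N%:R - s) by rewrite ler_pdivlMr ?subr_gt0// mul1r lerBlDr lerDl ltW.
have hu := Lp_L1 p1 mu hp.
have ma : mbl (fun y => `|u y|) by meas.
apply: L1_bound.
- by meas.
- side.
apply: le_trans (le_trans (hC (fun y => `|u y|) ma (fun y => normr_ge0 _) hp up1) _); last first.
 by rewrite lee_fin lerDl.
apply: int_le.
- side.
- by meas.
- by meas.
move=> x; rewrite lee_fin; apply: powR_le => //; exact: (Top_abs (ltW s0)).
Qed.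
End Bounded.

(** * Positive parts and symmetrized integrals *)

Section SymmetricIntegrals.
Context {R : realType} {N : nat}.
Local Notation X := (N.+1.-tuple R).
Local Notation P := (@sph R N.+1).
Local Notation M := (@hyp R N.+1).
Implicit Types (x y e : X) (u : X -> R).

Lemma min_norm (a b : R) : 0 <= a -> 0 <= b -> `|a - b| + 2 * Num.min a b = a + b.
Proof.
move=> a0 b0; case/orP: (le_total a b) => h.
 by rewrite min_l// distrC ger0_norm ?subr_ge0//; ring.
by rewrite min_r// ger0_norm ?subr_ge0//; ring.
Qed.

Definition pos u y : R := Num.max (u y) 0.

Definition neg u y : R := Num.max (- u y) 0.

Lemma pos_ge0 u y : 0 <= pos u y. Proof. by rewrite le_max lexx orbT. Qed.
Lemma neg_ge0 u y : 0 <= neg u y. Proof. by rewrite le_max lexx orbT. Qed.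

Lemma pos_neg u y : u y = pos u y - neg u y.
Proof.
by rewrite /pos /neg; case/orP: (le_total 0 (u y)) => h; [rewrite max_l// max_r ?oppr_le0//|rewrite max_r// max_l ?oppr_ge0//]; ring.
Qed.

Lemma abs_pos_neg u y : `|u y| = pos u y + neg u y.
Proof.
by rewrite /pos /neg; case/orP: (le_total 0 (u y)) => h; [rewrite max_l// max_r ?oppr_le0// ger0_norm//|rewrite max_r// max_l ?oppr_ge0// ler0_norm//]; ring.
Qed.

Lemma L1_pos u : L1 P u -> L1 P (pos u).
Proof.
move=> hu; have mu := L1_meas hu; apply: (L1_le (L1_abs hu)); first side.
by move=> y; rewrite ger0_norm ?pos_ge0// abs_pos_neg lerDl neg_ge0.
Qed.

Lemma L1_neg u : L1 P u -> L1 P (neg u).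
Proof.
move=> hu; have mu := L1_meas hu; apply: (L1_le (L1_abs hu)); first side.
by move=> y; rewrite ger0_norm ?neg_ge0// abs_pos_neg lerDr pos_ge0.
Qed.

Lemma refl_fix e y : dotp e y = 0 -> refl e y = y.
Proof. by move=> h; apply: eq_from_tnth => i; rewrite tnth_mktuple h mulr0 mul0r subr0. Qed.

Lemma Ir_P_half e (h : X -> R) : dotp e e = 1 -> L1 P h -> Ir P h = 2^-1 * Ir P (fun y => h y + h (refl e y)).
Proof.
move=> e1 hh; have [k1 k2] := @P_refl _ _ e h e1 (L1_meas hh).
rewrite (Ir_D hh (k1 hh)) k2; move: (Ir P h) => a; lra.
Qed.

Lemma Ir_M_half e (h : X -> R) : dotp e e = 1 -> L1 M h -> Ir M h = 2^-1 * Ir M (fun y => h y + h (refl e y)).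
Proof.
move=> e1 hh; have [k1 k2] := @M_refl _ _ e h e1 (L1_meas hh).
rewrite (Ir_D hh (k1 hh)) k2; move: (Ir M h) => a; lra.
Qed.

End SymmetricIntegrals.

(** * Log-convex sequences *)

Section LogConvex.
Context {R : realType}.

Lemma bernoulli_ineq (x : R) m : 0 <= x -> 1 + m%:R * x <= (1 + x) ^+ m.
Proof.
move=> x0; elim: m => [|m IH]; first by rewrite mul0r addr0 expr0.
rewrite exprS; apply: (le_trans (y := (1 + x) * (1 + m%:R * x))); last by rewrite ler_wpM2l// addr_ge0.
have -> : (1 + x) * (1 + m%:R * x) = 1 + m.+1%:R * x + m%:R * x ^+ 2 by rewrite -natr1; ring.
by rewrite lerDl mulr_ge0// sqr_ge0.
Qed.

(** By log-convexity the ratios [b (m+1) / b m] do not decrease, so a first ratio above [mu] would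
    force growth faster than [C mu^m]. *)
Lemma log_convex_bound (b : nat -> R) (C mu : R) : (forall m, 0 <= b m) ->
 (forall m, b m.+1 ^+ 2 <= b m * b m.+2) -> 0 <= mu -> (forall m, b m.+1 <= C * mu ^+ m) -> b 1%N <= mu * b 0%N.
Proof.
move=> b0 bc mu0 bm.
have [b00|bn] := eqVneq (b 0%N) 0.
 by have := bc 0%N; rewrite b00 mul0r mulr0 => h; rewrite -(ler_pXn2r (n := 2)) ?nnegrE// expr0n.
have bp : 0 < b 0%N by rewrite lt_neqAle eq_sym bn b0.
have r m : b 1%N * b m <= b m.+1 * b 0%N.
 elim: m => [//|m IH]; have [bm0|bmn] := eqVneq (b m) 0.
  have := bc m; rewrite bm0 mul0r => h.
  have -> : b m.+1 = 0 by apply/eqP; rewrite -sqrf_eq0 eq_le h sqr_ge0.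
  by rewrite mulr0 mulr_ge0.
 have bmp : 0 < b m by rewrite lt_neqAle eq_sym bmn b0.
 rewrite -(ler_pM2l bmp); apply: (le_trans (y := b m.+1 ^+ 2 * b 0%N)).
  have -> : b m * (b 1%N * b m.+1) = b m.+1 * (b 1%N * b m) by ring.
  by rewrite expr2 -mulrA ler_wpM2l.
 by rewrite mulrA ler_wpM2r.
rewrite leNgt; apply/negP => h.
pose t := b 1%N / b 0%N; have tmu : mu < t by rewrite /t ltr_pdivlMr.
have tp : 0 < t by exact: le_lt_trans tmu.
have lb m : t ^+ m * b 1%N <= b m.+1.
 elim: m => [|m IH]; first by rewrite expr0 mul1r.
 rewrite exprS -mulrA; apply: le_trans (ler_wpM2l (ltW tp) IH) _.
 by rewrite /t mulrAC ler_pdivrMr// r.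
have b1 : 0 < b 1%N by rewrite -(pmulr_lgt0 _ (_ : 0 < (b 0%N)^-1)) ?invr_gt0.
have [mu00|mun] := eqVneq mu 0.
 by have := le_trans (lb 1%N) (bm 1%N); rewrite mu00 !expr1 mulr0 leNgt mulr_gt0.
have mup : 0 < mu by rewrite lt_neqAle eq_sym mun.
pose x := t / mu - 1; have xp : 0 < x by rewrite subr_gt0 ltr_pdivlMr// mul1r.
pose m := Num.bound (C / (b 1%N * x)).
have h1 : (1 + m%:R * x) * b 1%N <= C.
 apply: le_trans (ler_wpM2r (ltW b1) (bernoulli_ineq m (ltW xp))) _.
 rewrite /x addrC subrK expr_div_n mulrAC ler_pdivrMr ?exprn_gt0//; exact: le_trans (lb m) (bm m).
have C0 : 0 <= C by apply: le_trans h1; rewrite mulr_ge0// ?addr_ge0// ?mulr_ge0 ?(ltW xp)// ltW.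
have := archi_boundP (divr_ge0 C0 (mulr_ge0 (ltW b1) (ltW xp))); rewrite -/m ltr_pdivrMr ?mulr_gt0// => h2.
have h3 : m%:R * (b 1%N * x) <= C by apply: le_trans h1; rewrite mulrDl mul1r mulrAC mulrA lerDr ltW.
by have := lt_le_trans h2 h3; rewrite ltxx.
Qed.

End LogConvex.

(** * Reflection-positive kernels on the sphere *)

Section ReflectionPositiveKernel.
Context {R : realType} {N : nat}.
Local Notation X := (N.+1.-tuple R).
Local Notation P := (@sph R N.+1).
Implicit Types (y w e z : X) (f g : X -> R).
Variables (k : X -> X -> R) (B L : R).
Hypothesis mk : mbl (fun z : X * X => k z.1 z.2).
Hypothesis kB : forall y w, `|k y w| <= B.
Hypothesis kC : forall y w, k y w = k w y.
Hypothesis k_refl : forall e y w, dotp e e = 1 -> k (refl e y) w = k y (refl e w).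
(** The kernel is larger between points on the same side of a mirror: positivity on functions
    antisymmetric under the reflection. *)
Hypothesis k_pos : forall e y w, dotp e e = 1 -> 0 <= dn e y * dn e w -> k y (refl e w) <= k y w.
Hypothesis L0 : 0 <= L.
Hypothesis k_lip : forall e y w, dotp e e = 1 -> `|k y w - k (refl e y) w| <= L * `|dn e y|.
Variable kap : R.
Hypothesis k_mean : forall y, enorm y = 1 -> Ir P (k y) = kap.

Let B0 : 0 <= B. Proof. exact: le_trans (normr_ge0 (k (t0 _) (t0 _))) (kB _ _). Qed.

Definition bdd f (c : R) : Prop := mbl f /\ forall y, `|f y| <= c.

Lemma bdd_L1 f c : bdd f c -> L1 P f.
Proof. by case=> mf hf; exact: L1_P_bd mf hf. Qed.

Lemma bdd_ge0 f c : bdd f c -> 0 <= c.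
Proof. by case=> _ /(_ (t0 _)); exact: le_trans (normr_ge0 _). Qed.

Lemma bddM f g c d : bdd f c -> bdd g d -> bdd (fun y => f y * g y) (c * d).
Proof. by move=> [mf hf] [mg hg]; split=> [|y]; [by meas|rewrite normrM ler_pM]. Qed.

Lemma bddD f g c d : bdd f c -> bdd g d -> bdd (fun y => f y + g y) (c + d).
Proof. by move=> [mf hf] [mg hg]; split=> [|y]; [by meas|apply: le_trans (ler_normD _ _) _; exact: lerD]. Qed.

Lemma bddZ f c (a : R) : bdd f c -> bdd (fun y => a * f y) (`|a| * c).
Proof. by move=> [mf hf]; split=> [|y]; [by meas|rewrite normrM ler_wpM2l]. Qed.

Lemma bdd_refl e f c : dotp e e = 1 -> bdd f c -> bdd (fun y => f (refl e y)) c.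
Proof. by move=> e1 [mf hf]; split=> [|y]; [by meas|exact: hf]. Qed.

Lemma bdd_dotp z : bdd (fun y => dn z y) (enorm z).
Proof. by split=> [|y]; [by meas|exact: dotp_nrm_le]. Qed.

Definition Aop f y : R := Ir P (fun w => k y w * f w).

Lemma meas_ky y : mbl (k y).
Proof. exact: (measurableT_comp mk (measurable_fun_pair (measurable_cst y) (@measurable_id _ X setT))). Qed.

Lemma Aop_L1 f c y : bdd f c -> L1 P (fun w => k y w * f w).
Proof. by move=> hf; apply: (@bdd_L1 _ (B * c)); apply: bddM => //; split; [exact: meas_ky|exact: kB]. Qed.

Lemma Aop_bdd f c : bdd f c -> bdd (Aop f) (B * c).
Proof.
move=> hf; split.
 apply: meas_Ir2; apply: measurable_funM => //; apply: measurableT_comp; [exact: hf.1|exact: measurable_snd].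
move=> y; apply: le_trans (Ir_abs (Aop_L1 y hf)) _.
rewrite -(@Ir_P_cst R N.+1 (B * c)); apply: Ir_le; [exact: L1_abs (Aop_L1 y hf)|exact: L1_P_cst|].
by move=> w; rewrite normrM ler_pM//; exact: hf.2.
Qed.

Lemma Aop_D f g c d y : bdd f c -> bdd g d -> Aop (fun w => f w + g w) y = Aop f y + Aop g y.
Proof.
move=> hf hg; rewrite /Aop -(Ir_D (Aop_L1 y hf) (Aop_L1 y hg)); apply: Ir_ext => w; exact: mulrDr.
Qed.

Lemma Aop_Z f c (a : R) y : bdd f c -> Aop (fun w => a * f w) y = a * Aop f y.
Proof. by move=> hf; rewrite /Aop -(Ir_Z a (Aop_L1 y hf)); apply: Ir_ext => w; exact: mulrCA. Qed.

Lemma Aop_refl e f c y : dotp e e = 1 -> bdd f c -> Aop f (refl e y) = Aop (fun w => f (refl e w)) y.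
Proof.
move=> e1 hf; have h := Aop_L1 y (bdd_refl e1 hf).
rewrite /Aop -((P_refl e1 (L1_meas h)).2); apply: Ir_ext => w.
by rewrite k_refl// reflK.
Qed.

Lemma Aop_sym f g c d : bdd f c -> bdd g d -> Ir P (fun y => g y * Aop f y) = Ir P (fun y => Aop g y * f y).
Proof.
move=> hf hg; pose F y w := g y * (k y w * f w).
have F1 y : L1 P (F y) by exact: L1_Z (Aop_L1 y hf).
have F2 w : L1 P (fun y => F y w).
 apply: (L1_ext _ (L1_Z (f w) (Aop_L1 w hg))) => y; rewrite /F kC; ring.
have [||||_ _ e] := @Ir_fubini _ _ _ _ _ P P F.
- rewrite /F; apply: measurable_funM; first by apply: measurableT_comp; [exact: hg.1|exact: measurable_fst].
 by apply: measurable_funM => //; apply: measurableT_comp; [exact: hf.1|exact: measurable_snd].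
- exact: F1.
- exact: F2.
- have mF : mbl (fun y => Ir P (fun w => `|F y w|)).
  apply: meas_Ir2; apply: measurableT_comp => //=.
  rewrite /F; apply: measurable_funM; first by apply: measurableT_comp; [exact: hg.1|exact: measurable_fst].
  by apply: measurable_funM => //; apply: measurableT_comp; [exact: hf.1|exact: measurable_snd].
 apply: (@L1_P_bd _ _ _ (d * (B * c))) => // y; rewrite ger0_norm; last by apply: Ir_ge0.
 rewrite -(@Ir_P_cst R N.+1 (d * (B * c))); apply: Ir_le; [exact: L1_abs (F1 y)|exact: L1_P_cst|].
 move=> w; rewrite !normrM; apply: ler_pM => //; first exact: hg.2.
 by apply: ler_pM => //; exact: hf.2.
have -> : Ir P (fun y => g y * Aop f y) = Ir P (fun y => Ir P (F y)) by apply: Ir_ext => y; rewrite -(Ir_Z _ (Aop_L1 y hf)).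
rewrite e.
apply: Ir_ext => w; rewrite mulrC -(Ir_Z _ (Aop_L1 w hg)); apply: Ir_ext => y; rewrite /F kC; ring.
Qed.

Lemma Aop_mean f c : bdd f c -> Ir P (Aop f) = kap * Ir P f.
Proof.
move=> hf; have h1 : bdd (fun=> 1) 1 by split=> [|y]; [exact: measurable_cst|rewrite normr1].
have -> : Ir P (Aop f) = Ir P (fun y => 1 * Aop f y) by apply: Ir_ext => y; rewrite mul1r.
rewrite (Aop_sym hf h1) -(Ir_Z _ (bdd_L1 hf)).
have m1 := (Aop_bdd h1).1; have mf := hf.1.
refine (P_unit (ltn0Sn N) _ _ _).2; [by meas|by meas|move=> y y1].
congr (_ * _); rewrite -(k_mean y1); apply: Ir_ext => w; exact: mulr1.
Qed.

Lemma dotp_refl_nrm e y : dotp e e = 1 -> dn e (refl e y) = - dn e y.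
Proof. by move=> e1; rewrite nrm_refl// dotp_refl_self. Qed.

(** Folding the integral along the mirror leaves the kernel [k y w - k y (refl e w)], whose sign is
    that of [(e.y) (e.w)]. *)
Lemma Aop_anti_ge0 e f c y : dotp e e = 1 -> bdd f c -> (forall w, f (refl e w) = - f w) ->
 (forall w, enorm w = 1 -> 0 <= dn e w * f w) -> 0 <= dn e y * Aop f y.
Proof.
move=> e1 hf fa fp; have h := Aop_L1 y hf.
have h' := (P_refl e1 (L1_meas h)).1 h.
rewrite /Aop (Ir_P_half e1 h) -(Ir_Z _ (L1_D h h')) -(Ir_Z _ (L1_Z _ (L1_D h h'))).
rewrite -[X in X <= _](@Ir_P_cst R N.+1 0); apply: (Ir_P_le (ltn0Sn N)); [exact: L1_P_cst|exact: L1_Z (L1_Z _ (L1_D h h'))|].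
move=> w w1; have := fp w w1; rewrite fa mulrN -mulrBl => hw.
have hp := @k_pos e y w e1; have hp' := @k_pos e y (refl e w) e1; rewrite reflK// dotp_refl_nrm// mulrN oppr_ge0 in hp'.
have hf0 : dn e w = 0 -> f w = 0.
 move=> h0; have w0 : dotp e w = 0 by move: h0; rewrite dotpZr w1 invr1 mul1r.
 have := fa w; rewrite refl_fix// => /eqP; rewrite -addr_eq0 -mulr2n mulrn_eq0/= => /eqP; exact.
rewrite mulrCA; apply: mulr_ge0; first side.
move: (dn e w) (dn e y) (k y w) (k y (refl e w)) (f w) hw hp hp' hf0 => b a u v t bt h1 h2 h0.
case: (ltrgtP b 0) => [b0|b0|/h0 ->]; last by rewrite !mulr0.
- have t0 : t <= 0 by rewrite -(nmulr_rge0 _ b0).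
 case: (leP 0 a) => a0.
  by apply: mulr_ge0 => //; apply: mulr_le0 => //; rewrite subr_le0 h2// mulr_ge0_le0// ltW.
 apply: mulr_le0; [exact: ltW|apply: mulr_ge0_le0 => //; rewrite subr_ge0 h1// mulr_le0// ltW//].
- have t0 : 0 <= t by rewrite -(pmulr_rge0 _ b0).
 case: (leP 0 a) => a0.
  by apply: mulr_ge0 => //; apply: mulr_ge0 => //; rewrite subr_ge0 h1// mulr_ge0// ltW.
 by apply: mulr_le0; [exact: ltW|apply: mulr_le0_ge0 => //; rewrite subr_le0 h2// mulr_le0_ge0// ltW].
Qed.

Lemma dotp_nrm_unit z y : enorm y = 1 -> dn z y = dotp z y.
Proof. by move=> y1; rewrite dotpZr y1 invr1 mul1r. Qed.

(** The reflection along [z] fixes [y] and reverses the linear function. *)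
Lemma Aop_orth z y : enorm y = 1 -> dotp z y = 0 -> Aop (fun w => dn z w) y = 0.
Proof.
move=> y1 zy; have [z0|z0] := eqVneq (enorm z) 0.
 rewrite /Aop -[RHS](@Ir_P_cst R N.+1 0); apply: Ir_ext => w.
 have := dotp_nrm_le z w; rewrite z0 normr_le0 => /eqP ->; exact: mulr0.
have zp : 0 < enorm z by rewrite lt_neqAle eq_sym z0 enorm_ge0.
pose e := nrm z.
have e1 : dotp e e = 1 by rewrite -enormE enorm_nrm// expr1n.
have ez w : dn z w = enorm z * dn e w by rewrite dotpZl mulrA mulfV// mul1r.
have he := bdd_dotp e.
have ey : refl e y = y by apply: refl_fix; rewrite dotpZl zy mulr0.
have h0 : Aop (fun w => dn e w) y = 0.
 have := Aop_refl y e1 he; rewrite ey.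
 have -> : Aop (fun w => dn e (refl e w)) y = - Aop (fun w => dn e w) y.
  rewrite -mulN1r -(Aop_Z _ _ he); apply: Ir_ext => w; rewrite dotp_refl_nrm// mulN1r//.
 by move=> /eqP; rewrite -addr_eq0 -mulr2n mulrn_eq0/= => /eqP.
rewrite -[RHS](mulr0 (enorm z)) -h0 -(Aop_Z _ _ he); apply: Ir_ext => w; rewrite ez//.
Qed.

(** Of the components of [z] along [y] and orthogonal to it only the first one contributes, by
    [Aop_orth]; its coefficient is constant on the sphere by reflection invariance. *)
Lemma Aop_eigen : exists mu : R, forall z y, enorm y = 1 -> Aop (fun w => dn z w) y = mu * dotp z y.
Proof.
pose F y := Aop (fun w => dn y w) y.
have FR e y : dotp e e = 1 -> F (refl e y) = F y.
 move=> e1; rewrite /F (Aop_refl _ e1 (bdd_dotp _)); apply: Ir_ext => w.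
 by rewrite nrm_refl// dotp_refl.
have e01 : enorm (@dlt R N.+1 ord0) = 1 by rewrite /enorm dlt_unit sqrtr1.
exists (F (dlt ord0)) => z y y1.
have yy : dotp y y = 1 by rewrite -enormE y1 expr1n.
pose z' := tsub z (tscale (dotp z y) y).
have zy' : dotp z' y = 0 by rewrite dotpBl dotpZl yy mulr1 subrr.
have -> : Aop (fun w => dn z w) y = Aop (fun w => dotp z y * dn y w + dotp z' (nrm w)) y.
 by apply: Ir_ext => w; rewrite dotpBl dotpZl addrC subrK.
rewrite (Aop_D _ (bddZ _ (bdd_dotp y)) (bdd_dotp z')) (Aop_orth y1 zy') addr0 (Aop_Z _ _ (bdd_dotp y)) mulrC.
congr (_ * _); apply: (radial_eq FR); by rewrite y1.
Qed.

(** Since [|y - refl e y| = 2 |e.y|] and two distinct points of the sphere are always exchanged by a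
    reflection, this is a Lipschitz condition in the chordal distance with constant [l/2]. *)
Definition lipc f (l : R) : Prop := forall e y, dotp e e = 1 -> enorm y = 1 -> `|f y - f (refl e y)| <= l * `|dotp e y|.

Lemma Aop_smooth f c : bdd f c -> lipc (Aop f) (L * c).
Proof.
move=> hf e y e1 y1; have h1 := Aop_L1 y hf; have h2 := Aop_L1 (refl e y) hf.
rewrite /Aop -(Ir_B h1 h2); apply: le_trans (Ir_abs (L1_B h1 h2)) _.
rewrite -(@Ir_P_cst R N.+1 (L * c * _)); apply: Ir_le; [exact: L1_abs (L1_B h1 h2)|exact: L1_P_cst|].
move=> w; rewrite -mulrBl normrM mulrAC; apply: ler_pM => //; last exact: hf.2.
by rewrite -(dotp_nrm_unit _ y1); exact: k_lip.
Qed.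

(** The functions [l (e.w) + d w] and [l (e.w) - d w], with [d w = f w - f (refl e w)], are
    antisymmetric and have the sign of [e.w]. The operator preserves this and multiplies [e.w] by
    [mu]. *)
Lemma Aop_contract (mu l : R) f c : (forall z y, enorm y = 1 -> Aop (fun w => dn z w) y = mu * dotp z y) ->
 0 <= l -> bdd f c -> lipc f l -> lipc (Aop f) (mu * l).
Proof.
move=> hmu l0 hf fl e y e1 y1.
have hr := bdd_refl e1 hf; have he := bdd_dotp e.
pose d w := f w + - 1 * f (refl e w).
have hd : bdd d (c + `|- 1 : R| * c) := bddD hf (bddZ _ hr).
have dE w : d w = f w - f (refl e w) by rewrite /d mulN1r.
have da w : d (refl e w) = - d w by rewrite !dE reflK// opprB.
have Ad : Aop d y = Aop f y - Aop f (refl e y).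
 by rewrite /d (Aop_D _ hf (bddZ _ hr)) (Aop_Z _ _ hr) mulN1r (Aop_refl _ e1 hf).
have key (t : R) : `|t| = 1 -> 0 <= dotp e y * (l * (mu * dotp e y) + t * Aop d y).
 move=> t1; have hl := bddZ l he; have ht := bddZ t hd.
 have := @Aop_anti_ge0 e _ _ y e1 (bddD hl ht).
 rewrite (Aop_D _ hl ht) (Aop_Z _ _ he) (Aop_Z _ _ hd) hmu// (dotp_nrm_unit _ y1); apply=> w.
  by rewrite dotp_refl_nrm// da !mulrN opprD.
 move=> w1; have := fl e w e1 w1; rewrite -dE (dotp_nrm_unit _ w1) => h.
 have : `|dotp e w * (t * d w)| <= l * dotp e w ^+ 2.
  rewrite normrM normrM t1 mul1r -(real_normK (num_real (dotp e w))) expr2 mulrCA.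
  exact: ler_wpM2l.
 rewrite ler_norml => /andP[h' _]; rewrite mulrDr; have -> : dotp e w * (l * dotp e w) = l * dotp e w ^+ 2 by ring.
 by rewrite -[X in X <= _](subrr (l * dotp e w ^+ 2)) lerD2l.
have := key 1 (normr1 _); have := key (-1) ltac:(by rewrite normrN normr1); rewrite Ad.
have f0 : dotp e y = 0 -> Aop f (refl e y) = Aop f y by move=> h; rewrite refl_fix.
rewrite mul1r mulN1r; move: (dotp e y) (Aop f y) (Aop f (refl e y)) f0 => a u v f0 h1 h2.
case: (ltrgtP a 0) => [a0|a0|a0].
- rewrite nmulr_rge0// in h1; rewrite nmulr_rge0// in h2.
 by rewrite (ltr0_norm a0) mulrN ler_norml opprK; apply/andP; split; rewrite -subr_le0;
   [apply: le_trans h1|apply: le_trans h2]; apply: eq_lew; ring.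
- rewrite pmulr_rge0// in h1; rewrite pmulr_rge0// in h2.
 by rewrite (gtr0_norm a0) ler_norml; apply/andP; split; rewrite -subr_ge0;
   [apply: le_trans h2 _|apply: le_trans h1 _]; apply: eq_lew; ring.
- by rewrite f0// subrr a0 normr0 mulr0.
Qed.

Lemma lipc_sup f c (l : R) : 0 <= l -> bdd f c -> lipc f l -> Ir P f = 0 -> forall y, enorm y = 1 -> `|f y| <= l.
Proof.
move=> l0 hf fl f0 y y1.
have h y' : enorm y' = 1 -> `|f y - f y'| <= l.
 move=> y1'; have [->|[e e1 <-]] := @refl_exists _ _ y y' ltac:(by rewrite y1 y1'); first by rewrite subrr normr0.
 apply: le_trans (fl e y e1 y1) _; rewrite ler_piMr//; apply: le_trans (dotp_le _ _) _.
 have -> : enorm e = 1 by rewrite /enorm e1 sqrtr1.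
 by rewrite y1 mulr1.
have hc := L1_P_cst N.+1 (f y); have hL := bdd_L1 hf.
rewrite -(subr0 (f y)) -f0 -(@Ir_P_cst R N.+1 (f y)) -(Ir_B hc hL).
apply: le_trans (Ir_abs (L1_B hc hL)) _; rewrite -(@Ir_P_cst R N.+1 l).
apply: (Ir_P_le (ltn0Sn N)); [exact: L1_abs (L1_B hc hL)|exact: L1_P_cst|exact: h].
Qed.

Lemma cauchy_schwarz f g c d : bdd f c -> bdd g d ->
 Ir P (fun y => f y * g y) ^+ 2 <= Ir P (fun y => f y ^+ 2) * Ir P (fun y => g y ^+ 2).
Proof.
move=> hf hg.
have lf : L1 P (fun y => f y ^+ 2) by apply: (bdd_L1 (bddM hf hf)).
have lg : L1 P (fun y => g y ^+ 2) by apply: (bdd_L1 (bddM hg hg)).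
have lfg : L1 P (fun y => f y * g y) by apply: (bdd_L1 (bddM hf hg)).
have a0 : 0 <= Ir P (fun y => f y ^+ 2) by apply: Ir_ge0 => y; exact: sqr_ge0.
have c0 : 0 <= Ir P (fun y => g y ^+ 2) by apply: Ir_ge0 => y; exact: sqr_ge0.
have key (t : R) : 2 * t * Ir P (fun y => f y * g y) <= Ir P (fun y => f y ^+ 2) + t ^+ 2 * Ir P (fun y => g y ^+ 2).
 rewrite -(Ir_Z _ lfg) -(Ir_Z _ lg) -(Ir_D lf (L1_Z _ lg)); apply: Ir_le; [exact: L1_Z|exact: L1_D lf (L1_Z _ lg)|].
 move=> y; rewrite -subr_ge0; have -> : f y ^+ 2 + t ^+ 2 * g y ^+ 2 - 2 * t * (f y * g y) = (f y - t * g y) ^+ 2 by ring.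
 exact: sqr_ge0.
move: (Ir P (fun y => f y ^+ 2)) (Ir P (fun y => g y ^+ 2)) (Ir P (fun y => f y * g y)) key a0 c0 => {lf lg lfg} a b m key a0 b0.
have [b00|bn] := eqVneq b 0.
 have [->|mn] := eqVneq m 0; first by rewrite expr0n b00 mulr0.
 have := key ((a + 1) / (2 * m)); rewrite b00 mulr0 addr0.
 have -> : 2 * ((a + 1) / (2 * m)) * m = a + 1 by field.
 by rewrite -subr_ge0 opprD addrA subrr sub0r oppr_ge0 ler10.
have bp : 0 < b by rewrite lt_neqAle eq_sym bn.
have := key (m / b); have -> : (m / b) ^+ 2 * b = m ^+ 2 / b by field.
have -> : 2 * (m / b) * m = m ^+ 2 / b + m ^+ 2 / b by field.
by rewrite lerD2r ler_pdivrMr.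
Qed.

(** One application makes [f] Lipschitz and each further one contracts by [mu]. With mean zero this
    bounds the sup norm, so the squared [L^2] norms [b m] of the iterates are [O(mu^(2m))]. Symmetry
    of the kernel makes [b] log-convex, hence [b 1 <= mu^2 * b 0], and Cauchy-Schwarz concludes. *)
Theorem reflection_gap (mu : R) f c : (forall z y, enorm y = 1 -> Aop (fun w => dn z w) y = mu * dotp z y) ->
 bdd f c -> Ir P f = 0 -> Ir P (fun y => f y * Aop f y) <= mu * Ir P (fun y => f y ^+ 2).
Proof.
move=> hmu hf f0.
pose F m := iter m Aop f.
have hF m : exists d, bdd (F m) d.
 by elim: m => [|m [d hd]]; [exists c|exists (B * d); rewrite /F iterS; exact: Aop_bdd].
have F0 m : Ir P (F m) = 0.
 by elim: m => [//|m IH]; have [d hd] := hF m; rewrite /F iterS (Aop_mean hd) -/(F m) IH mulr0.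
have mu0 : 0 <= mu.
 pose e0 : X := dlt ord0; have e00 : dotp e0 e0 = 1 := dlt_unit _.
 have e01 : enorm e0 = 1 by rewrite /enorm e00 sqrtr1.
 have := @Aop_anti_ge0 e0 _ _ e0 e00 (bdd_dotp e0).
 rewrite hmu// (dotp_nrm_unit _ e01) e00 mulr1 mul1r; apply=> w; first exact: dotp_refl_nrm.
 side.
have c0 := bdd_ge0 hf; have Lc : 0 <= L * c by exact: mulr_ge0.
have Fl m : lipc (F m.+1) (mu ^+ m * (L * c)).
 elim: m => [|m IH]; first by rewrite expr0 mul1r; exact: Aop_smooth.
 have [d hd] := hF m.+1; have mm : 0 <= mu ^+ m * (L * c) by apply: mulr_ge0 => //; exact: exprn_ge0.
 by rewrite exprS -mulrA; exact: (Aop_contract hmu mm hd IH).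
pose b m := Ir P (fun y => F m y ^+ 2).
have hb m : L1 P (fun y => F m y ^+ 2) by have [d hd] := hF m; exact: (bdd_L1 (bddM hd hd)).
have b0 m : 0 <= b m by apply: Ir_ge0 => y; exact: sqr_ge0.
have bs m : b m.+1 = Ir P (fun y => F m y * F m.+2 y).
 have [d hd] := hF m; have [d' hd'] := hF m.+1.
 have -> : Ir P (fun y => F m y * F m.+2 y) = Ir P (fun y => F m.+1 y * F m.+1 y).
  by rewrite -[RHS](Aop_sym hd' hd).
 side.
have h1 : b 1%N <= mu ^+ 2 * b 0%N.
 apply: (@log_convex_bound _ b ((L * c) ^+ 2)) => // [m||m]; last first.
 - rewrite -(@Ir_P_cst R N.+1 (_ * _)); apply: (Ir_P_le (ltn0Sn N)); [exact: hb|exact: L1_P_cst|move=> y y1].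
  have [d hd] := hF m.+1; have mm : 0 <= mu ^+ m * (L * c) by apply: mulr_ge0 => //; exact: exprn_ge0.
  have h := lipc_sup mm hd (Fl m) (F0 _) y1.
  rewrite -(real_normK (num_real _)) -exprM mulnC exprM -exprMn mulrC.
  by apply: lerXn2r; rewrite ?nnegrE.
 - exact: sqr_ge0.
 - by rewrite bs; have [d hd] := hF m; have [d' hd'] := hF m.+2; exact: (cauchy_schwarz hd hd').
have := cauchy_schwarz hf (Aop_bdd hf); rewrite -/(b 0%N) -/(b 1%N) => h2.
have h3 : Ir P (fun y => f y * Aop f y) ^+ 2 <= (mu * b 0%N) ^+ 2.
 by apply: le_trans h2 _; rewrite exprMn [_ ^+ 2 * _]mulrC [b 0%N ^+ 2]expr2 -mulrA [_ * mu ^+ 2]mulrC; apply: ler_wpM2l.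
apply: le_trans (ler_norm _) _; rewrite -[X in _ <= X]ger0_norm; last exact: mulr_ge0.
by rewrite -[X in X <= _]sqrtr_sqr -[X in _ <= X]sqrtr_sqr ler_sqrt// sqr_ge0.
Qed.

End ReflectionPositiveKernel.

(** * Surface integrals in terms of the uniform probability *)

Section SphereIntegral.
Context {R : realType} {N : nat}.
Local Notation X := (N.+1.-tuple R).
Local Notation P := (@sph R N.+1).
Local Notation ind b := ((b%R : bool)%:R : R).

Definition area : R := N.+1%:R * @vball R N.+1.

Lemma area_gt0 : 0 < area.
Proof. by rewrite mulr_gt0// vball_gt0. Qed.

Lemma sph_unit_eq (g h : X -> \bar R) : mbl g -> mbl h -> enneg g ->
 enneg h -> (forall y, enorm y = 1 -> g y = h y) -> (\int[P]_y g y = \int[P]_y h y)%E.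
Proof.
move=> mg mh g0 h0 gh; rewrite (sph_unit (ltn0Sn N) mg g0) (sph_unit (ltn0Sn N) mh h0); apply: eq_integral => y _.
by case: eqP => [/gh ->|_]; rewrite // !mul0e.
Qed.

Lemma sphere_intE (g h : X -> \bar R) : mbl h -> enneg h ->
 (forall y, enorm y = 1 -> g y = h y) -> sphere_int g = (area%:E * \int[P]_y h y)%E.
Proof.
move=> mh h0 gh.
pose h' y := ((ind (0 < enorm y))%:E * h y)%E.
have mh' : mbl h' by rewrite /h'; meas.
have h'0 y : (0 <= h' y)%E by rewrite mule_ge0// lee_fin.
rewrite (sph_unit_eq mh mh' h0 h'0); last by move=> y y1; rewrite /h' y1 ltr01 mul1e.
have E x : (if ((0 < enorm x) && (enorm x < 1))%R then g (tscale (enorm x)^-1%R x) else 0%E) =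
 ((ind (enorm x < 1))%:E * h' (nrm x))%E.
 rewrite /h'; have := enorm_ge0 x; rewrite le_eqVlt => /predU1P[x0|x0].
  by rewrite -x0 ltxx/= /nrm enormZ -x0 mulr0 ltxx mul0e mule0.
 rewrite (enorm_nrm x0) x0 ltr01 mul1e /=; case: ifP => _; last by rewrite mul0e.
 by rewrite mul1e; apply: gh; exact: enorm_nrm.
have mF : mbl (fun x : X => ((ind (enorm x < 1))%:E * h' (nrm x))%E).
 apply: emeasurable_funM; first by meas.
 side.
have F0 x : (0 <= (ind (enorm x < 1))%:E * h' (nrm x))%E by rewrite mule_ge0// lee_fin.
rewrite /sphere_int (_ : (fun x => _) = (fun x : X => ((ind (enorm x < 1))%:E * h' (nrm x))%E)); last by apply/funext => x; exact: E.
rewrite (iintE mF F0) (sph_int mh' h'0) muleA -EFinM /area -mulrA mulfV ?mulr1//.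
by rewrite gt_eqF// vball_gt0.
Qed.

Lemma sphere_area_eq : sphere_area N.+1 = area.
Proof.
rewrite /sphere_area (sphere_intE (h := fun=> 1%E))//.
have -> : (\int[P]_y (1 : \bar R) = 1)%E.
 by have := IrE (L1_P_cst N.+1 (1 : R)); rewrite (@Ir_P_cst R N.+1).
by rewrite mule1.
Qed.

Lemma LpS_powE (r : R) (u h : X -> R) : mbl h -> (forall y, enorm y = 1 -> u y = h y) ->
 LpS_pow r u = (area%:E * \int[P]_y (`|h y| `^ r)%:E)%E.
Proof.
move=> mh uh; apply: sphere_intE; first by meas.
 side.
by move=> y y1; rewrite uh.
Qed.

Lemma LpS_powE_L1 (r : R) (u h : X -> R) : L1 P (fun y => `|h y| `^ r) -> mbl h ->
 (forall y, enorm y = 1 -> u y = h y) -> LpS_pow r u = (area * Ir P (fun y => `|h y| `^ r))%:E.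
Proof. by move=> hL mh uh; rewrite (LpS_powE r mh uh) (IrE hL) EFinM. Qed.

Lemma sphere_rintE (g h : X -> R) : L1 P h -> (forall y, enorm y = 1 -> g y = h y) -> sphere_rint g = area * Ir P h.
Proof.
move=> hL gh; have mh := L1_meas hL; have mhn := L1_meas (L1_N hL).
have lp := L1_pos hL; have ln := L1_neg hL; have mp := L1_meas lp; have mn := L1_meas ln.
rewrite /sphere_rint (sphere_intE (h := fun y => (pos h y)%:E)); [|by meas|by move=> y; rewrite lee_fin pos_ge0|]; last first.
 by move=> y y1; rewrite gh.
rewrite (sphere_intE (h := fun y => (neg h y)%:E)); [|by meas|by move=> y; rewrite lee_fin neg_ge0|]; last first.
 by move=> y y1; rewrite gh.
rewrite (IrE lp) (IrE ln) -!EFinM -EFinB /= -mulrBr -(Ir_B lp ln); congr (_ * _); apply: Ir_ext => y.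
by rewrite -pos_neg.
Qed.

(** Extends a function known on the sphere along rays, with value 0 at the origin, so that
    measurability on the sphere becomes measurability everywhere. *)
Definition sext (u : X -> R) y : R := if 0 < enorm y then u (nrm y) else 0.

Lemma sext_unit u y : enorm y = 1 -> sext u y = u y.
Proof. by move=> y1; rewrite /sext y1 ltr01 nrm1. Qed.

Lemma meas_sext u : measurable_fun (@unit_sphere R N.+1) u -> mbl (sext u).
Proof.
move=> mu.
have mS : measurable (@unit_sphere R N.+1).
 have me : mbl (@enorm R N.+1) by meas.
 have := me measurableT [set 1] (measurable_set1 _); rewrite setTI.
 side.
have mb : mbl (fun y : X => 0 < enorm y) by meas.
apply: measurable_fun_if => //.
have mD : measurable (setT `&` (fun y : X => 0 < enorm y) @^-1` [set true]) by exact: mb.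
have mn : mbl (@nrm R N.+1) by meas.
apply: (measurable_comp mS _ mu); last exact: measurable_funS mn.
by move=> _ [y [_ y0] <-]; rewrite /unit_sphere /=; exact: enorm_nrm.
Qed.

End SphereIntegral.

(** Here [N = n - 1], [s = (n - alpha) / 2] and [q = n / (s - beta)]. The last two inequalities say
    that [N / q < min s (N - s)]; their sum gives [q > 2], and the last one is [p < q]. *)
Record prm (R : realType) (N : nat) := Prm {
 prm_s : R; prm_q : R;
 prm_N : (1 < N)%N;
 prm_s0 : 0 < prm_s; prm_sN : prm_s < N%:R;
 prm_qs : N%:R < prm_q * prm_s; prm_qN : N%:R < prm_q * (N%:R - prm_s) }.

(** * The extremal problem *)

Section Setting.
Context {R : realType} {N : nat}.
Variable pr : prm R N.
Local Notation X := (N.+1.-tuple R).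
Local Notation P := (@sph R N.+1).
Local Notation M := (@hyp R N.+1).
Local Notation s := (prm_s pr).
Local Notation q := (prm_q pr).
Local Notation T := (Top s).
Local Notation "'IP' y , F" := (Ir P (fun y => F)) (at level 200, y name).
Local Notation "'IM' x , F" := (Ir M (fun x => F)) (at level 200, x name).
Local Notation ind b := ((b%R : bool)%:R : R).
Implicit Types (x y e : X) (u v f : X -> R).

Definition pp : R := N%:R / (N%:R - s).
Local Notation p := pp.

Let N0 : (0 < N)%N. Proof. exact: ltnW (prm_N pr). Qed.
Let Np0 : 0 < N%:R :> R. Proof. by rewrite ltr0n. Qed.
Let s0 := prm_s0 pr.
Let s0' : 0 <= s. Proof. exact: ltW. Qed.
Let sN := prm_sN pr.
Let Ns : 0 < N%:R - s. Proof. by rewrite subr_gt0. Qed.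

Lemma p_gt1 : 1 < p.
Proof. by rewrite /p ltr_pdivlMr// mul1r ltrBlDr ltrDl. Qed.
Lemma p_gt0 : 0 < p.
Proof. exact: lt_trans p_gt1. Qed.
Lemma q_gt2 : 2 < q.
Proof.
have := ltrD (prm_qs pr) (prm_qN pr).
have -> : q * s + q * (N%:R - s) = q * N%:R by ring.
have -> : N%:R + N%:R = 2 * N%:R :> R by ring.
by rewrite ltr_pM2r.
Qed.
Lemma q_gt0 : 0 < q.
Proof. by apply: lt_trans q_gt2. Qed.
Lemma p_lt_q : p < q.
Proof. by rewrite /p ltr_pdivrMr// prm_qN. Qed.

Definition Lp u := mbl u /\ L1 P (fun y => `|u y| `^ p).
Definition Np u : R := (IP y, `|u y| `^ p).
Definition Nq u : R := (IM x, `|T u x| `^ q).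

Lemma Lp_meas u : Lp u -> mbl u. Proof. by case. Qed.
Lemma Lp_pow u : Lp u -> L1 P (fun y => `|u y| `^ p). Proof. by case. Qed.
Lemma LpL1 u : Lp u -> L1 P u.
Proof. by move=> [mu hu]; exact: (Lp_L1 (ltW p_gt1) mu hu). Qed.
Lemma Np_ge0 u : 0 <= Np u.
Proof. by apply: Ir_ge0 => y; exact: powR_ge0. Qed.
Lemma Nq_ge0 u : 0 <= Nq u.
Proof. by apply: Ir_ge0 => y; exact: powR_ge0. Qed.
Ltac pos_ext ::= first
 [ exact: hgt_gt0 | exact: phi_gt0 | exact: K_ge0 | exact: Np_ge0 | exact: Nq_ge0 | exact: p_gt0
 | exact: q_gt0 | exact: pos_ge0 | exact: neg_ge0 | apply: Ir_ge0 | apply: Top_ge0 ].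

Lemma Lp_bd u (c : R) : mbl u -> (forall y, `|u y| <= c) -> Lp u.
Proof.
move=> mu uc; split=> //; apply: (@L1_P_bd _ _ _ (c `^ p)); first by meas.
move=> y; rewrite ger0_norm ?powR_ge0//; apply: powR_le => //; exact: ltW p_gt0.
Qed.
Lemma Lp_cst c : Lp (fun=> c).
Proof. by apply: (@Lp_bd _ `|c|) => //; exact: measurable_cst. Qed.
Lemma Lp_Z c u : Lp u -> Lp (fun y => c * u y).
Proof.
move=> [mu hu]; split; first by meas.
by apply: (L1_ext _ (L1_Z (`|c| `^ p) hu)) => y; rewrite normrM powRM.
Qed.
Lemma Np_Z c u : Lp u -> Np (fun y => c * u y) = `|c| `^ p * Np u.
Proof.
by move=> [mu hu]; rewrite /Np -(Ir_Z _ hu); apply: Ir_ext => y; rewrite normrM powRM.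
Qed.
Lemma Nq_Z c u : L1 M (fun x => `|T u x| `^ q) -> Lp u -> Nq (fun y => c * u y) = `|c| `^ q * Nq u.
Proof.
move=> hT /LpL1 hu; rewrite /Nq -(Ir_Z _ hT); apply: Ir_ext => x.
by rewrite (Top_Z s0' _ _ hu) normrM powRM.
Qed.
Lemma Lp_D u v : Lp u -> Lp v -> Lp (fun y => u y + v y).
Proof.
move=> [mu hu] [mv hv]; split; first by meas.
apply: (L1_le (L1_Z (2 `^ p) (L1_D hu hv))); first by meas.
move=> y; rewrite ger0_norm ?powR_ge0//.
have p0 := ltW p_gt0.
apply: le_trans (@powR_le _ _ _ p p0 (normr_ge0 _) (ler_normD _ _)) _.
case/orP: (le_total `|u y| `|v y|) => h.
 apply: (le_trans (@powR_le _ _ (2 * `|v y|) p p0 _ _)); [by rewrite addr_ge0|by rewrite mulrDl mul1r lerD2r|].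
 by rewrite powRM// ler_wpM2l ?powR_ge0// lerDr powR_ge0.
apply: (le_trans (@powR_le _ _ (2 * `|u y|) p p0 _ _)); [by rewrite addr_ge0|by rewrite mulrDl mul1r lerD2l|].
by rewrite powRM// ler_wpM2l ?powR_ge0// lerDl powR_ge0.
Qed.
Lemma Lp_abs u : Lp u -> Lp (fun y => `|u y|).
Proof. by move=> [mu hu]; split; [meas|apply: (L1_ext _ hu) => y; rewrite normr_id]. Qed.
Lemma Np_abs u : Np (fun y => `|u y|) = Np u.
Proof. by apply: Ir_ext => y; rewrite normr_id. Qed.
Lemma Lp_le u v : Lp u -> mbl v -> (forall y, `|v y| <= `|u y|) -> Lp v.
Proof.
move=> [mu hu] mv vu; split=> //; apply: (L1_le hu); first by meas.
by move=> y; rewrite ger0_norm ?powR_ge0//; apply: powR_le => //; exact: ltW p_gt0.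
Qed.
Lemma Lp_refl e u : dotp e e = 1 -> Lp u -> Lp (fun y => u (refl e y)) /\ Np (fun y => u (refl e y)) = Np u.
Proof.
move=> e1 [mu hu]; have mp := L1_meas hu.
have [h1 h2] := @P_refl _ _ e _ e1 mp; split; last exact: h2.
split; last exact: h1.
by apply: (measurableT_comp mu); apply: meas_refl; meas.
Qed.

Lemma Ir_abs_le1 u : Lp u -> Np u <= 1 -> (IP y, `|u y|) <= 2.
Proof.
move=> hu u1; have h1 := L1_P_cst N.+1 (1 : R); have h2 := Lp_pow hu.
apply: (le_trans (y := (IP y, 1 + `|u y| `^ p))).
 apply: Ir_le; [exact: L1_abs (LpL1 hu)|exact: L1_D|].
 move=> y; case: (leP `|u y| 1) => h; first by rewrite (le_trans h)// lerDl powR_ge0.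
 by rewrite (le_trans (le1r_powR (ltW h) (ltW p_gt1)))// lerDr.
rewrite (Ir_D h1 h2) (@Ir_P_cst R N.+1 1).
by have -> : 2 = 1 + 1 :> R by []; rewrite lerD2l.
Qed.

Lemma Top_le_1 u x : Lp u -> Np u <= 1 -> `|T u x| <= 1.
Proof.
move=> hu u1; apply: le_trans (Top_abs s0' x (LpL1 hu)) _.
apply: (T_le1 N0 x s0 sN (erefl p)) => //.
- by apply: meas_norm; exact: Lp_meas.
- exact: Lp_pow.
Qed.

Let q_bd := T_bound N0 s0 sN (prm_qs pr) (prm_qN pr).

Definition Cset : set R := [set Nq u | u in [set u | Lp u /\ Np u <= 1]].
(** The [q]-th power of the best constant: [Nq u <= Cq * Np u^(q/p)], see [Nq_le]. *)
Definition Cq : R := sup Cset.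

Lemma Cset_sup : has_sup Cset.
Proof.
split; first by exists (Nq (fun=> 0)), (fun=> 0) => //; split; [exact: Lp_cst|
 rewrite /Np (Ir_ext _ (g := fun=> 0)) ?(@Ir_0 _ _ _ P)// => y; rewrite normr0 powR0// gt_eqF// p_gt0].
have [C C0 hC] := q_bd; exists C => _ [u [hu u1] <-].
by have [_ ->] := hC u (Lp_meas hu) (Lp_pow hu) u1.
Qed.

Lemma Nq_L1 u : Lp u -> L1 M (fun x => `|T u x| `^ q).
Proof.
move=> hu; have [C C0 hC] := q_bd.
pose c := (Np u + 1) `^ (- p^-1).
have n1 : 0 < Np u + 1 by rewrite ltr_wpDl// Np_ge0.
have c0 : 0 < c by exact: powR_gt0.
have cu : Np (fun y => c * u y) <= 1.
 rewrite (Np_Z _ hu) (gtr0_norm c0) /c -powRrM mulNr mulVf ?gt_eqF ?p_gt0// powR_inv1 ?(ltW n1)//.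
 by rewrite mulrC ler_pdivrMr// mul1r lerDl.
have hcu := Lp_Z c hu.
have [h _] := hC _ (Lp_meas hcu) (Lp_pow hcu) cu.
apply: (L1_ext _ (L1_Z (c `^ (- q)) h)) => x.
rewrite (Top_Z s0' _ _ (LpL1 hu)) normrM powRM// (gtr0_norm c0) mulrA -powRD1 ?gt_eqF//.
by rewrite addNr powRr0 mul1r.
Qed.

Lemma Nq_le1 u : Lp u -> Np u <= 1 -> Nq u <= Cq.
Proof. by move=> hu u1; apply: (sup_upper_bound Cset_sup); exists u. Qed.

Lemma Nq_le_bd u (t : R) : 0 < t -> Lp u -> Np u <= t `^ p -> Nq u <= Cq * t `^ q.
Proof.
move=> t0 hu ut.
have ti : 0 < t^-1 by rewrite invr_gt0.
have := Nq_le1 (Lp_Z t^-1 hu); rewrite (Np_Z _ hu) (Nq_Z _ (Nq_L1 hu) hu) (gtr0_norm ti).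
have iP (r : R) : t^-1 `^ r = (t `^ r)^-1 by rewrite -[r in LHS]opprK inv_powRN// powRN.
have tr (r : R) : 0 < t `^ r by exact: powR_gt0.
rewrite !iP => H.
have : (t `^ q)^-1 * Nq u <= Cq by apply: H; rewrite mulrC ler_pdivrMr// mul1r.
by rewrite mulrC ler_pdivrMr.
Qed.

Lemma phi_q_L1 : L1 M (fun x => phi s x `^ q).
Proof. by apply: (phi_powR_L1 N0 s0 sN); [exact: prm_qs|exact: prm_qN]. Qed.

Lemma Nq1E : Nq (fun=> 1) = (IM x, phi s x `^ q).
Proof. by apply: Ir_ext => x; rewrite ger0_norm//; exact/ltW/phi_gt0. Qed.

Lemma hgt_le2 x : enorm x < 1 -> hgt x <= 2.
Proof.
move=> x1; rewrite -(ler_pXn2r (ltn0Sn 1)) ?nnegrE ?(ltW (hgt_gt0 x))// hgt_sqr -enormE.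
by have := enorm_ge0 x; move: x1; move: (enorm x) => t; nra.
Qed.

Lemma M_pos (f : X -> R) : L1 M f -> nonneg f ->
 (forall x, enorm x < 1 -> (forall i, tnth x i != 0) -> 0 < f x) -> 0 < Ir M f.
Proof.
move=> hf f0 f1; have mf := L1_meas hf.
rewrite lt_neqAle Ir_ge0// andbT eq_sym; apply/negP => /eqP h.
pose c x : R := \prod_(i < N.+1) ind (tnth x i != 0).
have mc : mbl c.
 apply: measurable_prod => i _.
 rewrite (_ : (fun x => _) = (fun x : X => ind (0 < `|tnth x i|)%R)); first by meas.
 by apply/funext => x; rewrite normr_gt0.
pose g x : R := c x * ind (enorm x < 1).
have mg : mbl g by rewrite /g; meas.
have c0 x : 0 <= c x by apply: prodr_ge0 => i _.
have g0 x : 0 <= g x by rewrite mulr_ge0.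
have ae0 : ae_eq M setT (EFin \o f) (cst 0%E).
 apply/(ae_eq_integral_abs M measurableT); first exact/measurable_EFinP.
 rewrite (eq_integral (EFin \o f)); last by move=> x _; rewrite /= ger0_norm.
 by rewrite (IrE hf) h.
have aeg : ae_eq M setT (EFin \o g) (cst 0%E).
 apply: filterS ae0 => x fx _; rewrite /= /g.
 case: (ltP (enorm x) 1) => x1; last by rewrite mulr0.
 have [/forallP hx|hx] := boolP [forall i, tnth x i != 0].
  by have := f1 x x1 hx; have /= [->] := fx I; rewrite ltxx.
 move: hx; rewrite negb_forall => /existsP[i]; rewrite negbK => xi.
 by rewrite /c (bigD1 i)//= xi mul0r mul0r.
have : (\int[M]_x (g x)%:E = 0)%E.
 rewrite -(integral0 M setT); apply: ae_eq_integral => //; exact/measurable_EFinP.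
rewrite hyp_int; [|by meas|side].
have hg x : 0 < hgt (x : X) by exact: hgt_gt0.
apply/eqP; rewrite gt_eqF//.
apply: (lt_le_trans (y := (2^-1%:E * \int[leb N.+1]_x (ind (enorm (x : X) < 1)%R)%:E)%E)).
 by rewrite vballE -EFinM lte_fin mulr_gt0 ?vball_gt0.
rewrite leb_coords; [|by meas|side].
rewrite -int_Zl; [|by rewrite invr_ge0|by apply: emeasurable_funM; meas; exact: meas_EFin|side].
apply: int_le.
- by move=> x; apply: mule_ge0; [rewrite lee_fin invr_ge0|apply: mule_ge0; rewrite lee_fin; [exact: c0|]].
- side.
- by meas.
move=> x; rewrite -!EFinM lee_fin -/(c x) -/(g x) /g; case: (ltP (enorm x) 1) => x1; last by rewrite !mulr0 mul0r.
rewrite mulrC ler_wpM2l ?mulr1// lef_pV2 ?posrE//; exact: hgt_le2.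
Qed.

Lemma Nq1_gt0 : 0 < Nq (fun=> 1).
Proof. by rewrite Nq1E; apply: (M_pos phi_q_L1) => x *; rewrite ?powR_ge0// !powR_gt0 ?phi_gt0. Qed.

Lemma Np1 : Np (fun=> 1) = 1.
Proof. by rewrite /Np (Ir_ext _ (g := fun=> 1)) ?(@Ir_P_cst R N.+1)// => y; rewrite normr1 powR1. Qed.

Lemma Cq_gt0 : 0 < Cq.
Proof. by apply: lt_le_trans Nq1_gt0 (Nq_le1 (Lp_cst 1) _); rewrite Np1. Qed.

Lemma Nq_le u : Lp u -> Nq u <= Cq * Np u `^ (q / p).
Proof.
move=> hu; have [h0|h0] := eqVneq (Np u) 0; last first.
 have n0 : 0 < Np u by rewrite lt_neqAle eq_sym h0 Np_ge0.
 have := @Nq_le_bd u (Np u `^ p^-1) (powR_gt0 _ n0) hu.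
 rewrite -!powRrM mulVf ?gt_eqF ?p_gt0// powRr1 ?(ltW n0)// [p^-1 * q]mulrC; exact.
rewrite h0 powR0 ?mulf_neq0 ?invr_eq0 ?gt_eqF ?q_gt0 ?p_gt0// mulr0.
rewrite leNgt; apply/negP => hq.
have C0 := Cq_gt0; have qq := q_gt0.
(* When [Np u = 0], [Nq_le_bd] holds for every positive [t]; this one makes the bound equal to half
   of [Nq u]. *)
pose t := (Nq u / (2 * Cq)) `^ q^-1.
have d0 : 0 < Nq u / (2 * Cq) by rewrite divr_gt0// mulr_gt0.
have tt0 : 0 < t by exact: powR_gt0.
have := @Nq_le_bd u t tt0 hu; rewrite h0 => /(_ (powR_ge0 _ _)).
rewrite /t -powRrM mulVf ?gt_eqF// powRr1 ?(ltW d0)//.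
have -> : Cq * (Nq u / (2 * Cq)) = Nq u / 2 by field; rewrite gt_eqF.
lra.
Qed.

(* Boundedness also holds for a slightly smaller exponent, so a nearly maximal [Nq u]
  forces [|T u|] to be large somewhere. *)
Lemma sup_lower : exists2 k, 0 < k & forall u (S : R), Lp u -> Np u <= 1 -> Cq / 2 <= Nq u ->
 (forall x, `|T u x| <= S) -> k <= S.
Proof.
have C0 := Cq_gt0.
pose m := Num.min s (N%:R - s).
have m0 : 0 < m by rewrite lt_min s0.
have qm : N%:R < q * m by rewrite /m minr_pMr ?lt_min ?prm_qs ?prm_qN// ltW ?q_gt0.
(* A smaller exponent still above [N / min s (N - s)], so that [T] remains bounded; the other
   [q - q1] powers of [|T u|] go into the supremum. *)
have [q1 [q1q q1m]] : exists q1, q1 < q /\ N%:R < q1 * m.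
 exists ((N%:R / m + q) / 2).
 have h : N%:R / m < q by rewrite ltr_pdivrMr.
 by split; [lra|rewrite -ltr_pdivrMr//; lra].
have q10 : 0 < q1 by rewrite -(pmulr_lgt0 _ m0) (lt_trans Np0).
have h1 : N%:R < q1 * s by apply: lt_le_trans q1m _; rewrite ler_pM2l// ge_min lexx.
have h2 : N%:R < q1 * (N%:R - s) by apply: lt_le_trans q1m _; rewrite ler_pM2l// ge_min lexx orbT.
have [D D0 hD] := T_bound N0 s0 sN h1 h2.
have E0 : 0 < Cq / (2 * D) by rewrite divr_gt0// mulr_gt0.
exists ((Cq / (2 * D)) `^ (q - q1)^-1); first exact: powR_gt0.
move=> u S hu u1 uC uS.
have S0 : 0 <= S by apply: le_trans (uS (t0 _)).
have [k1 k2] := hD u (Lp_meas hu) (Lp_pow hu) u1.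
have dq : 0 < q - q1 by rewrite subr_gt0.
have : Cq / 2 <= S `^ (q - q1) * D.
 apply: le_trans uC _; apply: (le_trans (y := (IM x, S `^ (q - q1) * `|T u x| `^ q1))).
  apply: Ir_le; [exact: Nq_L1|exact: L1_Z|move=> x].
  have -> : `|T u x| `^ q = `|T u x| `^ (q - q1) * `|T u x| `^ q1.
   have [->|h] := eqVneq `|T u x| 0; last by rewrite -powRD1// subrK.
   by rewrite !powR0 ?mul0r ?gt_eqF// q_gt0.
  by rewrite ler_wpM2r ?powR_ge0//; apply: powR_le => //; exact: ltW.
 by rewrite (Ir_Z _ k1) ler_wpM2l ?powR_ge0.
have E : S = (S `^ (q - q1)) `^ (q - q1)^-1 by rewrite -powRrM mulfV ?gt_eqF// powRr1.
move=> h; rewrite [leRHS]E; apply: powR_le; [by rewrite invr_ge0 ltW|exact: ltW|].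
by rewrite invfM mulrA ler_pdivrMr.
Qed.

(** * Conformal moves and centering *)

Lemma ucf_Lp (c k : R) u : 0 < c -> c ^+ 2 = 1 + k ^+ 2 -> Lp u ->
 Lp (ucf c k s u) /\ Np (ucf c k s u) = Np u.
Proof.
move=> c0 ck [mu hu]; have mp := L1_meas hu.
have mU : mbl (ucf c k s u) by exact: meas_ucf.
have [h1 h2] := P_boost c0 ck N0 mp.
have m1 : mbl (fun y => `|u (nrm (cboost c k y))| `^ p * dil c k y ^- N).
 apply: meas_mul; first exact: (measurableT_comp mp (meas_Psi c k (@measurable_id _ _ setT))).
 by apply: meas_inv; apply: measurable_funX; exact: meas_dil.
have m2 : mbl (fun y => `|ucf c k s u y| `^ p) by meas.
have E y : enorm y = 1 -> `|u (nrm (cboost c k y))| `^ p * dil c k y ^- N = `|ucf c k s u y| `^ p.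
 by move=> y1; rewrite (@ucf_pow _ _ _ _ c0 ck s u p)// lt_eqF// prm_sN.
have [k1 k2] := P_unit (ltn0Sn N) m1 m2 E.
split; first by split=> //; apply: k1; exact: h1.
exact: (etrans (esym k2) h2).
Qed.

Lemma ucf_Nq (c k : R) u : 0 < c -> c ^+ 2 = 1 + k ^+ 2 -> Lp u -> Nq (ucf c k s u) = Nq u.
Proof.
move=> c0 ck hu; have mu := Lp_meas hu.
have mf : mbl (fun x => `|T u x| `^ q) by meas.
have [_ h] := @Ir_transfer _ _ _ M (boost c k) (fun=> 1) _ mf (fun=> ler01)
 (fun h mh h0 => etrans (eq_int _ (fun x => mule1 _)) (hyp_boost c0 ck mh h0))
 (meas_boost c k (@measurable_id _ _ setT)) (measurable_cst _).
rewrite /Nq -h; apply: Ir_ext => x; by rewrite mulr1 (Top_boost c0 ck N0).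
Qed.

(** Boosts along the first axis, after at most one reflection, suffice to carry the origin to any
    prescribed point. *)
Definition moved u v := exists c k, [/\ 0 < c, c ^+ 2 = 1 + k ^+ 2 &
 v = ucf c k s u \/ exists2 e, dotp e e = 1 & v = ucf c k s (fun y => u (refl e y))].

Lemma Nq_refl e u : dotp e e = 1 -> Lp u -> Nq (fun y => u (refl e y)) = Nq u.
Proof.
move=> e1 hu; have mu := Lp_meas hu.
have mf : mbl (fun x => `|T u x| `^ q) by meas.
have [_ h] := @M_refl _ _ e _ e1 mf.
by rewrite /Nq -h; apply: Ir_ext => x; rewrite Top_refl.
Qed.

(** The boost takes the origin to a point of norm [|x0|], and one reflection takes that point to
    [x0]. *)
Lemma move_exists u x0 : Lp u -> exists v, [/\ moved u v, Lp v, Np v = Np u, Nq v = Nq u &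
 T v (t0 _) = T u x0 /\ forall x, exists x', T v x = T u x'].
Proof.
move=> hu; pose c := hgt x0; pose k := enorm x0.
have c0 : 0 < c by exact: hgt_gt0.
have ck : c ^+ 2 = 1 + k ^+ 2 by rewrite hgt_sqr enormE.
have h0 : hgt (t0 N.+1) = 1 :> R by rewrite /hgt -enormE t0E expr0n addr0 sqrtr1.
have ez : enorm (boost c k (t0 N.+1)) = enorm x0.
 have E : hgt (boost c k (t0 N.+1)) = hgt x0 by rewrite hgt_boost// h0 mulr1 tnth_mktuple mulr0 addr0.
 have : dotp (boost c k (t0 N.+1)) (boost c k (t0 N.+1)) = dotp x0 x0.
  by have := hgt_sqr (boost c k (t0 N.+1)); rewrite E hgt_sqr => /addrI.
 by rewrite /enorm => ->.
have key w : Lp w -> exists v, [/\ v = ucf c k s w, Lp v, Np v = Np w, Nq v = Nq w &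
  T v (t0 _) = T w (boost c k (t0 _)) /\ forall x, exists x', T v x = T w x'].
 move=> hw; have [h1 h2] := ucf_Lp c0 ck hw; have mw := Lp_meas hw.
 exists (ucf c k s w); split; [by []|exact: h1|exact: h2|exact: ucf_Nq|].
 by split; [rewrite (Top_boost c0 ck N0)|move=> x; exists (boost c k x); rewrite (Top_boost c0 ck N0)].
case: (refl_exists ez) => [E|[e e1 E]].
 have [v [vE hv v1 v2 [v3 v4]]] := key u hu.
 exists v; split; [|exact: hv|exact: v1|exact: v2|].
  by exists c, k; split; [exact: c0|exact: ck|left].
 by split; [rewrite v3 E|exact: v4].
have [hr r1] := Lp_refl e1 hu.
have [v [vE hv v1 v2 [v3 v4]]] := key _ hr.
exists v; split; [|exact: hv| | |].
- by exists c, k; split; [exact: c0|exact: ck|right; exists e].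
- by rewrite v1.
- by rewrite v2 Nq_refl.
split; first by rewrite v3 -E Top_refl//; exact: (Lp_meas hu).
by move=> x; have [x' ->] := v4 x; exists (refl e x'); rewrite Top_refl//; exact: (Lp_meas hu).
Qed.

Lemma center_exists u (e : R) : Lp u -> Np u <= 1 -> 0 < e -> exists v (S : R), [/\ moved u v, Lp v, Np v = Np u,
 Nq v = Nq u & (forall x, `|T v x| <= S) /\ (1 - e) * S <= `|T v (t0 _)|].
Proof.
move=> hu u1 e0.
pose A := [set `|T u x| | x in setT].
have hA : has_sup A.
 split; first by exists `|T u (t0 _)|, (t0 _).
 by exists 1 => _ [x _ <-]; exact: Top_le_1.
pose S := sup A.
have uS x : `|T u x| <= S by apply: (sup_upper_bound hA); exists x.
have S0 : 0 <= S by apply: le_trans (uS (t0 _)).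
have [x0 hx0] : exists x0, (1 - e) * S <= `|T u x0|.
 move: S0; rewrite le_eqVlt => /predU1P[<-|S0]; first by exists (t0 _); rewrite mulr0.
 have eS : 0 < e * S by rewrite mulr_gt0.
 have [_ [x0 _ <-] h] := sup_adherent eS hA.
 by exists x0; rewrite mulrBl mul1r ltW.
have [v [mv hv v1 v2 [v3 v4]]] := move_exists x0 hu.
exists v, S; split; [exact: mv|exact: hv|exact: v1|exact: v2|split; last by rewrite v3].
by move=> x; have [x' ->] := v4 x.
Qed.

Lemma hgt_small (t : R) e : dotp e e = 1 -> 1 <= hgt (tscale t e) <= 1 + t ^+ 2.
Proof.
move=> e1; rewrite hgt_ge1/= -(ler_pXn2r (ltn0Sn 1)) ?nnegrE ?(ltW (hgt_gt0 _))//; last side.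
rewrite hgt_sqr dotpZl dotpZr e1 mulr1.
by have := sqr_ge0 t; rewrite -expr2; move: (t ^+ 2) => a a0; nra.
Qed.

Lemma K_expand : exists2 C, 0 <= C & forall (t : R) e y, dotp e e = 1 -> `|t| <= 1 / 4 ->
 `|K s (tscale t e) y - 1 - s * t * dn e y| <= C * t ^+ 2.
Proof.
have [C C0 hC] := powR1_taylor1 (- s).
exists (4 * C + s); first side.
move=> t e y e1 ht.
have /andP[g1 g2] := hgt_small t e1.
have hy : `|dn e y| <= 1.
 by apply: le_trans (dotp_nrm_le _ _) _; rewrite /enorm e1 sqrtr1.
rewrite /K /ker dotpZl; move: (dn e y) hy (hgt _) g1 g2 => d hd g g1 g2.
have t2 : t ^+ 2 <= `|t| / 4.
 by rewrite -(real_normK (num_real t)); have := normr_ge0 t; nra.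
have td : `|t * d| <= `|t| by rewrite normrM ler_piMr.
pose a := g - 1 - t * d.
have ga : `|g - 1| <= t ^+ 2 by rewrite ger0_norm; lra.
have ha : `|a| <= 2 * `|t|.
 by apply: le_trans (ler_normB _ _) _; have := normr_ge0 t; lra.
have a2 : a ^+ 2 <= 4 * t ^+ 2.
 rewrite -(real_normK (num_real a)) -(real_normK (num_real t)).
 by have := normr_ge0 a; nra.
have := hC a ltac:(lra); have -> : 1 + a = g - t * d by rewrite /a; ring.
have -> : (g - t * d) `^ (- s) - 1 - - s * a = (g - t * d) `^ (- s) - 1 - s * t * d + s * (g - 1) by rewrite /a; ring.
move=> h; have h2 : C * a ^+ 2 <= C * (4 * t ^+ 2) by rewrite ler_wpM2l.
set Z := _ - 1 - s * t * d; have -> : Z = (Z + s * (g - 1)) - s * (g - 1) by ring.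
apply: le_trans (ler_normB _ _) _; rewrite normrM (ger0_norm s0').
have h3 : s * `|g - 1| <= s * t ^+ 2 by rewrite ler_wpM2l.
by rewrite -/Z in h; lra.
Qed.

Lemma Top0 u : T u (t0 _) = Ir P u.
Proof.
apply: Ir_ext => y; rewrite /K /ker.
have -> : dn (t0 N.+1) y = 0 :> R by apply: big1 => i _; rewrite tnth_mktuple mul0r.
by rewrite /hgt -enormE t0E expr0n addr0 sqrtr1 subr0 powR1 mul1r.
Qed.

Lemma dotp_nrm_L1 e u : dotp e e = 1 -> L1 P u -> L1 P (fun y => dn e y * u y).
Proof.
move=> e1 hu; apply: (L1_le (L1_abs hu)); first by have := L1_meas hu => mu; meas.
move=> y; rewrite normrM ler_piMl//.
by apply: le_trans (dotp_nrm_le _ _) _; rewrite /enorm e1 sqrtr1.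
Qed.

(* First-order optimality at the origin of an almost maximal value of [|T v|]. *)
Lemma centering : exists2 C, 0 <= C & forall v (S r : R), Lp v -> Np v <= 1 -> 0 < r -> r <= 1 / 4 ->
 (forall x, `|T v x| <= S) -> (1 - r ^+ 2) * S <= `|T v (t0 _)| ->
 forall e, dotp e e = 1 -> `|(IP y, dn e y * v y)| <= C * r.
Proof.
have [C C0 hC] := K_expand.
exists ((2 * C + 2) / s); first side.
move=> v S r hv v1 r0 r4 vS vc e e1.
have hL := LpL1 hv; have hd := dotp_nrm_L1 e1 hL.
have key (t : R) : `|t| <= 1 / 4 ->
 `|T v (tscale t e) - Ir P v - s * t * (IP y, dn e y * v y)| <= C * t ^+ 2 * 2.
 move=> ht; have hK := Top_L1 s0' (tscale t e) hL.
 have hB := L1_B hK hL.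
 have hF : L1 P (fun y => (K s (tscale t e) y * v y - v y) - s * t * (dn e y * v y)).
  by apply: L1_B => //; exact: L1_Z.
 rewrite -(Ir_B hK hL) -(Ir_Z _ hd) -(Ir_B hB (L1_Z _ hd)).
 apply: le_trans (Ir_abs hF) _.
 apply: (le_trans (y := (IP y, C * t ^+ 2 * `|v y|))).
  apply: Ir_le; [exact: L1_abs|by apply: L1_Z; exact: L1_abs|move=> y].
  have -> : K s (tscale t e) y * v y - v y - s * t * (dn e y * v y) =
   (K s (tscale t e) y - 1 - s * t * dn e y) * v y by ring.
  by rewrite normrM ler_wpM2r//; exact: hC.
 rewrite (Ir_Z _ (L1_abs hL)); apply: ler_wpM2l; first side.
 exact: Ir_abs_le1 hv v1.
have S1 : `|T v (t0 _)| <= 1 by exact: Top_le_1.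
rewrite Top0 in vc S1.
move: vc key S1 (vS); move: (Ir P v) (IP y, dn e y * v y) => m I vc key S1 {}vS.
have S2 : S <= `|m| + 2 * r ^+ 2.
 have : r ^+ 2 <= 1 / 16 by rewrite expr2; nra.
 have := le_trans (normr_ge0 _) (vS (t0 _)).
 by have := sqr_ge0 r; move: (r ^+ 2) vc => a; nra.
(* The sign of [t] is chosen so that the linear term adds to [|m|]. Since [S] exceeds [|m|] by at
   most [2 r^2], this forces [s r |I|] to be [O(r^2)]. *)
have [t [tr tmI]] : exists t : R, `|t| = r /\ `|m + s * t * I| = `|m| + s * r * `|I|.
 have nd (a b : R) : 0 <= a * b -> `|a + b| = `|a| + `|b|.
  case: (ltgtP a 0) => [a0|a0|->]; last by rewrite !add0r normr0 add0r.
   by rewrite nmulr_rge0// => b0; rewrite !ler0_norm ?(ltW a0)// ?opprD//; lra.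
  by rewrite pmulr_rge0// => b0; rewrite !ger0_norm ?(ltW a0)//; lra.
 have sr : 0 < s * r by rewrite mulr_gt0.
 have [h|h] := boolP (0 <= m * I).
  exists r; split; first by rewrite gtr0_norm.
  by rewrite nd ?[`|s * r * I|]normrM ?(gtr0_norm sr)// mulrCA mulr_ge0// ltW.
 exists (- r); split; first by rewrite normrN gtr0_norm.
 rewrite -ltNge in h.
 rewrite mulrN mulNr nd ?normrN ?normrM ?(gtr0_norm s0) ?(gtr0_norm r0)//.
 by rewrite mulrN mulrCA -mulrN mulr_ge0 ?oppr_ge0 ?ltW.
have := key t; rewrite tr => /(_ r4); rewrite -(real_normK (num_real t)) tr => h.
rewrite mulrAC ler_pdivlMr//.
have h2 : `|m + s * t * I| <= S + C * r ^+ 2 * 2.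
 have -> : m + s * t * I = T v (tscale t e) - (T v (tscale t e) - m - s * t * I) by ring.
 by apply: le_trans (ler_normB _ _) _; apply: lerD => //; exact: vS.
rewrite tmI in h2.
have h3 : r * (`|I| * s) <= r * ((2 * C + 2) * r).
 have -> : r * (`|I| * s) = s * r * `|I| by ring.
 have -> : r * ((2 * C + 2) * r) = (2 * C + 2) * r ^+ 2 by ring.
 lra.
by rewrite ler_pM2l in h3.
Qed.

(** * Almost maximizers: sign and polarization *)

Let q0 := q_gt0.
Let q1 : 1 <= q. Proof. by apply: ltW; apply: lt_trans q_gt2; rewrite ltr1n. Qed.
Lemma ball_L1 : L1 M (fun x => ind (enorm x < 1)).
Proof.
have h : N%:R < N%:R + 1 :> R by rewrite ltrDl.
have t0 : 0 <= N%:R + 1 :> R by rewrite addr_ge0.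
apply: (L1_le (L1_Z (2 `^ (N%:R + 1)) (hgt_powR_L1 h))); first by meas.
move=> x; rewrite ger0_norm//; case: (ltP (enorm x) 1) => x1; last by rewrite mulr_ge0 ?powR_ge0.
rewrite powRN ler_pdivlMr ?powR_gt0 ?hgt_gt0// mul1r; apply: powR_le => //; first exact/ltW/hgt_gt0.
exact: hgt_le2.
Qed.

Lemma ball_weight_L1 (w : X -> R) c : mbl w -> (forall x, enorm x < 1 -> `|w x| <= c) ->
 L1 M (fun x => ind (enorm x < 1) * w x).
Proof.
move=> mw wc; apply: (L1_le (L1_Z c ball_L1)); first by meas.
move=> x; case: (ltP (enorm x) 1) => x1; last by rewrite mul0r normr0 mulr0.
by rewrite mul1r mulr1; exact: wc.
Qed.

Lemma Top_ball_ge u x : L1 P u -> nonneg u -> enorm x < 1 -> 4 `^ (- s) * Ir P u <= T u x.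
Proof.
move=> hu u0 x1; rewrite -(Ir_Z _ hu); apply: Ir_le; [exact: L1_Z|exact: Top_L1|move=> y].
rewrite ler_wpM2r//; apply: le_trans (K_ge x y s0'); apply: powRN_le => //.
 side.
by have := hgt_le2 x1; lra.
Qed.

(* Replacing [u] by [|u|] increases [|T u|] by [2 min(T u+, T u-)]. *)
Lemma sign_defect : exists2 C, 0 < C & forall u (r : R), Lp u -> Np u <= 1 -> Cq * (1 - r) <= Nq u ->
 Num.min (Ir P (pos u)) (Ir P (neg u)) `^ q <= C * r.
Proof.
have B0 : 0 < (IM x, ind (enorm x < 1)).
 by apply: M_pos; [exact: ball_L1|by []|move=> x -> _].
move: B0; set B := Ir M _ => B0.
(* On the unit ball [K >= 4^-s], so [2 min (T u+) (T u-)] is at least [d] times the smaller of the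
   two means there; [B] is the volume of that ball. *)
pose d := 2 * 4 `^ (- s) : R.
have d0 : 0 < d by rewrite mulr_gt0// powR_gt0.
have dq : 0 < d `^ q by exact: powR_gt0.
exists (Cq / (B * d `^ q)); first by rewrite divr_gt0 ?mulr_gt0// Cq_gt0.
move=> u r hu u1 uC; have hL := LpL1 hu.
have hp := L1_pos hL; have hn := L1_neg hL.
have ha := Lp_abs hu.
have TaE x : T (fun y => `|u y|) x = T (pos u) x + T (neg u) x.
 by rewrite -(Top_D s0' _ hp hn); apply: Top_ext => y; exact: abs_pos_neg.
have TuE x : T u x = T (pos u) x - T (neg u) x.
 by rewrite -(Top_B s0' _ hp hn); apply: Top_ext => y; exact: pos_neg.
have tp x : 0 <= T (pos u) x by apply: Top_ge0 => y; exact: pos_ge0.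
have tn x : 0 <= T (neg u) x by apply: Top_ge0 => y; exact: neg_ge0.
have mp := L1_meas hp; have mn := L1_meas hn.
pose m := Num.min (Ir P (pos u)) (Ir P (neg u)).
have m0 : 0 <= m by rewrite /m le_min !Ir_ge0// => y; [exact: neg_ge0|exact: pos_ge0].
have key x : `|T u x| `^ q + (d * m) `^ q * ind (enorm x < 1) <= `|T (fun y => `|u y|) x| `^ q.
 rewrite TuE TaE [X in _ <= X `^ _]ger0_norm ?addr_ge0// -(min_norm (tp x) (tn x)).
 set a := T (pos u) x; set b := T (neg u) x.
 have mab : 0 <= 2 * Num.min a b by rewrite mulr_ge0// le_min tp tn.
 apply: le_trans (powR_superadd q1 (normr_ge0 _) mab); rewrite lerD2l.
 case: (ltP (enorm x) 1) => x1; last by rewrite mulr0 powR_ge0.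
 rewrite mulr1; apply: powR_le; [exact: ltW|side|].
 rewrite /d -mulrA ler_pM2l// le_min; apply/andP; split.
  apply: le_trans (Top_ball_ge hp (pos_ge0 u) x1); rewrite ler_pM2l ?powR_gt0//.
  by rewrite /m ge_min lexx.
 apply: le_trans (Top_ball_ge hn (neg_ge0 u) x1); rewrite ler_pM2l ?powR_gt0//.
 by rewrite /m ge_min lexx orbT.
have h1 := Nq_L1 hu; have h2 := L1_Z ((d * m) `^ q) ball_L1.
have := Ir_le (L1_D h1 h2) (Nq_L1 ha) key.
rewrite (Ir_D h1 h2) (Ir_Z _ ball_L1) -/B.
have h3 : Nq (fun y => `|u y|) <= Cq by apply: Nq_le1 => //; rewrite Np_abs.
move=> h4; have h5 := le_trans h4 h3.
rewrite -/m mulrAC ler_pdivlMr ?mulr_gt0//.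
have -> : m `^ q * (B * d `^ q) = (d * m) `^ q * B by rewrite powRM ?(ltW d0)//; ring.
by move: h5 uC; rewrite -/(Nq u); move: (Nq u) => A; lra.
Qed.

(** Two-point polarization: of the values at two mirror points the larger one is put on the side
    [0 <= e.y]. *)
Definition pol e u y : R := if 0 <= dotp e y then Num.max (u y) (u (refl e y)) else Num.min (u y) (u (refl e y)).

Lemma pol_refl e u y : dotp e e = 1 ->
 (pol e u y = u y /\ pol e u (refl e y) = u (refl e y)) \/
 (pol e u y = u (refl e y) /\ pol e u (refl e y) = u y).
Proof.
move=> e1; rewrite /pol dotp_refl_self// oppr_ge0 reflK//.
case: (ltgtP (dotp e y) 0) => h.
- case/orP: (le_total (u y) (u (refl e y))) => k; [left|right].
  by rewrite min_l// max_l.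
 by rewrite min_r// max_r.
- case/orP: (le_total (u y) (u (refl e y))) => k; [right|left].
  by rewrite max_r// min_r.
 by rewrite max_l// min_l.
- by left; rewrite (refl_fix h) maxxx.
Qed.

Lemma meas_pol e u : mbl u -> mbl (pol e u).
Proof.
move=> mu; have mr : mbl (fun y => u (refl e y)).
 by apply: (measurableT_comp mu); apply: meas_refl; meas.
by rewrite /pol; meas.
Qed.

Lemma pol_Lp e u : dotp e e = 1 -> Lp u -> Lp (pol e u) /\ Np (pol e u) = Np u.
Proof.
move=> e1 hu; have [hr _] := Lp_refl e1 hu.
have mu := Lp_meas hu.
have hP : Lp (pol e u).
 apply: (Lp_le (Lp_D (Lp_abs hu) (Lp_abs hr))); first exact: meas_pol.
 move=> y; rewrite [leRHS]ger0_norm ?addr_ge0//.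
 by case: (pol_refl u y e1) => -[-> _]; rewrite ?lerDl ?lerDr.
split=> //; rewrite /Np (Ir_P_half e1 (Lp_pow hP)) (Ir_P_half e1 (Lp_pow hu)); congr (_ * _).
apply: Ir_ext => y; case: (pol_refl u y e1) => -[-> ->] //; exact: addrC.
Qed.

(** [K_diff] turns the kernel difference across the mirror into a first moment of [u]; the sign
    condition keeps all contributions nonnegative. *)
Lemma Top_anti_ge e u x : dotp e e = 1 -> L1 P u -> (forall y, u (refl e y) = - u y) ->
 (forall y, 0 <= dn e y * u y) -> 0 <= dotp e x ->
 s * (2 * hgt x) `^ (- s - 1) * dotp e x * (IP y, dn e y * u y) <= T u x.
Proof.
move=> e1 hu ua up ex; rewrite (Top_anti s0' x e1 hu ua).
have hd := dotp_nrm_L1 e1 hu.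
pose c := 2 * s * (2 * hgt x) `^ (- s - 1) * dotp e x.
have -> : s * (2 * hgt x) `^ (- s - 1) * dotp e x * (IP y, dn e y * u y) =
 2^-1 * (IP y, c * (dn e y * u y)).
 by rewrite (Ir_Z _ hd) /c; move: (Ir P _) => I; field.
rewrite ler_pM2l ?invr_gt0//.
have hK : L1 P (fun y => (K s x y - K s x (refl e y)) * u y).
 have hr : L1 P (fun y => K s x (refl e y) * u y).
  by apply: (L1_ext _ (Top_L1 s0' (refl e x) hu)) => y; rewrite K_reflC.
 by apply: (L1_ext _ (L1_B (Top_L1 s0' x hu) hr)) => y; rewrite mulrBl.
apply: Ir_le; [exact: L1_Z|exact: hK|move=> y].
rewrite /c; have := up y; set D := dn e y; set U := u y => DU.
case: (ltgtP D 0) => h.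
- have U0 : U <= 0 by rewrite -(nmulr_rge0 _ h).
 have h' : 0 <= dotp e x * dn e (refl e y).
  by rewrite nrm_refl// dotp_refl_self// mulr_ge0// oppr_ge0 ltW.
 have /andP[k _] := K_diff s0' e1 h'; rewrite reflK// nrm_refl// dotp_refl_self// in k.
 rewrite -/D in k.
 have : (K s x (refl e y) - K s x y) * U <= 2 * s * (2 * hgt x) `^ (- s - 1) * (dotp e x * - D) * U.
  by rewrite ler_wnM2r.
 move: (2 * s * _) (K s x y) (K s x (refl e y)) (dotp e x) => a b c' f *; lra.
- have U0 : 0 <= U by rewrite -(pmulr_rge0 _ h).
 have h' : 0 <= dotp e x * dn e y by rewrite mulr_ge0// ltW.
 have /andP[k _] := K_diff s0' e1 h'; rewrite -/D in k.
 have : 2 * s * (2 * hgt x) `^ (- s - 1) * (dotp e x * D) * U <= (K s x y - K s x (refl e y)) * U.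
  by rewrite ler_wpM2r.
 move: (2 * s * _) (K s x y) (K s x (refl e y)) (dotp e x) => a b c' f *; lra.
have -> : U = 0.
 have ey : dotp e y = 0.
  move: h; rewrite /D /nrm dotpZr => /eqP; rewrite mulf_eq0 invr_eq0 => /orP[|] /eqP//.
  by move=> /enorm_eq0 ->; apply: big1 => i _; rewrite tnth_mktuple mulr0.
 by have := ua y; rewrite (refl_fix ey) -/U; lra.
by rewrite !mulr0.
Qed.

Lemma Top_half e u x : dotp e e = 1 -> L1 P u -> mbl u ->
 T u x + T u (refl e x) = T (fun y => u y + u (refl e y)) x.
Proof.
move=> e1 hu mu; have [k1 _] := @P_refl _ _ e u e1 mu.
by rewrite (Top_D s0' _ hu (k1 hu)) (Top_refl _ _ e1 mu).
Qed.

(* Two-point rearrangement: [J1] and [J2] measure how much mass polarization moves across the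
  mirror in either direction; both being large would increase [Nq] beyond its supremum. *)
Lemma pol_defect : exists2 C, 0 < C & forall u e (r : R), Lp u -> Np u <= 1 -> nonneg u ->
 Cq * (1 - r) <= Nq u -> dotp e e = 1 ->
 Num.min (IP y, dn e y * (pol e u y - u y))
     (IP y, dn e y * (pol e u y - u (refl e y))) `^ q <= C * r.
Proof.
pose d x : R := s * (2 * hgt x) `^ (- s - 1).
have d0 x : 0 < d x by rewrite mulr_gt0// powR_gt0// mulr_gt0// hgt_gt0.
have dr e x : dotp e e = 1 -> d (refl e x) = d x by move=> e1; rewrite /d hgt_refl.
(* The gain is collected in the unit ball only. By reflection invariance its total weight does not
   depend on [e]. *)
pose w e x : R := ind (enorm x < 1) * (d x * `|dotp e x|) `^ q.
have md : mbl d by rewrite /d; meas.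
have hw e : dotp e e = 1 -> L1 M (w e).
 move=> e1; apply: (@ball_weight_L1 _ (s `^ q)); first by meas.
 move=> x x1; rewrite ger0_norm ?powR_ge0//; apply: powR_le; [exact: ltW|side|].
 rewrite -[leRHS]mulr1; apply: ler_pM => //; first exact: ltW.
  rewrite /d -[leRHS]mulr1 ler_pM2l//.
  have -> : - s - 1 = - (s + 1) by ring.
  rewrite powRN invf_le1 ?powR_gt0 ?mulr_gt0 ?hgt_gt0//.
  rewrite -[leLHS](one_powR (s + 1)); apply: powR_le => //; first side.
  by have := hgt_ge1 x; lra.
 apply: le_trans (dotp_le _ _) _; rewrite {1}/enorm e1 sqrtr1 mul1r; exact: ltW.
pose e0 : X := cons_tuple 1 (t0 N).
have e01 : dotp e0 e0 = 1 by rewrite dotp_cons -enormE t0E expr0n addr0 mulr1.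
have wE e : dotp e e = 1 -> Ir M (w e) = Ir M (w e0).
 move=> e1; have : enorm e = enorm e0 by rewrite /enorm e1 e01.
 case/refl_exists => [->//|[f f1 <-]].
 rewrite -[RHS](@M_refl _ _ f _ f1 (L1_meas (hw _ _))).2; last by rewrite dotp_refl.
 by apply: Ir_ext => x; rewrite /w enorm_refl// dr// dotp_refl.
have W0 : 0 < Ir M (w e0).
 apply: M_pos; [exact: hw|side|].
 move=> x x1 hx; rewrite /w x1 mul1r powR_gt0// mulr_gt0// normr_gt0.
 rewrite dotp_cons0 behead_cons.
 have -> : dotp (t0 N) (behead_tuple x) = 0 by apply: big1 => i _; rewrite tnth_mktuple mul0r.
 by rewrite [tnth e0 ord0](_ : _ = 1)// mul1r addr0.
have q2 : 2 <= q by exact/ltW/q_gt2.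
exists (4 * Cq / (q * Ir M (w e0))); first by rewrite divr_gt0 ?mulr_gt0// Cq_gt0.
move=> u e r hu u1 u0 uC e1.
have hL := LpL1 hu; have mu := Lp_meas hu.
have [hP NP] := pol_Lp e1 hu; have hPL := LpL1 hP; have mP := Lp_meas hP.
have [hr _] := Lp_refl e1 hu; have hrL := LpL1 hr.
have sumE y : pol e u y + pol e u (refl e y) = u y + u (refl e y).
 by case: (pol_refl u y e1) => -[-> ->] //; exact: addrC.
have P0 y : 0 <= pol e u y by case: (pol_refl u y e1) => -[-> _].
pose D1 y : R := pol e u y - u y; pose D2 y : R := pol e u y - u (refl e y).
have hD1 : L1 P D1 by exact: L1_B.
have hD2 : L1 P D2 by exact: L1_B.
have a1 y : D1 (refl e y) = - D1 y by have := sumE y; rewrite /D1; lra.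
have a2 y : D2 (refl e y) = - D2 y by have := sumE y; rewrite /D2 reflK//; lra.
have sg y : 0 <= dn e y * dotp e y.
 by rewrite /nrm dotpZr -mulrA mulr_ge0 ?invr_ge0 ?enorm_ge0// -expr2 sqr_ge0.
have sgn (D : X -> R) : (forall y, 0 <= dotp e y -> 0 <= D y) -> (forall y, dotp e y < 0 -> D y <= 0) ->
  forall y, 0 <= dn e y * D y.
 move=> dp dn y; rewrite /nrm dotpZr -mulrA mulr_ge0 ?invr_ge0 ?enorm_ge0//.
 case: (leP 0 (dotp e y)) => h; first by rewrite mulr_ge0// dp.
 by rewrite mulr_le0// ?(ltW h)// dn.
have g1 : forall y, 0 <= dn e y * D1 y.
 apply: sgn => y h; rewrite /D1 /pol; first by rewrite h subr_ge0 le_max lexx.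
 by rewrite (lt_geF h) subr_le0 ge_min lexx.
have g2 : forall y, 0 <= dn e y * D2 y.
 apply: sgn => y h; rewrite /D2 /pol; first by rewrite h subr_ge0 le_max lexx orbT.
 by rewrite (lt_geF h) subr_le0 ge_min lexx orbT.
have t1 := fun x => @Top_anti_ge e D1 x e1 hD1 a1 g1; have t2 := fun x => @Top_anti_ge e D2 x e1 hD2 a2 g2.
have j1 : 0 <= (IP y, dn e y * D1 y) by exact: Ir_ge0.
have j2 : 0 <= (IP y, dn e y * D2 y) by exact: Ir_ge0.
rewrite -/(IP y, dn e y * D1 y) -/(IP y, dn e y * D2 y).
move: (IP y, dn e y * D1 y) (IP y, dn e y * D2 y) t1 t2 j1 j2 => J1 J2 t1 t2 j1 j2.
set m := Num.min J1 J2.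
have m0 : 0 <= m by rewrite le_min j1.
(* Let [A], [B] be the values of [T (pol e u)] at [x] and its mirror image, and [a], [b] those of
   [T u]. Then [A + B = a + b], and [pol_strict] applies at the base [B] with the increments [A - a]
   and [A - b], bounded below by the two moments. *)
have key0 x : 0 <= dotp e x -> `|T u x| `^ q + `|T u (refl e x)| `^ q + q / 2 * m `^ q * w e x <=
  `|T (pol e u) x| `^ q + `|T (pol e u) (refl e x)| `^ q.
 move=> ex; have := t1 x ex; have := t2 x ex.
 rewrite (Top_B s0' _ hPL hL) (Top_B s0' _ hPL hrL) -(Top_refl _ _ e1 mu) -/(d x).
 have : T (pol e u) x + T (pol e u) (refl e x) = T u x + T u (refl e x).
  by rewrite (Top_half _ e1 hPL mP) (Top_half _ e1 hL mu); apply: Top_ext.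
 have := Top_ge0 s (refl e x) P0; have := Top_ge0 s x P0; have := Top_ge0 s (refl e x) u0; have := Top_ge0 s x u0.
 move: (T (pol e u) x) (T (pol e u) (refl e x)) (T u x) (T u (refl e x)) => A B a b a0 b0 A0 B0 AB h2 h1.
 rewrite !ger0_norm//.
 have dx : 0 <= d x * dotp e x by rewrite mulr_ge0// ltW.
 have x0 : 0 <= A - a by apply: le_trans h1; exact: mulr_ge0.
 have y0 : 0 <= A - b by apply: le_trans h2; exact: mulr_ge0.
 have := pol_strict q2 B0 x0 y0.
 have -> : B + (A - a) = b by lra.
 have -> : B + (A - b) = a by lra.
 have -> : b + (A - b) = A by ring.
 have hm : m `^ q * w e x <= Num.min (A - a) (A - b) `^ q.
  apply: (le_trans (y := (d x * dotp e x * m) `^ q)).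
   rewrite powRM// mulrC ler_wpM2r ?powR_ge0// /w (ger0_norm ex).
   by case: (_ < _); rewrite ?mul1r ?mul0r ?powR_ge0.
  apply: powR_le; [exact: ltW|exact: mulr_ge0|rewrite le_min; apply/andP; split].
   by apply: le_trans h1; rewrite ler_wpM2l// ge_min lexx.
  by apply: le_trans h2; rewrite ler_wpM2l// ge_min lexx orbT.
 have : q / 2 * (m `^ q * w e x) <= q / 2 * Num.min (A - a) (A - b) `^ q.
  by rewrite ler_wpM2l// divr_ge0// ltW.
 by rewrite mulrA; lra.
have sw (a b c A B : R) : b + a + c <= B + A -> a + b + c <= A + B by move=> h; rewrite (addrC a) (addrC A).
have key x : `|T u x| `^ q + `|T u (refl e x)| `^ q + q / 2 * m `^ q * w e x <=
  `|T (pol e u) x| `^ q + `|T (pol e u) (refl e x)| `^ q.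
 case: (leP 0 (dotp e x)) => ex; first exact: key0.
 have := key0 (refl e x); rewrite dotp_refl_self// oppr_ge0 reflK// => /(_ (ltW ex)).
 have -> : w e (refl e x) = w e x by rewrite /w enorm_refl// dr// dotp_refl_self// normrN.
 exact: sw.
have hq := Nq_L1 hu; have hqP := Nq_L1 hP.
have [r1 _] := @M_refl _ _ e _ e1 (L1_meas hq); have [r2 _] := @M_refl _ _ e _ e1 (L1_meas hqP).
have l1 := L1_D hq (r1 hq); have l2 := L1_Z (q / 2 * m `^ q) (hw e e1).
have := Ir_le (L1_D l1 l2) (L1_D hqP (r2 hqP)) key.
rewrite (Ir_D l1 l2) (Ir_Z _ (hw e e1)) (wE e e1).
have i1 := Ir_M_half e1 hq; have i2 := Ir_M_half e1 hqP.
have h3 : Nq (pol e u) <= Cq by apply: Nq_le1 => //; rewrite NP.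
rewrite /Nq i1 in uC; rewrite /Nq i2 in h3.
move: (IM x, _ + _) (IM x, _ + _) uC h3 => I1 I2 uC h3.
move: (Ir M (w e0)) W0 (m `^ q) => W W0 mq h.
have qW : 0 < q * W by rewrite mulr_gt0.
rewrite mulrAC ler_pdivlMr//; move: h uC h3; lra.
Qed.

(** The two moments of [pol_defect] have sum [int |e.y| |u - u o refl e|] and difference
    [- 2 int (e.y) u]. Their minimum is small by polarization and their difference by centering, so
    the sum is small. *)
Lemma pol_small : exists2 C, 0 < C & forall u e (r t : R), Lp u -> Np u <= 1 -> nonneg u ->
 Cq * (1 - r) <= Nq u -> dotp e e = 1 -> `|(IP y, dn e y * u y)| <= t ->
 0 <= r -> (IP y, `|dn e y| * `|u y - u (refl e y)|) <= C * r `^ q^-1 + 2 * t.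
Proof.
have [C C0 hC] := pol_defect.
exists (2 * C `^ q^-1); first side.
move=> u e r t hu u1 u0 uC e1 ut r0.
have h := hC u e r hu u1 u0 uC e1.
have hL := LpL1 hu; have [hP _] := pol_Lp e1 hu; have hPL := LpL1 hP.
have [hr _] := Lp_refl e1 hu; have hrL := LpL1 hr.
have h1 : L1 P (fun y => dn e y * (pol e u y - u y)) by apply: (dotp_nrm_L1 e1); exact: L1_B.
have h2 : L1 P (fun y => dn e y * (pol e u y - u (refl e y))) by apply: (dotp_nrm_L1 e1); exact: L1_B.
have hu1 := dotp_nrm_L1 e1 hL; have hr1 := dotp_nrm_L1 e1 hrL.
have EJ : (IP y, `|dn e y| * `|u y - u (refl e y)|) =
 (IP y, dn e y * (pol e u y - u y)) + (IP y, dn e y * (pol e u y - u (refl e y))).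
 rewrite -(Ir_D h1 h2); apply: Ir_ext => y; rewrite -mulrDr.
 have mm (a b : R) : Num.max a b - a + (Num.max a b - b) = `|a - b|.
  case/orP: (le_total a b) => k; first by rewrite max_r// distrC ger0_norm ?subr_ge0//; ring.
  by rewrite max_l// ger0_norm ?subr_ge0//; ring.
 have mn (a b : R) : Num.min a b - a + (Num.min a b - b) = - `|a - b|.
  case/orP: (le_total a b) => k; first by rewrite min_l// distrC ger0_norm ?subr_ge0//; ring.
  by rewrite min_r// ger0_norm ?subr_ge0//; ring.
 have ei : 0 <= (enorm y)^-1 by rewrite invr_ge0 enorm_ge0.
 rewrite /pol /nrm dotpZr normrM (ger0_norm ei) -!mulrA; congr (_ * _).
 case: (leP 0 (dotp e y)) => ey; first by rewrite mm ger0_norm.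
 by rewrite mn ltr0_norm// mulNr mulrN.
have ED : (IP y, dn e y * (pol e u y - u y)) - (IP y, dn e y * (pol e u y - u (refl e y))) =
 - 2 * (IP y, dn e y * u y).
 rewrite -(Ir_B h1 h2).
 have -> : (IP y, dn e y * (pol e u y - u y) - dn e y * (pol e u y - u (refl e y))) =
  (IP y, dn e y * u (refl e y) - dn e y * u y) by apply: Ir_ext => y; ring.
 rewrite (Ir_B hr1 hu1).
 have [_ k] := @P_refl _ _ e _ e1 (L1_meas hu1).
 have -> : (IP y, dn e y * u (refl e y)) = - (IP y, dn e y * u y).
  rewrite -k -Ir_N; last exact: (@P_refl _ _ e _ e1 (L1_meas hu1)).1 hu1.
  by apply: Ir_ext => y; rewrite nrm_refl// dotp_refl_self// mulNr opprK.
 ring.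
rewrite EJ; move: h ut ED {EJ}.
have j1 : 0 <= (IP y, dn e y * (pol e u y - u y)).
 apply: Ir_ge0 => y; rewrite /pol /nrm dotpZr -mulrA mulr_ge0 ?invr_ge0 ?enorm_ge0//.
 case: (leP 0 (dotp e y)) => ey; first by rewrite mulr_ge0// subr_ge0 le_max lexx.
 by rewrite mulr_le0 ?(ltW ey)// subr_le0 ge_min lexx.
have j2 : 0 <= (IP y, dn e y * (pol e u y - u (refl e y))).
 apply: Ir_ge0 => y; rewrite /pol /nrm dotpZr -mulrA mulr_ge0 ?invr_ge0 ?enorm_ge0//.
 case: (leP 0 (dotp e y)) => ey; first by rewrite mulr_ge0// subr_ge0 le_max lexx orbT.
 by rewrite mulr_le0 ?(ltW ey)// subr_le0 ge_min lexx orbT.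
move: (IP y, dn e y * (pol e u y - u y)) j1 => J1 j1.
move: (IP y, dn e y * (pol e u y - u (refl e y))) j2 => J2 j2.
move: (Ir P _) => I hm hI hD.
have hm' : Num.min J1 J2 <= C `^ q^-1 * r `^ q^-1.
 have mm0 : 0 <= Num.min J1 J2 by rewrite le_min j1.
 have iq : 0 <= q^-1 by rewrite invr_ge0 ltW.
 have := powR_le iq (powR_ge0 _ _) hm.
 by rewrite -powRrM mulfV ?gt_eqF// powRr1// powRM// ltW.
have hN := min_norm j1 j2; have : `|J1 - J2| <= 2 * t by rewrite hD mulNr normrN normrM ger0_norm// ler_pM2l.
by move: hm' hN; set Z := C `^ _ * _; rewrite -[2 * C `^ _ * _]mulrA -/Z; lra.
Qed.

(** * Almost radial potentials *)

Lemma Top_refl_lip u e x : L1 P u -> dotp e e = 1 ->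
 `|T u x - T u (refl e x)| <=
 s * (2 * hgt x) `^ (s + 1) * (2 * hgt x) * (IP y, `|dn e y| * `|u y - u (refl e y)|).
Proof.
move=> hu e1; have mu := L1_meas hu.
have hr : L1 P (fun y => u (refl e y)) by exact: (@P_refl _ _ e u e1 mu).1 hu.
pose D y : R := u y - u (refl e y).
have hD : L1 P D by exact: L1_B.
have Da y : D (refl e y) = - D y by rewrite /D reflK//; ring.
rewrite (Top_refl _ _ e1 mu) -(Top_B s0' _ hu hr) -/D (Top_anti s0' x e1 hD Da).
have hh : 0 < 2 * hgt x by rewrite mulr_gt0 ?hgt_gt0.
pose c := 2 * s * (2 * hgt x) `^ (s + 1) * (2 * hgt x).
have c0 : 0 <= c by rewrite !mulr_ge0 ?powR_ge0// ltW// hgt_gt0.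
have hd : L1 P (fun y => `|dn e y| * `|D y|).
 by apply: (L1_ext _ (L1_abs (dotp_nrm_L1 e1 hD))) => y; rewrite normrM.
have -> : s * (2 * hgt x) `^ (s + 1) * (2 * hgt x) * (IP y, `|dn e y| * `|D y|) =
 2^-1 * (IP y, c * (`|dn e y| * `|D y|)).
 by rewrite (Ir_Z _ hd) /c; move: (Ir P _) => I; field.
rewrite normrM ger0_norm ?invr_ge0// ler_pM2l ?invr_gt0//.
have hK : L1 P (fun y => (K s x y - K s x (refl e y)) * D y).
 have hr' : L1 P (fun y => K s x (refl e y) * D y).
  by apply: (L1_ext _ (Top_L1 s0' (refl e x) hD)) => y; rewrite K_reflC.
 by apply: (L1_ext _ (L1_B (Top_L1 s0' x hD) hr')) => y; rewrite mulrBl.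
apply: le_trans (Ir_abs hK) _; apply: Ir_le; [exact: L1_abs|exact: L1_Z|move=> y].
rewrite normrM [leRHS]mulrA ler_wpM2r//; apply: le_trans (K_lip x y s0' e1) _.
rewrite /c -[leRHS]mulrA ler_wpM2l ?mulr_ge0 ?powR_ge0// ler_wpM2r//.
have := dotp_le e x; rewrite {1}/enorm e1 sqrtr1 mul1r => h; apply: le_trans h _.
by have := enorm_lt_hgt x; have := hgt_gt0 x; lra.
Qed.

(** By Fubini the kernel is averaged over the directions of [x]. On the sphere it depends on [z] and
    [y] only through [z.y], so this average is [phi s x]. *)
Lemma Top_sphere_mean u x : L1 P u ->
 let f y := T u (tscale (enorm x) (nrm y)) in L1 P f /\ Ir P f = phi s x * Ir P u.
Proof.
move=> hu f; have mu := L1_meas hu; pose r := enorm x.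
have hr y : hgt (tscale r (nrm y)) <= hgt x.
 rewrite -(ler_pXn2r (ltn0Sn 1)) ?nnegrE ?(ltW (hgt_gt0 _))// !hgt_sqr lerD2l -!enormE enormZ.
 rewrite lerXn2r ?nnegrE ?mulr_ge0 ?enorm_ge0// (ger0_norm (enorm_ge0 _)).
 by rewrite ler_piMr ?enorm_ge0// enorm_nrm_le1.
have Kb z y : K s (tscale r (nrm z)) y <= (2 * hgt x) `^ s.
 apply: le_trans (K_le _ _ s0') _; apply: powR_le => //; first side.
 by rewrite ler_pM2l.
have mf : mbl f.
 by rewrite /f; meas; apply: meas_tscale; meas; apply: meas_nrm; meas.
have mz : mbl (fun z : X * X => tscale r (nrm z.1)) by apply: meas_tscale; meas; apply: meas_nrm; meas.
have mF : mbl (fun z : X * X => K s (tscale r (nrm z.1)) z.2 * u z.2).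
 by apply: meas_mul; [apply: meas_K => //; meas|exact: (measurableT_comp mu)].
have mzu y : mbl (fun z => K s (tscale r (nrm z)) y).
 by apply: meas_K; [apply: meas_tscale; meas; apply: meas_nrm; meas|meas].
have hA : L1 P (fun z => (IP y, `|K s (tscale r (nrm z)) y * u y|)).
 apply: (@L1_P_bd _ _ _ ((2 * hgt x) `^ s * (IP y, `|u y|))).
  apply: (@meas_Ir2 _ _ _ _ _ P (fun z y => `|K s (tscale r (nrm z)) y * u y|)); exact: meas_norm.
 move=> z; rewrite ger0_norm; last exact: Ir_ge0.
 rewrite -(Ir_Z _ (L1_abs hu)); apply: Ir_le; [exact: L1_abs (Top_L1 s0' _ hu)|exact: L1_Z (L1_abs hu)|].
 by move=> y; rewrite normrM (ger0_norm (K_ge0 _ _ _)) ler_wpM2r.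
have hY y : L1 P (fun z => K s (tscale r (nrm z)) y * u y).
 apply: (@L1_P_bd _ _ _ ((2 * hgt x) `^ s * `|u y|)); first by apply: meas_mul => //; exact: measurable_cst.
 by move=> z; rewrite normrM (ger0_norm (K_ge0 _ _ _)) ler_wpM2r.
have [h1 h2 h3] := @Ir_fubini _ _ _ _ _ P P (fun z y => K s (tscale r (nrm z)) y * u y) mF
 (fun z => Top_L1 s0' _ hu) hY hA.
split; first exact: h1.
rewrite [LHS]h3 -(Ir_Z _ hu).
apply: (P_unit (ltn0Sn N) (L1_meas h2) _ _).2; first by meas.
move=> y y1.
have hKy : L1 P (fun z => K s (tscale r (nrm z)) y).
 apply: (@L1_P_bd _ _ _ ((2 * hgt x) `^ s)); first exact: mzu.
 by move=> z; rewrite (ger0_norm (K_ge0 _ _ _)).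
have -> : (IP z, K s (tscale r (nrm z)) y * u y) = (IP z, K s (tscale r (nrm z)) y) * u y.
 by rewrite [RHS]mulrC -(Ir_Z _ hKy); apply: Ir_ext => z; rewrite mulrC.
congr (_ * _).
have ey : enorm (tscale r y) = enorm x by rewrite enormZ y1 mulr1 ger0_norm ?enorm_ge0.
rewrite -(radial_eq (F := phi s) _ ey); last by move=> *; exact: phi_refl.
rewrite phiE; apply: (P_unit (ltn0Sn N) _ _ _).2; [exact: mzu|by meas|move=> z z1].
rewrite /K /ker !(nrm1 z1) !(nrm1 y1) !dotpZl (dotpC z y); congr ((_ - _) `^ _).
by rewrite /hgt !dotpZl !dotpZr -!enormE y1 z1.
Qed.

(** Points at equal distance from the origin are mirror images, so [Top_refl_lip] bounds the
    distance of [T u x] from its spherical mean. *)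
Lemma near_radial u (t : R) : L1 P u ->
 (forall e, dotp e e = 1 -> (IP y, `|dn e y| * `|u y - u (refl e y)|) <= t) ->
 0 <= t -> forall x, `|T u x - phi s x * Ir P u| <= s * (2 * hgt x) `^ (s + 1) * (2 * hgt x) * t.
Proof.
move=> hu ht t0' x; have [hf <-] := Top_sphere_mean x hu.
have c0 : 0 <= s * (2 * hgt x) `^ (s + 1) * (2 * hgt x).
 side.
have hc := L1_P_cst N.+1 (T u x); rewrite -{1}(@Ir_P_cst R N.+1 (T u x)) -(Ir_B hc hf).
apply: le_trans (Ir_abs (L1_B hc hf)) _.
rewrite -[leRHS](@Ir_P_cst R N.+1); apply: (Ir_P_le (ltn0Sn N)); [exact: L1_abs (L1_B hc hf)|exact: L1_P_cst|].
move=> y y1; have ey : enorm x = enorm (tscale (enorm x) (nrm y)).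
 by rewrite enormZ (nrm1 y1) y1 mulr1 ger0_norm ?enorm_ge0.
case: (refl_exists ey) => [<-|[e e1 <-]]; first by rewrite subrr normr0 mulr_ge0.
apply: le_trans (Top_refl_lip x hu e1) _; apply: ler_wpM2l => //; exact: ht.
Qed.

Lemma phi_le1 x : phi s x <= 1.
Proof.
have := Top_le_1 x (Lp_cst 1); rewrite Np1 lexx => /(_ isT).
exact: le_trans (ler_norm _).
Qed.

Lemma Nq1_le : Nq (fun=> 1) <= Cq.
Proof. by apply: Nq_le1; [exact: Lp_cst|rewrite Np1]. Qed.

Lemma phi_tail (z : R) : 0 < z -> exists2 r, 0 < r & (IM x, ind (r <= enorm x) * phi s x `^ q) <= z.
Proof.
move=> z0.
pose m := Num.min s (N%:R - s).
have m0 : 0 < m by rewrite lt_min s0.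
have qm : N%:R < q * m by rewrite /m minr_pMr ?lt_min ?prm_qs ?prm_qN// ltW.
have hm : N%:R / q < m by rewrite ltr_pdivrMr// mulrC.
pose b := (N%:R / q + m) / 2.
have [hb1 hb2] : N%:R / q < b /\ b < m by split; rewrite /b; lra.
have bs : b < s by apply: lt_le_trans hb2 _; rewrite ge_min lexx.
have bN : b < N%:R - s by apply: lt_le_trans hb2 _; rewrite ge_min lexx orbT.
have [C C0 hC] := phi_decay N0 s0 sN bs bN.
have qb : N%:R < q * b by rewrite mulrC -ltr_pdivrMr.
(* Half of the surplus [q b - N] keeps the integral finite, the other half gives the small factor
   [r^-(q b - t)]. *)
pose t := (N%:R + q * b) / 2.
have [t1 t2] : N%:R < t /\ t < q * b by split; rewrite /t; lra.
have hL := hgt_powR_L1 t1.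
have I0 : 0 <= (IM x, hgt x `^ (- t)) by apply: Ir_ge0 => x; exact: powR_ge0.
set I := Ir M _ in I0.
pose A := C `^ q * I + 1.
have A0 : 0 < A by rewrite ltr_wpDl// mulr_ge0// powR_ge0.
pose r := (z / A) `^ (- (q * b - t)^-1).
have zA : 0 < z / A by rewrite divr_gt0.
have r0 : 0 < r by exact: powR_gt0.
have rE : r `^ (- (q * b - t)) = z / A.
 by rewrite /r -powRrM mulrNN mulVf ?powRr1 ?(ltW zA)// gt_eqF// subr_gt0.
exists r => //.
have hB := L1_Z (C `^ q * (z / A)) hL.
apply: (le_trans (y := (IM x, C `^ q * (z / A) * hgt x `^ (- t)))).
 apply: Ir_le.
 - apply: (L1_le (phi_q_L1)); first by meas.
  move=> x; rewrite normrM (ger0_norm (powR_ge0 _ _)) ler_piMl ?powR_ge0//.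
  by rewrite ger0_norm ?ler0n// lern1 leq_b1.
 - exact: hB.
 move=> x; case: (leP r (enorm x)) => rx; last first.
  by rewrite mul0r; apply: mulr_ge0; [apply: mulr_ge0; [exact: powR_ge0|exact: ltW]|exact: powR_ge0].
 rewrite mul1r; apply: le_trans (@powR_le _ _ _ q (ltW q0) _ (hC x)) _; first exact/ltW/phi_gt0.
 rewrite powRM ?powR_ge0 ?(ltW C0)// -mulrA ler_wpM2l ?powR_ge0// -powRrM.
 have hx := hgt_gt0 x.
 have -> : - b * q = - (q * b - t) - t by ring.
 rewrite powRD1 ?gt_eqF// ler_wpM2r ?powR_ge0// -rE; apply: powRN_le => //.
  by rewrite subr_ge0 ltW.
 by apply: le_trans rx _; exact/ltW/enorm_lt_hgt.
rewrite (Ir_Z _ hL) -/I.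
have -> : C `^ q * (z / A) * I = z * (C `^ q * I / A) by ring.
by rewrite ler_piMr ?(ltW z0)// ler_pdivrMr// mul1r /A lerDl.
Qed.

(** * The approximate Euler-Lagrange equation *)

Lemma fq1_L1 u (h : X -> R) : Lp u -> nonneg u -> mbl h -> (forall y, `|h y| <= 1) ->
 L1 M (fun x => T u x `^ (q - 1) * T h x).
Proof.
move=> hu u0 mh h1.
have mu := Lp_meas hu.
have hL : L1 P h by exact: L1_P_bd h1.
apply: (L1_le (L1_D (Nq_L1 hu) (phi_q_L1))); first by meas.
move=> x; rewrite normrM (ger0_norm (powR_ge0 _ _)).
have f0 : 0 <= T u x by exact: Top_ge0.
have ph : 0 <= phi s x by exact/ltW/phi_gt0.
have hT := Top_le_sup s0' x hL h1; rewrite mul1r in hT.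
rewrite (ger0_norm f0).
apply: (le_trans (ler_wpM2l (powR_ge0 _ _) hT)).
have qp : 0 <= q - 1 by rewrite subr_ge0.
case/orP: (le_total (T u x) (phi s x)) => k.
 apply: (le_trans (y := phi s x `^ q)); last by rewrite lerDr powR_ge0.
 by rewrite -(mulr_powRB1 ph q0) mulrC ler_wpM2l//; exact: powR_le.
apply: (le_trans (y := T u x `^ q)); last by rewrite lerDl powR_ge0.
by rewrite -(mulr_powRB1 f0 q0) mulrC ler_wpM2r// powR_ge0.
Qed.

Lemma up1_L1 u (h : X -> R) : Lp u -> nonneg u -> mbl h -> (forall y, `|h y| <= 1) ->
 L1 P (fun y => u y `^ (p - 1) * h y) /\ `|(IP y, u y `^ (p - 1) * h y)| <= 1 + Np u.
Proof.
move=> hu u0 mh h1; have mu := Lp_meas hu; have hc := L1_P_cst N.+1 (1 : R).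
have b y : `|u y `^ (p - 1) * h y| <= 1 + `|u y| `^ p.
 rewrite normrM (ger0_norm (powR_ge0 _ _)) (ger0_norm (u0 y)).
 have p1 := p_gt1; have pp0 : 0 <= p - 1 by rewrite subr_ge0 ltW.
 apply: (le_trans (y := u y `^ (p - 1))); first by rewrite ler_piMr// powR_ge0.
 case: (leP (u y) 1) => k.
  apply: (le_trans (y := 1)); last by rewrite lerDl powR_ge0.
  by rewrite -[leRHS](one_powR (p - 1)); exact: powR_le.
 apply: (le_trans (y := u y `^ p)); last by rewrite lerDr.
 by apply: ler_powR; [exact: ltW|rewrite gerBl].
have hL : L1 P (fun y => u y `^ (p - 1) * h y).
 by apply: (L1_le (L1_D hc (Lp_pow hu)) _ b); meas.
split=> //; apply: le_trans (Ir_abs hL) _.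
have -> : 1 + Np u = (IP y, 1 + `|u y| `^ p) by rewrite (Ir_D hc (Lp_pow hu)) (@Ir_P_cst R N.+1).
by apply: Ir_le => //; [exact: L1_abs|exact: L1_D hc (Lp_pow hu)].
Qed.

Let C0 := Cq_gt0.
Let p0 := p_gt0.
(* An almost maximizer almost satisfies the Euler-Lagrange equation. *)
Lemma euler_lagrange : exists C t0 : R, [/\ 0 <= C, 0 < t0 & forall u (h : X -> R) (t : R), Lp u -> nonneg u ->
 Np u = 1 -> mbl h -> (forall y, `|h y| <= 1) -> 0 < t -> t <= t0 ->
 Cq * (1 - t `^ Num.min p 2) <= Nq u ->
 `|Cq^-1 * (IM x, T u x `^ (q - 1) * T h x) - (IP y, u y `^ (p - 1) * h y)|
 <= C * t `^ (Num.min p 2 - 1)].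
Proof.
have [C1 C10 h1] := powR_var (p_gt1).
have [C3 C30 h3] := powR1_taylor1 (q / p).
set sg := Num.min p 2 in h1 *.
have sg1 : 1 < sg by rewrite lt_min p_gt1/= ltr1n.
have sg2 : sg <= 2 by rewrite ge_min lexx orbT.
pose C2 := 2 * p + 2 * C1.
have C20 : 0 < C2 by rewrite /C2; have := p0; lra.
pose C4 := q / p * (2 * C1) + C3 * C2 ^+ 2.
have qp0 : 0 <= q / p := divr_ge0 (ltW q0) (ltW p0).
have C40 : 0 <= C4 by apply: addr_ge0; apply: mulr_ge0 => //; [exact: mulr_ge0|exact: sqr_ge0].
(* Ensures [|Y| <= C2 t <= 1/2], the range of the Taylor estimate for [(1 + Y)^(q/p)]. *)
pose td := Num.min 1 (2 * C2)^-1.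
exists ((1 + C4) / q), td.
have td0 : 0 < td by rewrite lt_min ltr01 invr_gt0 mulr_gt0.
split=> //; first side.
move=> u h t hu u0 u1 mh hb t0 tt uC.
have t1 : t <= 1 by apply: le_trans tt _; rewrite ge_min lexx.
have tC : C2 * t <= 1 / 2.
 have : t <= (2 * C2)^-1 by apply: le_trans tt _; rewrite ge_min lexx orbT.
 by rewrite -[X in _ <= X]div1r ler_pdivlMr ?mulr_gt0//; lra.
have mu := Lp_meas hu.
(* A one-sided bound, used for [h] and [- h]. Convexity bounds [Nq (u + t g)] below to first order,
   [powR_var] bounds [Np (u + t g)] above, and [Nq_le] links them. The deficit has the same order
   [t^(min p 2)] as the error; dividing by [q t Cq] leaves [t^(min p 2 - 1)]. *)
have one (g : X -> R) : mbl g -> (forall y, `|g y| <= 1) ->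
  Cq^-1 * (IM x, T u x `^ (q - 1) * T g x) - (IP y, u y `^ (p - 1) * g y)
  <= (1 + C4) / q * t `^ (sg - 1).
 move=> mg gb.
 have hgL : L1 P g by exact: L1_P_bd gb.
 have hg : Lp g by exact: Lp_bd gb.
 have hw : Lp (fun y => u y + t * g y) by apply: Lp_D => //; exact: Lp_Z.
 have [hI hI2] := up1_L1 hu u0 mg gb; have hJ := fq1_L1 hu u0 mg gb.
 rewrite u1 in hI2.
 have lowq : Nq u + q * t * (IM x, T u x `^ (q - 1) * T g x) <= Nq (fun y => u y + t * g y).
  have hq := Nq_L1 hu; rewrite /Nq -(Ir_Z _ hJ) -(Ir_D hq (L1_Z _ hJ)).
  apply: Ir_le; [exact: L1_D hq (L1_Z _ hJ)|exact: Nq_L1|move=> x].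
  rewrite (Top_D s0' _ (LpL1 hu) (L1_Z _ hgL)) (Top_Z s0' _ _ hgL).
  have f0 : 0 <= T u x by exact: Top_ge0.
  have := @tan_abs _ q (T u x) (t * T g x) q1 f0.
  have sw (A B D E : R) : A + q * B * (t * D) <= E -> A + q * t * (B * D) <= E.
   by move=> k; have -> : q * t * (B * D) = q * B * (t * D) by ring.
  by rewrite (ger0_norm f0); exact: sw.
 have upp : Np (fun y => u y + t * g y) <= 1 + p * t * (IP y, u y `^ (p - 1) * g y) + 2 * C1 * t `^ sg.
  have hp := Lp_pow hu; have hc := L1_P_cst N.+1 (1 : R).
  have l1 := L1_D hp (L1_Z (p * t) hI); have l2 := L1_Z (C1 * t `^ sg) (L1_D hc hp).
  have -> : 1 + p * t * (IP y, u y `^ (p - 1) * g y) + 2 * C1 * t `^ sg =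
    (IP y, `|u y| `^ p + p * t * (u y `^ (p - 1) * g y) + C1 * t `^ sg * (1 + `|u y| `^ p)).
   rewrite (Ir_D l1 l2) (Ir_D hp (L1_Z (p * t) hI)) (Ir_Z _ hI) (Ir_Z _ (L1_D hc hp)) (Ir_D hc hp).
   by rewrite (@Ir_P_cst R N.+1) -/(Np u) u1; ring.
  apply: Ir_le; [exact: Lp_pow|exact: L1_D l1 l2|move=> y].
  have tg : `|t * g y| <= t by rewrite normrM (gtr0_norm t0) ler_piMr// ltW.
  have := h1 (u y) (t * g y) t (u0 y) tg t1.
  by rewrite (ger0_norm (u0 y)); move: (_ `^ _) (_ `^ _) (_ `^ _) (_ `^ _) => a b c d'; lra.
 have h4 := Nq_le hw.
 move: hI2 lowq upp h4; rewrite ler_norml => /andP[].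
 move: (IP y, u y `^ (p - 1) * g y) (IM x, T u x `^ (q - 1) * T g x) => I J i1 i2 lowq upp h4.
 pose Y := p * t * I + 2 * C1 * t `^ sg.
 have tsg : t `^ sg <= t.
  by rewrite -[leRHS](powRr1 (ltW t0)); apply: ger_powR; [rewrite t0|exact: ltW].
 have t2sg : t ^+ 2 <= t `^ sg.
  by rewrite -powR_mulrn ?(ltW t0)//; apply: ger_powR; [rewrite t0|].
 have tsg0 : 0 < t `^ sg by exact: powR_gt0.
 have pt0 : 0 < p * t by rewrite mulr_gt0.
 have Yb : `|Y| <= C2 * t.
  have a1 : `|p * t * I| <= 2 * (p * t).
   by rewrite normrM (gtr0_norm pt0) mulrC ler_pM2r// ler_norml; apply/andP; split; lra.
  have a2 : `|2 * C1 * t `^ sg| <= 2 * C1 * t.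
   by rewrite normrM (ger0_norm (ltW tsg0)) ger0_norm ?mulr_ge0// ler_wpM2l ?mulr_ge0.
  by apply: le_trans (ler_normD _ _) _; rewrite /C2; lra.
 have Y12 : `|Y| <= 1 / 2 by exact: le_trans tC.
 have := h3 Y Y12; rewrite ler_norml => /andP[_ h5].
 have Y2 : Y ^+ 2 <= C2 ^+ 2 * t `^ sg.
  rewrite -(real_normK (num_real Y)); apply: (le_trans (y := (C2 * t) ^+ 2)).
   by apply: lerXn2r => //; rewrite nnegrE; apply: mulr_ge0; exact: ltW.
  by rewrite exprMn ler_wpM2l ?sqr_ge0.
 have NpY : Np (fun y => u y + t * g y) `^ (q / p) <= (1 + Y) `^ (q / p).
  apply: powR_le; [by rewrite divr_ge0 ?ltW|exact: Np_ge0|by rewrite /Y addrA].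
 have up2 : (1 + Y) `^ (q / p) <= 1 + q * t * I + C4 * t `^ sg.
  have e1 : q / p * Y = q * t * I + q / p * (2 * C1) * t `^ sg by rewrite /Y; field; rewrite gt_eqF.
  have := ler_wpM2l C30 Y2; rewrite e1 in h5; rewrite /C4; move: h5.
  by move: (_ `^ (q / p)) (t `^ sg) => a b h5 h6; lra.
 have h6 : Cq * (1 - t `^ sg) + q * t * J <= Cq * (1 + q * t * I + C4 * t `^ sg).
  apply: le_trans (_ : Nq u + q * t * J <= _); first by rewrite lerD2r.
  apply: le_trans lowq _; apply: le_trans h4 _; rewrite ler_pM2l//; exact: le_trans NpY up2.
 have e2 : t `^ sg = t * t `^ (sg - 1) by rewrite mulr_powRB1 ?(ltW t0)//; lra.
 have h7 : (q * t * Cq) * (Cq^-1 * J - I) <= (q * t * Cq) * ((1 + C4) / q * t `^ (sg - 1)).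
  have -> : (q * t * Cq) * (Cq^-1 * J - I) = q * t * J - q * t * Cq * I by field; rewrite gt_eqF.
  have -> : (q * t * Cq) * ((1 + C4) / q * t `^ (sg - 1)) = Cq * (1 + C4) * (t * t `^ (sg - 1)).
   by field; rewrite gt_eqF.
  by rewrite -e2; move: (t `^ sg) h6 => b h6; lra.
 by rewrite ler_pM2l ?mulr_gt0// in h7.
have mN : mbl (fun y => - h y) by meas.
have bN y : `|- h y| <= 1 by rewrite normrN.
have hL : L1 P h by exact: L1_P_bd hb.
have n1 := one h mh hb; have n2 := one _ mN bN.
have [hI _] := up1_L1 hu u0 mh hb; have hJ := fq1_L1 hu u0 mh hb.
have eJ : (IM x, T u x `^ (q - 1) * T (fun y => - h y) x) = - (IM x, T u x `^ (q - 1) * T h x).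
 rewrite -(Ir_N hJ); apply: Ir_ext => x; rewrite -mulrN; congr (_ * _).
 rewrite -mulN1r -(Top_Z s0' _ _ hL); apply: Top_ext => y; by rewrite mulN1r.
have eI : (IP y, u y `^ (p - 1) * - h y) = - (IP y, u y `^ (p - 1) * h y).
 by rewrite -(Ir_N hI); apply: Ir_ext => x; rewrite mulrN.
rewrite eJ eI in n2; rewrite ler_norml; apply/andP; split=> //.
by move: n2; rewrite mulrN; lra.
Qed.

(** * Almost maximizers are almost constant *)

Lemma pow_small (C r b : R) : 0 <= C -> 0 < r -> 0 < b ->
 exists2 t, 0 < t <= 1 & forall t', 0 <= t' <= t -> C * t' `^ r <= b.
Proof.
move=> C0' r0 b0; have D0 : 0 < C + 1 by rewrite ltr_wpDl.
have bD : 0 < b / (C + 1) by rewrite divr_gt0.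
exists (Num.min 1 ((b / (C + 1)) `^ r^-1)); first by rewrite lt_min ltr01 powR_gt0//= ge_min lexx.
move=> t' /andP[t0]; rewrite le_min => /andP[_ h].
have h2 : t' `^ r <= b / (C + 1).
 apply: le_trans (@powR_le _ _ _ r (ltW r0) t0 h) _.
 by rewrite -powRrM mulVf ?gt_eqF// powRr1// ltW.
apply: (le_trans (ler_wpM2l C0' h2)); rewrite mulrA ler_pdivrMr//.
by rewrite mulrDr mulr1 mulrC lerDl ltW.
Qed.

Lemma hgt_le x : hgt x <= 1 + enorm x.
Proof.
have e0 := enorm_ge0 x.
rewrite -(ler_pXn2r (ltn0Sn 1)) ?nnegrE ?(ltW (hgt_gt0 x))//; last side.
by rewrite hgt_sqr -enormE; move: (enorm x) e0 => a a0; nra.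
Qed.

Lemma cutoff_L1 (r : R) (w : X -> R) c : 0 <= c -> mbl w ->
 (forall x, enorm x < r -> `|w x| <= c) -> L1 M (fun x => ind (enorm x < r) * w x).
Proof.
move=> c0 mw wc.
have h : N%:R < N%:R + 1 :> R by rewrite ltrDl.
have t0 : 0 <= N%:R + 1 :> R by rewrite addr_ge0.
apply: (L1_le (L1_Z (c * (1 + r) `^ (N%:R + 1)) (hgt_powR_L1 h))); first by meas.
move=> x; case: (ltP (enorm x) r) => x1; last by rewrite mul0r normr0 !mulr_ge0 ?powR_ge0.
rewrite mul1r -mulrA; apply: le_trans (wc x x1) _; rewrite ler_peMr// powRN ler_pdivlMr ?powR_gt0 ?hgt_gt0//.
rewrite mul1r; apply: powR_le => //; first exact/ltW/hgt_gt0.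
by apply: le_trans (hgt_le x) _; rewrite lerD2l ltW.
Qed.

(** Integrability is stated for all tuples [y], including the origin, because Fubini is applied on
    the ambient space; the value of the integral matters only on the sphere. *)
Lemma kernel_L1 (G : X -> R) y : mbl G -> nonneg G ->
 (forall e x, dotp e e = 1 -> G (refl e x) = G x) -> L1 M (fun x => phi s x * G x) ->
 L1 M (fun x => K s x y * G x) /\ (enorm y = 1 -> (IM x, K s x y * G x) = (IM x, phi s x * G x)).
Proof.
move=> mG G0 rG hG.
have mK z : mbl (fun x => K s x z * G x) by meas.
have K0 z x : 0 <= K s x z * G x by rewrite mulr_ge0 ?K_ge0.
have un z : enorm z = 1 -> L1 M (fun x => K s x z * G x) /\ (IM x, K s x z * G x) = (IM x, phi s x * G x).
 move=> z1; have E := kernel_avg s0' mG G0 rG z1.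
 have h : L1 M (fun x => K s x z * G x) by apply: L1_fin => //; rewrite E; exact: L1_fin_lt.
 by split=> //; rewrite !Ir_def E.
split; last by move=> /un[].
have [y0|y0] := eqVneq (enorm y) 0.
 apply: (L1_le (L1_Z (2 `^ s) hG)) => // x; rewrite ger0_norm// mulrA ler_wpM2r//.
 rewrite /K /ker (enorm_eq0 y0).
 have -> : dotp x (nrm (t0 N.+1)) = 0 by apply: big1 => i _; rewrite !tnth_mktuple !mulr0.
 rewrite subr0 -ler_pdivrMl ?powR_gt0// -powRN -powRM ?(ltW (hgt_gt0 x))//.
 exact: phi_ge.
have yp : 0 < enorm y by rewrite lt_neqAle eq_sym y0 enorm_ge0.
have [h _] := un _ (enorm_nrm yp).
by apply: (L1_ext _ h) => x; rewrite /K /ker nrmK.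
Qed.

(** The adjoint of [T] sends a radial function to a constant, by [kernel_avg]. *)
Lemma radial_dual (G h : X -> R) : mbl G -> nonneg G ->
 (forall e x, dotp e e = 1 -> G (refl e x) = G x) -> L1 M (fun x => phi s x * G x) -> L1 P h ->
 L1 M (fun x => G x * T h x) /\ (IM x, G x * T h x) = (IM x, phi s x * G x) * Ir P h.
Proof.
move=> mG G0 rG hG hh; have mh := L1_meas hh.
pose F x y : R := K s x y * G x * h y.
have mF : mbl (fun z : X * X => F z.1 z.2).
 rewrite /F; apply: meas_mul; last exact: (measurableT_comp mh measurable_snd).
 apply: meas_mul; last exact: (measurableT_comp mG measurable_fst).
 by apply: meas_K; [exact: measurable_fst|exact: measurable_snd].
have FE x y : F x y = G x * (K s x y * h y) by rewrite /F; ring.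
have h1 x : L1 P (F x) by apply: (L1_ext _ (L1_Z (G x) (Top_L1 s0' x hh))) => y; rewrite FE.
have h2 y : L1 M (fun x => F x y).
 have [k _] := kernel_L1 y mG G0 rG hG.
 by apply: (L1_ext _ (L1_Z (h y) k)) => x; rewrite /F mulrC.
set c := (IM x, phi s x * G x).
have hI : L1 M (fun x => (IP y, `|F x y|)).
 have mA : mbl (fun z : X * X => `|F z.1 z.2|) by exact: meas_norm.
 apply: L1_fin; first exact: (@meas_Ir2 _ _ _ _ _ P (fun x y => `|F x y|)).
  by move=> x; exact: Ir_ge0.
 have -> : (\int[M]_x (IP y, `|F x y|)%:E = \int[M]_x \int[P]_y (`|F x y|)%:E)%E.
  by apply: eq_int => x; rewrite (IrE (L1_abs (h1 x))).
 rewrite (@int_swap R _ _ _ _ M P (fun x y => (`|F x y|)%:E) (meas_EFin mA)); last side.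
 apply: (@le_lt_trans _ _ (\int[P]_y (c * `|h y|)%:E)%E); last exact: L1_fin_lt (L1_Z _ (L1_abs hh)).
 apply: sph_le_unit.
 - apply: (@measurable_int2 R _ _ _ _ M (fun y x => (`|F x y|)%:E)); last side.
  apply: meas_EFin; apply: meas_norm; rewrite /F; apply: meas_mul; last exact: (measurableT_comp mh measurable_fst).
  apply: meas_mul; last exact: (measurableT_comp mG measurable_snd).
  by apply: meas_K; [exact: measurable_snd|exact: measurable_fst].
 - by meas.
 - side.
 - move=> y; rewrite lee_fin mulr_ge0//; apply: Ir_ge0 => x; rewrite mulr_ge0//; exact/ltW/phi_gt0.
 move=> y y1; have [k1 k2] := kernel_L1 y mG G0 rG hG.
 rewrite (IrE (L1_abs (h2 y))) lee_fin /c -(k2 y1) mulrC -(Ir_Z _ k1).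
 apply: eq_lew; apply: Ir_ext => x.
 by rewrite /F normrM (ger0_norm (mulr_ge0 (K_ge0 _ _ _) (G0 x))) mulrC.
have [k1 k2 k3] := @Ir_fubini _ _ _ _ _ M P F mF h1 h2 hI.
have E1 x : Ir P (F x) = G x * T h x.
 by rewrite -(Ir_Z _ (Top_L1 s0' x hh)); apply: Ir_ext => y; rewrite FE.
split; first by apply: (L1_ext _ k1) => x; exact: E1.
have -> : (IM x, G x * T h x) = (IM x, Ir P (F x)) by apply: Ir_ext => x; rewrite E1.
rewrite k3 -(Ir_Z _ hh); apply: (P_unit (ltn0Sn N) (L1_meas k2) _ _).2; first by meas.
move=> y y1; have [l1 l2] := kernel_L1 y mG G0 rG hG.
rewrite /c -(l2 y1) mulrC -(Ir_Z _ l1); apply: Ir_ext => x; by rewrite /F mulrC.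
Qed.

Lemma cut_phi_L1 (r : R) : L1 M (fun x => ind (enorm x < r) * phi s x `^ q) /\ L1 M (fun x => ind (r <= enorm x) * phi s x `^ q).
Proof.
by split; apply: (L1_le (phi_q_L1)) => [|x]; [meas| |meas|]; rewrite normrM (ger0_norm (powR_ge0 _ _)) ler_piMl ?powR_ge0//
 ger0_norm ?ler0n// lern1 leq_b1.
Qed.

Lemma Ir_le1 u : Lp u -> Np u <= 1 -> Ir P u <= 1.
Proof. by move=> hu u1; rewrite -(Top0); apply: le_trans (ler_norm _) (Top_le_1 _ hu u1). Qed.

(* Inside a large ball [T u] is close to [m phi], so the Euler-Lagrange equation forces
  [u^(p-1)] to be close to a constant. *)
Lemma nearly_constant (d : R) : 0 < d -> exists r th : R, [/\ 0 < r, 0 <= th, th <= 1, th * Cq <= Nq (fun=> 1) &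
 forall u, Lp u -> nonneg u -> Np u = 1 -> Cq * (1 - r) <= Nq u ->
 (forall e, dotp e e = 1 -> `|(IP y, dn e y * u y)| <= r) ->
 L1 P (fun y => `|u y `^ (p - 1) - Ir P u `^ (q - 1) * th|) /\
 (IP y, `|u y `^ (p - 1) - Ir P u `^ (q - 1) * th|) <= d].
Proof.
move=> d0; have [C [tt [CC0 tt0 hEL]]] := euler_lagrange.
have [Cp Cp0 hpol] := pol_small.
have sg1 : 1 < Num.min p 2 by rewrite lt_min p_gt1/= ltr1n.
have q10 : 0 <= q - 1 by rewrite subr_ge0.
(* Outside the ball of radius [rho] two cases occur: either [phi <= z T u], or [(T u)^(q-1) phi] is
   at most [Z phi^q], whose tail is small. *)
pose z := d / 6; have z0 : 0 < z by rewrite divr_gt0.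
pose Z := z `^ (1 - q); have Z0 : 0 < Z by exact: powR_gt0.
have [rho rho0 htail] := phi_tail (divr_gt0 (mulr_gt0 C0 z0) Z0).
have [hin hout] := cut_phi_L1 rho.
pose Sr := (IM x, ind (enorm x < rho) * phi s x `^ q).
have Sr0 : 0 <= Sr by apply: Ir_ge0 => x; rewrite mulr_ge0 ?powR_ge0.
have Sr1 : Sr <= Nq (fun=> 1).
 rewrite Nq1E; apply: Ir_le => //; first exact: phi_q_L1.
 by move=> x; rewrite ler_piMl ?powR_ge0// lern1 leq_b1.
have hball : L1 M (fun x => ind (enorm x < rho) * 1).
 by apply: (@cutoff_L1 _ _ 1) => // x _; rewrite normr1.
pose B := (IM x, ind (enorm x < rho) * 1).
have B0 : 0 <= B by apply: Ir_ge0 => x; rewrite mulr_ge0.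
pose c := s * (2 * (1 + rho)) `^ (s + 1) * (2 * (1 + rho)).
have c0 : 0 <= c by rewrite !mulr_ge0 ?powR_ge0// addr_ge0 ?ltW.
pose A := (q - 1) * c * B / Cq.
have A0 : 0 <= A by apply: divr_ge0 (ltW C0); apply: mulr_ge0 => //; exact: mulr_ge0.
have d3 : 0 < d / 3 by rewrite divr_gt0.
have d6 : 0 < d / 6 by rewrite divr_gt0.
have [t1 /andP[t10 _] ht1] := @pow_small C (Num.min p 2 - 1) (d / 3) CC0 ltac:(rewrite subr_gt0//) d3.
have [r1 /andP[r10 _] hr1] := @pow_small (A * Cp) q^-1 (d / 6) (mulr_ge0 A0 (ltW Cp0)) ltac:(rewrite invr_gt0//) d6.
have [r2 /andP[r20 _] hr2] := @pow_small (A * 2) 1 (d / 6) (mulr_ge0 A0 (ler0n R 2)) ltr01 d6.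
pose t := Num.min tt t1.
have t0 : 0 < t by rewrite lt_min tt0.
pose r := Num.min (t `^ Num.min p 2) (Num.min r1 r2).
have r0 : 0 < r by rewrite !lt_min powR_gt0//= r10.
exists r, (Sr / Cq); split=> //.
- side.
- by rewrite ler_pdivrMr// mul1r; apply: le_trans Sr1 (Nq1_le).
- by rewrite divfK// gt_eqF.
move=> u hu u0 u1 uC ue.
have u1' : Np u <= 1 by rewrite u1.
have hL := LpL1 hu; have mu := Lp_meas hu.
have m0 : 0 <= Ir P u by exact: Ir_ge0.
have m1 : Ir P u <= 1 by exact: Ir_le1.
have uC' : Cq * (1 - t `^ Num.min p 2) <= Nq u.
 by apply: le_trans uC; rewrite ler_pM2l// lerD2l lerN2 ge_min lexx.
pose eta := Cp * r `^ q^-1 + 2 * r.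
have eta0 : 0 <= eta by rewrite addr_ge0 ?mulr_ge0 ?powR_ge0// ltW.
have hpo e : dotp e e = 1 -> (IP y, `|dn e y| * `|u y - u (refl e y)|) <= eta.
 by move=> e1; apply: hpol => //; [exact: ue|exact: ltW].
have hrad := near_radial hL hpo eta0.
have Aeta : A * eta <= d / 3.
 have k1 : A * Cp * r `^ q^-1 <= d / 6 by apply: hr1; rewrite (ltW r0)/= !ge_min lexx /= orbT.
 have k2 : A * 2 * r `^ 1 <= d / 6 by apply: hr2; rewrite (ltW r0)/= !ge_min lexx !orbT.
 rewrite (powRr1 (ltW r0)) in k2; rewrite /eta mulrDr !mulrA.
 by apply: le_trans (lerD k1 k2) _; rewrite -mulrDr; apply: eq_lew; congr (_ * _); field.
move: (Ir P u) m0 m1 hrad => m m0 m1 hrad.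
(* The right-hand side of the Euler-Lagrange equation when [T u] is replaced by [m phi] inside the
   ball and by 0 outside. *)
pose a := m `^ (q - 1) * (Sr / Cq).
(* Testing with the sign of [u^(p-1) - a] produces its [L^1] norm. *)
pose h y : R := if a <= u y `^ (p - 1) then 1 else - 1.
have mh : mbl h by rewrite /h; meas.
have hb y : `|h y| <= 1 by rewrite /h; case: ifP; rewrite ?normrN normr1.
have hh : L1 P h by exact: L1_P_bd hb.
have [hI _] := up1_L1 hu u0 mh hb; have hJ := fq1_L1 hu u0 mh hb.
have sgnE y : `|u y `^ (p - 1) - a| = u y `^ (p - 1) * h y - a * h y.
 rewrite /h; case: ifP => k; first by rewrite ger0_norm ?subr_ge0//; ring.
 by rewrite ltr0_norm ?subr_lt0 1?ltNge ?k//; ring.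
have hd := L1_B hI (L1_Z a hh).
split; first by apply: (L1_ext _ hd) => y; rewrite sgnE.
rewrite (Ir_ext _ sgnE) (Ir_B hI (L1_Z a hh)) (Ir_Z _ hh).
pose G x : R := ind (enorm x < rho) * phi s x `^ (q - 1).
have G0 x : 0 <= G x by rewrite mulr_ge0 ?powR_ge0.
have mG : mbl G by rewrite /G; meas.
have rG e x : dotp e e = 1 -> G (refl e x) = G x by move=> e1; rewrite /G (enorm_refl _ e1) (phi_refl _ _ e1).
have phx x : 0 < phi s x by exact: phi_gt0.
have GE x : phi s x * G x = ind (enorm x < rho) * phi s x `^ q.
 by rewrite /G mulrCA mulr_powRB1// ltW.
have hG : L1 M (fun x => phi s x * G x) by apply: (L1_ext _ hin) => x; rewrite GE.
have [k1 k2] := radial_dual mG G0 rG hG hh.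
have SE : (IM x, phi s x * G x) = Sr by apply: Ir_ext => x; rewrite GE.
rewrite SE in k2.
have := hEL u h t hu u0 u1 mh hb t0 _ uC'; rewrite ge_min lexx => /(_ isT) EL.
have EL2 : C * t `^ (Num.min p 2 - 1) <= d / 3 by apply: ht1; rewrite (ltW t0)/= ge_min lexx orbT.
have DE : `|(IM x, T u x `^ (q - 1) * T h x) - m `^ (q - 1) * (Sr * Ir P h)| <=
  (q - 1) * c * B * eta + z * Cq + Z * (Cq * z / Z).
 have kz := L1_Z (m `^ (q - 1)) k1.
 rewrite -k2 -(Ir_Z _ k1) -(Ir_B hJ kz).
 apply: le_trans (Ir_abs (L1_B hJ kz)) _.
 have l1 := L1_Z ((q - 1) * c * eta) hball; have l2 := L1_Z z (Nq_L1 hu); have l3 := L1_Z Z hout.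
 apply: (le_trans (y := (IM x, (q - 1) * c * eta * (ind (enorm x < rho) * 1) + z * `|T u x| `^ q + Z * (ind (rho <= enorm x) * phi s x `^ q)))); last first.
  rewrite (Ir_D (L1_D l1 l2) l3) (Ir_D l1 l2) (Ir_Z _ hball) (Ir_Z _ (Nq_L1 hu)) (Ir_Z _ hout) -/B -/(Nq u).
  apply: lerD; last by rewrite ler_pM2l.
  apply: lerD; first by apply: eq_lew; ring.
  by rewrite ler_pM2l//; apply: Nq_le1.
 apply: Ir_le; [exact: L1_abs (L1_B hJ kz)|exact: L1_D (L1_D l1 l2) l3|move=> x].
 have f0 : 0 <= T u x by exact: Top_ge0.
 have hT := Top_le_sup s0' x hh hb; rewrite mul1r in hT.
 have f1 : T u x <= 1 by apply: le_trans (ler_norm _) (Top_le_1 x hu u1').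
 have ph1 := phi_le1 x; have ph0 := ltW (phx x).
 rewrite mulrA -mulrBl normrM (ger0_norm f0) /G.
 have ff := hrad x.
 apply: (le_trans (ler_wpM2l (normr_ge0 _) hT)).
 have fq0 : 0 <= T u x `^ q by exact: powR_ge0.
 have pq0 : 0 <= phi s x `^ q by exact: powR_ge0.
 case: (ltP (enorm x) rho) => xr.
  rewrite !mul1r mul0r mulr0 addr0 mulr1.
  apply: (le_trans (y := (q - 1) * c * eta)); last by rewrite lerDl mulr_ge0// ltW.
  rewrite -powRM// -[leRHS]mulr1; apply: ler_pM => //.
  have mp0 : 0 <= m * phi s x by rewrite mulr_ge0.
  have mp1 : m * phi s x <= 1 by rewrite mulr_ile1.
  have q11 : 1 <= q - 1 by rewrite lerBrDr; exact: ltW (q_gt2).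
  apply: le_trans (powR_lip q11 f0 mp0) _.
  have mx : Num.max (T u x) (m * phi s x) `^ (q - 1 - 1) <= 1.
   rewrite -[leRHS](one_powR (q - 1 - 1)); apply: powR_le.
   - by rewrite subr_ge0.
   - by rewrite le_max f0.
   - by rewrite ge_max f1.
  have ffc : `|T u x - m * phi s x| <= c * eta.
   rewrite [m * _]mulrC; apply: le_trans ff _; apply: ler_wpM2r => //.
   have hx : 2 * hgt x <= 2 * (1 + rho) by rewrite ler_pM2l//; apply: le_trans (hgt_le x) _; rewrite lerD2l ltW.
   have hx0 : 0 <= 2 * hgt x by rewrite mulr_ge0// ltW// hgt_gt0.
   apply: ler_pM => //; first by rewrite mulr_ge0 ?powR_ge0.
   by apply: ler_wpM2l => //; apply: powR_le => //; rewrite addr_ge0.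
  have -> : (q - 1) * c * eta = (q - 1) * 1 * (c * eta) by ring.
  by apply: ler_pM => //; [apply: mulr_ge0 => //; exact: powR_ge0|apply: ler_wpM2l].
 rewrite !mul0r !mulr0 add0r subr0 mul1r (ger0_norm (powR_ge0 _ _)).
 case: (leP (phi s x) (z * T u x)) => k.
  apply: (le_trans (y := z * T u x `^ q)); last by rewrite lerDl mulr_ge0// ltW.
  rewrite -(mulr_powRB1 f0 q0) mulrA mulrC ler_wpM2r ?powR_ge0//.
 apply: (le_trans (y := Z * phi s x `^ q)); last by rewrite lerDr mulr_ge0// ltW.
 rewrite -(mulr_powRB1 ph0 q0) mulrCA mulrC ler_wpM2l//.
 have kk : T u x <= z^-1 * phi s x by rewrite ler_pdivlMl// ltW.
 apply: le_trans (powR_le q10 f0 kk) _; rewrite powRM ?invr_ge0 ?(ltW z0)//.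
 by rewrite /Z -[z^-1 `^ _]inv_powRN ?invr_gt0// invrK opprB.
move: EL DE EL2 Aeta; rewrite /a /A.
move: (IP y, _) (IM x, T u x `^ (q - 1) * T h x) (Ir P h) (m `^ (q - 1)) (C * _) => I J H mq CT EL DE EL2 Aeta.
have -> : I - mq * (Sr / Cq) * H = - (Cq^-1 * J - I) + Cq^-1 * (J - mq * (Sr * H)) by field; rewrite gt_eqF.
apply: le_trans (ler_norm _) _; apply: le_trans (ler_normD _ _) _; rewrite normrN normrM (gtr0_norm (_ : 0 < Cq^-1)) ?invr_gt0//.
have iC : 0 <= Cq^-1 by rewrite invr_ge0 ltW.
have := ler_wpM2l iC DE.
have -> : Cq^-1 * ((q - 1) * c * B * eta + z * Cq + Z * (Cq * z / Z)) = (q - 1) * c * B / Cq * eta + 2 * z.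
 by field; rewrite !gt_eqF.
rewrite /z; move: EL2 Aeta EL; move: (_ / Cq * eta) `|Cq^-1 * J - I| (Cq^-1 * _) => a1 a2 a3; clear; lra.
Qed.

(** Through [powR_inv_le] the estimate for [u^(p-1)] gives [m <= m^g th^(1/(p-1))] up to a small
    error, with [m] the mean and [g = (q-1)/(p-1) > 1]. As [m >= k], dividing by [m] forces both [m]
    and [th] to be near 1; the latter says that constants are nearly extremal. *)
Lemma cpt_pos (d k : R) : 0 < d -> d < 1 -> 0 < k -> exists2 r, 0 < r & forall u, Lp u ->
 nonneg u -> Np u = 1 -> Cq * (1 - r) <= Nq u ->
 (forall e, dotp e e = 1 -> `|(IP y, dn e y * u y)| <= r) -> k <= Ir P u ->
 1 - d <= Ir P u /\ (1 - d) * Cq <= Nq (fun=> 1).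
Proof.
have h0 (A B D E : R) : A <= B + D * 2 + E -> E <= D -> A - B <= 3 * D by lra.
have contr (A B E F : R) : 1 - A * B <= F / 2 -> 0 <= B <= 1 -> 0 <= A <= 1 -> F <= 1 - E -> 0 < F -> A <= E -> False.
 by nra.
move=> d0 d1 k0; have p1 := p_gt1.
have pm : 0 < p - 1 by rewrite subr_gt0.
pose g := (q - 1) / (p - 1).
have g1 : 0 < g - 1 by rewrite subr_gt0 ltr_pdivlMr// mul1r ltrD2r p_lt_q.
have ip : 0 < (p - 1)^-1 by rewrite invr_gt0.
have lt1 (a : R) : 0 < a -> (1 - d) `^ a < 1.
 move=> a0; rewrite -[ltRHS](one_powR a); apply: gt0_ltr_powR => //.
 - by rewrite nnegrE subr_ge0 ltW.
 - by rewrite nnegrE.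
 - by rewrite gtrBl.
pose mu := Num.min (1 - (1 - d) `^ (g - 1)) (1 - (1 - d) `^ (p - 1)^-1).
have mu0 : 0 < mu by rewrite lt_min !subr_gt0 !lt1.
(* Three errors [z] add up to [k mu / 2], while [m] or [th] below [1 - d] would cost at least
   [k mu]. *)
pose z := k * mu / 6; have z0 : 0 < z by rewrite divr_gt0// mulr_gt0.
have [C CC0 hC] := @powR_inv_le _ p (p - 1) z p1 pm z0.
have D0 : 0 < C + 1 by rewrite ltr_wpDl.
have [r [th [r0 th0 th1 thC hr]]] := nearly_constant (divr_gt0 z0 D0).
exists r => // u hu u0 u1 uC ue km.
have [l1 l2] := hr u hu u0 u1 uC ue.
have hL := LpL1 hu; have u1' : Np u <= 1 by rewrite u1.
have m1 : Ir P u <= 1 by exact: (Ir_le1 hu u1').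
have [m Em] : exists m, m = Ir P u by exists (Ir P u).
rewrite -Em in l1 l2 km m1 *.
have m0 : 0 < m by exact: lt_le_trans k0 km.
pose a := (m `^ (q - 1) * th) `^ (p - 1)^-1.
have x0 : 0 <= m `^ (q - 1) * th by rewrite mulr_ge0 ?powR_ge0.
have aE : a `^ (p - 1) = m `^ (q - 1) * th by rewrite /a -powRrM mulVf ?gt_eqF// powRr1.
have pw1 (b c : R) : 0 <= c -> 0 <= b -> b <= 1 -> b `^ c <= 1.
 by move=> c0 b0 b1; rewrite -[leRHS](one_powR c); exact: powR_le.
have a1 : 0 <= a <= 1.
 rewrite powR_ge0/=; apply: (@pw1 _ _) => //; first exact: ltW.
 by rewrite mulr_ile1 ?powR_ge0//; apply: (@pw1 _ _) => //; [rewrite subr_ge0|exact: ltW].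
have h1 : m <= a + z * 2 + C * (z / (C + 1)).
 have hp := Lp_pow hu; have hc := L1_P_cst N.+1 (1 : R); have ha := L1_P_cst N.+1 a.
 have k1 := L1_Z z (L1_D hc hp); have k2 := L1_Z C l1.
 apply: (le_trans (y := (IP y, a + z * (1 + `|u y| `^ p) + C * `|u y `^ (p - 1) - m `^ (q - 1) * th|))).
  rewrite {1}Em; apply: Ir_le => //; first exact: L1_D (L1_D ha k1) k2.
  by move=> y; rewrite (ger0_norm (u0 y)) -aE; exact: hC.
 rewrite (Ir_D (L1_D ha k1) k2) (Ir_D ha k1) (Ir_Z _ (L1_D hc hp)) (Ir_D hc hp) (Ir_Z _ l1) !(@Ir_P_cst R N.+1).
 by rewrite -/(Np u) u1; apply: lerD => //; exact: ler_wpM2l.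
have h2 : C * (z / (C + 1)) <= z.
 by rewrite mulrA ler_pdivrMr// mulrDr mulr1 mulrC lerDl ltW.
pose t := th `^ (p - 1)^-1.
have aE2 : a = m * (m `^ (g - 1) * t).
 rewrite /a powRM ?powR_ge0// -powRrM -/g -/t mulrA; congr (_ * _).
 by rewrite mulr_powRB1 ?(ltW m0)//; rewrite -(subrK 1 g) addr_gt0.
have h3 : k * (1 - m `^ (g - 1) * t) <= k * (mu / 2).
 have mt1 : 0 <= 1 - m `^ (g - 1) * t.
  rewrite subr_ge0 mulr_ile1 ?powR_ge0//; apply: (@pw1 _ _) => //; exact: ltW.
 apply: le_trans (_ : m * (1 - m `^ (g - 1) * t) <= _); first by rewrite ler_wpM2r.
 rewrite mulrBr mulr1 -aE2; apply: le_trans (h0 _ _ _ _ h1 h2) _.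
 by rewrite /z; apply: eq_lew; field.
rewrite ler_pM2l// in h3.
have t1 : 0 <= t <= 1 by rewrite powR_ge0/=; apply: (@pw1 _ _) => //; exact: ltW.
have mg1 : 0 <= m `^ (g - 1) <= 1 by rewrite powR_ge0/=; apply: (@pw1 _ _) => //; exact: ltW.
have mu1 : mu <= 1 - (1 - d) `^ (g - 1) by rewrite ge_min lexx.
have mu2 : mu <= 1 - (1 - d) `^ (p - 1)^-1 by rewrite ge_min lexx orbT.
split.
 rewrite leNgt; apply/negP => hm.
 have : m `^ (g - 1) <= (1 - d) `^ (g - 1) by apply: powR_le; exact: ltW.
 exact: (contr _ _ _ _ h3 t1 mg1 mu1 mu0).
apply: le_trans thC; rewrite ler_pM2r// leNgt; apply/negP => hm.
have : t <= (1 - d) `^ (p - 1)^-1 by apply: powR_le => //; exact: ltW.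
by rewrite mulrC in h3; exact: (contr _ _ _ _ h3 mg1 t1 mu2 mu0).
Qed.

(** Reduction to [|u|]: by [sign_defect] the positive or the negative part has small mean, so [|u|]
    inherits the small first moments of [u], and its mean is close to [|Ir P u|]. The lower bound
    for the mean comes from [sup_lower]. *)
Lemma compactness (d : R) : 0 < d -> d < 1 -> exists2 r, 0 < r < 1 & forall u S, Lp u -> Np u = 1 ->
 Cq * (1 - r) <= Nq u -> (forall x, `|T u x| <= S) -> (1 - r) * S <= `|Ir P u| ->
 1 - d <= `|Ir P u| /\ (1 - d) * Cq <= Nq (fun=> 1).
Proof.
have hlp1 (a : R) : a <= 1 / 2 -> 2^-1 <= 1 - a by lra.
have hlp2 (a1 a2 b1 b2 ct b2' r2 : R) : `|b1| <= a1 -> `|b2| <= a2 -> `|b1 - b2| <= ct -> 2 * Num.min a1 a2 <= b2' ->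
   b2' <= r2 / 2 -> ct <= r2 / 2 -> `|b1 + b2| <= r2.
  rewrite !ler_norml => /andP[? ?] /andP[? ?] /andP[? ?].
  by case/orP: (le_total a1 a2) => hle; rewrite ?(min_l hle) ?(min_r hle) => *; apply/andP; split; lra.
have hlp3 (a k' S' : R) : k' <= S' -> a <= 1 / 2 -> 0 < k' -> k' / 2 <= (1 - a) * S' by nra.
have hlp4 (a1 a2 a3 a4 : R) : 1 - d / 2 <= a1 -> 2 * a2 <= a4 -> a3 + 2 * a2 = a1 -> a4 <= d / 2 -> 1 - d <= a3 by lra.
move=> d0 d1; have [k k0 hk] := sup_lower.
have d20 : 0 < d / 2 by rewrite divr_gt0.
have d21 : d / 2 < 1 by apply: lt_trans d1; rewrite ltr_pdivrMr// mulr2n mulrDr mulr1 ltrDl.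
have k2 : 0 < k / 2 by rewrite divr_gt0.
have [r1 r10 h1] := cpt_pos d20 d21 k2.
have [Cs Cs0 hs] := sign_defect; have [Cc Cc0 hc] := centering.
have r12 : 0 < r1 / 2 by rewrite divr_gt0.
pose b := Num.min (r1 / 2) (d / 2); have b0 : 0 < b by rewrite lt_min r12.
pose b' := Num.min r1 (1 / 2); have b'0 : 0 < b' by rewrite lt_min r10 divr_gt0.
have q2 : 0 < 2 / q by rewrite divr_gt0.
have [t1 /andP[t10 _] ht1] := @pow_small Cc 1 (r1 / 2) Cc0 ltr01 r12.
have [t2 /andP[t20 _] ht2] := @pow_small (2 * Cs `^ q^-1) (2 / q) b (mulr_ge0 (ler0n R 2) (powR_ge0 _ _)) q2 b0.
have [t3 /andP[t30 _] ht3] := @pow_small 1 2 b' ler01 (ltr0n R 2) b'0.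
(* [t] is the step length of [centering]; the admissible deficit is [t^2]. *)
pose t := Num.min (1 / 4) (Num.min t1 (Num.min t2 t3)).
have t0 : 0 < t by rewrite !lt_min t10 t20 t30 divr_gt0.
have t4 : t <= 1 / 4 by rewrite ge_min lexx.
have [k1 [k2' k3]] : Cc * t `^ 1 <= r1 / 2 /\ (2 * Cs `^ q^-1 * t `^ (2 / q) <= b /\ 1 * t `^ 2 <= b').
 by split; [apply: ht1|split; [apply: ht2|apply: ht3]]; rewrite (ltW t0)/= !ge_min lexx ?orbT.
rewrite (powRr1 (ltW t0)) in k1.
have t2E : t `^ 2 = t ^+ 2 by rewrite powR_mulrn// ltW.
rewrite mul1r t2E in k3.
have rb1 : t ^+ 2 <= r1 by apply: le_trans k3 _; rewrite ge_min lexx.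
have rb2 : t ^+ 2 <= 1 / 2 by apply: le_trans k3 _; rewrite ge_min lexx orbT.
have r0 : 0 < t ^+ 2 by exact: exprn_gt0.
exists (t ^+ 2); first by rewrite r0/=; apply: le_lt_trans rb2 _; rewrite ltr_pdivrMr// mul1r ltr1n.
move=> u S hu u1 uC uS uc.
have u1' : Np u <= 1 by rewrite u1.
have S0 : k <= S.
 apply: (hk u) => //; apply: le_trans uC; rewrite ler_pM2l//.
 exact: hlp1.
have hL := LpL1 hu; have hp := L1_pos hL; have hn := L1_neg hL.
have hsd := hs u _ hu u1' uC.
have hm : 2 * Num.min (Ir P (pos u)) (Ir P (neg u)) <= b.
 have n0 : 0 <= Num.min (Ir P (pos u)) (Ir P (neg u)).
  by rewrite le_min !Ir_ge0// => y; [exact: neg_ge0|exact: pos_ge0].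
 apply: le_trans k2'; rewrite -mulrA ler_pM2l//.
 have iq : 0 <= q^-1 by rewrite invr_ge0 ltW.
 have := powR_le iq (powR_ge0 _ _) hsd.
 rewrite -powRrM mulfV ?gt_eqF// (powRr1 n0) powRM ?(ltW r0) ?(ltW Cs0)// => h; apply: le_trans h _.
 by rewrite -t2E -powRrM.
have pE : Ir P u = Ir P (pos u) - Ir P (neg u) by rewrite -(Ir_B hp hn); apply: Ir_ext => y; exact: pos_neg.
have aE : (IP y, `|u y|) = Ir P (pos u) + Ir P (neg u) by rewrite -(Ir_D hp hn); apply: Ir_ext => y; exact: abs_pos_neg.
have pg : 0 <= Ir P (pos u) by apply: Ir_ge0 => y; exact: pos_ge0.
have ng : 0 <= Ir P (neg u) by apply: Ir_ge0 => y; exact: neg_ge0.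
have mE := min_norm pg ng; rewrite -pE -aE in mE.
have ha := Lp_abs hu.
have [] := h1 (fun y => `|u y|) ha.
- side.
- by rewrite Np_abs.
- apply: le_trans (_ : Nq u <= _).
  apply: le_trans uC; rewrite ler_pM2l// lerD2l lerN2; exact: rb1.
 apply: Ir_le; [exact: Nq_L1|exact: Nq_L1|move=> x]; apply: powR_le => //; first exact: ltW.
 by apply: le_trans (Top_abs s0' x hL) _; exact: ler_norm.
- move=> e e1; have cE := hc u S t hu u1' t0 t4 uS; rewrite Top0 in cE.
 have {}cE := cE uc e e1.
 have bb (w : X -> R) : L1 P w -> nonneg w -> `|(IP y, dn e y * w y)| <= Ir P w.
  move=> hw w0; have hd := dotp_nrm_L1 e1 hw; apply: le_trans (Ir_abs hd) _.
  apply: Ir_le => //; first exact: L1_abs.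
  move=> y; rewrite normrM (ger0_norm (w0 y)) ler_piMl//.
  by apply: le_trans (dotp_nrm_le _ _) _; rewrite /enorm e1 sqrtr1.
 have hd1 := dotp_nrm_L1 e1 hp; have hd2 := dotp_nrm_L1 e1 hn; have hdu := dotp_nrm_L1 e1 hL.
 have A1 : (IP y, dn e y * `|u y|) =
   (IP y, dn e y * pos u y) + (IP y, dn e y * neg u y).
  by rewrite -(Ir_D hd1 hd2); apply: Ir_ext => y; rewrite abs_pos_neg mulrDr.
 have A2 : (IP y, dn e y * u y) =
   (IP y, dn e y * pos u y) - (IP y, dn e y * neg u y).
  by rewrite -(Ir_B hd1 hd2); apply: Ir_ext => y; rewrite -mulrBr -pos_neg.
 have B1 := bb _ hp (pos_ge0 u); have B2 := bb _ hn (neg_ge0 u).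
 rewrite A1; rewrite A2 in cE.
 have bb1 : b <= r1 / 2 by rewrite ge_min lexx.
 exact: (hlp2 _ _ _ _ _ _ _ B1 B2 cE hm bb1 k1).
- apply: le_trans (_ : `|Ir P u| <= _); last exact: Ir_abs.
 by apply: le_trans uc; exact: hlp3.
move=> c1 c2; split; last first.
 apply: le_trans c2; rewrite ler_pM2r// lerD2l lerN2.
 by rewrite ler_pdivrMr// mulr2n mulrDr mulr1 lerDl ltW.
have bb2 : b <= d / 2 by rewrite ge_min lexx orbT.
exact: (hlp4 _ _ _ _ c1 hm mE bb2).
Qed.

Lemma near_max (r : R) : 0 < r -> exists u, [/\ Lp u, Np u = 1 & Cq * (1 - r) <= Nq u].
Proof.
move=> r0; pose r' := Num.min r (1 / 2).
have r'0 : 0 < r' by rewrite lt_min r0 divr_gt0.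
have [_ [u [hu u1] <-] h] := sup_adherent (mulr_gt0 C0 r'0) (Cset_sup).
rewrite -/Cq in h.
have h' : Cq * (1 - r) <= Nq u.
 apply: ltW; apply: le_lt_trans h; by rewrite mulrBr mulr1 lerD2l lerN2 ler_pM2l// ge_min lexx.
have Nq0 : 0 < Nq u.
 apply: le_lt_trans h; rewrite subr_ge0 -[leRHS]mulr1 ler_pM2l// ge_min; apply/orP; right.
 by rewrite ler_pdivrMr// mul1r ler1n.
have Nn : 0 < Np u.
 rewrite lt_neqAle eq_sym Np_ge0 andbT; apply/negP => /eqP E.
 have := Nq_le hu; rewrite E powR0 ?mulr0; last by rewrite mulf_neq0 ?invr_eq0 ?gt_eqF.
 by rewrite leNgt Nq0.
pose c := Np u `^ (- p^-1).
have c0 : 0 < c by exact: powR_gt0.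
exists (fun y => c * u y); split; first exact: Lp_Z.
 rewrite (Np_Z _ hu) (gtr0_norm c0) /c -powRrM mulNr mulVf ?gt_eqF// powR_inv1 ?(ltW Nn)//.
 by rewrite mulVf// gt_eqF.
rewrite (Nq_Z _ (Nq_L1 hu) hu) (gtr0_norm c0); apply: le_trans h' _; rewrite ler_peMl ?(ltW Nq0)//.
rewrite -[leLHS](one_powR q); apply: powR_le => //; first exact: ltW.
rewrite /c powRN invf_ge1 ?powR_gt0//.
by rewrite -[leRHS](one_powR p^-1); apply: powR_le => //; [rewrite invr_ge0 ltW|exact: ltW].
Qed.

(** Almost maximizers of norm 1 exist and can be centered, so [compactness] applies for every small
    [d]. *)
Lemma Nq1_Cq : Nq (fun=> 1) = Cq.
Proof.
apply/eqP; rewrite eq_le Nq1_le/=; apply/ler_addgt0Pr => e e0.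
pose d := Num.min (1 / 2) (e / Cq).
have d0 : 0 < d by rewrite lt_min !divr_gt0.
have d1 : d < 1 by apply: le_lt_trans (_ : d <= 1 / 2) _; rewrite ?ge_min ?lexx// ltr_pdivrMr// mul1r ltr1n.
have [r /andP[r0 r1] hr] := compactness d0 d1.
have [u [hu u1 uC]] := near_max r0.
have u1' : Np u <= 1 by rewrite u1.
have [v [S [_ hv v1 v2 [v3 v4]]]] := center_exists hu u1' r0.
rewrite Top0 in v4.
have [_ h] := hr v S hv (etrans v1 u1) (eq_ind_r (fun z => Cq * (1 - r) <= z) uC v2) v3 v4.
rewrite mulrBl mul1r lerBlDr in h; apply: le_trans h _; rewrite lerD2l -ler_pdivlMr//.
by rewrite ge_min lexx orbT.
Qed.

(** * Second variation and spectral gap *)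

Let qm2 : 0 < q - 2. Proof. by rewrite subr_gt0 q_gt2. Qed.
Let phx x : 0 < phi s x. Proof. exact: phi_gt0. Qed.
(** Up to the factor [q (q - 1)], the second variation of [Nq] at the constant 1, normalized so that
    its value at 1 is 1. *)
Definition Bq u : R := Cq^-1 * (IM x, phi s x `^ (q - 2) * T u x ^+ 2).

Lemma Bq_pointwise u x : phi s x `^ (q - 2) * T u x ^+ 2 <= phi s x `^ q + `|T u x| `^ q.
Proof.
rewrite -(real_normK (num_real (T u x))).
have := phx x; move: (phi s x) `|T u x| (normr_ge0 (T u x)) => a b b0 a0.
have E c : 0 <= c -> c `^ q = c `^ (q - 2) * c ^+ 2.
 rewrite le_eqVlt => /predU1P[<-|c0]; first by rewrite expr0n mulr0 powR0// gt_eqF.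
 by rewrite -powR_mulrn ?(ltW c0)// -powRD1 ?gt_eqF// subrK.
case/orP: (le_total a b) => k.
 apply: (le_trans (y := b `^ q)); last by rewrite lerDr powR_ge0.
 by rewrite (E b b0) ler_wpM2r ?sqr_ge0//; apply: powR_le => //; exact: ltW.
apply: (le_trans (y := a `^ q)); last by rewrite lerDl powR_ge0.
by rewrite (E a (ltW a0)) ler_wpM2l ?powR_ge0// lerXn2r// nnegrE// ltW.
Qed.

Lemma Bq_L1 u : Lp u -> L1 M (fun x => phi s x `^ (q - 2) * T u x ^+ 2).
Proof.
move=> hu; have mu := Lp_meas hu.
apply: (L1_le (L1_D phi_q_L1 (Nq_L1 hu))); first by meas.
by move=> x; rewrite normrM (ger0_norm (powR_ge0 _ _)) (ger0_norm (sqr_ge0 _)); exact: Bq_pointwise.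
Qed.

Lemma Bq_ge0 u : 0 <= Bq u.
Proof. by rewrite mulr_ge0 ?invr_ge0 ?(ltW C0)//; apply: Ir_ge0 => x; rewrite mulr_ge0 ?powR_ge0 ?sqr_ge0. Qed.

(** The exact Euler-Lagrange equation of the constant function 1. *)
Lemma Ir_phi_Top (h : X -> R) : L1 P h ->
 L1 M (fun x => phi s x `^ (q - 1) * T h x) /\ (IM x, phi s x `^ (q - 1) * T h x) = Cq * Ir P h.
Proof.
move=> hh; have E x : phi s x * phi s x `^ (q - 1) = phi s x `^ q by rewrite mulr_powRB1// ltW.
have hG : L1 M (fun x => phi s x * phi s x `^ (q - 1)) by apply: (L1_ext _ (phi_q_L1)) => x; rewrite E.
have [|||k1 k2] := @radial_dual (fun x => phi s x `^ (q - 1)) h _ _ _ hG hh.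
- by meas.
- side.
- by move=> e x e1; rewrite phi_refl.
split=> //; rewrite k2; congr (_ * _); rewrite -(Nq1_Cq) Nq1E; apply: Ir_ext => x; exact: E.
Qed.

Lemma phiqE : (IM x, phi s x `^ q) = Cq.
Proof. by rewrite -(Nq1_Cq) Nq1E. Qed.

(** Expand [Nq (1 + t h) <= Cq * Np (1 + t h)^(q/p)], an equality at [t = 0], to second order. It
    serves to bound the eigenvalue on linear functions, by testing with a coordinate. *)
Lemma second_variation (h : X -> R) : mbl h -> (forall y, `|h y| <= 1) -> Ir P h = 0 ->
 (q - 1) * Bq h <= (p - 1) * (IP y, h y ^+ 2).
Proof.
have hlp (Q A B c t : R) : 0 < t -> t ^+ 2 * Q * (A - B) <= c * t ^+ 3 -> Q * (A - B) <= c * t.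
 by move=> t0 H; rewrite -(ler_pM2l (exprn_gt0 2 t0)) mulrA; have -> : t ^+ 2 * (c * t) = c * t ^+ 3 by ring.
move=> mh hb h0.
have hL : L1 P h by exact: L1_P_bd hb.
have hLp : Lp h by exact: Lp_bd hb.
have h2L : L1 P (fun y => h y ^+ 2).
 apply: (@L1_P_bd _ _ _ 1); first by meas.
 by move=> y; rewrite normrX exprn_ile1.
have I0 : 0 <= (IP y, h y ^+ 2) by apply: Ir_ge0 => y; exact: sqr_ge0.
have I1 : (IP y, h y ^+ 2) <= 1.
 rewrite -(@Ir_P_cst R N.+1 1); apply: Ir_le => //; first exact: L1_P_cst.
 by move=> y; rewrite -(real_normK (num_real _)) exprn_ile1.
have [Cp Cp0 tp] := powR1_taylor2 p; have [Ck Ck0 tq] := powR1_taylor2 q.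
have [C3 C30 t3] := powR1_taylor1 (q / p).
have p1 := p_gt1.
have hc := L1_P_cst N.+1 (1 : R).
have [m1 m2] := Ir_phi_Top hL; rewrite h0 mulr0 in m2.
have hB := Bq_L1 hLp.
set I := (IP y, h y ^+ 2) in I0 I1 *.
pose D := p * (p - 1) / 2 + Cp.
have D0 : 0 < D by rewrite ltr_wpDr// divr_gt0// mulr_gt0// ?p_gt0// subr_gt0.
pose c := Ck + (q / p) * Cp + C3 * D ^+ 2.
have c0 : 0 <= c.
 apply: addr_ge0; [apply: addr_ge0 => //; apply: mulr_ge0 => //; exact: divr_ge0 (ltW q0) (ltW p0)|].
 side.
(* The third-order remainders become [O(t)] after division by [t^2]; [t] tends to 0 at the end. The
   condition [D t <= 1] keeps [Y] in the Taylor range. *)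
have key (t : R) : 0 < t -> t <= 1 / 2 -> D * t <= 1 -> q / 2 * ((q - 1) * Bq h - (p - 1) * I) <= c * t.
 move=> t0 t12 Dt; apply: (hlp _ _ _ _ _ t0).
 have th y : `|t * h y| <= t by rewrite normrM (gtr0_norm t0) ler_piMr// ltW.
 have hw : Lp (fun y => 1 + t * h y) by apply: Lp_D; [exact: Lp_cst|exact: Lp_Z].
 have lowq : Cq + q * (q - 1) / 2 * t ^+ 2 * (Cq * Bq h) - Ck * t ^+ 3 * Cq <= Nq (fun y => 1 + t * h y).
  have l1 := phi_q_L1; have l2 := L1_Z (q * t) m1; have l3 := L1_Z (q * (q - 1) / 2 * t ^+ 2) hB.
  have l4 := L1_Z (Ck * t ^+ 3) l1.
  have -> : Cq * Bq h = (IM x, phi s x `^ (q - 2) * T h x ^+ 2) by rewrite /Bq mulrA mulfV ?mul1r// gt_eqF.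
  rewrite -phiqE -(Ir_Z _ hB) -(Ir_Z _ l1) -[X in X + _ - _]addr0 -[in X in _ + X + _ - _](mulr0 (q * t)) -m2 -(Ir_Z _ m1).
  rewrite -(Ir_D l1 l2) -(Ir_D (L1_D l1 l2) l3) -(Ir_B (L1_D (L1_D l1 l2) l3) l4).
  apply: Ir_le; [exact: L1_B (L1_D (L1_D l1 l2) l3) l4|exact: Nq_L1|move=> x].
  rewrite (Top_D s0' _ hc (L1_Z _ hL)) (Top_Z s0' _ _ hL) -/(phi s x).
  have hT := Top_le_sup s0' x hL hb; rewrite mul1r in hT.
  have := phx x; move: (phi s x) (T h x) hT => a b ba a0.
  pose z := t * b / a.
  have zt : `|z| <= t.
   rewrite /z normrM normfV (gtr0_norm a0) ler_pdivrMr// normrM (gtr0_norm t0) ler_pM2l//.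
  have z12 : `|z| <= 1 / 2 by exact: le_trans t12.
  have := tq z z12; rewrite ler_norml => /andP[k _].
  have /andP[z1 _] := half_pos z12.
  have E1 : a + t * b = a * (1 + z) by rewrite /z; field; rewrite gt_eqF.
  have E2 : a `^ q = a `^ (q - 2) * a ^+ 2 by rewrite -powR_mulrn ?(ltW a0)// -powRD1 ?gt_eqF// subrK.
  have E3 : a `^ (q - 1) = a `^ (q - 2) * a.
   by rewrite -[X in _ = _ * X](powRr1 (ltW a0)) -powRD1 ?gt_eqF//; congr powR; ring.
  rewrite E1 ger0_norm; last by rewrite mulr_ge0 ?(ltW a0)//; apply: le_trans z1; rewrite divr_ge0.
  rewrite powRM ?(ltW a0)//; last by apply: le_trans z1; rewrite divr_ge0.
  have z3 : Ck * `|z| ^+ 3 <= Ck * t ^+ 3 by rewrite ler_wpM2l// lerXn2r// nnegrE ltW.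
  have k2 : 1 + q * z + q * (q - 1) / 2 * z ^+ 2 - Ck * t ^+ 3 <= (1 + z) `^ q.
   have hl (A B C' F G : R) : - F <= A - 1 - B - C' -> F <= G -> 1 + B + C' - G <= A by lra.
   exact: hl k z3.
  apply: le_trans (ler_wpM2l (powR_ge0 a q) k2).
  rewrite E3 E2 /z; apply: eq_lew; field; rewrite gt_eqF//.
 have upp : Np (fun y => 1 + t * h y) <= 1 + p * (p - 1) / 2 * t ^+ 2 * I + Cp * t ^+ 3.
  have l2 := L1_Z (p * t) hL; have l3 := L1_Z (p * (p - 1) / 2 * t ^+ 2) h2L; have l4 := L1_P_cst N.+1 (Cp * t ^+ 3).
  have -> : 1 + p * (p - 1) / 2 * t ^+ 2 * I + Cp * t ^+ 3 =
   (IP y, 1 + p * t * h y + p * (p - 1) / 2 * t ^+ 2 * h y ^+ 2 + Cp * t ^+ 3).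
   rewrite (Ir_D (L1_D (L1_D hc l2) l3) l4) (Ir_D (L1_D hc l2) l3) (Ir_D hc l2) (Ir_Z _ hL) (Ir_Z _ h2L) !(@Ir_P_cst R N.+1).
   by rewrite h0 mulr0 addr0.
  apply: Ir_le; [exact: Lp_pow|exact: L1_D (L1_D (L1_D hc l2) l3) l4|move=> y].
  have z12 : `|t * h y| <= 1 / 2 by apply: le_trans (th y) t12.
  have /andP[z1 _] := half_pos z12.
  have := tp _ z12; rewrite ler_norml => /andP[_ k].
  rewrite ger0_norm; last by apply: le_trans z1; rewrite divr_ge0.
  have z3 : Cp * `|t * h y| ^+ 3 <= Cp * t ^+ 3 by rewrite ler_wpM2l// lerXn2r// nnegrE ltW.
  have hl (A B C' F G : R) : A - 1 - B - C' <= F -> F <= G -> A <= 1 + B + C' + G by lra.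
  apply: le_trans (hl _ _ _ _ _ k z3) _.
  by rewrite exprMn; apply: eq_lew; ring.
 have h4 := Nq_le hw.
 pose Y := p * (p - 1) / 2 * t ^+ 2 * I + Cp * t ^+ 3.
 have pp1 : 0 <= p * (p - 1) / 2 by rewrite divr_ge0// mulr_ge0 ?(ltW p0)// subr_ge0 ltW.
 have t20 : 0 <= t ^+ 2 by exact: sqr_ge0.
 have t3t : t ^+ 3 <= t ^+ 2 by rewrite exprS ler_piMl//; apply: le_trans t12 _; rewrite ler_pdivrMr// mul1r ler1n.
 have Y0 : 0 <= Y by apply: addr_ge0; apply: mulr_ge0 => //; [exact: mulr_ge0|exact: exprn_ge0 (ltW t0)].
 have YD : Y <= D * t ^+ 2.
  rewrite /Y /D mulrDl; apply: lerD; last exact: ler_wpM2l.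
  by rewrite ler_piMr// mulr_ge0.
 have Y12 : `|Y| <= 1 / 2.
  rewrite ger0_norm//; apply: le_trans YD _; rewrite expr2 mulrA.
  by apply: le_trans (ler_wpM2r (ltW t0) Dt) _; rewrite [X in X <= _]mul1r; exact: t12.
 have := t3 Y Y12; rewrite ler_norml => /andP[_ k5].
 have Y2 : C3 * Y ^+ 2 <= C3 * D ^+ 2 * t ^+ 3.
  rewrite -mulrA; apply: ler_wpM2l => //.
  apply: le_trans (_ : (D * t ^+ 2) ^+ 2 <= _).
   by rewrite lerXn2r ?nnegrE// mulr_ge0// ltW.
  rewrite exprMn ler_wpM2l ?sqr_ge0// -exprM; apply: ler_wiXn2l => //; first exact: ltW.
  by apply: le_trans t12 _; rewrite ler_pdivrMr// mul1r ler1n.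
 have NpY : Np (fun y => 1 + t * h y) `^ (q / p) <= (1 + Y) `^ (q / p).
  by apply: powR_le; [exact: divr_ge0 (ltW q0) (ltW p0)|exact: Np_ge0|rewrite /Y addrA].
 have e1 : q / p * Y = q * (p - 1) / 2 * t ^+ 2 * I + q / p * Cp * t ^+ 3 by rewrite /Y; field; rewrite gt_eqF ?p_gt0.
 rewrite e1 in k5.
 have h6 := le_trans lowq (le_trans h4 (ler_wpM2l (ltW C0) NpY)).
 have h7 : 1 + q * (q - 1) / 2 * t ^+ 2 * Bq h - Ck * t ^+ 3 <= (1 + Y) `^ (q / p).
  rewrite -(ler_pM2l C0); apply: le_trans h6; apply: eq_lew; ring.
 have hl (A B C' E F G W k' : R) : 1 + A - B <= W -> W - 1 - (C' + E) <= F -> F <= G -> A - C' <= B + E + G by lra.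
 have := hl _ _ _ _ _ _ _ 0 h7 k5 Y2.
 rewrite /c => H; apply: (le_trans (y := Ck * t ^+ 3 + q / p * Cp * t ^+ 3 + C3 * D ^+ 2 * t ^+ 3)); last first.
  by apply: eq_lew; ring.
 by apply: le_trans H; apply: eq_lew; field.
have q20 : 0 < q / 2 by rewrite divr_gt0.
rewrite -subr_le0 -(pmulr_rle0 _ q20); apply/ler_addgt0Pr => e e0; rewrite add0r.
have e1 : 0 < Num.min e 1 by rewrite lt_min e0 ltr01.
have [t /andP[t0 _] ht] := @pow_small (c + D) 1 (Num.min e 1) (addr_ge0 c0 (ltW D0)) ltr01 e1.
pose t' := Num.min t (1 / 2); have t'0 : 0 < t' by rewrite lt_min t0 divr_gt0.
have h1 : (c + D) * t' `^ 1 <= Num.min e 1 by apply: ht; rewrite (ltW t'0)/= ge_min lexx.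
rewrite (powRr1 (ltW t'0)) le_min in h1; case/andP: h1 => h1 h2.
apply: le_trans (key t' t'0 _ _) _.
- by rewrite ge_min lexx orbT.
- by apply: le_trans h2; rewrite ler_wpM2r ?(ltW t'0)// lerDr.
- by apply: le_trans h1; rewrite ler_wpM2r ?(ltW t'0)// lerDl ltW.
Qed.

Lemma phi_q2_le1 x : phi s x `^ (q - 2) <= 1.
Proof. have h := powR_le (ltW qm2) (ltW (phx x)) (phi_le1 x).
by apply: le_trans h _; rewrite (one_powR _). Qed.

(** Cauchy-Schwarz for the measure [K s x y dP(y)], whose mass is [phi s x]. *)
Lemma Top_sqr_le u x : L1 P u -> L1 P (fun y => u y ^+ 2) -> T u x ^+ 2 <= phi s x * T (fun y => u y ^+ 2) x.
Proof.
move=> hu hu2; have hc := L1_P_cst N.+1 (1 : R).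
have key (t : R) : 2 * t * T u x <= T (fun y => u y ^+ 2) x + t ^+ 2 * phi s x.
 rewrite -(Top_Z s0' _ _ hu) -(Top_Z s0' _ _ hc) -(Top_D s0' _ hu2 (L1_Z _ hc)).
 apply: Top_le => //; [exact: L1_Z|exact: L1_D hu2 (L1_Z _ hc)|move=> y].
 rewrite mulr1 -subr_ge0; have -> : u y ^+ 2 + t ^+ 2 - 2 * t * u y = (u y - t) ^+ 2 by ring.
 exact: sqr_ge0.
have := phx x; have := key (T u x / phi s x).
move: (T u x) (phi s x) (T (fun y => u y ^+ 2) x) => a b c h b0.
have b0' : b != 0 by rewrite gt_eqF.
move: h; have -> : (a / b) ^+ 2 * b = a ^+ 2 / b by field.
have -> : 2 * (a / b) * a = a ^+ 2 / b + a ^+ 2 / b by field.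
by rewrite lerD2r ler_pdivrMr// mulrC.
Qed.

(** The weight of [Bq] cut off to a ball, so that the induced kernel on the sphere is bounded and
    Lipschitz, as [reflection_gap] requires. *)
Definition om (r : R) x : R := ind (enorm x < r) * (phi s x `^ (q - 2) / Cq).

Lemma om_ge0 r x : 0 <= om r x.
Proof. by side. Qed.

Lemma meas_om r : mbl (om r).
Proof. by rewrite /om; meas. Qed.

Lemma om_refl r e x : dotp e e = 1 -> om r (refl e x) = om r x.
Proof. by move=> e1; rewrite /om (enorm_refl _ e1) (phi_refl _ _ e1). Qed.

Lemma om_L1 (r : R) (w : X -> R) c : 0 <= c -> mbl w ->
 (forall x, enorm x < r -> `|w x| <= c) -> L1 M (fun x => om r x * w x).
Proof.
move=> c0 mw hw.
have h : L1 M (fun x => ind (enorm x < r) * (phi s x `^ (q - 2) / Cq * w x)); last first.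
 by apply: (L1_ext _ h) => x; rewrite /om mulrA.
apply: (@cutoff_L1 r _ (c / Cq)).
- side.
- by meas.
- move=> x xr; rewrite normrM (ger0_norm (divr_ge0 (powR_ge0 _ _) (ltW C0))) mulrAC ler_wpM2r ?invr_ge0 ?(ltW C0)//.
 by apply: le_trans (ler_wpM2r _ (phi_q2_le1 x)) _ => //; rewrite mul1r; exact: hw.
Qed.

(** Bounds the part of [Bq] outside the ball relative to the squared [L^2] norm; it becomes
    arbitrarily small for large [r]. *)
Definition tq (r : R) : R := Cq^-1 * (IM x, ind (r <= enorm x) * phi s x `^ q).

(** Outside the ball [(T u)^2] is replaced by [phi T(u^2)], and [radial_dual] evaluates the integral
    of [T(u^2)] against a radial weight. *)
Lemma Bq_split (r : R) u : Lp u -> L1 P (fun y => u y ^+ 2) ->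
 L1 M (fun x => om r x * T u x ^+ 2) /\
 Bq u <= (IM x, om r x * T u x ^+ 2) + tq r * (IP y, u y ^+ 2).
Proof.
move=> hu hu2; have hu1 := LpL1 hu; have mu := Lp_meas hu.
have hB := Bq_L1 hu.
have l1 : L1 M (fun x => om r x * T u x ^+ 2).
 apply: (L1_le (L1_Z Cq^-1 hB)); first by have := meas_om r => mo; meas.
 move=> x; rewrite normrM (ger0_norm (om_ge0 _ _)) (ger0_norm (sqr_ge0 _)) /om [X in _ <= X]mulrA; apply: ler_wpM2r; first exact: sqr_ge0.
 by rewrite mulrA [Cq^-1 * _]mulrC ler_wpM2r ?invr_ge0 ?(ltW C0)// ler_piMl ?powR_ge0// lern1 leq_b1.
split=> //.
have E x : phi s x * phi s x `^ (q - 1) = phi s x `^ q by rewrite mulr_powRB1// ltW.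
have [_ hc] := cut_phi_L1 r.
have EE x : phi s x * (ind (r <= enorm x) * phi s x `^ (q - 1)) = ind (r <= enorm x) * phi s x `^ q by rewrite mulrCA E.
have hc' : L1 M (fun x => phi s x * (ind (r <= enorm x) * phi s x `^ (q - 1))) by apply: (L1_ext _ hc) => x; rewrite EE.
have [|||k1 k2] := @radial_dual (fun x => ind (r <= enorm x) * phi s x `^ (q - 1)) (fun y => u y ^+ 2) _ _ _ hc' hu2.
- by meas.
- side.
- by move=> e x e1; rewrite (enorm_refl _ e1) (phi_refl _ _ e1).
have k3 : (IM x, phi s x * (ind (r <= enorm x) * phi s x `^ (q - 1))) = (IM x, ind (r <= enorm x) * phi s x `^ q).
 by apply: Ir_ext => x; exact: EE.
rewrite k3 in k2.
rewrite /tq -mulrA -k2 -(Ir_Z _ k1) -(Ir_D l1 (L1_Z _ k1)) /Bq -(Ir_Z _ hB).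
apply: Ir_le; [exact: L1_Z|exact: L1_D l1 (L1_Z _ k1)|move=> x].
have h := Top_sqr_le x hu1 hu2; rewrite /om; case: (ltP (enorm x) r) => xr.
 by rewrite mul1r mul0r mul0r mulr0 addr0 mulrA [Cq^-1 * _]mulrC.
rewrite !mul0r add0r mul1r; apply: ler_wpM2l; first side.
have -> : phi s x `^ (q - 1) = phi s x `^ (q - 2) * phi s x.
 by rewrite -[X in _ = _ * X](powRr1 (ltW (phx x))) -powRD1 ?gt_eqF//; congr powR; ring.
by rewrite -mulrA; apply: ler_wpM2l => //; exact: powR_ge0.
Qed.

(** On the ball the kernel is bounded, so [T u] is controlled there by the [L^1] norm alone. *)
Lemma om_Top_le (r : R) : exists2 C, 0 < C & forall u, L1 P u ->
 (IM x, om r x * T u x ^+ 2) <= C * (IP y, `|u y|) ^+ 2.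
Proof.
pose b : R := (2 * (1 + `|r|)) `^ s.
have b0 : 0 <= b by exact: powR_ge0.
have l1 : L1 M (fun x => om r x * 1).
 by apply: (@om_L1 r _ 1) => // x _; rewrite normr1.
have I0 : 0 <= (IM x, om r x * 1) by apply: Ir_ge0 => x; rewrite mulr1 om_ge0.
exists (b ^+ 2 * (IM x, om r x * 1) + 1).
 by apply: ltr_wpDl => //; apply: mulr_ge0 => //; exact: sqr_ge0.
move=> u hu; have mu := L1_meas hu; set a := Ir P _.
have a0 : 0 <= a by apply: Ir_ge0.
apply: (le_trans (y := b ^+ 2 * (IM x, om r x * 1) * a ^+ 2)); last by rewrite ler_wpM2r ?sqr_ge0// lerDl.
rewrite mulrAC -(Ir_Z _ l1).
have hT x : enorm x < r -> `|T u x| <= b * a.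
 move=> xr; apply: le_trans (Top_abs s0' x hu) _; rewrite -(Ir_Z _ (L1_abs hu)).
 apply: Ir_le; [exact: Top_L1 s0' _ _ (L1_abs hu)|exact: L1_Z (L1_abs hu)|move=> y].
 apply: ler_wpM2r => //; apply: le_trans (K_le _ _ s0') _; apply: powR_le => //.
  side.
 by rewrite ler_wpM2l//; apply: le_trans (hgt_le x) _; rewrite lerD2l (le_trans (ltW xr))// ler_norm.
have ba : 0 <= b * a by exact: mulr_ge0.
apply: Ir_le; [|exact: L1_Z|].
 apply: (@om_L1 r _ ((b * a) ^+ 2)); [exact: sqr_ge0|by meas|move=> x xr].
 by rewrite normrX; apply: lerXn2r; rewrite ?nnegrE//; exact: hT.
move=> x; rewrite mulr1 mulrC; case: (ltP (enorm x) r) => xr; last by rewrite /om ltNge xr/= !mul0r !mulr0.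
apply: ler_wpM2r; first exact: om_ge0.
rewrite -(real_normK (num_real (T u x))) -exprMn; apply: lerXn2r; rewrite ?nnegrE//; exact: hT.
Qed.

Definition Kb (r : R) : R := (2 * (1 + `|r|)) `^ s.

Lemma K_cut (r : R) x y : enorm x < r -> K s x y <= Kb r.
Proof.
move=> xr; apply: le_trans (K_le _ _ s0') _; apply: powR_le => //.
 side.
by rewrite ler_wpM2l//; apply: le_trans (hgt_le x) _; rewrite lerD2l (le_trans (ltW xr))// ler_norm.
Qed.

Lemma Kb_ge0 r : 0 <= Kb r.
Proof. exact: powR_ge0. Qed.
Let Kb0 r : 0 <= Kb r. Proof. exact: powR_ge0. Qed.

Lemma om_norm_le r x (a b : R) : (enorm x < r -> `|a| <= b) -> `|om r x * a| <= om r x * b.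
Proof.
move=> h; rewrite normrM (ger0_norm (om_ge0 _ _)); case: (ltP (enorm x) r) => xr.
 by apply: ler_wpM2l; [exact: om_ge0|exact: h].
by rewrite /om ltNge xr/= !mul0r.
Qed.

Lemma om_cst_L1 r (c : R) : 0 <= c -> L1 M (fun x => om r x * c).
Proof. by move=> c0; apply: (@om_L1 r _ c) => // x _; rewrite ger0_norm. Qed.

Lemma om_dual (r c d : R) (G h : X -> R) : mbl G -> (forall x, enorm x < r -> `|G x| <= c) -> 0 <= c ->
 bdd h d -> L1 P (fun w => h w * (IM x, om r x * (G x * K s x w))) /\
 (IP w, h w * (IM x, om r x * (G x * K s x w))) = (IM x, om r x * (G x * T h x)).
Proof.
move=> mG hG c0 hh; have hL := bdd_L1 hh; have mh := hh.1; have d0 := bdd_ge0 hh; have mo := meas_om r.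
pose F x w := om r x * (G x * (K s x w * h w)).
have mF : mbl (fun z : X * X => F z.1 z.2).
 rewrite /F; apply: measurable_funM; first by apply: measurableT_comp; [exact: mo|exact: measurable_fst].
 apply: measurable_funM; first by apply: measurableT_comp; [exact: mG|exact: measurable_fst].
 by apply: measurable_funM; [apply: meas_K|apply: measurableT_comp; [exact: mh|]].
have hF x w : `|F x w| <= om r x * (c * (Kb r * d)).
 apply: om_norm_le => xr; rewrite !normrM; apply: ler_pM => //; first exact: hG.
 by apply: ler_pM => //; [rewrite (ger0_norm (K_ge0 _ _ _)); exact: K_cut|exact: hh.2].
have c1 : 0 <= c * (Kb r * d) by apply: mulr_ge0 => //; exact: mulr_ge0.
have hO := om_cst_L1 r c1.
have h1 x : L1 P (F x) by exact: L1_Z (L1_Z _ (Top_L1 s0' x hL)).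
have h2 w : L1 M (fun x => F x w).
 apply: (L1_le hO); last by move=> x; exact: hF.
 by apply: (measurableT_comp mF (measurable_fun_pair (@measurable_id _ X setT) (measurable_cst w))).
have hI : L1 M (fun x => (IP w, `|F x w|)).
 apply: (L1_le hO); first by apply: meas_Ir2; apply: measurableT_comp.
 move=> x; rewrite ger0_norm; last by apply: Ir_ge0.
 rewrite -(@Ir_P_cst R N.+1 (_ * _)); apply: Ir_le; [exact: L1_abs (h1 x)|exact: L1_P_cst|exact: hF].
have [_ k2 k3] := @Ir_fubini _ _ _ _ _ M P F mF h1 h2 hI.
have E w : (IM x, F x w) = h w * (IM x, om r x * (G x * K s x w)).
 have hK : L1 M (fun x => om r x * (G x * K s x w)).
  have cK : 0 <= c * Kb r by exact: mulr_ge0.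
  apply: (@om_L1 r _ (c * Kb r)) => //; first by apply: measurable_funM => //; apply: meas_K.
  by move=> x xr; rewrite normrM; apply: ler_pM => //; [exact: hG|rewrite (ger0_norm (K_ge0 _ _ _)); exact: K_cut].
 by rewrite -(Ir_Z _ hK); apply: Ir_ext => x; rewrite /F; ring.
split; first exact: L1_ext E k2.
rewrite -(Ir_ext P E) -k3; apply: Ir_ext => x.
by rewrite (Ir_Z _ (L1_Z _ (Top_L1 s0' x hL))) (Ir_Z _ (Top_L1 s0' x hL)).
Qed.

(** The kernel of the truncated form, that is of the adjoint of [T] times [om] times [T]. *)
Definition k0 (r : R) y w : R := (IM x, om r x * (K s x y * K s x w)).
(** Subtracting [g (y.w)] lowers the eigenvalue on linear functions. As long as the kernel stays
    reflection positive, that eigenvalue still bounds the form on functions of mean zero. *)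
Definition kg (r g : R) y w : R := k0 r y w - g * dn (nrm y) w.

Lemma k0_L1 r y w : L1 M (fun x => om r x * (K s x y * K s x w)).
Proof.
apply: (@om_L1 r _ (Kb r * Kb r)); first exact: mulr_ge0.
 by apply: measurable_funM; apply: meas_K.
by move=> x xr; rewrite normrM !(ger0_norm (K_ge0 _ _ _)); apply: ler_pM; rewrite ?K_ge0//; exact: K_cut.
Qed.

Lemma k0_le r y w : `|k0 r y w| <= (IM x, om r x * (Kb r * Kb r)).
Proof.
have hO := om_cst_L1 r (mulr_ge0 (Kb0 r) (Kb0 r)).
apply: le_trans (Ir_abs (k0_L1 r y w)) _; apply: Ir_le; [exact: L1_abs (k0_L1 r y w)|exact: hO|move=> x].
apply: om_norm_le => xr.
by rewrite normrM !(ger0_norm (K_ge0 _ _ _)); apply: ler_pM; rewrite ?K_ge0//; exact: K_cut.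
Qed.

Lemma meas_k0 r : mbl (fun z : X * X => k0 r z.1 z.2).
Proof.
have mo := meas_om r.
apply: (@meas_Ir2 _ _ _ _ _ M (fun z x => om r x * (K s x z.1 * K s x z.2))).
apply: measurable_funM; first by apply: measurableT_comp; [exact: mo|exact: measurable_snd].
apply: measurable_funM; apply: meas_K; try exact: measurable_snd.
- by apply: (measurableT_comp (@measurable_fst _ _ X X)); exact: measurable_fst.
- by apply: (measurableT_comp (@measurable_snd _ _ X X)); exact: measurable_fst.
Qed.

Lemma k0_refl r e y w : dotp e e = 1 -> k0 r (refl e y) w = k0 r y (refl e w).
Proof.
move=> e1; rewrite /k0 -((M_refl e1 (L1_meas (k0_L1 r (refl e y) w))).2); apply: Ir_ext => x.
by rewrite (om_refl _ _ e1) (K_refl _ _ _ e1) (K_reflC _ _ _ e1).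
Qed.

(** Averaging over [x] and its mirror image turns the difference into an integral of products of two
    kernel differences, which have the same sign when [y] and [w] lie on the same side. *)
Lemma k0_diff r e y w : dotp e e = 1 ->
 k0 r y w - k0 r y (refl e w) = 2^-1 * (IM x, om r x * ((K s x y - K s x (refl e y)) * (K s x w - K s x (refl e w)))).
Proof.
move=> e1; have h1 := k0_L1 r y w; have h2 := k0_L1 r y (refl e w).
rewrite /k0 -(Ir_B h1 h2) (Ir_M_half e1 (L1_B h1 h2)); congr (_ * _); apply: Ir_ext => x.
rewrite (om_refl _ _ e1) !(K_reflC _ _ _ e1) (reflK e1).
by move: (om r x) (K s x y) (K s x w) (K s x (refl e y)) (K s x (refl e w)) => o a b c d; ring.
Qed.

Definition wt x : R := s ^+ 2 * ((2 * hgt x) `^ (- s - 1)) ^+ 2.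
(** The multiple of [y.w] that the lower bound of [K_diff] allows to subtract; by [W1_eq] it is the
    same for all unit vectors. *)
Definition W1 e : R := (IM x, om 1 x * (wt x * dotp e x ^+ 2)).

Lemma W1_L1 e : dotp e e = 1 -> L1 M (fun x => om 1 x * (wt x * dotp e x ^+ 2)).
Proof.
move=> e1; apply: (@om_L1 1 _ (s ^+ 2)); [exact: sqr_ge0|by rewrite /wt; meas|move=> x x1].
have w0 : 0 <= wt x by apply: mulr_ge0; exact: sqr_ge0.
rewrite normrM (ger0_norm w0) (ger0_norm (sqr_ge0 _)) /wt -mulrA; apply: ler_piMr; first exact: sqr_ge0.
have t2 : 1 <= 2 * hgt x by apply: le_trans (hgt_ge1 x) _; rewrite ler_peMl ?ler1n// ltW// hgt_gt0.
have h1 : (2 * hgt x) `^ (- s - 1) <= 1.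
 have := powRN_le (addr_ge0 s0' ler01) (@ltr01 R) t2.
 by rewrite opprD (one_powR (- s - 1)).
have h2 : `|dotp e x| <= 1.
 apply: le_trans (dotp_le _ _) _; have -> : enorm e = 1 by rewrite /enorm e1 sqrtr1.
 by rewrite mul1r ltW.
rewrite -(real_normK (num_real (dotp e x))) -[X in _ <= X]mulr1; apply: ler_pM; try exact: sqr_ge0.
 by apply: exprn_ile1 => //; exact: powR_ge0.
by apply: exprn_ile1.
Qed.

Lemma W1_eq e e' : dotp e e = 1 -> dotp e' e' = 1 -> W1 e = W1 e'.
Proof.
move=> e1 e1'.
have RW z x : dotp z z = 1 -> dotp x x = 1 -> W1 (refl z x) = W1 x.
 move=> z1 x1; rewrite /W1 -((M_refl z1 (L1_meas (W1_L1 x1))).2); apply: Ir_ext => w.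
 by rewrite (om_refl _ _ z1) /wt (hgt_refl _ z1) dotp_reflC.
have [->//|[z z1 <-]] := @refl_exists _ _ e e' ltac:(by rewrite /enorm e1 e1').
by rewrite RW.
Qed.

Lemma sgn_prod (c t1 t2 D1 D2 : R) : 0 <= c -> (0 <= t1 -> c * t1 <= D1) -> (t1 <= 0 -> D1 <= c * t1) ->
 (0 <= t2 -> c * t2 <= D2) -> (t2 <= 0 -> D2 <= c * t2) -> 0 <= t1 * t2 -> c ^+ 2 * (t1 * t2) <= D1 * D2.
Proof.
move=> c0 h1 h2 h3 h4 t12; have -> : c ^+ 2 * (t1 * t2) = (c * t1) * (c * t2) by ring.
case: (ltrgtP t1 0) => a.
- have b : t2 <= 0 by rewrite -(nmulr_rge0 _ a).
 rewrite -[X in X <= _]mulrNN -[X in _ <= X]mulrNN; apply: ler_pM; rewrite ?lerN2 ?oppr_ge0 ?h4 ?h2 ?(ltW a)//.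
  by apply: mulr_ge0_le0 => //; exact: ltW.
 exact: mulr_ge0_le0.
- have b : 0 <= t2 by rewrite -(pmulr_rge0 _ a).
 by apply: ler_pM; rewrite ?h1 ?h3 ?(ltW a)//; apply: mulr_ge0 => //; exact: ltW.
- have D0 : D1 = 0 by apply/eqP; rewrite eq_le; move: h1 h2; rewrite a mulr0 lexx => h1 h2; rewrite h1// h2.
 by rewrite D0 a mulr0 !mul0r.
Qed.

Lemma K_sgn e x y : dotp e e = 1 -> let t := dotp e x * dn e y in
 let c := 2 * (s * (2 * hgt x) `^ (- s - 1)) in
 (0 <= t -> c * t <= K s x y - K s x (refl e y)) /\ (t <= 0 -> K s x y - K s x (refl e y) <= c * t).
Proof.
move=> e1 t c; split=> t0.
 by have /andP[h _] := K_diff s0' e1 t0; apply: le_trans h; rewrite /c mulrA.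
have t0' : 0 <= dotp e x * dn e (refl e y) by rewrite (dotp_refl_nrm _ e1) mulrN oppr_ge0.
have /andP[h _] := K_diff s0' e1 t0'; move: h; rewrite (reflK e1) (dotp_refl_nrm _ e1) !mulrN lerNl opprB => h.
by apply: le_trans h _; rewrite /c /t (mulrA 2 s).
Qed.

Lemma om_mono (r r' : R) x : r <= r' -> om r x <= om r' x.
Proof.
move=> h; rewrite /om; apply: ler_wpM2r; first side.
by rewrite ler_nat; case: (ltP (enorm x) r) => // a; rewrite (lt_le_trans a h).
Qed.

(** By [K_sgn] each kernel difference in [k0_diff] is in absolute value at least
    [2 s (2 hgt x)^(-s-1)] times [(e.x)(e.y)], respectively [(e.x)(e.w)]. Over the unit ball the
    products integrate to at least [4 W1] times [(e.y)(e.w)], which is what the subtracted term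
    takes away. *)
Lemma kg_pos (r : R) e0 e y w : 1 <= r -> dotp e0 e0 = 1 -> dotp e e = 1 ->
 0 <= dn e y * dn e w -> kg r (W1 e0) y (refl e w) <= kg r (W1 e0) y w.
Proof.
have fin (A B g d t D : R) : A - B = 2^-1 * D -> 4 * (g * t) <= D -> 0 <= A - g * d - (B - g * (d - 2 * t)).
 move=> h1 h2; have -> : A - g * d - (B - g * (d - 2 * t)) = (A - B) - 2 * (g * t) by ring.
 by rewrite h1; move: (g * t) h2 => z h2; lra.
move=> r1 e01 e1 ab0; have hW := W1_L1 e1.
rewrite -subr_ge0 /kg.
have -> : dn (nrm y) (refl e w) = dn (nrm y) w - 2 * (dn e y * dn e w).
 by rewrite (nrm_refl _ e1) -dotp_reflC dotp_refll -(mulrA 2).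
apply: (fin _ _ _ _ _ _ (k0_diff _ _ _ e1)).
rewrite (W1_eq e01 e1).
have E (a b : R) : 4 * (a * b) = (4 * b) * a by ring.
rewrite E -(Ir_Z _ hW); apply: Ir_le; [exact: L1_Z| |move=> x].
 have K20 : 0 <= (Kb r + Kb r) * (Kb r + Kb r) by apply: mulr_ge0; apply: addr_ge0; exact: Kb_ge0.
 apply: (@om_L1 r _ ((Kb r + Kb r) * (Kb r + Kb r))) => //.
  by apply: measurable_funM; apply: measurable_funB; apply: meas_K.
 move=> x xr; rewrite normrM; apply: ler_pM => //; apply: le_trans (ler_normB _ _) _; rewrite !(ger0_norm (K_ge0 _ _ _));
  apply: lerD; exact: K_cut.
have [a1 a2] := K_sgn x y e1; have [b1 b2] := K_sgn x w e1.
set c := 2 * (s * (2 * hgt x) `^ (- s - 1)) in a1 a2 b1 b2.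
have c0 : 0 <= c by apply: mulr_ge0 => //; apply: mulr_ge0 => //; exact: powR_ge0.
have t12 : 0 <= dotp e x * dn e y * (dotp e x * dn e w).
 by rewrite mulrACA -expr2; apply: mulr_ge0 => //; exact: sqr_ge0.
have h := sgn_prod c0 a1 a2 b1 b2 t12.
apply: (le_trans (y := om r x * (c ^+ 2 * (dotp e x * dn e y * (dotp e x * dn e w))))); last first.
 by apply: ler_wpM2l => //; exact: om_ge0.
apply: (le_trans (y := om 1 x * (c ^+ 2 * (dotp e x * dn e y * (dotp e x * dn e w))))); last first.
 by apply: ler_wpM2r; [apply: mulr_ge0 => //; exact: sqr_ge0|exact: om_mono].
rewrite /c /wt; move: (om 1 x) (dotp e x) (dn e y) (dn e w) ((2 * hgt x) `^ (- s - 1)) => A B C' D F.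
by apply: eq_lew; ring.
Qed.

Lemma kg_lip (r g : R) : exists2 L, 0 <= L & forall e y w, dotp e e = 1 ->
 `|kg r g y w - kg r g (refl e y) w| <= L * `|dn e y|.
Proof.
pose c := 2 * s * (2 * (1 + `|r|)) `^ (s + 1) * `|r|.
have c0 : 0 <= c.
 side.
have cK : 0 <= c * Kb r by apply: mulr_ge0 => //; exact: Kb_ge0.
have hO := om_cst_L1 r cK.
exists ((IM x, om r x * (c * Kb r)) + `|g| * 2).
 by apply: addr_ge0; [apply: Ir_ge0 => x; apply: mulr_ge0 => //; exact: om_ge0|exact: mulr_ge0].
move=> e y w e1; rewrite /kg.
have -> : dotp (nrm (refl e y)) (nrm w) = dn (nrm y) w - 2 * (dn e y * dn e w).
 by rewrite (nrm_refl _ e1) dotp_refll -(mulrA 2).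
have ee : enorm e = 1 by rewrite /enorm e1 sqrtr1.
have h1 := k0_L1 r y w; have h2 := k0_L1 r (refl e y) w.
have h3 : `|k0 r y w - k0 r (refl e y) w| <= (IM x, om r x * (c * Kb r)) * `|dn e y|.
 rewrite /k0 -(Ir_B h1 h2) mulrC -(Ir_Z _ hO); apply: le_trans (Ir_abs (L1_B h1 h2)) _.
 apply: Ir_le; [exact: L1_abs (L1_B h1 h2)|exact: L1_Z|move=> x].
 rewrite -mulrBr -mulrBl [X in _ <= X]mulrCA; apply: om_norm_le => xr.
 rewrite normrM (ger0_norm (K_ge0 _ _ _)) mulrA; apply: ler_pM => //; [exact: K_ge0| |exact: K_cut].
 apply: le_trans (K_lip x y s0' e1) _; rewrite mulrA mulrC ler_wpM2l// /c.
 have xr' : enorm x <= `|r| by apply: le_trans (ltW xr) (ler_norm _).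
 apply: ler_pM => //; first by apply: mulr_ge0; [exact: mulr_ge0|exact: powR_ge0].
  apply: ler_wpM2l; first exact: mulr_ge0.
  apply: powR_le; [exact: addr_ge0|side|].
  by rewrite ler_wpM2l//; apply: le_trans (hgt_le x) _; rewrite lerD2l.
 by apply: le_trans (dotp_le _ _) _; rewrite ee mul1r.
have h4 : `|dn e w| <= 1 by rewrite -ee; exact: dotp_nrm_le.
move: (k0 r y w) (k0 r (refl e y) w) (Ir M _) (dn e y) (dn e w) (dn (nrm y) w) h3 h4 => A B I a b d h3 h4.
have -> : A - g * d - (B - g * (d - 2 * (a * b))) = (A - B) - g * 2 * (a * b) by ring.
apply: le_trans (ler_normB _ _) _; rewrite mulrDl; apply: lerD => //.
rewrite !normrM normr_nat; apply: ler_wpM2l; first exact: mulr_ge0.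
by rewrite ler_piMr.
Qed.

Lemma bdd_tnth i : bdd (fun w : X => tnth (nrm w) i) 1.
Proof.
split=> [|w]; last exact: le_trans (tnth_enorm_le _ _) (enorm_nrm_le1 _).
have -> : (fun w : X => tnth (nrm w) i) = (fun w => dn (dlt i) w) by apply/funext => w; rewrite dotp_dlt.
by meas.
Qed.

Lemma vmean_dot (f : X -> R) c z : bdd f c ->
 (IP w, dn z w * f w) = \sum_i tnth z i * (IP w, tnth (nrm w) i * f w).
Proof.
move=> hf.
have hi i : L1 P (fun w => tnth (nrm w) i * f w) := bdd_L1 (bddM (bdd_tnth i) hf).
rewrite (eq_bigr (fun i => (IP w, tnth z i * (tnth (nrm w) i * f w)))); last by move=> i _; rewrite (Ir_Z _ (hi i)).
rewrite -Ir_sum; last by move=> i; exact: L1_Z.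
by apply: Ir_ext => w; rewrite /dotp mulr_suml; apply: eq_bigr => i _; rewrite mulrA.
Qed.

Definition vmean (f : X -> R) i : R := (IP w, tnth (nrm w) i * f w).

Lemma kg_form (r g : R) (f : X -> R) c : bdd f c ->
 (IP y, f y * Aop (kg r g) f y) = (IM x, om r x * T f x ^+ 2) - g * \sum_i vmean f i ^+ 2.
Proof.
move=> hf; have hL := bdd_L1 hf; have mf := hf.1; have c0 := bdd_ge0 hf.
have mT : mbl (T f) by apply: meas_Top.
have E1 y : Aop (kg r g) f y = (IM x, om r x * (T f x * K s x y)) - g * \sum_i tnth (nrm y) i * vmean f i.
 rewrite -(vmean_dot (nrm y) hf).
 have mKy : mbl (fun x => K s x y) by apply: meas_K.
 have hKy x : enorm x < r -> `|K s x y| <= Kb r by move=> xr; rewrite (ger0_norm (K_ge0 _ _ _)); exact: K_cut.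
 have [_ E2] := om_dual mKy hKy (Kb_ge0 r) hf.
 have -> : (IM x, om r x * (T f x * K s x y)) = (IM x, om r x * (K s x y * T f x)).
  by apply: Ir_ext => x; rewrite (mulrC (Top _ _ _)).
 rewrite -E2.
 have l1 : L1 P (fun w => f w * k0 r y w).
  apply: (bdd_L1 (bddM hf (_ : bdd _ (IM x, om r x * (Kb r * Kb r))))); split; last by move=> w; exact: k0_le.
  exact: (measurableT_comp (meas_k0 r) (measurable_fun_pair (measurable_cst y) (@measurable_id _ X setT))).
 have l2 : L1 P (fun w => dn (nrm y) w * f w) := bdd_L1 (bddM (bdd_dotp _) hf).
 rewrite -(Ir_Z _ l2) -(Ir_B l1 (L1_Z _ l2)); apply: Ir_ext => w; rewrite /kg; ring.
have hT x : enorm x < r -> `|T f x| <= c.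
 move=> _; apply: le_trans (Top_le_sup s0' x hL hf.2) _.
 by rewrite ler_piMr//; exact: phi_le1.
have [l1 E2] := om_dual mT hT c0 hf.
have hi i : L1 P (fun w => tnth (nrm w) i * f w) := bdd_L1 (bddM (bdd_tnth i) hf).
have -> : \sum_i vmean f i ^+ 2 = (IP y, \sum_i vmean f i * (tnth (nrm y) i * f y)).
 rewrite Ir_sum; last by move=> i; exact: L1_Z.
 by apply: eq_bigr => i _; rewrite (Ir_Z _ (hi i)) expr2.
have l2 : L1 P (fun y => \sum_i vmean f i * (tnth (nrm y) i * f y)) by apply: L1_sum => i; exact: L1_Z.
have -> : (IM x, om r x * T f x ^+ 2) = (IM x, om r x * (T f x * T f x)).
 by apply: Ir_ext => x; rewrite expr2.
rewrite -E2 -(Ir_Z _ l2) -(Ir_B l1 (L1_Z _ l2)); apply: Ir_ext => y.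
rewrite E1 mulrBr; congr (_ - _); rewrite mulrCA; congr (_ * _); rewrite mulr_sumr; apply: eq_bigr => i _; ring.
Qed.

Lemma om_le_Bq (r : R) u : Lp u -> L1 P (fun y => u y ^+ 2) -> (IM x, om r x * T u x ^+ 2) <= Bq u.
Proof.
move=> hu hu2; have [l1 _] := Bq_split r hu hu2; have hB := Bq_L1 hu.
rewrite /Bq -(Ir_Z _ hB); apply: Ir_le; [exact: l1|exact: L1_Z|move=> x].
rewrite mulrA; apply: ler_wpM2r; first exact: sqr_ge0.
rewrite [X in _ <= X]mulrC /om; apply: ler_piMl; last by rewrite lern1 leq_b1.
side.
Qed.

Lemma W1_gt0 i : 0 < W1 (dlt i).
Proof.
apply: M_pos; [exact: W1_L1 (dlt_unit i)|move=> x|move=> x x1 xi].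
 by apply: mulr_ge0; [exact: om_ge0|apply: mulr_ge0; [apply: mulr_ge0; exact: sqr_ge0|exact: sqr_ge0]].
have h2 : 0 < 2 * hgt x by rewrite mulr_gt0// hgt_gt0.
rewrite /om x1 mul1r; apply: mulr_gt0; first side.
apply: mulr_gt0; first by rewrite /wt; apply: mulr_gt0; apply: exprn_gt0 => //; exact: powR_gt0.
by rewrite dotp_dlt exprn_even_gt0//= xi.
Qed.

(** The second moments of the coordinates add up to 1. *)
Lemma coord_variance : exists i, 0 < (IP y, tnth (nrm y) i ^+ 2).
Proof.
have h0 i : 0 <= Ir P (fun y : X => tnth (nrm y) i ^+ 2) by apply: Ir_ge0 => y; exact: sqr_ge0.
have hL i : L1 P (fun y : X => tnth (nrm y) i ^+ 2) := bdd_L1 (bddM (bdd_tnth i) (bdd_tnth i)).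
have S : \sum_i Ir P (fun y : X => tnth (nrm y) i ^+ 2) = 1.
 rewrite -(Ir_sum hL) -[RHS](@Ir_P_cst R N.+1 1).
 have ms : L1 P (fun y : X => \sum_i tnth (nrm y) i ^+ 2) by exact: L1_sum.
 refine (P_unit (ltn0Sn N) (L1_meas ms) (@measurable_cst _ _ X R setT 1) _).2 => y y1.
 have <- : dn (nrm y) y = 1 by rewrite -enormE enorm_nrm ?expr1n// y1.
 by apply: eq_bigr => i _; rewrite expr2.
apply/not_existsP => h; have : \sum_i Ir P (fun y : X => tnth (nrm y) i ^+ 2) = 0.
 by apply: big1 => i _; apply/eqP; rewrite eq_le h0 andbT leNgt; apply/negP; exact: h.
by rewrite S => /eqP; rewrite oner_eq0.
Qed.

Lemma tq_anti (r r' : R) : r <= r' -> tq r' <= tq r.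
Proof.
move=> h; rewrite /tq; apply: ler_wpM2l; first side.
apply: Ir_le; [exact: (cut_phi_L1 r').2|exact: (cut_phi_L1 r).2|move=> x].
apply: ler_wpM2r; first exact: powR_ge0.
by rewrite ler_nat; case: (leP r' (enorm x)) => // a; rewrite (le_trans h a).
Qed.

Lemma tq_small (z : R) : 0 < z -> exists2 r, 1 <= r & tq r <= z.
Proof.
move=> z0; have [r _ hr] := phi_tail (mulr_gt0 C0 z0).
exists (Num.max r 1); first by rewrite le_max lexx orbT.
apply: le_trans (tq_anti (_ : r <= _)) _; first by rewrite le_max lexx.
by rewrite /tq mulrC ler_pdivrMr// mulrC.
Qed.

(** [reflection_gap] bounds the form of [kg] by its eigenvalue [mu] on linear functions. Testing
    with one coordinate, [second_variation] bounds the uncorrected form by [(p-1)/(q-1)], and the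
    subtracted term lowers this by [W1 * k2]. The cut-off radius is so large that the tail costs at
    most half of the gain. *)
Theorem spectral_gap : exists g G : R, [/\ 0 < g, 0 <= G & forall (f : X -> R) c, bdd f c -> Ir P f = 0 ->
 Bq f <= ((p - 1) / (q - 1) - g) * (IP y, f y ^+ 2) + G * \sum_i vmean f i ^+ 2].
Proof.
have fin (b o S I t m g a : R) : o - S <= m * I -> b <= o + t * I -> 0 <= I -> t <= g / 2 -> m <= a - g ->
 b <= (a - g / 2) * I + S.
 move=> k1 k2' I0' tg ma; apply: le_trans k2' _; have h : (t + m) * I <= (a - g / 2) * I.
  by apply: ler_wpM2r => //; lra.
 by move: k1 h; rewrite mulrDl; move: (m * I) (t * I) ((a - g / 2) * I) => x y z; lra.
have [i hi] := coord_variance.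
have W0 := W1_gt0 i; have e1 := @dlt_unit R _ i; have ex := @dotp_dlt R _ i; set e := dlt i in W0 e1 ex.
set k2 := Ir P _ in hi.
have g0 : 0 < W1 e * k2 / 2 by rewrite divr_gt0// mulr_gt0.
have [r r1 hr] := tq_small g0.
exists (W1 e * k2 / 2), (W1 e); split=> //; first exact: ltW.
pose k := kg r (W1 e).
have [L L0 klip] := kg_lip r (W1 e).
pose B := (IM x, om r x * (Kb r * Kb r)) + W1 e.
have mk : mbl (fun z : X * X => k z.1 z.2).
 apply: measurable_funB; first exact: meas_k0.
 apply: measurable_funM => //.
 have -> : (fun z : X * X => dotp (nrm z.1) (nrm z.2)) = (fun z => \sum_j tnth (nrm z.1) j * tnth (nrm z.2) j) by [].
 by apply: measurable_sum => j; apply: measurable_funM; apply: (measurableT_comp (bdd_tnth j).1).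
have kB y w : `|k y w| <= B.
 apply: le_trans (ler_normB _ _) _; apply: lerD; first exact: k0_le.
 rewrite normrM (gtr0_norm W0) ler_piMr ?(ltW W0)//; apply: le_trans (dotp_nrm_le _ _) _; exact: enorm_nrm_le1.
have kC y w : k y w = k w y.
 by rewrite /k /kg dotpC; congr (_ - _); apply: Ir_ext => x; rewrite (mulrC (K _ _ _)).
have kR z y w : dotp z z = 1 -> k (refl z y) w = k y (refl z w).
 by move=> z1; rewrite /k /kg (k0_refl _ _ _ z1) !(nrm_refl _ z1) dotp_reflC.
have kP z y w : dotp z z = 1 -> 0 <= dn z y * dn z w -> k y (refl z w) <= k y w.
 by move=> z1 h; exact: kg_pos.
have kM y : enorm y = 1 -> Ir P (k y) = Ir P (k e).
 move=> y1; apply: (@radial_eq _ _ _ (fun y => Ir P (k y))) => [z x z1|]; last by rewrite y1 /enorm e1 sqrtr1.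
 have mkx : mbl (k x).
  exact: (measurableT_comp mk (measurable_fun_pair (measurable_cst x) (@measurable_id _ X setT))).
 by rewrite -((P_refl z1 mkx).2); apply: Ir_ext => w; exact: kR.
have [mu hmu] := Aop_eigen mk kB kR.
have q10 : 0 < q - 1 by rewrite subr_gt0; apply: lt_trans (q_gt2); rewrite ltr1n.
have hmu1 : mu <= (p - 1) / (q - 1) - W1 e * k2.
 have he : bdd (fun w : X => tnth (nrm w) i) 1 := bdd_tnth i.
 have heL := bdd_L1 he.
 have heLp : Lp (fun y => tnth (nrm y) i) by apply: Lp_bd; [exact: he.1|exact: he.2].
 have he2 : L1 P (fun y : X => tnth (nrm y) i ^+ 2) := bdd_L1 (bddM he he).
 have m0 : Ir P (fun y : X => tnth (nrm y) i) = 0.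
  have := (P_refl e1 he.1).2.
  have -> : Ir P (fun y : X => tnth (nrm (refl e y)) i) = - Ir P (fun y : X => tnth (nrm y) i).
   by rewrite -(Ir_N heL); apply: Ir_ext => y; rewrite -!ex; exact: dotp_refl_nrm.
  by move=> /eqP; rewrite eq_sym -addr_eq0 -mulr2n mulrn_eq0/= => /eqP.
 have h1 := kg_form r (W1 e) he.
 have h2 : Ir P (fun y : X => tnth (nrm y) i * Aop k (fun w => tnth (nrm w) i) y) = mu * k2.
  rewrite -(Ir_Z _ he2).
  have mA := (Aop_bdd mk kB he).1; have me := he.1.
  refine (P_unit (ltn0Sn N) _ _ _).2; [by meas|by meas|move=> y y1].
  have <- : (fun w => dn e w) = (fun w : X => tnth (nrm w) i) by apply/funext => w; exact: ex.
  by rewrite hmu// -ex (dotp_nrm_unit _ y1); ring.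
 rewrite h2 in h1.
 have h3 := om_le_Bq r heLp he2.
 have h4 := second_variation he.1 he.2 m0.
 have h5 : k2 ^+ 2 <= \sum_j vmean (fun y : X => tnth (nrm y) i) j ^+ 2.
  rewrite (bigD1 i)//=.
  have -> : vmean (fun y : X => tnth (nrm y) i) i = k2 by apply: Ir_ext => y; rewrite expr2.
  by rewrite lerDl; apply: sumr_ge0 => j _; exact: sqr_ge0.
 rewrite -(ler_pM2r hi) h1 -(ler_pM2l q10).
 have h6 : W1 e * k2 ^+ 2 <= W1 e * \sum_j vmean (fun y : X => tnth (nrm y) i) j ^+ 2 by apply: ler_wpM2l; [exact: ltW|exact: h5].
 apply: (le_trans (y := (q - 1) * (Bq (fun y => tnth (nrm y) i) - W1 e * k2 ^+ 2))).
  by rewrite ler_wpM2l ?(ltW q10)//; apply: lerB.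
 have -> : (q - 1) * (((p - 1) / (q - 1) - W1 e * k2) * k2) = (p - 1) * k2 - (q - 1) * (W1 e * k2 ^+ 2).
  by field; rewrite gt_eqF.
 by rewrite mulrBr; apply: lerB.
move=> f c hf f0.
have hfLp : Lp f by apply: Lp_bd; [exact: hf.1|exact: hf.2].
have hf2 : L1 P (fun y : X => f y ^+ 2) := bdd_L1 (bddM hf hf).
have I0 : 0 <= (IP y, f y ^+ 2) by apply: Ir_ge0 => y; exact: sqr_ge0.
have h1 := reflection_gap mk kB kC kR kP L0 klip kM hmu hf f0.
rewrite (kg_form r (W1 e) hf) in h1.
have [_ h2] := Bq_split r hfLp hf2.
exact: (fin _ _ _ _ _ _ _ _ h1 h2 I0 hr hmu1).
Qed.

(** * The local estimate near the constant *)

Lemma Bq_D (e : R) u v : 0 < e -> Lp u -> Lp v -> Bq (fun y => u y + v y) <= (1 + e) * Bq u + (1 + e^-1) * Bq v.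
Proof.
move=> e0 hu hv; have hB := Bq_L1 (Lp_D hu hv); have hBu := Bq_L1 hu; have hBv := Bq_L1 hv.
have E (a b c d k : R) : a * (k * b) + c * (k * d) = k * (a * b + c * d) by ring.
rewrite /Bq E; apply: ler_wpM2l; first side.
rewrite -(Ir_Z _ hBu) -(Ir_Z _ hBv) -(Ir_D (L1_Z _ hBu) (L1_Z _ hBv)).
apply: Ir_le; [exact: hB|exact: L1_D (L1_Z _ hBu) (L1_Z _ hBv)|move=> x].
rewrite (Top_D s0' _ (LpL1 hu) (LpL1 hv)) E; apply: ler_wpM2l; first exact: powR_ge0.
move: (T u x) (T v x) => a b; rewrite -subr_ge0.
have -> : (1 + e) * a ^+ 2 + (1 + e^-1) * b ^+ 2 - (a + b) ^+ 2 = e * (a - e^-1 * b) ^+ 2 by field; rewrite gt_eqF.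
side.
Qed.

Lemma Bq_Z c u : Lp u -> Bq (fun y => c * u y) = c ^+ 2 * Bq u.
Proof.
move=> hu; rewrite /Bq mulrCA -(Ir_Z _ (Bq_L1 hu)); congr (_ * _); apply: Ir_ext => x.
by rewrite (Top_Z s0' _ _ (LpL1 hu)) exprMn mulrCA.
Qed.

Lemma Bq_Np1 u : Lp u -> Np u <= 1 -> Bq u <= 2.
Proof.
move=> hu u1; have hB := Bq_L1 hu; have hN := Nq_L1 hu; have hp := phi_q_L1.
rewrite /Bq mulrC ler_pdivrMr//.
apply: (le_trans (y := (IM x, phi s x `^ q + `|T u x| `^ q))); last first.
 rewrite (Ir_D hp hN) phiqE mulrDl mul1r; apply: lerD => //; exact: Nq_le1.
by apply: Ir_le; [exact: hB|exact: L1_D hp hN|exact: Bq_pointwise].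
Qed.

Lemma Bq_Np (t : R) u : 0 < t -> Lp u -> Np u <= t `^ p -> Bq u <= 2 * t ^+ 2.
Proof.
move=> t0 hu ut; have hw := Lp_Z t^-1 hu.
have w1 : Np (fun y => t^-1 * u y) <= 1.
 rewrite (Np_Z _ hu) ger0_norm ?invr_ge0 ?(ltW t0)//.
 have tp : 0 < t `^ p by exact: powR_gt0.
 by rewrite (inv_powR _ t0) mulrC ler_pdivrMr ?mul1r.
have := Bq_Np1 hw w1; rewrite (Bq_Z _ hu) exprVn mulrC ler_pdivrMr//; exact: exprn_gt0.
Qed.

(** [powR_upper] at [T f / phi]. The linear term vanishes because [f] has mean zero, and the
    exponent [p/q <= 1] is handled by concavity. *)
Lemma Nq_upper (e : R) : 0 < e -> exists2 C, 0 <= C & forall f, Lp f -> Ir P f = 0 ->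
 (Nq (fun y => 1 + f y) / Cq) `^ (p / q) <= 1 + p * (q - 1) / 2 * (1 + e) * Bq f + C * Np f `^ (q / p).
Proof.
move=> e0; have [C C0' hC] := powR_upper (ltW (q_gt2)) e0.
have pq : 0 < p / q by rewrite divr_gt0.
exists (p / q * C); first by apply: mulr_ge0 => //; exact: ltW.
move=> f hf f0; have hL := LpL1 hf; have hc := L1_P_cst N.+1 (1 : R).
have [m1 m2] := Ir_phi_Top hL; rewrite f0 mulr0 in m2.
have hB := Bq_L1 hf; have hN := Nq_L1 hf; have hp := phi_q_L1.
have l2 := L1_Z q m1; have l3 := L1_Z (q * (q - 1) / 2 * (1 + e)) hB; have l4 := L1_Z C hN.
have hw : Lp (fun y => 1 + f y) by apply: Lp_D => //; exact: Lp_cst.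
have h1 : Nq (fun y => 1 + f y) <= Cq * (1 + q * (q - 1) / 2 * (1 + e) * Bq f + C * Np f `^ (q / p)).
 apply: (le_trans (y := Cq + q * 0 + q * (q - 1) / 2 * (1 + e) * (Cq * Bq f) + C * Nq f)); last first.
  have h := ler_wpM2l C0' (Nq_le hf).
  rewrite mulr0 addr0; apply: le_trans (lerD (lexx _) h) _.
  by apply: eq_lew; ring.
 have -> : Cq * Bq f = (IM x, phi s x `^ (q - 2) * T f x ^+ 2) by rewrite /Bq mulrA mulfV ?mul1r// gt_eqF.
 rewrite -[X in X + _ + _ + _](phiqE) -m2 -(Ir_Z _ m1) -(Ir_Z _ hB) -(Ir_Z _ hN).
 rewrite -(Ir_D hp l2) -(Ir_D (L1_D hp l2) l3) -(Ir_D (L1_D (L1_D hp l2) l3) l4).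
 apply: Ir_le; [exact: Nq_L1|exact: L1_D (L1_D (L1_D hp l2) l3) l4|move=> x].
 rewrite (Top_D s0' _ hc hL) -/(phi s x).
 have := phx x; move: (phi s x) (T f x) => a b a0.
 have an : a != 0 by rewrite gt_eqF.
 have E1 : a + b = a * (1 + b / a) by field.
 have E2 : a `^ q = a `^ (q - 2) * a ^+ 2 by rewrite -powR_mulrn ?(ltW a0)// -powRD1 ?gt_eqF// subrK.
 have E3 : a `^ (q - 1) = a `^ (q - 2) * a.
  by rewrite -[X in _ = _ * X](powRr1 (ltW a0)) -powRD1 ?gt_eqF//; congr powR; ring.
 have E4 : `|b| `^ q = a `^ q * `|b / a| `^ q.
  by rewrite -powRM ?(ltW a0)// normrM normfV (gtr0_norm a0); congr powR; field.
 rewrite E1 normrM (gtr0_norm a0) powRM ?(ltW a0)//.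
 apply: le_trans (ler_wpM2l (powR_ge0 a q) (hC (b / a))) _.
 rewrite E4 E3 E2; move: (a `^ (q - 2)) (`|b / a| `^ q) => A D.
 by apply: eq_lew; field.
have B0 := Bq_ge0 f.
have h2 : Nq (fun y => 1 + f y) / Cq <= 1 + (q * (q - 1) / 2 * (1 + e) * Bq f + C * Np f `^ (q / p)).
 by rewrite ler_pdivrMr// mulrC addrA.
have q10 : 0 <= q - 1 by rewrite subr_ge0.
have X0 : 0 <= q * (q - 1) / 2 * (1 + e) * Bq f + C * Np f `^ (q / p).
 apply: addr_ge0; last side.
 apply: mulr_ge0 => //; apply: mulr_ge0; last side.
 side.
have h0 : 0 <= Nq (fun y => 1 + f y) / Cq by apply: divr_ge0; [exact: Nq_ge0|exact: ltW].
apply: le_trans (powR_le (ltW pq) h0 h2) _.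
have pq1 : p / q <= 1 by rewrite ler_pdivrMr// mul1r ltW// p_lt_q.
have pq01 : 0 <= p / q <= 1 by rewrite (ltW pq).
have := tan_le pq01 (addr_ge0 ler01 X0) (@ltr01 R).
rewrite !(one_powR _) mulr1 => h3; apply: le_trans h3 _.
move: (Np f `^ (q / p)) (Bq f) => A D; apply: eq_lew; field; rewrite gt_eqF//.
Qed.

Definition small (d : R) (f : X -> R) y : R := if `|f y| <= d then f y else 0.
Definition large (d : R) (f : X -> R) y : R := if `|f y| <= d then 0 else f y.

Lemma small_large (d : R) f y : f y = small d f y + large d f y.
Proof. by rewrite /small /large; case: ifP; rewrite ?addr0 ?add0r. Qed.

Lemma meas_small d f : mbl f -> mbl (small d f) /\ mbl (large d f).
Proof. by move=> mf; split; rewrite /small /large; meas. Qed.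

Lemma small_bdd d f : 0 <= d -> mbl f -> bdd (small d f) d.
Proof.
move=> d0 mf; split=> [|y]; first exact: (meas_small d mf).1.
by rewrite /small; case: (leP `|f y| d) => //; rewrite normr0.
Qed.

Lemma large_Lp d f : Lp f -> Lp (large d f).
Proof.
move=> hf; apply: (Lp_le hf) => [|y]; first exact: (meas_small d (Lp_meas hf)).2.
by rewrite /large; case: ifP; rewrite ?normr0.
Qed.

Lemma Np_split d f : 0 <= d -> Lp f -> Np f = Np (small d f) + Np (large d f).
Proof.
move=> d0 hf; have hs : Lp (small d f) by have [ms hs] := small_bdd d0 (Lp_meas hf); apply: Lp_bd ms hs.
have hl := large_Lp d hf.
rewrite /Np -(Ir_D (Lp_pow hs) (Lp_pow hl)); apply: Ir_ext => y.
by rewrite /small /large; case: ifP; rewrite normr0 powR0 ?addr0 ?add0r// gt_eqF.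
Qed.

Lemma Np_lower (e : R) : 0 < e -> exists2 d, 0 < d <= 1 / 2 & exists2 c, 0 < c &
 forall f, Lp f -> Ir P f = 0 ->
 1 + p * (p - 1) / 2 * (1 - e) * (IP y, small d f y ^+ 2) + c * Np (large d f) <= Np (fun y => 1 + f y).
Proof.
move=> e0; have [d dd hd] := powR_lower_near (p_gt1) e0; have [c c0 hc] := powR_lower_far (p_gt1) dd.
exists d => //; exists c => // f hf f0; have d0 : 0 <= d by case/andP: dd => /ltW.
have hs := small_bdd d0 (Lp_meas hf); have hs2 : L1 P (fun y => small d f y ^+ 2) := bdd_L1 (bddM hs hs).
have hl := Lp_pow (large_Lp d hf); have hL := LpL1 hf; have h1 := L1_P_cst N.+1 (1 : R).
have l2 := L1_Z p hL; have l3 := L1_Z (p * (p - 1) / 2 * (1 - e)) hs2; have l4 := L1_Z c hl.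
have -> : 1 + p * (p - 1) / 2 * (1 - e) * (IP y, small d f y ^+ 2) + c * Np (large d f) =
 (IP y, 1 + p * f y + p * (p - 1) / 2 * (1 - e) * small d f y ^+ 2 + c * `|large d f y| `^ p).
 rewrite (Ir_D (L1_D (L1_D h1 l2) l3) l4) (Ir_D (L1_D h1 l2) l3) (Ir_D h1 l2) (Ir_Z _ hL) (Ir_Z _ hs2) (Ir_Z _ hl).
 by rewrite (@Ir_P_cst R N.+1) f0 mulr0 addr0.
apply: Ir_le; [exact: L1_D (L1_D (L1_D h1 l2) l3) l4| |move=> y].
 by apply: Lp_pow; apply: Lp_D => //; exact: Lp_cst.
rewrite /small /large; case: (leP `|f y| d) => k.
 by rewrite normr0 powR0 ?gt_eqF// mulr0 addr0; exact: hd.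
by rewrite expr0n/= mulr0 addr0; exact: hc.
Qed.

(** Where [|f| > d] one has [|f| <= d^(1-p) |f|^p]. *)
Lemma large_L1_le (d : R) f : 0 < d -> Lp f -> (IP y, `|large d f y|) <= d `^ (1 - p) * Np (large d f).
Proof.
move=> d0 hf; have hl := large_Lp d hf; rewrite /Np -(Ir_Z _ (Lp_pow hl)).
apply: Ir_le; [exact: L1_abs (LpL1 hl)|exact: L1_Z (Lp_pow hl)|move=> y].
rewrite /large; case: (leP `|f y| d) => k; first by rewrite normr0 mulr_ge0 ?powR_ge0.
have f0 : 0 < `|f y| by exact: lt_trans k.
have -> : `|f y| `^ p = `|f y| * `|f y| `^ (p - 1) by rewrite mulr_powRB1// ltW.
rewrite mulrCA ler_peMr//.
have p10 : 0 <= p - 1 by rewrite subr_ge0 ltW// p_gt1.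
have h := powR_le p10 (ltW d0) (ltW k).
apply: le_trans (ler_wpM2l (powR_ge0 d (1 - p)) h).
by rewrite -powRD1 ?gt_eqF// addrC addrA subrK subrr powRr0.
Qed.

Lemma large_sub_le (d m : R) f : 0 < d -> Lp f -> `|m| <= d `^ (1 - p) * Np (large d f) ->
 (IP y, `|large d f y - m|) <= 2 * d `^ (1 - p) * Np (large d f).
Proof.
move=> d0 hf hm; have hL := LpL1 (large_Lp d hf); have hc (c : R) : L1 P (fun=> c) by exact: L1_P_cst.
apply: (le_trans (y := (IP y, `|large d f y| + `|m|))).
 by apply: Ir_le; [exact: L1_abs (L1_B hL (hc _))|exact: L1_D (L1_abs hL) (hc _)|move=> y; exact: ler_normB].
rewrite (Ir_D (L1_abs hL) (hc _)) (@Ir_P_cst R N.+1) -mulrA mulrDl mul1r; apply: lerD => //; exact: large_L1_le.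
Qed.

Lemma powR_absD_le (r a b : R) : 0 <= r -> `|a + b| `^ r <= 2 `^ r * (`|a| `^ r + `|b| `^ r).
Proof.
move=> r0; apply: (le_trans (y := (2 * Num.max `|a| `|b|) `^ r)).
 apply: powR_le => //; apply: le_trans (ler_normD _ _) _; rewrite mulr2n mulrDl mul1r.
 by apply: lerD; rewrite le_max lexx ?orbT.
rewrite powRM ?le_max ?normr_ge0//; apply: ler_wpM2l; first exact: powR_ge0.
by rewrite maxEle; case: ifP => _; rewrite ?lerDl ?lerDr powR_ge0.
Qed.

Lemma Bq_le_Np u : Lp u -> Bq u <= 2 * Np u `^ (2 / p).
Proof.
move=> hu; have := Np_ge0 u; rewrite le_eqVlt => /predU1P[h|h].
 rewrite -h powR0 ?mulr0; last by rewrite gt_eqF// divr_gt0.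
 apply/ler_addgt0Pr => e e0; rewrite add0r.
 pose t := Num.min e 1 / 2; have t0 : 0 < t by rewrite divr_gt0// lt_min e0 ltr01.
 apply: le_trans (Bq_Np t0 hu _) _; first by rewrite -h powR_ge0.
 have te : t <= e / 2 by rewrite ler_pM2r// ge_min lexx.
 have t1 : t <= 1 / 2 by rewrite ler_pM2r// ge_min lexx orbT.
 have h2 : t * t <= 1 / 2 * (e / 2) by apply: ler_pM => //; exact: ltW.
 by rewrite expr2; move: (t * t) h2 => z h2; lra.
have t0 : 0 < Np u `^ p^-1 by exact: powR_gt0.
apply: le_trans (Bq_Np t0 hu _) _; first by rewrite -powRrM mulVf ?gt_eqF// powRr1// ltW.
by rewrite -(powR_mulrn _ (ltW t0)) -powRrM (mulrC p^-1).
Qed.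

Lemma large_sqr (d : R) f : 2 <= p -> 0 < d -> Lp f -> L1 P (fun y => large d f y ^+ 2) /\
 (IP y, large d f y ^+ 2) <= d `^ (2 - p) * Np (large d f).
Proof.
move=> p2 d0 hf; have hl := large_Lp d hf; have hp := L1_Z (d `^ (2 - p)) (Lp_pow hl).
have k y : large d f y ^+ 2 <= d `^ (2 - p) * `|large d f y| `^ p.
 rewrite /large; case: (leP `|f y| d) => k; first by rewrite expr0n/= mulr_ge0 ?powR_ge0.
 have f0 : 0 < `|f y| by exact: lt_trans k.
 have -> : `|f y| `^ p = `|f y| `^ (p - 2) * f y ^+ 2.
  by rewrite -(real_normK (num_real (f y))) -powR_mulrn// -powRD1 ?gt_eqF// subrK.
 rewrite mulrA ler_peMl ?sqr_ge0//.
 have p20 : 0 <= p - 2 by rewrite subr_ge0.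
 have h := powR_le p20 (ltW d0) (ltW k); apply: le_trans (ler_wpM2l (powR_ge0 d (2 - p)) h).
 by rewrite -powRD1 ?gt_eqF// addrC addrA subrK subrr powRr0.
have l1 : L1 P (fun y => large d f y ^+ 2).
 apply: (L1_le hp) => [|y]; first by have m := Lp_meas hl; meas.
 by rewrite ger0_norm ?sqr_ge0.
by split=> //; rewrite /Np -(Ir_Z _ (Lp_pow hl)); apply: Ir_le.
Qed.

(** For [p >= 2], outside a large ball [Bq] costs a small multiple of the squared [L^2] norm, which
    [Np] controls, and inside it the square of the [L^1] norm, quadratic in [Np]. For [p < 2],
    [Bq <= 2 Np^(2/p)] with [2/p > 1]. *)
Lemma large_Bq (d eta : R) : 0 < d -> 0 < eta -> exists2 dl, 0 < dl & forall f, Lp f -> Np (large d f) <= dl ->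
 Bq (fun y => large d f y - Ir P (large d f)) <= eta * Np (large d f).
Proof.
move=> d0 e0; pose a := d `^ (1 - p); have a0 : 0 < a by exact: powR_gt0.
have hm f : Lp f -> `|Ir P (large d f)| <= a * Np (large d f).
 move=> hf; apply: le_trans (Ir_abs (LpL1 (large_Lp d hf))) _; exact: large_L1_le.
case: (leP 2 p) => p2.
 pose z := eta / 2 / d `^ (2 - p).
 have dp : 0 < d `^ (2 - p) by exact: powR_gt0.
 have z0 : 0 < z by rewrite !divr_gt0.
 have [r _ hr] := tq_small z0; have [C C0' hC] := om_Top_le r.
 have D0 : 0 < C * (4 * a ^+ 2) by apply: mulr_gt0 => //; apply: mulr_gt0 => //; exact: exprn_gt0.
 exists (eta / 2 / (C * (4 * a ^+ 2))); first by rewrite !divr_gt0.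
 move=> f hf hE; have hl := large_Lp d hf; have hL := LpL1 hl; have [l2 k2] := large_sqr p2 d0 hf.
 set m := Ir P (large d f); have hmf := hm f hf; rewrite -/m in hmf.
 set E := Np (large d f) in hE k2 hmf *.
 have E0 : 0 <= E by exact: Np_ge0.
 have hc (c : R) : L1 P (fun=> c) by exact: L1_P_cst.
 have hu : Lp (fun y => large d f y - m) by apply: Lp_D => //; exact: Lp_cst.
 have uE y : (large d f y - m) ^+ 2 = large d f y ^+ 2 + (- (2 * m)) * large d f y + m ^+ 2 by ring.
 have l3 := L1_Z (- (2 * m)) hL.
 have u2 : L1 P (fun y => (large d f y - m) ^+ 2).
  by apply: (L1_ext _ (L1_D (L1_D l2 l3) (hc (m ^+ 2)))) => y; rewrite uE.
 have I2 : (IP y, (large d f y - m) ^+ 2) <= d `^ (2 - p) * E.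
  apply: le_trans k2; rewrite (Ir_ext P uE) (Ir_D (L1_D l2 l3) (hc _)) (Ir_D l2 l3) (Ir_Z _ hL) (@Ir_P_cst R N.+1) -/m.
  have -> : (IP y, large d f y ^+ 2) + - (2 * m) * m + m ^+ 2 = (IP y, large d f y ^+ 2) - m ^+ 2 by ring.
  by rewrite gerBl sqr_ge0.
 have [_ h1] := Bq_split r hu u2.
 have h2 := hC _ (LpL1 hu).
 have h3 := large_sub_le d0 hf hmf; rewrite -/a -/E in h3.
 have h4 : C * (IP y, `|large d f y - m|) ^+ 2 <= eta / 2 * E.
  apply: (le_trans (y := C * (2 * a * E) ^+ 2)).
   apply: ler_wpM2l; first exact: ltW.
   apply: lerXn2r => //; rewrite nnegrE; first by apply: Ir_ge0.
   side.
  have -> : C * (2 * a * E) ^+ 2 = C * (4 * a ^+ 2) * E * E by ring.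
  by apply: ler_wpM2r => //; rewrite mulrC -ler_pdivlMr.
 have h5 : tq r * (IP y, (large d f y - m) ^+ 2) <= eta / 2 * E.
  apply: (le_trans (y := z * (d `^ (2 - p) * E))).
   by apply: ler_pM => //; [apply: mulr_ge0; [rewrite invr_ge0 ltW|apply: Ir_ge0 => x; apply: mulr_ge0 => //; exact: powR_ge0]|apply: Ir_ge0 => y; exact: sqr_ge0].
  by rewrite mulrA /z divfK// gt_eqF.
 apply: le_trans h1 _; have -> : eta * E = eta / 2 * E + eta / 2 * E by field.
 by apply: lerD => //; exact: le_trans h2 h4.
pose A := 2 `^ p * (1 + a `^ p).
have A0 : 0 <= A by apply: mulr_ge0; [exact: powR_ge0|apply: addr_ge0 => //; exact: powR_ge0].
have r0 : 0 < 2 / p - 1 by rewrite subr_gt0 ltr_pdivlMr// mul1r.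
have C2 : 0 <= 2 * A `^ (2 / p) by apply: mulr_ge0 => //; exact: powR_ge0.
have [t /andP[t0 t1] ht] := pow_small C2 r0 e0.
exists t => // f hf hE; have hl := large_Lp d hf; have hmf := hm f hf; set m := Ir P (large d f) in hmf *.
set E := Np (large d f) in hE hmf *.
have E0 : 0 <= E by exact: Np_ge0.
have E1 : E <= 1 by exact: le_trans hE t1.
have hc (c : R) : L1 P (fun=> c) by exact: L1_P_cst.
have hu : Lp (fun y => large d f y - m) by apply: Lp_D => //; exact: Lp_cst.
have mp : `|m| `^ p <= a `^ p * E.
 apply: le_trans (powR_le (ltW p0) (normr_ge0 _) hmf) _.
 rewrite powRM ?(ltW a0)//; apply: ler_wpM2l; first exact: powR_ge0.
 rewrite -(mulr_powRB1 E0 p0); apply: ler_piMr => //.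
 have p10 : 0 <= p - 1 by rewrite subr_ge0 ltW// p_gt1.
 by apply: le_trans (powR_le p10 E0 E1) _; rewrite (one_powR _).
have k : Np (fun y => large d f y - m) <= A * E.
 have l1 := L1_D (Lp_pow hl) (hc (`|m| `^ p)).
 apply: (le_trans (y := 2 `^ p * (E + `|m| `^ p))).
  have -> : E + `|m| `^ p = (IP y, `|large d f y| `^ p + `|m| `^ p) by rewrite (Ir_D (Lp_pow hl) (hc _)) (@Ir_P_cst R N.+1).
  rewrite -(Ir_Z _ l1); apply: Ir_le; [exact: Lp_pow|exact: L1_Z|move=> y].
  by rewrite -(normrN m); apply: powR_absD_le; exact: ltW.
 rewrite /A -mulrA; apply: ler_wpM2l; first exact: powR_ge0.
 by rewrite mulrDl mul1r lerD2l.
apply: le_trans (Bq_le_Np hu) _.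
have p20 : 0 <= 2 / p by rewrite divr_ge0// ltW.
apply: le_trans (ler_wpM2l _ (powR_le p20 (Np_ge0 _) k)) _ => //.
rewrite (powRM _ A0 E0) mulrA; have -> : E `^ (2 / p) = E * E `^ (2 / p - 1) by rewrite mulr_powRB1// divr_gt0.
by rewrite mulrCA [X in _ <= X]mulrC; apply: ler_wpM2l => //; apply: ht; rewrite E0.
Qed.

(** The quantity that the local expansion controls; when small, it dominates the distances in both
    cases of the theorem. *)
Definition energy (d : R) f : R := (IP y, small d f y ^+ 2) + Np (large d f).

Lemma energy_ge0 (d : R) f : 0 <= energy d f.
Proof. by apply: addr_ge0; [apply: Ir_ge0 => y; exact: sqr_ge0|exact: Np_ge0]. Qed.

Lemma energy_ge2 (d : R) f : 2 <= p -> 0 < d -> d <= 1 / 2 -> Lp f -> Np f <= energy d f.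
Proof.
move=> p2 d0 d1 hf; rewrite (Np_split (ltW d0) hf) lerD2r.
have hs := small_bdd (ltW d0) (Lp_meas hf); have hs2 : L1 P (fun y => small d f y ^+ 2) := bdd_L1 (bddM hs hs).
apply: Ir_le => //; first by apply: Lp_pow; apply: Lp_bd; [exact: hs.1|exact: hs.2].
move=> y; have := hs.2 y; rewrite -(real_normK (num_real (small d f y))).
have := normr_ge0 (small d f y); move: `|small d f y| => t; rewrite le_eqVlt => /predU1P[<- _|t0 td].
 by rewrite expr0n powR0// gt_eqF.
rewrite -(powR_mulrn _ (ltW t0)); apply: ger_powR => //; rewrite t0/=.
by apply: le_trans td (le_trans d1 _); rewrite ler_pdivrMr// mul1r ler1n.
Qed.

(** With [t^2] the energy: values of [|f|] below [t] contribute at most [t^p], those between [t] and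
    [d] at most [t^(p-2) f^2], and the large part at most [t^2 <= t^p]. *)
Lemma energy_lt2 (d : R) f : p < 2 -> 0 < d -> Lp f -> energy d f <= 1 -> Np f <= 3 * energy d f `^ (p / 2).
Proof.
move=> p2 d0 hf E1; have E0 := energy_ge0 d f.
have hs := small_bdd (ltW d0) (Lp_meas hf); have hs2 : L1 P (fun y => small d f y ^+ 2) := bdd_L1 (bddM hs hs).
have key (t : R) : 0 < t -> t <= 1 -> energy d f <= t ^+ 2 -> Np f <= 3 * t `^ p.
 move=> t0 t1 Et; rewrite (Np_split (ltW d0) hf).
 have tp0 := powR_ge0 t p.
 have t2 : t ^+ 2 <= t `^ p by rewrite -(powR_mulrn _ (ltW t0)); apply: ger_powR; rewrite ?t0// ltW.
 have I0 : 0 <= (IP y, small d f y ^+ 2) by apply: Ir_ge0 => y; exact: sqr_ge0.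
 have b1 : Np (small d f) <= t `^ (p - 2) * (IP y, small d f y ^+ 2) + t `^ p.
  have hc := L1_P_cst N.+1 (t `^ p).
  rewrite -(Ir_Z _ hs2) -[X in _ + X](@Ir_P_cst R N.+1) -(Ir_D (L1_Z _ hs2) hc).
  apply: Ir_le; [by apply: Lp_pow; apply: Lp_bd; [exact: hs.1|exact: hs.2]|exact: L1_D (L1_Z _ hs2) hc|move=> y].
  rewrite -(real_normK (num_real (small d f y))); have := normr_ge0 (small d f y); move: `|small d f y| => z z0.
  case: (leP z t) => zt.
   apply: le_trans (powR_le (ltW p0) z0 zt) _; rewrite lerDr; apply: mulr_ge0; [exact: powR_ge0|exact: sqr_ge0].
  have zp : 0 < z by exact: lt_trans zt.
  apply: (le_trans (y := t `^ (p - 2) * z ^+ 2)); last by rewrite lerDl.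
  have -> : z `^ p = z `^ (p - 2) * z ^+ 2 by rewrite -(powR_mulrn _ z0) -powRD1 ?gt_eqF// subrK.
  apply: ler_wpM2r; first exact: sqr_ge0.
  have p20 : 0 <= 2 - p by rewrite subr_ge0 ltW.
  by have := powRN_le p20 t0 (ltW zt); rewrite opprB.
 have b2 : t `^ (p - 2) * (IP y, small d f y ^+ 2) + Np (large d f) * t `^ (p - 2) <= t `^ p.
  rewrite [X in _ + X]mulrC -mulrDr; apply: le_trans (ler_wpM2l (powR_ge0 _ _) Et) _.
  by rewrite -(powR_mulrn _ (ltW t0)) -powRD1 ?gt_eqF// subrK.
 have b3 : Np (large d f) <= t ^+ 2 by apply: le_trans Et; rewrite lerDr.
 have b4 : t `^ (p - 2) * (IP y, small d f y ^+ 2) <= t `^ p.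
  by apply: le_trans b2; rewrite lerDl; apply: mulr_ge0; [exact: Np_ge0|exact: powR_ge0].
 have := le_trans b3 t2; move: (Np (small d f)) (Np (large d f)) (t `^ p) (t `^ (p - 2) * _) b1 b4 => A B C' D k1 k2 k3; lra.
move: E0; rewrite le_eqVlt => /predU1P[h|h]; last first.
 have t0 : 0 < energy d f `^ 2^-1 by exact: powR_gt0.
 have e1 : energy d f `^ (p / 2) = (energy d f `^ 2^-1) `^ p by rewrite -powRrM mulrC.
 rewrite e1; apply: key => //.
  have h2 : (0 : R) <= 2^-1 by rewrite invr_ge0.
  by apply: le_trans (powR_le h2 (ltW h) E1) _; rewrite (one_powR _).
 by rewrite -(powR_mulrn _ (ltW t0)) -powRrM mulVf// powRr1// ltW.
rewrite -h powR0 ?mulr0; last by rewrite gt_eqF// divr_gt0.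
apply/ler_addgt0Pr => e e0; rewrite add0r.
have [t /andP[t0 t1] ht] := @pow_small 3 p e (ler0n _ _) p0 e0.
apply: le_trans (key t t0 t1 _) (ht t _); first by rewrite -h sqr_ge0.
by rewrite (ltW t0) lexx.
Qed.

(** [Np] is at most of the order of the energy for [p >= 2] and of its power [p/2] for [p < 2]; in
    both cases the exponent becomes larger than 1, since [q > p] and [q > 2]. *)
Lemma Np_superlinear (d eta : R) : 0 < d -> d <= 1 / 2 -> 0 < eta -> exists2 dl, 0 < dl <= 1 & forall f, Lp f ->
 energy d f <= dl -> Np f `^ (q / p) <= eta * energy d f.
Proof.
move=> d0 d1 e0; have qp0 : 0 < q / p by rewrite divr_gt0.
case: (leP 2 p) => p2.
 have r0 : 0 < q / p - 1 by rewrite subr_gt0 ltr_pdivlMr// mul1r p_lt_q.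
 have [t tt ht] := @pow_small 1 _ _ ler01 r0 e0; exists t => // f hf hE.
 have E0 := energy_ge0 d f.
 apply: le_trans (powR_le (ltW qp0) (Np_ge0 _) (energy_ge2 p2 d0 d1 hf)) _.
 rewrite -(mulr_powRB1 E0 qp0) mulrC; apply: ler_wpM2r => //.
 by rewrite -[X in X <= _]mul1r; apply: ht; rewrite E0.
have r0 : 0 < q / 2 - 1 by rewrite subr_gt0 ltr_pdivlMr// mul1r q_gt2.
have [t /andP[t0 t1] ht] := @pow_small (3 `^ (q / p)) _ _ (powR_ge0 _ _) r0 e0; exists t; first by rewrite t0.
move=> f hf hE; have E0 := energy_ge0 d f.
apply: le_trans (powR_le (ltW qp0) (Np_ge0 _) (energy_lt2 p2 d0 hf (le_trans hE t1))) _.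
rewrite powRM ?powR_ge0// -powRrM.
have -> : p / 2 * (q / p) = q / 2 by field; rewrite gt_eqF.
have q20 : 0 < q / 2 by rewrite divr_gt0.
rewrite -(mulr_powRB1 E0 q20) mulrCA [X in _ <= X]mulrC; apply: ler_wpM2l => //.
by apply: ht; rewrite E0.
Qed.

(** Truncation and recentering change the first moments by at most the [L^1] norm of the recentered
    large part, of order [Np (large d f)], so the error is quadratic. *)
Lemma vmean_split (d : R) f (m : R) : 0 < d -> Lp f -> `|m| <= d `^ (1 - p) * Np (large d f) ->
 \sum_i vmean (fun y => small d f y + m) i ^+ 2 <=
 2 * \sum_i vmean f i ^+ 2 + (8 * N.+1%:R * d `^ (1 - p) ^+ 2 * Np (large d f)) * Np (large d f).
Proof.
move=> d0 hf hm; set a := d `^ (1 - p) in hm *; set E := Np (large d f) in hm *.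
have hl := large_Lp d hf; have hL := LpL1 hl; have hs := small_bdd (ltW d0) (Lp_meas hf).
have hc (c : R) : L1 P (fun=> c) by exact: L1_P_cst.
have hi u i : L1 P u -> L1 P (fun w => tnth (nrm w) i * u w).
 move=> hu; apply: (L1_le (L1_abs hu)); first by have m1 := (bdd_tnth i).1; have m2 := L1_meas hu; meas.
 by move=> w; rewrite normrM ler_piMl//; exact: (bdd_tnth i).2.
have h2 : L1 P (fun y => large d f y - m) := L1_D hL (hc _).
have h3 := large_sub_le d0 hf hm; rewrite -/a -/E in h3.
have E0 : 0 <= E by exact: Np_ge0.
have k i : vmean (fun y => small d f y + m) i ^+ 2 <= 2 * vmean f i ^+ 2 + 8 * a ^+ 2 * E * E.
 have hsm : L1 P (fun y => small d f y + m) := L1_D (bdd_L1 hs) (hc _).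
 have -> : vmean f i = vmean (fun y => small d f y + m) i + vmean (fun y => large d f y - m) i.
  rewrite /vmean -(Ir_D (hi _ i hsm) (hi _ i h2)); apply: Ir_ext => y.
  by rewrite (small_large d f y); ring.
 have : `|vmean (fun y => large d f y - m) i| <= 2 * a * E.
  apply: le_trans h3; apply: le_trans (Ir_abs (hi _ i h2)) _.
  apply: Ir_le; [exact: L1_abs (hi _ i h2)|exact: L1_abs h2|move=> w].
  by rewrite normrM ler_piMl//; exact: (bdd_tnth i).2.
 move: (vmean _ i) (vmean _ i) => A B hB.
 have hB2 : B ^+ 2 <= (2 * a * E) ^+ 2.
  rewrite -(real_normK (num_real B)); apply: lerXn2r => //; rewrite nnegrE//; exact: le_trans hB.
 have hA : A ^+ 2 <= 2 * (A + B) ^+ 2 + 2 * B ^+ 2.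
  rewrite -subr_ge0; have -> : 2 * (A + B) ^+ 2 + 2 * B ^+ 2 - A ^+ 2 = (A + 2 * B) ^+ 2 by ring.
  exact: sqr_ge0.
 apply: le_trans hA _; rewrite lerD2l; apply: le_trans (ler_wpM2l (ler0n _ 2) hB2) _.
 by apply: eq_lew; ring.
apply: (le_trans (y := \sum_(i < N.+1) (2 * vmean f i ^+ 2 + 8 * a ^+ 2 * E * E))); first by apply: ler_sum => i _; exact: k.
rewrite big_split/= -mulr_sumr sumr_const card_ord -mulr_natr lerD2l.
by apply: eq_lew; ring.
Qed.

Lemma small_variance (d : R) f : 0 < d -> Lp f ->
 (IP y, (small d f y - Ir P (small d f)) ^+ 2) <= (IP y, small d f y ^+ 2).
Proof.
move=> d0 hf; have hs := small_bdd (ltW d0) (Lp_meas hf); have hL := bdd_L1 hs.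
have hs2 : L1 P (fun y => small d f y ^+ 2) := bdd_L1 (bddM hs hs).
set m := Ir P (small d f); have hc := L1_P_cst N.+1 (m ^+ 2).
have uE y : (small d f y - m) ^+ 2 = small d f y ^+ 2 + (- (2 * m)) * small d f y + m ^+ 2 by ring.
have l3 := L1_Z (- (2 * m)) hL.
rewrite (Ir_ext P uE) (Ir_D (L1_D hs2 l3) hc) (Ir_D hs2 l3) (Ir_Z _ hL) (@Ir_P_cst R N.+1) -/m.
move: (Ir P _) => A; have -> : A + - (2 * m) * m + m ^+ 2 = A - m ^+ 2 by ring.
by rewrite gerBl sqr_ge0.
Qed.

(** With [P = p - 1] and [Q = q - 1]: for this [e], perturbing the coefficients by [1 - e] and
    [(1 + e)^2] costs at most half of the gap [Q g]. *)
Lemma gap_margin (P Q e g : R) : 0 < P -> 0 < Q -> 0 < g -> g <= P / Q -> e = Q * g / (8 * P + Q * g) ->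
 Q * g / 2 <= P * (1 - e) - Q * (1 + e) ^+ 2 * (P / Q - g).
Proof.
move=> P0 Q0 g0 gP eE.
have Qg : 0 < Q * g by exact: mulr_gt0.
have D0 : 0 < 8 * P + Q * g by apply: addr_gt0 => //; exact: mulr_gt0.
have e0 : 0 <= e by rewrite eE; apply: divr_ge0; exact: ltW.
have e1 : e <= 1 by rewrite eE ler_pdivrMr// mul1r lerDr; apply: mulr_ge0 => //; exact: ltW.
have eP : 8 * (P * e) <= Q * g.
 rewrite eE mulrCA mulrA mulrA ler_pdivrMr// mulrC; apply: ler_wpM2l; first exact: ltW.
 by rewrite mulrC lerDl ltW.
have e2 : P * e ^+ 2 <= P * e by rewrite expr2 mulrA; apply: ler_piMr => //; apply: mulr_ge0 => //; exact: ltW.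
have -> : P * (1 - e) - Q * (1 + e) ^+ 2 * (P / Q - g) = Q * g * (1 + e) ^+ 2 - P * e * 3 - P * e ^+ 2.
 by field; rewrite gt_eqF.
have h : Q * g <= Q * g * (1 + e) ^+ 2.
 by apply: ler_peMr; [exact: ltW|apply: exprn_ege1; rewrite lerDl].
move: (Q * g) (Q * g * _) (P * e) (P * e ^+ 2) Qg eP e2 h => a b c d a0 h1 h2 h3; lra.
Qed.

(** The gap is applied to the small part recentered to mean zero; the large part, recentered the
    opposite way, enters [Bq] only as an error. The first assertion needs no smallness and later
    yields the bound on the energy that the second one assumes. *)
Theorem local_stability : exists d c C dl : R, [/\ 0 < d <= 1 / 2, 0 < c, 0 <= C, 0 < dl <= 1 & forall f, Lp f -> Ir P f = 0 ->
 1 + c * energy d f <= Np (fun y => 1 + f y) /\ (energy d f <= dl ->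
 c * energy d f <= Np (fun y => 1 + f y) - (Nq (fun y => 1 + f y) / Cq) `^ (p / q) + C * \sum_i vmean f i ^+ 2)].
Proof.
have fin (I1 E2 I1' V V' NP NQ b B B1 B2 h1' e' k G' c C1 F a1 Q K1 a' : R) :
 1 + a1 * I1 + c * E2 <= NP -> NQ <= 1 + b * B + C1 * F -> B <= h1' * B1 + e' * B2 -> 0 <= b -> 0 <= h1' -> 0 <= e' ->
 B1 <= a' * I1' + G' * V' -> 0 <= a' -> I1' <= I1 -> 0 <= G' -> V' <= 2 * V + K1 * E2 ->
 b * h1' * G' * K1 <= c / 4 -> b * e' * B2 <= c / 4 * E2 -> C1 * F <= Num.min k c / 4 * (I1 + E2) ->
 0 <= I1 -> 0 <= E2 -> 0 < k -> 0 < c -> k <= a1 - b * h1' * a' ->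
 Num.min k c / 4 * (I1 + E2) <= NP - NQ + (2 * (b * h1' * G')) * V.
 move=> H1 H2 H3 b0 h0 e0 H4 a0 H5 G0 H6 H7 H8 H9 I0 E0 k0 c0 H10.
 have t1 : b * B <= b * h1' * (a' * I1 + G' * (2 * V + K1 * E2)) + b * e' * B2.
  rewrite -!mulrA -mulrDr; apply: ler_wpM2l => //; apply: le_trans H3 _; rewrite lerD2r; apply: ler_wpM2l => //.
  by apply: le_trans H4 _; apply: lerD; apply: ler_wpM2l.
 have t2 : b * h1' * G' * K1 * E2 <= c / 4 * E2 by exact: ler_wpM2r.
 have t3 : k * I1 <= (a1 - b * h1' * a') * I1 by exact: ler_wpM2r.
 have t4 : Num.min k c * (I1 + E2) <= k * I1 + c * E2.
  by rewrite mulrDr; apply: lerD; apply: ler_wpM2r => //; rewrite ge_min lexx ?orbT.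
 have t5 : b * h1' * (a' * I1 + G' * (2 * V + K1 * E2)) = b * h1' * a' * I1 + 2 * (b * h1' * G') * V + b * h1' * G' * K1 * E2 by ring.
 rewrite t5 in t1; rewrite mulrBl in t3.
 have k1 : 0 <= k * I1 by apply: mulr_ge0 => //; exact: ltW.
 have k2 : 0 <= c * E2 by apply: mulr_ge0 => //; exact: ltW.
 have t6 : Num.min k c / 4 * (I1 + E2) = Num.min k c * (I1 + E2) / 4 by rewrite mulrAC.
 have t7 : c / 4 * E2 = c * E2 / 4 by rewrite mulrAC.
 rewrite t6 in H9 *; rewrite t7 in t2 H8.
 move: (b * h1' * a' * I1) (2 * (b * h1' * G') * V) (b * h1' * G' * K1 * E2) (b * e' * B2) (b * B) (c * E2) (k * I1) (a1 * I1)
  (C1 * F) (Num.min k c * (I1 + E2)) H1 H2 H8 H9 t1 t2 t3 t4 k1 k2 => z1 z2 z3 z4 z5 z6 z7 z8 z9 z10.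
 by move=> {}H1 {}H2 {}H8 {}H9 {}t1 {}t2 {}t3 {}t4 {}k1 {}k2; lra.
have [g' [G [g'0 G0 gap]]] := spectral_gap.
have P0 : 0 < p - 1 by rewrite subr_gt0 p_gt1.
have Q0 : 0 < q - 1 by rewrite subr_gt0; apply: lt_trans (q_gt2); rewrite ltr1n.
(* Capping the gap keeps the coefficient [(p-1)/(q-1) - g] nonnegative. *)
pose g := Num.min g' ((p - 1) / (q - 1)).
have g0 : 0 < g by rewrite lt_min g'0 divr_gt0.
have gP : g <= (p - 1) / (q - 1) by rewrite ge_min lexx orbT.
pose e := (q - 1) * g / (8 * (p - 1) + (q - 1) * g).
have Qg : 0 < (q - 1) * g by exact: mulr_gt0.
have e0 : 0 < e by apply: divr_gt0 => //; apply: addr_gt0 => //; exact: mulr_gt0.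
have mrg := gap_margin P0 Q0 g0 gP (erefl e).
have [d dd [c c0 hlow]] := Np_lower e0; have [C1 C10 hup] := Nq_upper e0.
have /andP[d0 d1] := dd.
pose b := p * (q - 1) / 2 * (1 + e).
have b0 : 0 < b by apply: mulr_gt0; [apply: divr_gt0 => //; exact: mulr_gt0|exact: addr_gt0].
have h10 : 0 < 1 + e by exact: addr_gt0.
have e10 : 0 < 1 + e^-1 by apply: addr_gt0 => //; rewrite invr_gt0.
pose k := p / 2 * ((q - 1) * g / 2).
have k0 : 0 < k by apply: mulr_gt0; apply: divr_gt0.
have kc : 0 < Num.min k c by rewrite lt_min k0.
have eta1 : 0 < c / 4 / (b * (1 + e^-1)) by apply: divr_gt0; [exact: divr_gt0|exact: mulr_gt0].
have [dl1 dl10 hB2] := large_Bq d0 eta1.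
have eta2 : 0 < Num.min k c / 4 / (C1 + 1) by apply: divr_gt0; [exact: divr_gt0|exact: ltr_wpDl].
have [dl2 /andP[dl20 dl21] hF] := Np_superlinear d0 d1 eta2.
pose K2 := b * (1 + e) * G * (8 * N.+1%:R * d `^ (1 - p) ^+ 2).
have K20 : 0 <= K2.
 apply: mulr_ge0; first by apply: mulr_ge0 => //; apply: mulr_ge0; exact: ltW.
 side.
pose dl3 := c / 4 / (K2 + 1).
have dl30 : 0 < dl3 by apply: divr_gt0; [exact: divr_gt0|exact: ltr_wpDl].
exists d, (Num.min k c / 4), (2 * (b * (1 + e) * G)), (Num.min dl1 (Num.min dl2 dl3)); split.
- exact: dd.
- exact: divr_gt0.
- by apply: mulr_ge0 => //; apply: mulr_ge0 => //; apply: mulr_ge0; exact: ltW.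
- by rewrite !lt_min dl10 dl20 dl30/= !ge_min dl21 orbT.
move=> f hf f0.
have I0 : 0 <= (IP y, small d f y ^+ 2) by apply: Ir_ge0 => y; exact: sqr_ge0.
split.
 apply: le_trans (hlow f hf f0); rewrite -addrA lerD2l /energy mulrDr.
 have k4 : Num.min k c / 4 <= Num.min k c by rewrite ler_pdivrMr// ler_peMr ?ler1n// ltW.
 apply: lerD; apply: ler_wpM2r => //; [|exact: Np_ge0|]; apply: le_trans k4 _; rewrite ge_min ?lexx ?orbT//.
 apply/orP; left; rewrite /k.
 have mr : (q - 1) * g / 2 <= (p - 1) * (1 - e).
  apply: le_trans mrg _; rewrite gerBl; apply: mulr_ge0; last by rewrite subr_ge0.
  by apply: mulr_ge0; [exact: ltW|exact: sqr_ge0].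
 have -> : p * (p - 1) / 2 * (1 - e) = p / 2 * ((p - 1) * (1 - e)) by ring.
 by apply: ler_wpM2l => //; apply: divr_ge0 => //; exact: ltW.
rewrite !le_min => /and3P[E1 E2 E3].
have hl := large_Lp d hf; have hs := small_bdd (ltW d0) (Lp_meas hf); have hsL := bdd_L1 hs.
have LE : Np (large d f) <= energy d f by rewrite lerDr.
have mE : Ir P (small d f) = - Ir P (large d f).
 apply/eqP; rewrite -addr_eq0 -(Ir_D hsL (LpL1 hl)); apply/eqP; rewrite -[RHS]f0.
 by apply: Ir_ext => y; rewrite -small_large.
have hm : `|Ir P (large d f)| <= d `^ (1 - p) * Np (large d f).
 by apply: le_trans (Ir_abs (LpL1 hl)) _; exact: large_L1_le.
have hs' : bdd (fun y => small d f y + Ir P (large d f)) (d + `|Ir P (large d f)|).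
 by apply: bddD hs _; split=> //; exact: measurable_cst.
have s'0 : (IP y, small d f y + Ir P (large d f)) = 0.
 by rewrite (Ir_D hsL (L1_P_cst _ _)) (@Ir_P_cst R N.+1) mE addNr.
have hl' : Lp (fun y => large d f y - Ir P (large d f)) by apply: Lp_D => //; exact: Lp_cst.
have hs'Lp : Lp (fun y => small d f y + Ir P (large d f)) by apply: Lp_bd; [exact: hs'.1|exact: hs'.2].
have fE : Bq f = Bq (fun y => (small d f y + Ir P (large d f)) + (large d f y - Ir P (large d f))).
 congr (Bq _); apply/funext => y; rewrite (small_large d f y); ring.
apply: (fin _ _ (IP y, (small d f y + Ir P (large d f)) ^+ 2) _
 (\sum_i vmean (fun y => small d f y + Ir P (large d f)) i ^+ 2) _ _ _ _ _ _ (1 + e) (1 + e^-1) k G c C1 _ _ 0 _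
 ((p - 1) / (q - 1) - g) (hlow f hf f0) (hup f hf f0)).
- by rewrite fE; exact: Bq_D e0 hs'Lp hl'.
- exact: ltW.
- exact: ltW.
- exact: ltW.
- apply: le_trans (gap _ _ hs' s'0) _; rewrite lerD2r; apply: ler_wpM2r; first by apply: Ir_ge0 => y; exact: sqr_ge0.
 by rewrite lerD2l lerN2 ge_min lexx.
- by rewrite subr_ge0.
- have := small_variance d0 hf; by rewrite mE opprK.
- exact: G0.
- exact: vmean_split d0 hf hm.
- rewrite -/b mulrA -/K2; apply: le_trans (ler_wpM2l K20 (le_trans LE E3)) _.
 by rewrite /dl3 mulrA ler_pdivrMr ?ltr_wpDl// mulrC; apply: ler_wpM2l; [apply: divr_ge0 => //; exact: ltW|rewrite lerDl].
- have h := hB2 f hf (le_trans LE E1); have h' := ler_wpM2l (mulr_ge0 (ltW b0) (ltW e10)) h.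
 by apply: le_trans h' _; rewrite mulrA [X in X * _ <= _]mulrC divfK// gt_eqF// mulr_gt0.
- have h := ler_wpM2l C10 (hF f hf E2); apply: le_trans h _; rewrite mulrA; apply: ler_wpM2r; first exact: energy_ge0.
 by rewrite mulrA ler_pdivrMr ?ltr_wpDl// mulrC; apply: ler_wpM2l; [apply: divr_ge0 => //; exact: ltW|rewrite lerDl].
- exact: I0.
- exact: Np_ge0.
- exact: k0.
- exact: c0.
- have h := ler_wpM2l (ltW (divr_gt0 p0 (ltr0n _ 2))) mrg; apply: le_trans h _.
 by rewrite /b; apply: eq_lew; ring.
Qed.

(** * From local to global stability *)

Lemma Ir_dotp_nrm e : dotp e e = 1 -> (IP y, dn e y) = 0.
Proof.
move=> e1; have hb := bdd_dotp e; have heL := bdd_L1 hb.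
have := (P_refl e1 hb.1).2.
have -> : (IP y, dn e (refl e y)) = - (IP y, dn e y).
 by rewrite -(Ir_N heL); apply: Ir_ext => y; exact: dotp_refl_nrm.
by move=> /eqP; rewrite eq_sym -addr_eq0 -mulr2n mulrn_eq0/= => /eqP.
Qed.

Lemma vmean_center (v : X -> R) (m t : R) i : L1 P v -> 
 (forall e, dotp e e = 1 -> `|(IP y, dn e y * v y)| <= t) ->
 `|vmean (fun y => m * v y - 1) i| <= `|m| * t.
Proof.
move=> hv ht; pose e : X := dlt i; have e1 : dotp e e = 1 := dlt_unit i.
have l1 := L1_Z m (dotp_nrm_L1 e1 hv); have l2 := bdd_L1 (bdd_dotp e).
have -> : vmean (fun y => m * v y - 1) i = m * (IP y, dn e y * v y) - (IP y, dn e y).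
 by rewrite -(Ir_Z _ (dotp_nrm_L1 e1 hv)) -(Ir_B l1 l2); apply: Ir_ext => y; rewrite dotp_dlt; ring.
by rewrite (Ir_dotp_nrm e1) subr0 normrM; apply: ler_wpM2l => //; exact: ht.
Qed.

Lemma deviation_ge2 (d : R) f : 2 <= p -> 0 < d -> d <= 1 / 2 -> Lp f -> L1 P (fun y => f y ^+ 2) /\
 Np f + (IP y, f y ^+ 2) <= (2 + d `^ (2 - p)) * energy d f.
Proof.
move=> p2 d0 d1 hf; have [l2 k2] := large_sqr p2 d0 hf.
have hs := small_bdd (ltW d0) (Lp_meas hf); have hs2 : L1 P (fun y => small d f y ^+ 2) := bdd_L1 (bddM hs hs).
have E y : small d f y ^+ 2 + large d f y ^+ 2 = f y ^+ 2.
 by rewrite /small /large; case: ifP; rewrite expr0n ?addr0 ?add0r.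
split; first exact: (L1_ext E (L1_D hs2 l2)).
rewrite -(Ir_ext P E) (Ir_D hs2 l2).
have h := energy_ge2 p2 d0 d1 hf; have I0 : 0 <= (IP y, small d f y ^+ 2) by apply: Ir_ge0 => y; exact: sqr_ge0.
have n0 := Np_ge0 (large d f); have a0 := powR_ge0 d (2 - p).
rewrite mulrDl mulrDl mul1r -addrA; apply: lerD => //; apply: lerD; first by rewrite lerDl.
by apply: le_trans k2 _; apply: ler_wpM2l => //; rewrite lerDr.
Qed.

Lemma deviation_lt2 (d : R) f : p < 2 -> 0 < d -> Lp f -> energy d f <= 1 -> Np f `^ (2 / p) <= 3 `^ (2 / p) * energy d f.
Proof.
move=> p2 d0 hf E1; have p20 : 0 <= 2 / p by rewrite divr_ge0// ltW.
apply: le_trans (powR_le p20 (Np_ge0 _) (energy_lt2 p2 d0 hf E1)) _.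
rewrite powRM ?powR_ge0// -powRrM; have -> : p / 2 * (2 / p) = 1 by field; rewrite gt_eqF.
by rewrite powRr1// energy_ge0.
Qed.

(** The choice of [d] makes [(1 - p d) (1 + a) = 1], and [x^p >= 1 - p d] by convexity. *)
Lemma inv_powR_le (d a x : R) : 0 < a -> d = a / (p * (1 + a)) -> 1 - d <= x -> [/\ 0 < d, d < 1, 0 < x & x^-1 `^ p <= 1 + a].
Proof.
move=> a0 dE dx; have a1 : 0 < 1 + a by exact: addr_gt0.
have d0 : 0 < d by rewrite dE divr_gt0// mulr_gt0.
have pd : p * d * (1 + a) = a by rewrite dE; field; rewrite !gt_eqF.
have p1 := ltW (p_gt1).
have d1 : d < 1.
 rewrite dE ltr_pdivrMr; last exact: mulr_gt0.
 by rewrite mul1r; apply: (lt_le_trans (y := 1 + a)); rewrite ?ltrDr// ler_peMl// ltW.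
have x0 : 0 < x by apply: lt_le_trans dx; rewrite subr_gt0.
split=> //.
have := tan_ge p1 (ltW x0) (@ler01 R); rewrite !(one_powR _) mulr1 => h.
have h2 : 1 - p * d <= x `^ p.
 apply: le_trans h; rewrite lerD2l -mulrN; apply: ler_wpM2l; first exact: ltW.
 by rewrite lerBrDl.
have xp : 0 < x `^ p by exact: powR_gt0.
rewrite (inv_powR _ x0) -[_^-1]mul1r ler_pdivrMr//; apply: le_trans (ler_wpM2l (ltW a1) h2).
by rewrite mulrBr mulr1 (mulrC (1 + a)) pd addrK.
Qed.

(** If the deficit is small, [u] is centered and divided by its mean: [f = l v - 1] then has mean
    zero and first moments [O(t)], with [t] arbitrarily small. These moments account for the error
    [e]. *)
Theorem global_stability : exists2 c, 0 < c & forall u, Lp u -> Np u = 1 -> forall e : R, 0 < e ->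
 exists v (l : R), [/\ moved u v, Lp v,
  2 <= p -> L1 P (fun y => (l * v y - 1) ^+ 2) /\
   c * (Np (fun y => l * v y - 1) + (IP y, (l * v y - 1) ^+ 2)) <= 1 - (Nq u / Cq) `^ (p / q) + e &
  p < 2 -> c * Np (fun y => l * v y - 1) `^ (2 / p) <= 1 - (Nq u / Cq) `^ (p / q) + e].
Proof.
have [d [c [C [dl [/andP[d0 d1] c0 C0' /andP[dl0 dl1] loc]]]]] := local_stability.
(* The mean must be so close to 1 in absolute value that its inverse [m] has [|m|^p <= 1 + c dl];
   then the first half of [local_stability] gives [energy d f <= dl]. *)
have a0 : 0 < c * dl by exact: mulr_gt0.
pose K := 1 + c * dl; have K0 : 0 < K by exact: addr_gt0.
pose dc := (c * dl) / (p * (1 + c * dl)).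
have [dc0 dc1 _ _] := inv_powR_le a0 (erefl dc) (lexx _).
have [r /andP[r0 r1] cpt] := compactness dc0 dc1.
have [Cc Cc0 cen] := centering.
pose d2 := Num.min (1 / 2) (p / q * r).
have pq0 : 0 < p / q by rewrite divr_gt0.
have d20 : 0 < d2 by rewrite lt_min divr_gt0// mulr_gt0.
(* Covers the constants of [deviation_ge2] and [deviation_lt2] together. *)
pose Cd := 2 + d `^ (2 - p) + 3 `^ (2 / p).
have Cd0 : 0 < Cd by rewrite /Cd -addrA ltr_wpDr// addr_ge0 ?powR_ge0.
exists (Num.min (d2 / 2) (c / (K * Cd))); first by rewrite lt_min divr_gt0//= divr_gt0// mulr_gt0.
move=> u hu u1 e e0; have u1' : Np u <= 1 by rewrite u1.
set D := 1 - (Nq u / Cq) `^ (p / q).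
set cc := Num.min _ _.
have cc0 : 0 <= cc by rewrite le_min !divr_ge0 ?(ltW d20) ?(ltW c0)// mulr_ge0 ?(ltW K0) ?(ltW Cd0).
have x0 : 0 <= Nq u / Cq by apply: divr_ge0; [exact: Nq_ge0|exact: ltW].
have x1 : Nq u / Cq <= 1 by rewrite ler_pdivrMr// mul1r; apply: Nq_le1 => //; rewrite u1.
have D0 : 0 <= D.
 by rewrite subr_ge0; apply: le_trans (powR_le (ltW pq0) x0 x1) _; rewrite (one_powR _).
(* Large deficit: with [l = 0] the deviation is the constant [- 1], of norm 1. *)
have [hD|hD] := leP d2 D.
 have [v [S [mv hv _ _ _]]] := center_exists hu u1' (@ltr01 R).
 exists v, 0; have E1 y : 0 * v y - 1 = - 1 by rewrite mul0r sub0r.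
 have n1 : Np (fun y => 0 * v y - 1) = 1.
  by rewrite -[RHS](Np1); apply: Ir_ext => y; rewrite E1 normrN//.
 have i1 : (IP y, (0 * v y - 1) ^+ 2) = 1.
  by rewrite -[RHS](@Ir_P_cst R N.+1 1); apply: Ir_ext => y; rewrite E1 sqrrN expr1n.
 have cd : cc <= d2 / 2 by rewrite ge_min lexx.
 split=> //.
  move=> _; split; first by apply: (L1_ext _ (L1_P_cst N.+1 (1 : R))) => y; rewrite E1 sqrrN expr1n.
  rewrite n1 i1; apply: (le_trans (y := d2)); last by apply: le_trans hD _; rewrite lerDl ltW.
  by rewrite -ler_pdivlMr.
 move=> _; rewrite n1 (one_powR _) mulr1; apply: le_trans cd _.
 by rewrite ler_pdivrMr//; apply: le_trans hD _; rewrite mulrDl mulr2n mulrDr mulr1 -addrA lerDl; apply: addr_ge0 => //; apply: mulr_ge0 => //; exact: ltW.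
(* [Nq u / Cq = (1 - D)^(q/p) >= 1 - (q/p) D], hence the factor [p/q] in [d2]. *)
have hNq : Cq * (1 - r) <= Nq u.
 rewrite mulrC -ler_pdivlMr//.
 have xE : Nq u / Cq = (1 - D) `^ (q / p).
  rewrite /D opprB addrC subrK -powRrM; have -> : p / q * (q / p) = 1 by field; rewrite !gt_eqF.
  by rewrite powRr1.
 have qp1 : 1 <= q / p by rewrite ler_pdivlMr// mul1r ltW// p_lt_q.
 have D1 : 0 <= 1 - D by rewrite /D opprB addrC subrK powR_ge0.
 have := tan_ge qp1 D1 (@ler01 R); rewrite -xE !(one_powR _) mulr1 => h.
 apply: le_trans h; rewrite lerD2l addrAC subrr sub0r mulrN lerN2.
 have : D <= p / q * r by apply: le_trans (ltW hD) _; rewrite ge_min lexx orbT.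
 move=> h; apply: le_trans (ler_wpM2l (le_trans ler01 qp1) h) _.
 by rewrite mulrA; have -> : q / p * (p / q) = 1; [by field; rewrite !gt_eqF|rewrite mul1r].
(* [Z t^2] is the contribution of the first moments divided by [K]; [t] is chosen to make it at most
   [e]. *)
pose Z := C * (N.+1%:R * ((1 - dc)^-1 * Cc) ^+ 2) / K.
have Z0 : 0 <= Z.
 apply: divr_ge0; [apply: mulr_ge0 => //; apply: mulr_ge0 => //; exact: sqr_ge0|exact: ltW].
have ri : 0 < r^-1 by rewrite invr_gt0.
have Zr : 0 <= Z + 4 + r^-1 by apply: addr_ge0; [exact: addr_ge0|exact: ltW].
have e1 : 0 < Num.min e 1 by rewrite lt_min e0 ltr01.
have [t /andP[t_0 t1] ht] := pow_small Zr ltr01 e1.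
have := ht t; rewrite (ltW t_0) lexx (powRr1 (ltW t_0)) => /(_ isT); rewrite le_min => /andP[te tl].
have t4 : t <= 1 / 4.
 rewrite ler_pdivlMr// mulrC; apply: le_trans tl; apply: ler_wpM2r; first exact: ltW.
 by rewrite -addrA addrCA lerDl addr_ge0// ltW.
have tr : t ^+ 2 <= r.
 apply: (le_trans (y := t)); first by rewrite expr2 ler_piMl// ltW.
 have : r^-1 * t <= 1 by apply: le_trans tl; apply: ler_wpM2r; [exact: ltW|rewrite lerDr addr_ge0].
 by rewrite mulrC ler_pdivrMr// mul1r.
have tZ : Z * t ^+ 2 <= e.
 apply: (le_trans (y := Z * t)); first by apply: ler_wpM2l => //; rewrite expr2 ler_piMl// ltW.
 by apply: le_trans te; apply: ler_wpM2r; [exact: ltW|rewrite -addrA lerDl addr_ge0// ltW].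
have t20 : 0 < t ^+ 2 by exact: exprn_gt0.
have [v [S [mv hv v1 vq [vS v0]]]] := center_exists hu u1' t20.
rewrite u1 in v1; have v1' : Np v <= 1 by rewrite v1.
have vmom := cen v S t hv v1' t_0 t4 vS v0.
have S0 : 0 <= S by exact: le_trans (normr_ge0 _) (vS (t0 _)).
have vr : (1 - r) * S <= `|Ir P v|.
 by rewrite -(Top0); apply: le_trans v0; apply: ler_wpM2r => //; rewrite lerD2l lerN2.
have vq' : Cq * (1 - r) <= Nq v by rewrite vq.
have [hm _] := cpt v S hv v1 vq' vS vr.
have [_ _ m0 mK] := inv_powR_le a0 (erefl dc) hm; rewrite -/K -normfV in mK.
exists v, (Ir P v)^-1; set m := (Ir P v)^-1 in mK *.
have mn : Ir P v != 0 by rewrite -normr_gt0.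
have hL := LpL1 hv.
pose f y := m * v y - 1.
have hf : Lp f by apply: Lp_D; [exact: Lp_Z|exact: Lp_cst].
have f0 : Ir P f = 0.
 by rewrite /f (Ir_B (L1_Z m hL) (L1_P_cst _ _)) (Ir_Z _ hL) (@Ir_P_cst R N.+1) mulVf// subrr.
have fE : (fun y => 1 + f y) = (fun y => m * v y) by apply/funext => y; rewrite /f addrC subrK.
have [lo st] := loc f hf f0; rewrite fE (Np_Z _ hv) v1 mulr1 in lo st.
have Edl : energy d f <= dl.
 by rewrite -(ler_pM2l c0) -(lerD2l 1); exact: le_trans lo mK.
have {}st := st Edl; rewrite (Nq_Z _ (Nq_L1 hv) hv) vq -mulrA (powRM _ (powR_ge0 _ _) x0) -powRrM in st.
have pE : q * (p / q) = p by field; rewrite gt_eqF.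
rewrite pE in st.
have hV : \sum_i vmean f i ^+ 2 <= N.+1%:R * ((1 - dc)^-1 * Cc) ^+ 2 * t ^+ 2.
 have -> : N.+1%:R * ((1 - dc)^-1 * Cc) ^+ 2 * t ^+ 2 = \sum_(i < N.+1) ((1 - dc)^-1 * (Cc * t)) ^+ 2.
  rewrite sumr_const card_ord -mulr_natl; ring.
 apply: ler_sum => i _; have h := vmean_center m i hL vmom.
 have dcp : 0 < 1 - dc by rewrite subr_gt0.
 have mi : `|m| <= (1 - dc)^-1 by rewrite normfV lef_pV2 ?posrE.
 rewrite -(real_normK (num_real (vmean f i))); apply: lerXn2r; rewrite ?nnegrE//.
  by apply: mulr_ge0; [rewrite invr_ge0 ltW|apply: mulr_ge0 => //; exact: ltW].
 by apply: le_trans h _; apply: ler_wpM2r => //; apply: mulr_ge0 => //; exact: ltW.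
have main : c * energy d f <= K * (D + e).
 apply: le_trans st _.
 have -> : `|m| `^ p - `|m| `^ p * (Nq u / Cq) `^ (p / q) = `|m| `^ p * D by rewrite /D mulrBr mulr1.
 rewrite [X in _ <= X]mulrDr; apply: lerD; first exact: ler_wpM2r.
 apply: le_trans (ler_wpM2l C0' hV) _; rewrite [X in _ <= X]mulrC -ler_pdivrMr//.
 by apply: le_trans tZ; rewrite /Z; apply: eq_lew; ring.
have key (x : R) : x <= Cd * energy d f -> cc * x <= D + e.
 move=> h; apply: le_trans (ler_wpM2l cc0 h) _.
 have E0 := energy_ge0 d f.
 apply: (le_trans (y := c / (K * Cd) * (Cd * energy d f))).
  by apply: ler_wpM2r; [apply: mulr_ge0 => //; exact: ltW|rewrite ge_min lexx orbT].
 have -> : c / (K * Cd) * (Cd * energy d f) = c * energy d f / K by field; rewrite !gt_eqF.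
 by rewrite ler_pdivrMr// [X in _ <= X]mulrC.
have a1 := powR_ge0 d (2 - p); have a2 := powR_ge0 (3 : R) (2 / p); have E0 := energy_ge0 d f.
split=> //.
 move=> p2; have [l1 h] := deviation_ge2 p2 d0 d1 hf; split; first exact: l1.
 by apply: key; apply: le_trans h _; apply: ler_wpM2r => //; rewrite lerDl.
move=> p2; apply: key; apply: le_trans (deviation_lt2 p2 d0 hf (le_trans Edl dl1)) _.
by apply: ler_wpM2r => //; rewrite lerDr; apply: addr_ge0.
Qed.

(** * Back to the ball and the sphere *)

Local Notation area := (@area R N).
Section BallSide.
Variables al be : R.
Hypothesis hs : s = (N.+1%:R - al) / 2.
Hypothesis hq : q * (s - be) = N.+1%:R.
Let A0 : 0 < area. Proof. exact: area_gt0. Qed.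
Let om x : R := 2 / (1 - enorm x ^+ 2).
Definition kapQ : R := (area * 2 `^ (- s)) `^ q.

Lemma kapQ_gt0 : 0 < kapQ.
Proof. by side. Qed.

(** [|x - y|^2 = (1 - |x|^2) ker (om x * x) y] for [|y| = 1], and [al - n = - 2 s]. *)
Lemma ball_ker x y : enorm x < 1 -> enorm y = 1 ->
 enorm (tsub x y) `^ (al - N.+1%:R) = (1 - enorm x ^+ 2) `^ (- s) * K s (tscale (om x) x) y.
Proof.
move=> x1 y1; have a1 : 0 < 1 - enorm x ^+ 2 by rewrite subr_gt0 expr_lt1// enorm_ge0.
have hE : hgt (tscale (om x) x) = (1 + enorm x ^+ 2) / (1 - enorm x ^+ 2).
 have h0 : 0 <= (1 + enorm x ^+ 2) / (1 - enorm x ^+ 2).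
  by apply: divr_ge0; [apply: addr_ge0 => //; exact: sqr_ge0|exact: ltW].
 rewrite /hgt -[RHS](ger0_norm h0) -[RHS]sqrtr_sqr; congr Num.sqrt; rewrite dotpZl dotpZr -enormE /om.
 by field; rewrite gt_eqF.
have kE : enorm (tsub x y) ^+ 2 = (1 - enorm x ^+ 2) * ker (tscale (om x) x) y.
 rewrite enormE dotpBl !dotpBr -!enormE y1 (dotpC y x) /ker hE dotpZl (nrm1 y1) /om.
 by field; rewrite gt_eqF.
have -> : al - N.+1%:R = 2%:R * - s by rewrite hs; field.
by rewrite powRrM powR_mulrn ?enorm_ge0// kE powRM ?(ltW a1)// ltW// ker_gt0.
Qed.

Lemma QabE u x : Lp (sext u) -> enorm x < 1 ->
 Qab al be u x = area * 2 `^ (- s) * (om x `^ (s - be) * T (sext u) (tscale (om x) x)).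
Proof.
move=> hu x1; have a1 : 0 < 1 - enorm x ^+ 2 by rewrite subr_gt0 expr_lt1// enorm_ge0.
have o0 : 0 < om x by rewrite divr_gt0.
have hL := LpL1 hu; have hT := Top_L1 s0' (tscale (om x) x) hL.
rewrite /Qab (sphere_rintE (h := fun y => (1 - enorm x ^+ 2) `^ (- s) * (K s (tscale (om x) x) y * sext u y))).
- rewrite (Ir_Z _ hT) -/(T (sext u) _).
 have -> : (1 - enorm x ^+ 2) / 2 = (om x)^-1 by rewrite /om invf_div.
 have -> : 1 - enorm x ^+ 2 = 2 * (om x)^-1 by rewrite /om invf_div mulrC divfK.
 rewrite powRM ?invr_ge0 ?(ltW o0)// -!powR_inv1 ?(ltW o0)// -!powRrM !mulN1r opprK.
 have -> : om x `^ (s - be) = om x `^ (- be) * om x `^ s by rewrite -powRD1 ?gt_eqF// addrC.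
 by ring.
- exact: L1_Z.
- by move=> y y1; rewrite ball_ker// sext_unit// mulrA.
Qed.

(** The weights combine to [om^((s - be) q)], and [(s - be) q = n] is exactly the exponent of the
    hyperbolic volume in the ball. *)
Lemma LqB_powE u : Lp (sext u) -> LqB_pow q (Qab al be u) = (kapQ * Nq (sext u))%:E.
Proof.
move=> hu; have mT : mbl (T (sext u)) by have mu := Lp_meas hu; apply: meas_Top.
pose F x : \bar R := (kapQ * `|T (sext u) x| `^ q)%:E.
have mF : mbl F by rewrite /F; meas.
have F0 x : (0 <= F x)%E by rewrite lee_fin mulr_ge0 ?powR_ge0.
have k0 : 0 <= area * 2 `^ (- s) by apply: mulr_ge0; [exact: ltW|exact: powR_ge0].
have E x : (if enorm x < 1 then (`|Qab al be u x| `^ q)%:E else 0%E) =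
 ((ind (enorm x < 1) * (2 / (1 - enorm x ^+ 2)) ^+ N.+1)%:E * F (tscale (2 / (1 - enorm x ^+ 2)) x))%E.
 case: ifPn => x1; last by rewrite mul0r mul0e.
 have a1 : 0 < 1 - enorm x ^+ 2 by rewrite subr_gt0 expr_lt1// enorm_ge0.
 have o0 : 0 < om x by rewrite divr_gt0.
 rewrite QabE// mul1r /F -EFinM -/(om x); congr EFin.
 rewrite normrM (ger0_norm k0) normrM (ger0_norm (powR_ge0 _ _)) (powRM _ k0) ?mulr_ge0 ?powR_ge0//.
 rewrite -/kapQ (powRM _ (powR_ge0 _ _)) // -powRrM.
 have -> : (s - be) * q = N.+1%:R by rewrite mulrC.
 by rewrite powR_mulrn ?(ltW o0)// mulrCA.
rewrite /LqB_pow /ball_int; have -> := (funext E : (fun x => _) = _).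
rewrite iintE; first last.
- move=> x; case: (ltP (enorm x) 1) => x1; last by rewrite mul0r mul0e.
 apply: mule_ge0 => //; rewrite lee_fin mul1r; apply: exprn_ge0; apply: divr_ge0 => //.
 by rewrite subr_ge0 expr_le1 ?enorm_ge0// ltW.
- by apply: emeasurable_funM; [meas|apply: (measurableT_comp mF); meas].
by rewrite (ball_hyp mF F0) (IrE (L1_Z _ (Nq_L1 hu))) (Ir_Z _ (Nq_L1 hu)).
Qed.

End BallSide.

(** The point lies on the first axis at [- k / (1 + c)], minus the hyperbolic tangent of half the
    rapidity. *)
Lemma Psi_boost (c k : R) : 0 < c -> c ^+ 2 = 1 + k ^+ 2 -> exists z : X, enorm z < 1 /\ forall y, enorm y = 1 ->
 Psi z y = nrm (cboost c k y) /\ conf_jac z y = dil c k y ^- N.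
Proof.
move=> c0 ck; have c1 : 0 < 1 + c by exact: addr_gt0.
have cn : 1 + c != 0 by rewrite gt_eqF.
pose t := - k / (1 + c).
have kk : k ^+ 2 = (c - 1) * (1 + c) by have -> : k ^+ 2 = c ^+ 2 - 1; [rewrite ck|]; ring.
have t2 : t ^+ 2 = (c - 1) / (1 + c) by rewrite /t expr_div_n sqrrN kk; field.
have t21 : 1 - t ^+ 2 = 2 / (1 + c) by rewrite t2; field.
have tp : 0 < 1 - t ^+ 2 by rewrite t21 divr_gt0.
pose e0 : X := dlt ord0; have ex := @dotp_dlt R N.+1 ord0.
pose z := tscale t e0; have zy y : dotp z y = t * tnth y ord0 by rewrite dotpZl ex.
have zz : enorm z ^+ 2 = t ^+ 2 by rewrite enormE /z dotpZl dotpZr ex tnth_mktuple eqxx mulr1 expr2.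
exists z; split.
 by rewrite -(ltr_pXn2r (n := 2)) ?nnegrE ?enorm_ge0// expr1n zz -subr_gt0.
move=> y y1; have dp : 0 < dil c k y by apply: dil_gt0 => //; rewrite y1.
have dn : dil c k y != 0 by rewrite gt_eqF.
have den : 1 - 2 * dotp z y + enorm z ^+ 2 = (1 - t ^+ 2) * dil c k y.
 rewrite zy zz t21 /dil y1 t2 /t; field; exact: cn.
split; last by rewrite /conf_jac den zz /= invfM mulrA mulfV ?gt_eqF// mul1r exprVn.
have yz : enorm (tsub y z) ^+ 2 = 1 - 2 * dotp z y + enorm z ^+ 2.
 by rewrite enormE dotpBl !dotpBr -!enormE y1 (dotpC y z); ring.
apply: eq_from_tnth => i; rewrite !tnth_mktuple yz y1 expr1n mulr1 den zz (enorm_cboost ck (ltW dp)) invfM.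
have -> : tnth (cboost c k y) i = if i == ord0 then c * tnth y ord0 + k else tnth y i.
 rewrite /cboost y1 mulr1; case: (unliftP ord0 i) => [j ->|->] //.
 case/tupleP: y {y1 dp dn den yz} => a u.
 have -> : behead_tuple [tuple of a :: u] = u by apply/val_inj.
 by rewrite !tnthS.
have E (a b : R) : a = b -> (1 - t ^+ 2) * a / ((1 - t ^+ 2) * dil c k y) = (dil c k y)^-1 * b.
 by move=> ->; field; rewrite dn gt_eqF.
rewrite -invfM -[_ * dil _ _ _ * (t * _)]mulrA -mulrBr; apply: E.
case: eqP => [->|_]; last by rewrite !mulr0 !subr0.
rewrite mulr1 /dil y1 mulr1.
have -> : tnth y ord0 - t - (c + k * tnth y ord0) * t = tnth y ord0 + k + k ^+ 2 * tnth y ord0 / (1 + c).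
 by rewrite /t; field.
by rewrite kk; field.
Qed.

(** The Householder matrix of [refl e]. *)
Definition hh (e : X) : 'M[R]_N.+1 := \matrix_(i, j) ((i == j)%:R - 2 * (tnth e i * tnth e j)).

Lemma mxapp_hh e x : mxapp (hh e) x = refl e x.
Proof.
apply: eq_from_tnth => i; rewrite !tnth_mktuple.
have -> : \sum_j hh e i j * tnth x j = \sum_j (i == j)%:R * tnth x j - 2 * tnth e i * \sum_j tnth e j * tnth x j.
 by rewrite mulr_sumr -sumrB; apply: eq_bigr => j _; rewrite mxE; ring.
rewrite (bigD1 i)//= eqxx mul1r big1 ?addr0; last by move=> j ji; rewrite eq_sym (negbTE ji) mul0r.
by rewrite -/(dotp e x); ring.
Qed.

Lemma hh_orthogonal e : dotp e e = 1 -> Defs.orthogonal (hh e).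
Proof.
move=> e1; apply/matrixP => i j; rewrite !mxE.
have := congr1 (fun x => tnth x i) (reflK e1 [tuple (k == j)%:R | k < N.+1]).
rewrite -!mxapp_hh !tnth_mktuple /= => <-; apply: eq_bigr => k _; congr (_ * _).
rewrite tnth_mktuple (bigD1 j)//= big1 ?addr0; last by move=> l lj; rewrite tnth_mktuple (negbTE lj) mulr0.
by rewrite tnth_mktuple eqxx mulr1 !mxE eq_sym (mulrC (tnth e j)).
Qed.

(** The Jacobian [dil^-N] raised to [1/p] is the weight [dil^(s-N)] of [ucf], since
    [N/p = N - s]. *)
Lemma moved_conf (u : X -> R) (nu : R) v : Lp (sext u) -> moved (fun y => nu * sext u y) v ->
 exists O (z : X), [/\ Defs.orthogonal O, enorm z < 1 & forall y, enorm y = 1 -> v y = nu * u_conf p O z u y].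
Proof.
move=> hu [c [k [c0 ck hv]]]; have [z [z1 hz]] := Psi_boost c0 ck.
have js y : enorm y = 1 -> conf_jac z y `^ p^-1 = dil c k y `^ (s - N%:R).
 move=> y1; have [_ ->] := hz y y1; have dp : 0 < dil c k y by apply: dil_gt0 => //; rewrite y1.
 rewrite -(powR_mulrn _ (ltW dp)) -powRN -powRrM; congr powR; rewrite /pp; field.
 by rewrite pnatr_eq0 -lt0n N0 subr_eq0 gt_eqF// prm_sN.
have n1 y : enorm y = 1 -> enorm (nrm (cboost c k y)) = 1.
 move=> y1; have dp : 0 < dil c k y by apply: dil_gt0 => //; rewrite y1.
 by apply: enorm_nrm; rewrite (enorm_cboost ck (ltW dp)).
case: hv => [->|[e e1 ->]].
 exists 1%:M, z; split=> //; first by rewrite /Defs.orthogonal trmx1 mulmx1.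
 move=> y y1; rewrite /u_conf js// /conf_map (hz y y1).1 /ucf sext_unit ?n1// mulrCA; congr (_ * (_ * u _)).
 apply: eq_from_tnth => i; rewrite [RHS]tnth_mktuple (bigD1 i)//= mxE eqxx mul1r big1 ?addr0// => j ji.
 by rewrite mxE eq_sym (negbTE ji) mul0r.
exists (hh e), z; split=> //; first exact: hh_orthogonal.
move=> y y1; rewrite /u_conf js// /conf_map (hz y y1).1 mxapp_hh /ucf sext_unit ?enorm_refl ?n1//; exact: mulrCA.
Qed.

(** * The sharp constant and the deficit *)

Section Assembly.
Variables al be : R.
Hypothesis hs : s = (N.+1%:R - al) / 2.
Hypothesis hq : q * (s - be) = N.+1%:R.
Hypothesis hpe : p_exp N.+1 al = p.
Hypothesis hqe : q_exp N.+1 al be = q.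
Let A0 : 0 < area. Proof. exact: area_gt0. Qed.

Lemma inLpS_Lp u : inLpS p u -> Lp (sext u) /\ LpS_pow p u = (area * Np (sext u))%:E.
Proof.
move=> [mu fu]; have ms := meas_sext mu.
have uE y : enorm y = 1 -> u y = sext u y by move=> y1; rewrite sext_unit.
have E := LpS_powE p ms uE.
have hL : L1 P (fun y => `|sext u y| `^ p).
 apply: L1_fin; [by meas|side|].
 move: fu; rewrite E ltNge => h; rewrite ltNge; apply: contra h; rewrite leye_eq => /eqP ->.
 by rewrite gt0_muley// lte_fin.
by split=> //; rewrite (LpS_powE_L1 hL ms uE).
Qed.

(** The factor between the normalizations of the two problems: [c_ab = hQ * Cq^(1/q)], see
    [c_abE]. *)
Definition hQ : R := kapQ `^ q^-1 / area `^ p^-1.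
Definition nml u : R := (Np (sext u) `^ p^-1)^-1.

Lemma hQ_gt0 : 0 < hQ.
Proof. by apply: divr_gt0; apply: powR_gt0 => //; exact: kapQ_gt0. Qed.

Lemma nml_Np u : Lp (sext u) -> 0 < Np (sext u) -> Np (fun y => nml u * sext u y) = 1.
Proof.
move=> hu u0; have n0 : 0 < Np (sext u) `^ p^-1 by exact: powR_gt0.
have E : (Np (sext u) `^ p^-1) `^ p = Np (sext u) by rewrite -powRrM mulVf ?gt_eqF// powRr1// ltW.
by rewrite (Np_Z _ hu) /nml gtr0_norm ?invr_gt0// (inv_powR _ n0) E mulVf// gt_eqF.
Qed.

Lemma QratioE u : Lp (sext u) -> LpS_pow p u = (area * Np (sext u))%:E -> 0 < Np (sext u) ->
 Qratio al be u = (hQ * Nq (fun y => nml u * sext u y) `^ q^-1)%:E.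
Proof.
move=> hu hE u0; have n0 : 0 < Np (sext u) `^ p^-1 by exact: powR_gt0.
have v0 : 0 <= nml u by rewrite invr_ge0 ltW.
rewrite /Qratio hqe hpe hE (LqB_powE hs hq hu) poweR_EFin -EFinM; congr EFin => /=.
rewrite (powRM _ (ltW A0) (ltW u0)) (powRM _ (ltW (kapQ_gt0)) (Nq_ge0 _)).
have NE : Nq (fun y => nml u * sext u y) `^ q^-1 = nml u * Nq (sext u) `^ q^-1.
 rewrite (Nq_Z _ (Nq_L1 hu) hu); have W0 := Nq_ge0 (sext u); move: (Nq _) W0 => W W0.
 have qn : q != 0 by rewrite gt_eqF.
 by rewrite (powRM _ (powR_ge0 _ _) W0) -powRrM (mulfV qn) (powRr1 (normr_ge0 _)) (ger0_norm v0).
rewrite NE /hQ /nml invfM; move: (Nq _ `^ _) (kapQ `^ _) (area `^ _) (Np _ `^ _) => a b c d; ring.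
Qed.

Lemma c_abE : c_ab N.+1 al be = (hQ * Cq `^ q^-1)%:E.
Proof.
have qi : 0 <= q^-1 by rewrite invr_ge0 ltW.
apply/eqP; rewrite eq_le; apply/andP; split.
 apply: ge_ereal_sup => _ [u [hu u0] <-]; rewrite hpe in hu u0.
 have [hL hE] := inLpS_Lp hu; rewrite hE lte_fin pmulr_rgt0// in u0.
 rewrite (QratioE hL hE u0) lee_fin; apply: ler_wpM2l; first exact: ltW hQ_gt0.
 apply: powR_le => //; first exact: Nq_ge0.
 by apply: Nq_le1; [exact: Lp_Z|rewrite nml_Np].
pose u1 : X -> R := fun=> 1.
have h1 : inLpS p u1.
 split; first exact: measurable_cst.
 have m1 : mbl u1 by exact: measurable_cst.
 have l1 : L1 P (fun y => `|u1 y| `^ p) by exact: Lp_pow (Lp_cst 1).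
 by rewrite (LpS_powE_L1 l1 m1)// ltry.
have [hL hE] := inLpS_Lp h1.
have mS := Lp_meas hL; have m1 : mbl u1 by exact: measurable_cst.
have n1 : Np (sext u1) = 1.
 rewrite -[RHS](Np1); refine (P_unit (ltn0Sn N) _ _ _).2; [by meas|by meas|].
 by move=> y y1; rewrite sext_unit.
have E0 : (0 < LpS_pow (p_exp N.+1 al) u1)%E by rewrite hpe hE n1 mulr1 lte_fin.
have <- : Qratio al be u1 = (hQ * Cq `^ q^-1)%:E.
 rewrite (QratioE hL hE) ?n1//; congr (_ * _ `^ _)%:E; rewrite -[RHS](Nq1_Cq); apply: Ir_ext => x.
 congr (`|_| `^ _); refine (P_unit (ltn0Sn N) _ _ _).2; [by apply: measurable_funM; [apply: meas_K|meas]|by apply: measurable_funM; [apply: meas_K|meas]|].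
 by move=> y y1; rewrite sext_unit// /nml n1 (one_powR _) invr1 mul1r.
apply: ereal_sup_ubound; exists u1; [split; [rewrite hpe; exact: h1|exact: E0]|reflexivity].
Qed.

Definition bQ : R := hQ `^ p * Cq `^ (p / q).

Lemma bQ_gt0 : 0 < bQ.
Proof. by rewrite mulr_gt0 ?powR_gt0// hQ_gt0. Qed.

Lemma deficitE u : Lp (sext u) -> LpS_pow p u = (area * Np (sext u))%:E -> 0 < Np (sext u) ->
 deficit al be u = (bQ * (1 - (Nq (fun y => nml u * sext u y) / Cq) `^ (p / q)))%:E.
Proof.
move=> hu hE u0; rewrite /deficit c_abE (QratioE hu hE u0) hpe !poweR_EFin -EFinB; congr EFin.
have W0 := Nq_ge0 (fun y => nml u * sext u y); move: (Nq _) W0 => W W0.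
have WE : W = Cq * (W / Cq) by rewrite mulrCA mulfV ?mulr1// gt_eqF.
have WC : 0 <= W / Cq by apply: divr_ge0 => //; exact: ltW.
rewrite !(powRM _ (ltW hQ_gt0)) ?powR_ge0// -!powRrM ![q^-1 * p]mulrC {1}WE (powRM _ (ltW C0) WC) /bQ.
by ring.
Qed.

Theorem stability_approx : exists2 c0, 0 < c0 & forall u, inLpS p u -> (0 < LpS_pow p u)%E -> forall e : R, 0 < e ->
 exists O (z : X) (l : R), [/\ Defs.orthogonal O, enorm z < 1,
  2 <= p -> (c0%:E * (LpS_pow p (deviation p O z l u) + LpS_pow 2 (deviation p O z l u)) <= deficit al be u + e%:E)%E &
  p < 2 -> (c0%:E * poweR (LpS_pow p (deviation p O z l u)) (2 / p) <= deficit al be u + e%:E)%E].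
Proof.
have [c c0 stab] := global_stability.
have B0 := bQ_gt0.
have Ap : 0 < area `^ (2 / p) by exact: powR_gt0.
exists (bQ * c * Num.min area^-1 (area `^ (2 / p))^-1).
 by apply: mulr_gt0; [exact: mulr_gt0|rewrite lt_min !invr_gt0 A0].
move=> u hu u0 e e0; have [hL hE] := inLpS_Lp hu; rewrite hE lte_fin pmulr_rgt0// in u0.
have eB : 0 < e / bQ by exact: divr_gt0.
have [v [l [mv hv h2 h1]]] := stab _ (Lp_Z (nml u) hL) (nml_Np hL u0) _ eB.
have [Om [z [oO z1 hz]]] := moved_conf hL mv.
exists Om, z, (l * nml u / area `^ p^-1).
set D := 1 - _ in h2 h1.
have dE : deficit al be u = (bQ * D)%:E by exact: deficitE.
have devE y : enorm y = 1 -> deviation p Om z (l * nml u / area `^ p^-1) u y = l * v y - 1.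
 move=> y1; rewrite /deviation sphere_area_eq divfK ?gt_eqF ?powR_gt0// hz// mulrA//.
have mv' := Lp_meas hv.
have md : mbl (fun y => l * v y - 1) by meas.
have hw : Lp (fun y => l * v y - 1) by apply: Lp_D; [exact: Lp_Z|exact: Lp_cst].
have LE : LpS_pow p (deviation p Om z (l * nml u / area `^ p^-1) u) = (area * Np (fun y => l * v y - 1))%:E.
 exact: (LpS_powE_L1 (Lp_pow hw) md devE).
have LE2 : L1 P (fun y => (l * v y - 1) ^+ 2) ->
 LpS_pow 2 (deviation p Om z (l * nml u / area `^ p^-1) u) = (area * (IP y, (l * v y - 1) ^+ 2))%:E.
 have E y : `|l * v y - 1| `^ 2 = (l * v y - 1) ^+ 2.
  by rewrite (powR_mulrn 2 (normr_ge0 _)) real_normK ?num_real.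
 move=> k; rewrite (LpS_powE_L1 (L1_ext (fun y => esym (E y)) k) md devE); congr (_ * _)%:E; exact: Ir_ext.
have N0' := Np_ge0 (fun y => l * v y - 1).
have m1 : Num.min area^-1 (area `^ (2 / p))^-1 <= area^-1 by rewrite ge_min lexx.
have m2 : Num.min area^-1 (area `^ (2 / p))^-1 <= (area `^ (2 / p))^-1 by rewrite ge_min lexx orbT.
have fin (m a x D' : R) : 0 < a -> m <= a^-1 -> 0 <= x -> c * x <= D' + e / bQ -> bQ * c * m * (a * x) <= bQ * D' + e.
 move=> a0 ma x0 h; have -> : bQ * c * m * (a * x) = bQ * c * x * (m * a) by ring.
 apply: (le_trans (y := bQ * c * x)).
  apply: ler_piMr; first by apply: mulr_ge0 => //; apply: mulr_ge0; exact: ltW.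
  by rewrite -ler_pdivlMr// mul1r.
 rewrite -mulrA; apply: le_trans (ler_wpM2l (ltW B0) h) _.
 by rewrite mulrDr mulrCA mulfV ?mulr1// gt_eqF.
split=> // p2.
 have [k1 k2] := h2 p2; rewrite LE (LE2 k1) dE -EFinD -EFinM -EFinD lee_fin -mulrDr; apply: fin => //.
 by apply: addr_ge0 => //; apply: Ir_ge0 => y; exact: sqr_ge0.
rewrite LE dE poweR_EFin -EFinM -EFinD lee_fin (powRM _ (ltW A0) N0'); apply: fin => //; first exact: powR_ge0.
exact: h1.
Qed.

End Assembly.

End Setting.

Theorem theorem1p1 (R : realType) (n : nat) (alpha beta : R) :
  (3 <= n)%N -> 0 <= beta -> 0 < alpha + beta -> alpha + beta < n%:R - beta ->
  (n%:R - alpha - 2 * beta) / (2 * n%:R) + (n%:R - alpha) / (2 * (n%:R - 1)) < 1 ->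
  (alpha <= 1 ->
   exists c0 : R, 0 < c0 /\
     forall u : n.-tuple R -> R,
       inLpS (p_exp n alpha) u -> (0 < LpS_pow (p_exp n alpha) u)%E ->
       (c0%:E * inf_conf (fun O zeta lambda =>
            LpS_pow (p_exp n alpha) (deviation (p_exp n alpha) O zeta lambda u)
          + LpS_pow 2 (deviation (p_exp n alpha) O zeta lambda u))
        <= deficit alpha beta u)%E)
  /\
  (1 < alpha < n%:R ->
   exists c0 : R, 0 < c0 /\
     forall u : n.-tuple R -> R,
       inLpS (p_exp n alpha) u -> (0 < LpS_pow (p_exp n alpha) u)%E ->
       (c0%:E * inf_conf (fun O zeta lambda =>
            poweR (LpS_pow (p_exp n alpha) (deviation (p_exp n alpha) O zeta lambda u))
                  (2 / p_exp n alpha))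
        <= deficit alpha beta u)%E).
Proof.
case: n => [//|N]; rewrite ltnS => N2 b0 ab abn cond.
have N0 : 0 < N%:R :> R by rewrite ltr0n ltnW.
have nE : N.+1%:R - 1 = N%:R :> R by rewrite -natr1 addrK.
pose s : R := (N.+1%:R - alpha) / 2.
have hsb : 0 < s - beta.
  have -> : s - beta = (N.+1%:R - beta - (alpha + beta)) / 2 by rewrite /s; field.
  by rewrite divr_gt0// subr_gt0.
have s0 : 0 < s by apply: lt_le_trans hsb _; rewrite gerBl.
have n0 : 0 < N.+1%:R :> R by rewrite ltr0n.
pose q : R := N.+1%:R / (s - beta).
have q0 : 0 < q by rewrite divr_gt0.
(* The numerical hypothesis multiplied by [n N]; divided by [s - beta] it reads [N < q (N - s)]. *)
have {}cond : N%:R * (s - beta) + N.+1%:R * s < N.+1%:R * N%:R.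
  rewrite nE in cond.
  have -> : N%:R * (s - beta) + N.+1%:R * s = ((N.+1%:R - alpha - 2 * beta) / (2 * N.+1%:R) + (N.+1%:R - alpha) / (2 * N%:R)) * (N.+1%:R * N%:R).
    by rewrite /s; field; rewrite !gt_eqF.
  by rewrite gtr_pMl// mulr_gt0.
have qE : q * (s - beta) = N.+1%:R by rewrite /q divfK// gt_eqF.
have sN : s < N%:R.
  rewrite -(ltr_pM2l n0); apply: le_lt_trans cond; rewrite lerDr; apply: mulr_ge0; exact: ltW.
(* Here [q s >= q (s - beta) = n > N]. *)
have qs : N%:R < q * s.
  rewrite /q mulrAC ltr_pdivlMr//; apply: (le_lt_trans (y := N%:R * s)).
    by rewrite ler_pM2l// gerBl.
  by rewrite ltr_pM2r// ltr_nat.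
have qN : N%:R < q * (N%:R - s) by rewrite /q mulrAC ltr_pdivlMr// [X in _ < X]mulrBr ltrBrDr.
pose pr := Prm N2 s0 sN qs qN.
have pE : p_exp N.+1 alpha = pp pr.
  have sN' : N%:R - s = (N.+1%:R + alpha - 2) / 2 by rewrite -nE /s; field.
  have d0 : N.+1%:R + alpha - 2 != 0 by rewrite gt_eqF// -(pmulr_lgt0 _ (_ : 0 < 2^-1)) ?invr_gt0// -sN' subr_gt0.
  by rewrite /p_exp nE /pp /= sN'; move: (_ + alpha - 2) d0 => D d0; field.
have qE' : q_exp N.+1 alpha beta = q.
  have d0 : N.+1%:R - alpha - 2 * beta != 0.
    have -> : N.+1%:R - alpha - 2 * beta = (s - beta) * 2 by rewrite /s; field.
    by rewrite gt_eqF// mulr_gt0.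
  rewrite /q_exp /q; have -> : s - beta = (N.+1%:R - alpha - 2 * beta) / 2 by rewrite /s; field.
  by move: (_ - alpha - _) d0 => D d0; field.
have p2 : (2 <= pp pr) = (alpha <= 1).
  rewrite /pp /= ler_pdivlMr ?subr_gt0//; have -> : 2 * (N%:R - s) = N%:R + (alpha - 1) by rewrite -nE /s; field.
  by rewrite gerDl subr_le0.
have [c0 c0p stab] := @stability_approx R N pr alpha beta (erefl _) qE pE qE'.
(* The maps supplied by [stability_approx] depend on [e]; bounding the infimum by their value leaves
   an error [e] that is arbitrary. *)
rewrite pE; split=> [a1|/andP[a1 _]]; exists c0; split=> // u hu u0; apply/lee_addgt0Pr => e e0;
  have [Om [z [l [oO z1 h2 h1]]]] := stab u hu u0 e e0.
- apply: (le_trans _ (h2 _)); last by rewrite p2.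
  apply: lee_wpmul2l; first by rewrite lee_fin ltW.
  by apply: ereal_inf_lbound; exists Om, z, l.
- apply: (le_trans _ (h1 _)); last by rewrite ltNge p2 -ltNge.
  apply: lee_wpmul2l; first by rewrite lee_fin ltW.
  by apply: ereal_inf_lbound; exists Om, z, l.
Qed.
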